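(* Assume the following. (Boundedness) There exist constants $C,C'>0$ such that for every $\theta\in\Theta$: the $\mathcal G_t^\theta$-intensity $\boldsymbol\lambda^\theta$ of $N^\theta$ is càglàd with $\sup_{0\le t\le 1}\boldsymbol\lambda_t^\theta\le C$ almost surely; the residual process $G^\theta$ is càglàd with $\sup_{0\le t\le 1}|G_t^\theta|\le C'$ almost surely; and the estimators satisfy the same bounds, $\sup_t|\hat\lambda_t^{(n),\theta}|\le C$ and $\sup_t|\hat G_t^{(n),\theta}|\le C'$ almost surely. (Rates) $|J_n|\to\infty$ as $n\to\infty$, and with $g^\theta(n)=\||G^\theta-\hat G^{(n),\theta}\||_2$ and $h^\theta(n)=\||\lambda^\theta-\hat\lambda^{(n),\theta}\||_2$, $$\lim_{n\to\infty}\sup_{\theta\in\Theta}\max\{g^\theta(n),\,h^\theta(n),\,\sqrt{|J_n|}\,g^\theta(n)h^\theta(n)\}=0 .$$ Then: i) $\sqrt{|J_n|}\,\hat\gamma^{(n),\theta}\xrightarrow{\mathcal D/\Theta_0}U^\theta$ in $D[0,1]$ (Skorokhod topology) as $n\to\infty$, where for each $\theta\in\Theta_0$, $U^\theta$ is a mean zero continuous Gaussian martingale on $[0,1]$ with variance function $\mathcal V^\theta$. ii) If $G^\theta$ is the additive residual process (for every $\theta\in\Theta$), then for every $\varepsilon>0$ there exists $K>0$ such that $$\limsup_{n\to\infty}\sup_{\theta\in\Theta}\mathbb P\left(\sqrt{|J_n|}\cdot\|\hat\gamma^{(n),\theta}-\gamma^\theta\|_\infty>K\right)<\varepsilon .$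$
   Context: Setting. $\Theta$ is an arbitrary set indexing sampling distributions; every object below depends on $\theta\in\Theta$, with the superscript $\theta$ often suppressed. Time is $[0,1]$. $N$ is a counting process adapted to a right-continuous complete filtration $\mathcal F_t$; $X$ is a real-valued càglàd process; $\mathcal G_t$ is the right-continuous complete filtration generated by $\mathcal F_t$ and $X_t$. $N$ has an $\mathcal F_t$-intensity $\lambda$ (i.e. $\lambda$ is $\mathcal F_t$-predictable and $M_t=N_t-\int_0^t\lambda_s\,ds$ is a local $\mathcal F_t$-martingale) and a $\mathcal G_t$-intensity $\boldsymbol\lambda$. The hypothesis $H_0$ (conditional local independence of $N$ from $X$ given $\mathcal F_t$) is: $M$ is also a local $\mathcal G_t$-martingale. $\Theta_0=\{\theta\in\Theta: H_0\text{ is valid}\}$. A residual process $G$ of $X$ given $\mathcal F_t$ is a càglàd $\mathcal G_t$-adapted process with $E(G_t\mid\mathcal F_{t-})=0$ for all $t\in[0,1]$. The additive residual process is $G_t=X_t-\Pi_t$, where $\Pi_t=E(X_t\mid\mathcal F_{t-})$ is the predictable projection. A residual process $G$ is fixed for each $\theta$. The Local Covariance Measure is $\gamma_t=E\int_0^tG_s\,dM_s$, and the variance function is $\mathcal V(t)=E\int_0^tG_s^2\,dN_s$. Data and estimators. $(N_j,X_j,\mathcal F_j)$, $j=1,\dots,n$, are i.i.d. replications of $(N,X,\mathcal F)$. $J_n\cup J_n^c=\{1,\dots,n\}$ is a partition into two disjoint sets. The estimates $\hat\lambda^{(n)}$ and $\hat G^{(n)}$ are fitted on data indexed by $J_n^c$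 only; given those data they are fixed maps, evaluated on the $\mathcal F$-history resp. $\mathcal G$-history of a new observation, yielding (conditionally on the training data) an $\mathcal F_t$-predictable process resp. a $\mathcal G_t$-predictable process. $\hat\lambda_j^{(n)},\hat G_j^{(n)}$ are their evaluations on observation $j\in J_n$; $\hat\lambda_t^{(n)},\hat G_t^{(n)}$ are their evaluations on one additional copy $(N,X,\mathcal F)$ independent of the data. For the additive residual process, $\hat G^{(n)}_t=X_t-\hat\Pi_t^{(n)}$ with $\hat\Pi^{(n)}$ an estimate of $\Pi$ evaluated on the $\mathcal F$-history (hence $\mathcal F_t$-predictable given the training data). With $\hat M_{j,t}^{(n)}=N_{j,t}-\int_0^t\hat\lambda_{j,s}^{(n)}ds$, the estimator is $$\hat\gamma_t^{(n)}=\frac1{|J_n|}\sum_{j\in J_n}\int_0^t\hat G_{j,s}^{(n)}\,d\hat M_{j,s}^{(n)} .$$ For a process $W$ on $[0,1]$, $\||W\||_2^2=E\int_0^1W_s^2\,ds$; $\|\cdot\|_\infty$ is the supremum norm on $[0,1]$. Uniform convergence. For a metric space $(\mathbb D,d)$, $BL_1(\mathbb D)$ is the set of $f:\mathbb D\to\mathbb R$ with $\|f\|_\infty\le1$ and $|f(x)-f(y)|\le d(x,y)$, and $d_{BL}(Y,Y')=\sup_{f\in BL_1(\mathbb D)}|E f(Y)-E f(Y')|$ for $\mathbb D$-valued random variables. If all $Y^\theta$ take values a.s. in a common separable subset, $Y_n^\theta\xrightarrow{\mathcal D/\Theta_0}Y^\theta$ means $\sup_{\theta\in\Theta_0}d_{BL}(Y_n^\theta,Y^\theta)\to0$.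 $D[0,1]$ is the space of càdlàg functions with the complete Skorokhod metric. *)

(* Defs.v *)
From HB Require Import structures.
From mathcomp Require Import all_boot all_order all_algebra.
From mathcomp Require Import all_classical all_reals all_analysis.
Set Implicit Arguments.
Unset Strict Implicit.
Unset Printing Implicit Defensive.
Import Order.TTheory GRing.Theory Num.Theory.
Import numFieldNormedType.Exports.
Local Open Scope classical_set_scope.
Local Open Scope ring_scope.

(* Time is [0, 1].  Processes are functions of a real time parameter, of which
   only the restriction to [0, 1] matters; a path is a function R -> R. *)

(* Supremum of a family of nonnegative quantities, equal to 0 (not -oo) when
   the index set is empty. *)
Definition sup_nonneg {R : realType} (I : Type) (A : set I) (f : I -> \bar R) : \bar R :=
  ereal_sup ([set 0%E] `|` [set f i | i in A]).

Definition supnorm {R : realType} (x : R -> R) : \bar R :=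
  ereal_sup [set (`|x t|)%:E | t in `[0, 1]].

(** Paths *)

Definition caglad {R : realType} (x : R -> R) : Prop :=
  (forall t, 0 < t <= 1 -> x s @[s --> t^'-] --> x t) /\
  (forall t, 0 <= t < 1 -> exists l : R, x s @[s --> t^'+] --> l).

Definition cadlag {R : realType} (x : R -> R) : Prop :=
  (forall t, 0 <= t < 1 -> x s @[s --> t^'+] --> x t) /\
  (forall t, 0 < t <= 1 -> exists l : R, x s @[s --> t^'-] --> l).

(* Right-continuous nondecreasing integer-valued path started at 0 with jumps
   of size 1; being integer-valued, limits are eventual equalities. *)
Definition counting_path {R : realType} (n : R -> nat) : Prop :=
  [/\ n 0 = 0%N,
      (forall s t, 0 <= s -> s <= t -> t <= 1 -> (n s <= n t)%N),
      (forall t, 0 <= t < 1 -> \forall s \near t^'+, n s = n t) &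
      (forall t, 0 < t <= 1 -> \forall s \near t^'-, (n t <= (n s).+1)%N)].

Definition jump_times {R : realType} (n : R -> nat) : set R :=
  [set t | 0 < t <= 1 /\ \forall s \near t^'-, (n s < n t)%N].

(* int_0^t h dn: the Stieltjes integral against a counting path is the finite
   sum of h over the jump times in ]0, t]. *)
Definition int_counting {R : realType} (n : R -> nat) (h : R -> R) (t : R) : R :=
  \sum_(s \in jump_times n `&` [set s | s <= t]) h s.

(* int_0^t h dm for the path m_t = n_t - int_0^t l_s ds. *)
Definition int_compensated {R : realType} (n : R -> nat) (l h : R -> R) (t : R) : R :=
  int_counting n h t -
  Rintegral lebesgue_measure `[0, t] (fun s => h s * l s).

Definition compensated {R : realType} (T : Type) (N : R -> T -> nat)
    (l : R -> T -> R) (t : R) (w : T) : R :=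
  (N t w)%:R - Rintegral lebesgue_measure `[0, t] (l ^~ w).

(** Filtrations, measurability, conditional expectation *)

Definition measurable_wrt {R : realType} (T : Type) (H : set (set T))
    (f : T -> R) : Prop :=
  preimage_set_system setT f measurable `<=` H.

Definition adapted {R : realType} (T : Type) (F : R -> set (set T))
    (Y : R -> T -> R) : Prop :=
  forall t, 0 <= t <= 1 -> measurable_wrt (F t) (Y t).

(* Right-continuous complete filtration on [0, 1].  Completeness puts every
   subset of a null set in F 0; in particular P is a complete measure. *)
Definition usual_filtration {R : realType} d (T : measurableType d)
    (P : probability T R) (F : R -> set (set T)) : Prop :=
  [/\ (forall t, 0 <= t <= 1 -> sigma_algebra setT (F t) /\ F t `<=` measurable),
      (forall s t, 0 <= s -> s <= t -> t <= 1 -> F s `<=` F t),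
      (forall t, 0 <= t < 1 -> \bigcap_(s in `]t, 1]) F s `<=` F t) &
      P.-negligible `<=` F 0].

(* F_{t-}, with the convention F_{0-} = F_0. *)
Definition left_filtration {R : realType} (T : Type) (F : R -> set (set T))
    (t : R) : set (set T) :=
  if t <= 0 then F 0 else <<s \bigcup_(s in `[0, t[) F s >>.

Definition natural_filtration {R : realType} (T : Type) (Y : R -> T -> R)
    (t : R) : set (set T) :=
  <<s \bigcup_(s in `[0, t]) preimage_set_system setT (Y s) measurable >>.

(* The right-continuous filtration generated by F and X, namely
   \bigcap_(t < s <= 1) (F_s \/ sigma(X_u, u <= s)) for t < 1, and
   F_1 \/ sigma(X_u, u <= 1) at t = 1.  It is complete as soon as F is. *)
Definition enlarge {R : realType} (T : Type) (F : R -> set (set T))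
    (X : R -> T -> R) (t : R) : set (set T) :=
  \bigcap_(s in `]t, 1] `|` [set 1]) <<s F s `|` natural_filtration X s >>.

(* Predictable sigma-algebra on [0, 1] x T. *)
Definition predictable_sets {R : realType} (T : Type) (F : R -> set (set T))
    : set (set (R * T)) :=
  <<s `[0, 1] `*` setT,
    [set [set 0] `*` A | A in F 0] `|`
    [set B | exists s t A,
       [/\ 0 <= s, s <= t, t <= 1, F s A & B = `]s, t] `*` A]] >>.

Definition predictable {R : realType} (T : Type) (F : R -> set (set T))
    (Y : R -> T -> R) : Prop :=
  preimage_set_system (`[0, 1] `*` setT) (fun p => Y p.1 p.2) measurable
    `<=` predictable_sets F.

(* Z is a version of E(Y | H). *)
Definition is_cond_exp {R : realType} d (T : measurableType d)
    (P : probability T R) (H : set (set T)) (Y Z : T -> R) : Prop :=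
  [/\ P.-integrable setT (EFin \o Y), P.-integrable setT (EFin \o Z),
      measurable_wrt H Z &
      forall A, H A -> (\int[P]_(w in A) (Y w)%:E = \int[P]_(w in A) (Z w)%:E)%E].

Definition martingale {R : realType} d (T : measurableType d)
    (P : probability T R) (F : R -> set (set T)) (M : R -> T -> R) : Prop :=
  forall s t, 0 <= s -> s <= t -> t <= 1 -> is_cond_exp P (F s) (M t) (M s).

(* On the compact time interval [0, 1] a localizing sequence almost surely
   satisfies tau k >= 1 for some k (not merely tau k --> 1). *)
Definition local_martingale {R : realType} d (T : measurableType d)
    (P : probability T R) (F : R -> set (set T)) (M : R -> T -> R) : Prop :=
  exists tau : nat -> T -> R,
  [/\ (forall k w, 0 <= tau k w <= tau k.+1 w),
      (forall k t, 0 <= t <= 1 -> F t [set w | tau k w <= t]),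
      {ae P, forall w, exists k, 1 <= tau k w} &
      forall k, martingale P F (fun t w => M (Num.min t (tau k w)) w)].

(** The model *)

(* l is an F-intensity of N; integrability of the paths of l is what makes
   int_0^t l_s ds meaningful. *)
Definition intensity {R : realType} d (T : measurableType d)
    (P : probability T R) (F : R -> set (set T)) (N : R -> T -> nat)
    (l : R -> T -> R) : Prop :=
  [/\ predictable F l,
      {ae P, forall w,
        lebesgue_measure.-integrable `[0, 1] (fun s => (l s w)%:E)} &
      local_martingale P F (compensated N l)].

Definition counting_model {R : realType} d (T : measurableType d)
    (P : probability T R) (F : R -> set (set T)) (N : R -> T -> nat)
    (X lam blam : R -> T -> R) : Prop :=
  [/\ usual_filtration P F,
      ((forall w, counting_path (N ^~ w)) /\
        adapted F (fun t w => (N t w)%:R : R)),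
      ((forall w, caglad (X ^~ w)) /\
        forall t, 0 <= t <= 1 -> measurable_fun setT (X t)),
      intensity P F N lam &
      intensity P (enlarge F X) N blam].

(* The hypothesis H_0: N is conditionally locally independent of X given F. *)
Definition cond_local_indep {R : realType} d (T : measurableType d)
    (P : probability T R) (F : R -> set (set T)) (N : R -> T -> nat)
    (X lam : R -> T -> R) : Prop :=
  local_martingale P (enlarge F X) (compensated N lam).

Definition residual_process {R : realType} d (T : measurableType d)
    (P : probability T R) (F : R -> set (set T)) (X G : R -> T -> R) : Prop :=
  [/\ (forall w, caglad (G ^~ w)),
      adapted (enlarge F X) G &
      forall t, 0 <= t <= 1 ->
        is_cond_exp P (left_filtration F t) (G t) (fun=> 0)].

Definition predictable_projection {R : realType} d (T : measurableType d)
    (P : probability T R) (F : R -> set (set T)) (X Pi : R -> T -> R) : Prop :=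
  predictable F Pi /\
  forall t, 0 <= t <= 1 -> is_cond_exp P (left_filtration F t) (X t) (Pi t).

Definition additive_residual {R : realType} d (T : measurableType d)
    (P : probability T R) (F : R -> set (set T)) (X G : R -> T -> R) : Prop :=
  exists2 Pi, predictable_projection P F X Pi &
    forall t w, 0 <= t <= 1 -> G t w = X t w - Pi t w.

(* Local covariance measure gamma_t = E int_0^t G_s dM_s. *)
Definition lcm_gamma {R : realType} d (T : measurableType d)
    (P : probability T R) (N : R -> T -> nat) (lam G : R -> T -> R) (t : R) : R :=
  fine 'E_P[fun w => int_compensated (N ^~ w) (lam ^~ w) (G ^~ w) t].

(* Variance function V(t) = E int_0^t G_s^2 dN_s. *)
Definition lcm_variance {R : realType} d (T : measurableType d)
    (P : probability T R) (N : R -> T -> nat) (G : R -> T -> R) (t : R) : R :=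
  fine 'E_P[fun w => int_counting (N ^~ w) (fun s => G s w ^+ 2) t].

(* ||| W |||_2 *)
Definition process_norm2 {R : realType} d (T : measurableType d)
    (P : probability T R) (W : R -> T -> R) : \bar R :=
  sqrte (\int[P]_w \int[lebesgue_measure]_(s in `[0%R, 1%R]) (W s w ^+ 2)%:E)%E.

(** Data and estimators *)

(* An i.i.d. sample of size n, defined on a complete probability space
   (S, PS).  Replication j is a random element Z j of the basic filtered space
   T with law P: the j-th copies of N, X, and F are N_t \o Z j, X_t \o Z j and
   the preimages of the F_t under Z j, and similarly for all objects
   constructed on T. *)
Definition iid_sample {R : realType} d (T : measurableType d)
    (P : probability T R) dS (S : measurableType dS) (PS : probability S R)
    (n : nat) (Z : 'I_n -> S -> T) : Prop :=
  [/\ measure_is_complete PS,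
      (forall j, measurable_fun setT (Z j)),
      (forall j A, measurable A -> PS (Z j @^-1` A) = P A) &
      forall A : 'I_n -> set T, (forall j, measurable (A j)) ->
        PS (\bigcap_(j in [set: 'I_n]) (Z j @^-1` A j)) =
        (\prod_(j < n) PS (Z j @^-1` A j))%E].

(* Sigma-algebra generated by the observations whose index is not in J. *)
Definition training_sigma dT (T : measurableType dT) (S : Type) (n : nat)
    (Z : 'I_n -> S -> T) (J : {set 'I_n}) : set (set S) :=
  <<s \bigcup_(j in [set j | j \notin J])
        preimage_set_system setT (Z j) measurable >>.

(* An estimated process fitted on the observations outside J: for sample point
   s, the fixed map Y s sends an observation w : T to the path t |-> Y s t w.
   Joint measurability with respect to the product of the training
   sigma-algebra and the H-predictable one makes Y depend on s through the
   training data only, and every section Y s an H-predictable process. *)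
Definition fitted_predictable {R : realType} dT (T : measurableType dT)
    (S : Type) (n : nat) (Z : 'I_n -> S -> T) (J : {set 'I_n})
    (H : R -> set (set T)) (Y : S -> R -> T -> R) : Prop :=
  preimage_set_system (setT `*` (`[0, 1] `*` setT))
      (fun p : S * (R * T) => Y p.1 p.2.1 p.2.2) measurable
    `<=` <<s setT `*` (`[0, 1] `*` setT),
           [set C | exists A B, [/\ training_sigma Z J A,
                                    predictable_sets H B & C = A `*` B]] >>.

Definition lcm_estimator {R : realType} (T S : Type) (n : nat)
    (Z : 'I_n -> S -> T) (J : {set 'I_n}) (N : R -> T -> nat)
    (lamhat Ghat : S -> R -> T -> R) (s : S) (t : R) : R :=
  (#|J|%:R)^-1 * \sum_(j in J)
    int_compensated (N ^~ (Z j s)) (lamhat s ^~ (Z j s)) (Ghat s ^~ (Z j s)) t.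

(* ||| W - What |||_2.  A new observation independent of the data is the second
   coordinate of S * T under the product probability. *)
Definition estimation_error {R : realType} d (T : measurableType d)
    (P : probability T R) dS (S : measurableType dS) (PS : probability S R)
    (W : R -> T -> R) (What : S -> R -> T -> R) : \bar R :=
  process_norm2 (PS \x P)%E (fun t p => W t p.2 - What p.1 t p.2).

(** Skorokhod space and uniform convergence in distribution *)

Definition time_change {R : realType} : set (R -> R) :=
  [set mu : R -> R | [/\ mu 0 = 0, mu 1 = 1, {within `[0, 1], continuous mu} &
                {in `[0, 1] &, {homo mu : s t / s < t}}]].

Definition time_change_norm {R : realType} (mu : R -> R) : \bar R :=
  ereal_sup [set (`|ln ((mu p.2 - mu p.1) / (p.2 - p.1))|)%:E
            | p in [set p : R * R | [/\ 0 <= p.1, p.1 < p.2 & p.2 <= 1]]].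

(* Billingsley's complete metric on D[0, 1]. *)
Definition skorokhod_dist {R : realType} (x y : R -> R) : \bar R :=
  ereal_inf [set maxe (time_change_norm mu) (supnorm (fun t => x t - y (mu t)))
            | mu in time_change].

(* Below, a metric space is a subset D of a type together with a distance on
   D; this allows D[0, 1] to be the subset cadlag of R -> R, elements of which
   are identified when they agree on [0, 1]. *)
Definition BL1 {R : realType} (T : Type) (D : set T) (dist : T -> T -> \bar R)
    : set (T -> R) :=
  [set f | (forall x, D x -> `|f x| <= 1) /\
           (forall x y, D x -> D y -> ((`|f x - f y|)%:E <= dist x y)%E)].

Definition dBL {R : realType} (T : Type) (D : set T) (dist : T -> T -> \bar R)
    d1 (T1 : measurableType d1) (P1 : probability T1 R) (Y1 : T1 -> T)
    d2 (T2 : measurableType d2) (P2 : probability T2 R) (Y2 : T2 -> T) : \bar R :=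
  ereal_sup [set (`| fine 'E_P1[f \o Y1] - fine 'E_P2[f \o Y2] |)%:E
            | f in BL1 D dist].

Definition separable_subset {R : realType} (T : Type) (D : set T)
    (dist : T -> T -> \bar R) (Q : set T) : Prop :=
  Q `<=` D /\
  exists C : set T, [/\ countable C, C `<=` Q &
    forall x (e : R), Q x -> 0 < e -> exists2 c, C c & (dist x c < e%:E)%E].

Definition unif_cvg_distr {R : realType} (T : Type) (D : set T)
    (dist : T -> T -> \bar R) (I : Type) (A : set I)
    (d1 : I -> measure_display) (T1 : forall i, measurableType (d1 i))
    (P1 : forall i, probability (T1 i) R) (Yn : forall i, nat -> T1 i -> T)
    (d2 : I -> measure_display) (T2 : forall i, measurableType (d2 i))
    (P2 : forall i, probability (T2 i) R) (Y : forall i, T2 i -> T) : Prop :=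
  (exists2 Q, separable_subset D dist Q &
     forall i, A i -> {ae P2 i, forall w, Q (Y i w)}) /\
  sup_nonneg A (fun i => dBL D dist (P1 i) (Yn i n) (P2 i) (Y i)) @[n --> \oo] --> 0%E.

(** Gaussian martingales *)

(* Normal law, degenerate ones included; normal_prob m s is the normal law of
   standard deviation s only for s != 0. *)
Definition normal_rv {R : realType} d (T : measurableType d)
    (P : probability T R) (Y : T -> R) : Prop :=
  measurable_fun setT Y /\
  exists m : R,
    {ae P, forall w, Y w = m} \/
    exists2 s : R, 0 < s &
      forall A, measurable A -> P (Y @^-1` A) = normal_prob m s A.

Definition gaussian_process {R : realType} d (T : measurableType d)
    (P : probability T R) (U : R -> T -> R) : Prop :=
  forall (k : nat) (t a : 'I_k -> R), (forall i, 0 <= t i <= 1) ->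
    normal_rv P (fun w => \sum_(i < k) a i * U (t i) w).

Definition gaussian_martingale {R : realType} d (T : measurableType d)
    (P : probability T R) (V : R -> R) (U : R -> T -> R) : Prop :=
  [/\ (forall w, {within `[0, 1], continuous (U ^~ w)}),
      gaussian_process P U,
      martingale P (natural_filtration U) U &
      forall t, 0 <= t <= 1 -> ('E_P[U t] = 0 /\ 'V_P[U t] = (V t)%:E)%E].

(* Main.v *)
Require Import Defs.
From HB Require Import structures.
From mathcomp Require Import all_boot all_order all_algebra.
From mathcomp Require Import all_classical all_reals all_analysis.
From mathcomp Require Import measurable_realfun.
From mathcomp Require Import ring lra zify.
Set Implicit Arguments.
Unset Strict Implicit.
Unset Printing Implicit Defensive.
Import Order.TTheory GRing.Theory Num.Theory.
Import numFieldNormedType.Exports.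
Local Open Scope classical_set_scope.
Local Open Scope ring_scope.
Notation mT:= (measurable_fun setT).
Notation bdd f M:= (forall x, `|f x| <= M).
Notation mType:= measurableType.
Notation prob:= probability.
Notation ger0N:= ger0_norm.
Notation lerM2l:= ler_wpM2l.
Notation sub_sig:= sub_sigma_algebra.
Notation msum:= measurable_sum.
Notation fubini_measG:= measurable_fun_fubini_tonelli_G.
Notation ler_pdivr:= ler_pdivrMr.
Notation mfunM:= measurable_funM.
Notation mcompT:= measurableT_comp.
Notation mEFinP:= measurable_EFinP.
Notation sigmaT:= g_sigma_algebraType.
Notation mfunD:= measurable_funD.
Notation mfunB:= measurable_funB.
Notation mpair1:= measurable_fun_pair1.
Notation mpair2:= measurable_fun_pair2.
Notation mfunX:= measurable_funX.
Notation mfun_le:= measurable_fun_ler.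
Notation mfun_lt:= measurable_fun_ltr.
Notation sigmaTE:= measurable_g_measurableTypeE.
Notation mpair:= measurable_fun_pair.
Notation mfst:= measurable_fst.
Notation msnd:= measurable_snd.
Notation mcst:= measurable_cst.
Notation mfun_cvg:= measurable_fun_cvg.
Notation mindic:= measurable_indic.
Notation cont_meas:= continuous_measurable_fun.
(** The problem is transferred to bounded predictable versions [b], [l], [g] of
    the intensities and the residual, for which the martingale property reads
    E sum_i K(tau_i) = E int K b ds, K predictable; this gives the moments of
    the increments and the isometry E (int K dM)^2 = E int K^2 dN. Given the
    training data the estimator is a mean of independent paths int Ghat dMhat:
    its bias is at most E int |G - Ghat| |lam - lamhat| ds, chaining controls
    its fluctuations, and trigonometric polynomials compare it, under H_0, with
    a Brownian motion (built from binary digits) run at the clock V. *)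

(** Convergence has to be uniform in the parameter, so every estimate is quantitative, with
    constants that depend only on [C], [C'], the size of J and the two errors. A test functional
    composed with a path-valued map is not known to be measurable; its expectation is squeezed
    between those of measurable functions of finitely many grid values. Because counting paths jump,
    fourth moments of increments contain a term linear in the time step, and chaining has to stop at
    a mesh of order 1 / |J|; below it a path moves by at most a multiple of [N] and of time. The
    bias is a product by orthogonality: E int g (l - lhat) ds vanishes as g is a residual and l -
    lhat is F-predictable, and ghat - g does not distinguish the two intensities, under H_0 because
    they agree, for additive residuals because ghat - g is F-predictable. The F-intensity comes with
    no bound: it is integrable because it lies at finite distance from a bounded estimate, and at
    most [C] because it has the same integrals as the G-intensity over F-predictable sets. *)

Lemma meas_cos_R {R : realType} : mT (@cos R).
by apply: cont_meas; exact: continuous_cos. Qed.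
Lemma meas_bool d (T : mType d) (R : realType) (f : T -> bool) :
mT f -> mT (fun x=> (f x)%:R : R).
move=> mf; rewrite (_ : (fun _=> _) = (fun b : bool=> b%:R : R) \o f)//.
by apply: mcompT.
Qed.
Lemma indic_le1 {R : realType} T (A : set T) x : `|\1_A x : R| <= 1.
by rewrite indicE; case: (_ \in _); rewrite ?normr1 ?normr0. Qed.

(** * Tactics for measurability and signs *)

Ltac mfx:= fail.

(** [n] is fuel: composing with measurable hypotheses could otherwise recurse without end. [mfx] is
    a hook, redefined once expectations are available. *)
Ltac mfn n:= lazymatch n with O=> fail | S ?m=> first [lazymatch goal with
| |- measurable_fun _ _=> first [assumption | exact: mcst | exact: measurable_id
 | exact: mfst | exact: msnd | match goal with
| |- measurable_fun _ (fun x=> (@?f x * @?g x)%R)=> apply: mfunM; mfn m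
| |- measurable_fun _ (_ \* _)=> apply: mfunM; mfn m
| |- measurable_fun _ (fun x=> (@?f x - @?g x)%R)=> apply: mfunB; mfn m
| |- measurable_fun _ (fun x=> (@?f x + @?g x)%R)=> apply: mfunD; mfn m
| |- measurable_fun _ (fun x=> (@?f x ^+ _)%R)=> apply: mfunX; mfn m
| |- measurable_fun _ (fun x=> (- @?f x)%R)=> apply: mcompT; mfn m
| |- measurable_fun _ (fun x=> `|@?f x|%R)=> apply: mcompT; mfn m
| |- measurable_fun _ (fun x=> (\sum_(i <- _ | _) _)%R)=> apply: msum=> ?; mfn m
| |- measurable_fun _ (fun x=> EFin (@?f x))=> apply/mEFinP; mfn m
| |- measurable_fun _ (fun x=> (nat_of_bool (_ <= _)%R)%:R%R)=> apply: meas_bool; apply: mfun_le; mfn m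
| |- measurable_fun _ (fun x=> (nat_of_bool (_ < _)%R)%:R%R)=> apply: meas_bool; apply: mfun_lt; mfn m
| |- measurable_fun _ (fun x=> Num.max _ _)=> apply: measurable_maxr; mfn m
| |- measurable_fun _ (fun x=> cos _)=> apply: (mcompT meas_cos_R); mfn m
| |- measurable_fun _ (fun x=> (@?f x, @?g x))=> apply: mpair; mfn m
| |- _=> mfx; mfn m
| h : measurable_fun _ _ |- _=> first [exact: h | apply: (mcompT h); mfn m]
| h : forall i, measurable_fun _ _ |- _=> first [exact: h | apply: (mcompT (h _)); mfn m]
end] end | done] end.
Ltac mf:= mfn 9%nat.

Ltac nn:= first [assumption | lazymatch goal with
| |- is_true (0 <= _ * _)%R=> apply: mulr_ge0; nn
| |- is_true (0 <= _ + _)%R=> apply: addr_ge0; nn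
| |- is_true (0 <= _ ^+ 2)%R=> exact: sqr_ge0
| |- is_true (0 <= _ ^+ _)%R=> apply: exprn_ge0; nn
| |- is_true (0 <= _^-1)%R=> rewrite invr_ge0; nn
| |- is_true (0 <= \sum_(_ <- _ | _) _)%R=> apply: sumr_ge0=> *; nn
| |- is_true (0 < _ * _)%R=> apply: mulr_gt0; nn
| |- is_true (0 < _ ^+ _)%R=> apply: exprn_gt0; nn
| |- is_true (0 < _^-1)%R=> rewrite invr_gt0; nn
| |- is_true (0 < Num.sqrt _)%R=> rewrite sqrtr_gt0; nn
| |- is_true (0 < _ + _)%R=> first [apply: addr_gt0; nn | apply: ltr_wpDr; nn | apply: ltr_wpDl; nn]
| |- is_true (0 <= Num.max _ 0)%R=> by rewrite le_max lexx orbT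
| |- is_true (0%:E <= EFin _)%E=> rewrite lee_fin; nn
| |- is_true (0 <= `|_|)%R=> exact: normr_ge0
| |- is_true (_ <= _)%R=> apply: ltW; nn end | done].

(** * The monotone class theorem for functions *)

Import HBNNSimple.
Lemma max0_split (R : realDomainType) (x : R) : x = Num.max x 0 - Num.max (- x) 0.
by case: (lerP x 0)=> x0; case: (lerP (- x) 0)=> x0'; lra. Qed.
(** Dynkin's lemma gives the indicators of all sets of the generated sigma-algebra, linearity the
    simple functions, and approximation the bounded ones, split into positive and negative parts.
    Limits are asked of sequences with values in [0, M], so that closure can be checked by dominated
    convergence. *)
Lemma monotone_class_fun (R : realType) (X : pointedType) (G : set (set X))
 (Q : (X -> R) -> Prop) :
setI_closed G -> Q (cst 1) -> (forall B, G B -> Q \1_B) ->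
(forall f g (a : R), Q f -> Q g -> Q (fun x=> f x + a * g x)) ->
(forall (f_ : nat -> X -> R) (f : X -> R) (M : R), (forall n, Q (f_ n)) ->
 (forall n x, 0 <= f_ n x <= M) ->
 (forall x, f_ n x @[n --> \oo] --> f x) -> Q f) ->
forall (f : sigmaT G -> R) (M : R), mT f ->
 bdd f M -> Q f.
move=> GI Q1 QG Qlin Qlim f M mf fM.
have Q0 : Q (cst 0).
have -> : (cst 0 : X -> R) = fun x=> cst 1 x + (-1) * cst 1 x.
 by apply/funext=> x /=; rewrite mulN1r subrr.
exact: Qlin.
have Qset B : <<s G >> B -> Q \1_B.
rewrite -(setI_closed_g_dynkin_g_sigma_algebra GI).
suff dQ : dynkin [set B : set X | Q \1_B].
 by move=> GB; apply: (GB [set B : set X | Q \1_B]); split=> // A GA; exact: QG.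
split=> /=.
- by rewrite indicT.
- move=> A QA /=.
 have -> : (\1_(~` A) : X -> R) = fun x=> cst 1 x + (-1) * \1_A x.
  apply/funext=> x; rewrite !indicE in_setC /=.
  by case: (x \in A)=> /=; rewrite ?mulr1 ?mulr0 ?subrr ?addr0.
 exact: Qlin.
- move=> F tF QF /=.
 (* Partial sums of indicators of disjoint sets are indicators again, hence bounded by 1 as closure
    under limits requires. *)
 have Fn n : Q (fun x=> \sum_(i < n) \1_(F i) x).
  elim: n=> [|n IH].
   by rewrite (_ : (fun _=> _) = cst 0)//; apply/funext=> x; rewrite big_ord0.
  rewrite (_ : (fun _=> _) =
   fun x=> (fun x=> \sum_(i < n) \1_(F i) x) x + 1 * (\1_(F n) : X -> R) x).
   exact: (Qlin _ _ 1 IH (QF n)).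
  by apply/funext=> x; rewrite big_ord_recr mul1r.
 have FE n x : (\sum_(i < n) \1_(F i) x : R) = \1_(\big[setU/set0]_(i < n) F i) x.
  rewrite -bigcup_mkord.
  have [xF|xF]:= pselect ((\bigcup_(i in `I_n) F i) x).
   rewrite indicE mem_set//.
   have [i /= ni Fix]:= xF.
   rewrite (bigD1 (Ordinal ni))//= indicE mem_set// big1 ?addr0// => j /eqP ji.
   rewrite indicE memNset// => Fjx; apply: ji; apply: val_inj=> /=.
   by apply: (tF j i)=> //; exists x.
  rewrite indicE memNset// big1// => j _.
  by rewrite indicE memNset// => Fjx; apply: xF; exists (val j)=> //=.
 apply: (Qlim (fun n x=> \sum_(i < n) \1_(F i) x) _ 1 Fn).
  move=> n x; rewrite FE indicE; case: (_ \in _)=> /=; rewrite ?lexx ?ler01//.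
 move=> x; under eq_fun do rewrite FE.
 have [[i _ Fix]|xF]:= pselect ((\bigcup_k F k) x).
  rewrite indicE mem_set; last by exists i.
  apply: cvg_near_cst; exists i.+1=> // n /= ni.
  by rewrite indicE mem_set// -bigcup_mkord; exists i.
 rewrite indicE memNset//.
 apply: cvg_near_cst; exists 0%N=> // n /= ni.
 rewrite indicE memNset// -bigcup_mkord=> -[j _ Fj]; apply: xF.
 by exists j.
have Qge0 (h : sigmaT G -> R) : mT h ->
 (forall x, 0 <= h x <= M) -> Q h.
move=> mh hM.
have mh' : mT (fun x=> (h x)%:E) by mf.
pose g:= nnsfun_approx measurableT mh'.
have h0 x : setT x -> (0 <= (h x)%:E)%E.
 by move=> _; rewrite lee_fin; have /andP[]:= hM x.
have gcvg x : g n x @[n --> \oo] --> h x.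
 have:= cvg_nnsfun_approx measurableT mh' h0 (x:= x) I.
 by move/fine_cvgP=> [_].
apply: (Qlim (fun n=> g n : X -> R) h M).
- move=> n.
 have -> : (g n : X -> R) = fun x=>
   \sum_(y <- finmap.enum_fset (fset_set (range (g n)))) y * \1_(g n @^-1` [set y]) x.
  apply/funext=> x; rewrite (fimfunE (g n)) fsbig_finite//=; exact: fimfunP.
 have QB y : Q (\1_(g n @^-1` [set y]) : X -> R).
  apply: Qset.
  by have:= measurable_funPTI (g n) (measurable_set1 y).
 elim: (finmap.enum_fset _)=> [|y s IH].
  by rewrite (_ : (fun _=> _) = cst 0)//; apply/funext=> x; rewrite big_nil.
 rewrite (_ : (fun _=> _) = fun x=> (fun x=> \sum_(y <- s)
   y * \1_(g n @^-1` [set y]) x) x + y * (\1_(g n @^-1` [set y]) : X -> R) x).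
  exact: (Qlin _ _ y IH (QB y)).
 by apply/funext=> x; rewrite big_cons addrC.
- move=> n x; apply/andP; split; first nn.
 have /andP[_ hx]:= hM x; apply: le_trans hx.
 have nd : nondecreasing_seq (fun n=> g n x).
  move=> a b ab; have:= nd_nnsfun_approx measurableT mh' ab.
  by move=> /lefP /(_ x).
 have cv : cvgn (fun n=> g n x) by apply/cvg_ex; exists (h x); exact: gcvg.
 have:= nondecreasing_cvgn_le nd cv n.
 by rewrite (cvg_lim _ (gcvg x)).
- exact: gcvg.
have M0 : X -> 0 <= M by move=> x; exact: le_trans (normr_ge0 (f x)) (fM x).
have -> : f = (fun x=> (fun x=> Num.max (f x) 0) x + (-1) * (fun x=> Num.max (- f x) 0) x).
apply/funext=> x /=; rewrite mulN1r.
exact: max0_split.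
apply: (Qlin (fun x=> Num.max (f x) 0) (fun x=> Num.max (- f x) 0)); apply: Qge0.
- mf.
- move=> x; rewrite le_max lexx orbT/= ge_max M0// andbT.
exact: le_trans (ler_norm _) (fM x).
- apply: measurable_maxr=> //; mf.
- move=> x; rewrite le_max lexx orbT/= ge_max M0// andbT.
by apply: le_trans (fM x); rewrite -normrN ler_norm.
Unshelve. all: by end_near.
Qed.
Lemma cvg_sum_seq (R : realType) (U : Type) (F : set_system U) {FF : Filter F} (I : Type)
 (s : seq I) (f : I -> U -> R) (l : I -> R) :
(forall i, f i x @[x --> F] --> l i) ->
(\sum_(i <- s) f i x) @[x --> F] --> \sum_(i <- s) l i.
move=> fl; elim: s=> [|i s IH].
by rewrite big_nil; under eq_fun do rewrite big_nil; exact: cvg_cst.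
by rewrite big_cons; under eq_fun do rewrite big_cons; exact: cvgD.
Qed.

(** * Real-valued expectations, laws and Fubini *)

Section expectation.
Context {R : realType}.
(** A real number: [fine] sends an infinite integral to 0, which is why the rules below ask for
    [L1]. *)
Definition Ex d (T : mType d) (P : prob T R) (f : T -> R) : R :=
\int[P]_x f x.
Definition L1 d (T : mType d) (P : prob T R) (f : T -> R) :=
P.-integrable setT (EFin \o f).
Section one_space.
Context d (T : mType d) (P : prob T R).
Implicit Types f g : T -> R.
Lemma L1_meas f : L1 P f -> mT f.
by move=> /integrableP[/mEFinP]. Qed.
Lemma L1_bd f M : mT f -> bdd f M -> L1 P f.
move=> mf fM; apply: measurable_bounded_integrable=> //.
by rewrite [X in (X < _)%E](@probability_setT _ _ _ P) ltry.
exists M; split; first by rewrite num_real.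
by move=> y My x _; exact: le_trans (fM x) (ltW My).
Qed.
Lemma L1_le f g : mT f -> L1 P g -> (forall x, `|f x| <= g x) -> L1 P f.
move=> mf ig fg; apply: (le_integrable _ _ _ ig)=> //; first exact/mEFinP.
by move=> x _ /=; rewrite lee_fin; exact: le_trans (fg x) (ler_norm _).
Qed.
Lemma L1_cst c : L1 P (fun=> c).
by apply: (@L1_bd _ `|c|). Qed.
Lemma L1D f g : L1 P f -> L1 P g -> L1 P (fun x=> f x + g x).
move=> i1 i2; rewrite /L1 (_ : _ \o _ = (EFin \o f) \+ (EFin \o g))%E//.
exact: integrableD.
Qed.
Lemma L1N f : L1 P f -> L1 P (fun x=> - f x).
move=> i1; rewrite /L1 (_ : _ \o _ = \- (EFin \o f))%E//.
exact: integrableN.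
Qed.
Lemma L1B f g : L1 P f -> L1 P g -> L1 P (fun x=> f x - g x).
by move=> i1 i2; apply: L1D=> //; exact: L1N. Qed.
Lemma L1Z c f : L1 P f -> L1 P (fun x=> c * f x).
move=> i1; rewrite /L1 (_ : _ \o _ = (fun x=> c%:E * (EFin \o f) x))%E//.
exact: integrableZl.
Qed.
Lemma L1_sum (I : Type) (s : seq I) (F : I -> T -> R) :
(forall i, L1 P (F i)) -> L1 P (fun x=> \sum_(i <- s) F i x).
move=> iF; elim: s=> [|i s IH].
by under eq_fun do rewrite big_nil; exact: L1_cst.
by under eq_fun do rewrite big_cons; exact: L1D.
Qed.
Lemma L1_norm f : L1 P f -> L1 P (fun x=> `|f x|).
move=> fi; apply: (@L1_le _ (fun x=> `|f x|))=> //; last by move=> x; rewrite normr_id.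
by apply: mcompT=> //; exact: L1_meas.
exact: integrable_norm.
Qed.
Lemma L1_max0 f : L1 P f -> L1 P (fun x=> Num.max (f x) 0).
move=> fi; apply: (@L1_le _ (fun x=> `|f x|)); [|exact: L1_norm|].
by apply: measurable_maxr; [exact: L1_meas|mf].
by move=> x; rewrite ger0N ?le_max ?lexx ?orbT// ge_max ler_norm normr_ge0.
Qed.
Lemma L1_ae f g : mT g -> {ae P, forall x, f x = g x} ->
L1 P f -> L1 P g.
move=> mg fg fi; apply/integrableP; split; first exact/mEFinP.
have /integrableP[mf]:= fi; congr (_ < _)%E; apply: ae_eq_integral=> //.
- exact: mcompT.
- by apply: mcompT=> //; exact/mEFinP.
- by apply: filterS fg=> x /= -> _.
Qed.
Lemma EFin_Ex f : L1 P f -> ((Ex P f)%:E = \int[P]_x (f x)%:E)%E.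
by move=> fi; rewrite /Ex /Rintegral fineK//; exact: integrable_fin_num. Qed.
Lemma ExD f g : L1 P f -> L1 P g -> Ex P (fun x=> f x + g x) = Ex P f + Ex P g.
by move=> *; exact: RintegralD. Qed.
Lemma ExZ c f : L1 P f -> Ex P (fun x=> c * f x) = c * Ex P f.
by move=> *; exact: RintegralZl. Qed.
Lemma ExN f : L1 P f -> Ex P (fun x=> - f x) = - Ex P f.
by move=> fi; rewrite -mulN1r -ExZ//; congr Ex; apply/funext=> x; rewrite mulN1r.
Qed.
Lemma ExB f g : L1 P f -> L1 P g -> Ex P (fun x=> f x - g x) = Ex P f - Ex P g.
by move=> *; exact: RintegralB. Qed.
Lemma Ex_cst c : Ex P (fun=> c) = c.
by rewrite /Ex Rintegral_cst// [X in fine X](@probability_setT _ _ _ P) mulr1. Qed.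
Lemma Ex_le f g : L1 P f -> L1 P g -> (forall x, f x <= g x) -> Ex P f <= Ex P g.
by move=> *; exact: le_Rintegral. Qed.
Lemma Ex_ge0 f : (forall x, 0 <= f x) -> 0 <= Ex P f.
by move=> *; exact: Rintegral_ge0. Qed.
Lemma Ex_norm f : L1 P f -> `|Ex P f| <= Ex P (fun x=> `|f x|).
by move=> *; exact: le_normr_Rintegral. Qed.
Lemma Ex_sum (I : Type) (s : seq I) (F : I -> T -> R) : (forall i, L1 P (F i)) ->
Ex P (fun x=> \sum_(i <- s) F i x) = \sum_(i <- s) Ex P (F i).
move=> iF; elim: s=> [|i s IH].
by under eq_fun do rewrite big_nil; rewrite Ex_cst big_nil.
under eq_fun do rewrite big_cons; rewrite ExD// ?big_cons ?IH//; exact: L1_sum.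
Qed.
Lemma Ex_indic A : measurable A -> Ex P \1_A = fine (P A).
by move=> mA; rewrite /Ex /Rintegral integral_indic// setIT. Qed.
Lemma Ex_bd f M : mT f -> bdd f M -> `|Ex P f| <= M.
move=> mf fM; have fi:= L1_bd mf fM.
apply: le_trans (Ex_norm fi) _; rewrite -[leRHS]Ex_cst; apply: Ex_le=> //.
exact: L1_norm.
exact: L1_cst.
Qed.
Lemma Ex_ae f g : mT f -> mT g ->
{ae P, forall x, f x = g x} -> Ex P f = Ex P g.
move=> mf mg fg; rewrite /Ex /Rintegral; congr fine.
apply: ae_eq_integral=> //; try exact/mEFinP.
by apply: filterS fg=> x /= -> _.
Qed.
Lemma Ex_dct (f_ : nat -> T -> R) f g : (forall n, mT (f_ n)) ->
(forall x, f_ n x @[n --> \oo] --> f x) -> L1 P g ->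
(forall n x, `|f_ n x| <= g x) ->
L1 P f /\ Ex P (f_ n) @[n --> \oo] --> Ex P f.
move=> mf ff ig fg.
have mf' : mT f by apply: (mfun_cvg mf)=> x _; exact: ff.
have fi : L1 P f.
apply: (L1_le mf' ig)=> x.
have cx : `|f_ n x| @[n --> \oo] --> `|f x| by apply: cvg_norm; exact: ff.
rewrite -(cvg_lim _ cx)//; apply: limr_le; first by apply/cvg_ex; exists `|f x|.
by apply: nearW=> n; exact: fg.
split=> //.
have fni n : L1 P (f_ n) by exact: L1_le (mf n) ig (fg n).
have:= @dominated_cvg _ _ _ P setT measurableT (fun n=> EFin \o f_ n) (EFin \o f)
(EFin \o g).
rewrite -(EFin_Ex fi)=> H.
suff /fine_cvgP[_] : (\int[P]_x (f_ n x)%:E)%E @[n --> \oo] --> (Ex P f)%:E by [].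
apply: H=> //.
- by move=> n; exact/mEFinP.
- by move=> x _; apply: cvg_EFin; [exact: nearW|exact: ff].
- by move=> n x _ /=; rewrite lee_fin.
Qed.
(** Gives integrability of the limit along with the bound; this is how moments not known to exist
    are obtained below. *)
Lemma Ex_fatou (f_ : nat -> T -> R) f M : (forall n, L1 P (f_ n)) ->
(forall n x, 0 <= f_ n x) -> (forall x, f_ n x @[n --> \oo] --> f x) ->
(forall n, Ex P (f_ n) <= M) -> L1 P f /\ Ex P f <= M.
move=> fi f0 ff fM.
have mf' : mT f.
by apply: (mfun_cvg (fun n=> L1_meas (fi n)))=> x _; exact: ff.
have f0' x : 0 <= f x.
by rewrite -(cvg_lim _ (ff x))//; apply: limr_ge; [apply/cvg_ex; exists (f x)|exact: nearW].
have : (\int[P]_x (f x)%:E <= M%:E)%E.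
have mf n : mT (fun x=> (f_ n x)%:E) by exact/mEFinP/L1_meas.
have:= fatou P measurableT mf (fun n x _=> f0 n x).
rewrite (eq_integral (fun x=> (f x)%:E)); last first.
 move=> x _; apply: (cvg_limn_einf_sup _).1; apply: cvg_EFin; [exact: nearW|exact: ff].
move=> /le_trans; apply.
have -> : (fun n=> \int[P]_x (f_ n x)%:E)%E = (fun n=> (Ex P (f_ n))%:E).
 by apply/funext=> n; rewrite EFin_Ex.
rewrite limn_einf_lim; apply: lime_le; first exact: is_cvg_einfs.
apply: nearW=> n; apply: (@le_trans _ _ (Ex P (f_ n))%:E); last by rewrite lee_fin.
by apply: ereal_inf_lbound; exists n=> //=.
move=> intf; have fi' : L1 P f.
apply/integrableP; split; first exact/mEFinP.
rewrite (eq_integral (fun x=> (f x)%:E)); first by apply: le_lt_trans intf _; rewrite ltry.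
by move=> x _ /=; rewrite ger0N.
by split=> //; rewrite -lee_fin EFin_Ex.
Qed.
Lemma Ex_eq0 f : L1 P f -> (forall x, 0 <= f x) -> Ex P f = 0 ->
{ae P, forall x, f x = 0}.
move=> fi f0 E0.
have mf : mT (EFin \o f) by exact/mEFinP/L1_meas.
have : (\int[P]_x `|(EFin \o f) x| = 0)%E.
rewrite (_ : (fun _=> _) = EFin \o f); first by rewrite -EFin_Ex// E0.
by apply/funext=> x /=; rewrite ger0N.
move/(ae_eq_integral_abs P measurableT mf); apply: filterS=> x /(_ I) /=.
by move=> [].
Qed.
End one_space.
Definition image_law d (T : mType d) (P : prob T R) d' (T' : mType d')
 (phi : T -> T') (mphi : mT phi) : prob T' R :=
distribution P (mfun_Sub (mem_set mphi)).
Section two_spaces.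
Context d (T : mType d) (P : prob T R).
Context d' (T' : mType d') (P' : prob T' R).
Section law.
Variables (phi : T -> T') (mphi : mT phi).
Hypothesis law : forall A, measurable A -> P (phi @^-1` A) = P' A.
Lemma int_law (f : T' -> \bar R) : mT f -> (forall x, 0 <= f x)%E ->
(\int[P]_x f (phi x) = \int[P']_x f x)%E.
move=> mf f0.
transitivity (\int[pushforward P phi]_x f x)%E; first by rewrite ge0_integral_pushforward.
by apply: eq_measure_integral=> A mA _; exact: law.
Qed.
Lemma L1_law_inv f : mT f -> L1 P (f \o phi) -> L1 P' f.
move=> mf /integrableP[_ fi]; apply/integrableP; split; first exact/mEFinP.
move: fi; rewrite (int_law (f:= fun x=> `|(f x)%:E|%E))//.
by apply: mcompT=> //; mf.
Qed.
Lemma L1_law f : L1 P' f -> L1 P (f \o phi).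
move=> /integrableP[mf fi]; apply/integrableP; split.
mf.
by rewrite (int_law (f:= fun x=> `|(f x)%:E|%E))//; exact: mcompT.
Qed.
Lemma Ex_law f : L1 P' f -> Ex P (f \o phi) = Ex P' f.
move=> fi; have mf:= L1_meas fi.
have mp : mT (EFin \o f) by exact/mEFinP.
rewrite /Ex /Rintegral; congr fine; rewrite [LHS]integralE [RHS]integralE; congr (_ - _)%E.
rewrite -(int_law (measurable_funepos mp))=> [|x]; last nn.
by apply: eq_integral=> x _; rewrite !unlock.
rewrite -(int_law (measurable_funeneg mp))=> [|x]; last nn.
by apply: eq_integral=> x _; rewrite !unlock.
Qed.
End law.
(** Holds without integrability: the section integrals of the positive and negative parts are
    measurable by Tonelli, and so is [fine] of their difference. *)
Lemma meas_Ex (f : T * T' -> R) : mT f ->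
mT (fun x=> Ex P' (fun y=> f (x, y))).
move=> mf.
have mp : mT (EFin \o f) by exact/mEFinP.
have m1 : mT (fubini_F P' (EFin \o f)^\+%E).
by apply: measurable_fun_fubini_tonelli_F=> //; exact: measurable_funepos.
have m2 : mT (fubini_F P' (EFin \o f)^\-%E).
by apply: measurable_fun_fubini_tonelli_F=> //; exact: measurable_funeneg.
rewrite /Ex /Rintegral.
apply: (mcompT (@fine_measurable R setT measurableT)).
rewrite (_ : (fun _=> _) = (fubini_F P' (EFin \o f)^\+ \- fubini_F P' (EFin \o f)^\-)%E).
exact: emeasurable_funB.
apply/funext=> x; rewrite [LHS]integralE; congr (_ - _)%E.
by apply: eq_integral=> y _; rewrite !unlock.
by apply: eq_integral=> y _; rewrite !unlock.
Qed.
Lemma meas_Ex2 (f : T * T' -> R) : mT f ->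
mT (fun y=> Ex P (fun x=> f (x, y))).
move=> mf.
have mp : mT (EFin \o f) by exact/mEFinP.
have m1 : mT (fubini_G P (EFin \o f)^\+%E).
by apply: fubini_measG=> //; exact: measurable_funepos.
have m2 : mT (fubini_G P (EFin \o f)^\-%E).
by apply: fubini_measG=> //; exact: measurable_funeneg.
rewrite /Ex /Rintegral.
apply: (mcompT (@fine_measurable R setT measurableT)).
rewrite (_ : (fun _=> _) = (fubini_G P (EFin \o f)^\+ \- fubini_G P (EFin \o f)^\-)%E).
exact: emeasurable_funB.
apply/funext=> y; rewrite [LHS]integralE; congr (_ - _)%E.
by apply: eq_integral=> x _; rewrite !unlock.
by apply: eq_integral=> x _; rewrite !unlock.
Qed.
Lemma L1_pair2 f : L1 (P \x P')%E f -> (forall y, L1 P (fun x=> f (x, y))) ->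
L1 P' (fun y=> Ex P (fun x=> f (x, y))).
move=> fi f2; have mf:= L1_meas fi.
have mp : mT (EFin \o f) by exact/mEFinP.
apply/integrableP; split; first by apply/mEFinP; exact: meas_Ex2.
have /(integrable21ltyP _ _ mp):= fi; apply: le_lt_trans.
apply: ge0_le_integral=> //.
- apply: mcompT=> //; apply/mEFinP; exact: meas_Ex2.
- have mn : mT (fun p=> `|(f p)%:E|%E) by exact: mcompT.
exact: (fubini_measG (m1:= P) _ mn (fun p=> abse_ge0 _)).
- move=> y _ /=; rewrite (eq_integral (fun x=> (`|f (x, y)|)%:E))//.
by rewrite -EFin_Ex ?lee_fin ?Ex_norm//; exact: L1_norm.
Qed.
Lemma Ex_pair f : L1 (P \x P')%E f -> (forall x, L1 P' (fun y=> f (x, y))) ->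
Ex (P \x P')%E f = Ex P (fun x=> Ex P' (fun y=> f (x, y))).
move=> fi f2; rewrite {1}/Ex /Rintegral -(integral12_prod_meas1 fi) {2}/Ex /Rintegral.
by congr fine; apply: eq_integral=> x _; rewrite EFin_Ex.
Qed.
Lemma Ex_pair2 f : L1 (P \x P')%E f -> (forall y, L1 P (fun x=> f (x, y))) ->
Ex (P \x P')%E f = Ex P' (fun y=> Ex P (fun x=> f (x, y))).
move=> fi f2; rewrite {1}/Ex /Rintegral -(integral21_prod_meas1 fi) {2}/Ex /Rintegral.
by congr fine; apply: eq_integral=> x _; rewrite EFin_Ex.
Qed.
Lemma Ex_pair_bd (f : T * T' -> R) M : mT f -> bdd f M ->
Ex (P \x P')%E f = Ex P (fun x=> Ex P' (fun y=> f (x, y))).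
move=> mf fM; apply: Ex_pair; first exact: L1_bd mf fM.
by move=> x; apply: (@L1_bd _ _ _ _ M)=> //; mf.
Qed.
Lemma Ex_pair2_bd (f : T * T' -> R) M : mT f -> bdd f M ->
Ex (P \x P')%E f = Ex P' (fun y=> Ex P (fun x=> f (x, y))).
move=> mf fM; apply: Ex_pair2; first exact: L1_bd mf fM.
by move=> x; apply: (@L1_bd _ _ _ _ M)=> //; mf.
Qed.
(* Sections of a nonnegative integrand need not be integrable everywhere, hence the hypothesis. *)
Lemma L1_pair_ge0 (f : T * T' -> R) : mT f -> (forall x, 0 <= f x) ->
(forall x, L1 P' (fun y=> f (x, y))) ->
L1 P (fun x=> Ex P' (fun y=> f (x, y))) -> L1 (P \x P')%E f.
move=> mf f0 f2 fi; apply/integrable12ltyP; first exact/mEFinP.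
have /integrableP[_]:= fi; congr (_ < _)%E; apply: eq_integral=> x _ /=.
rewrite ger0N ?Ex_ge0// EFin_Ex//.
by apply: eq_integral=> y _ /=; rewrite ger0N.
Qed.
End two_spaces.
End expectation.

Ltac eqEx:= congr Ex; apply/funext.

Ltac li:= first [assumption | exact: L1_cst | match goal with
| |- L1 _ (fun x=> (@?f x - @?g x)%R)=> apply: L1B; li
| |- L1 _ (fun x=> (@?f x + @?g x)%R)=> apply: L1D; li
| |- L1 _ (fun x=> (- @?f x)%R)=> apply: L1N; li
| |- L1 _ (fun x=> (?c * @?g x)%R)=> apply: L1Z; li
| |- L1 _ (fun x=> `|@?g x|%R)=> apply: L1_norm; li
| |- L1 _ (fun x=> (\sum_(i <- _) _)%R)=> apply: L1_sum=> ?; li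
| h : L1 _ _ |- _=> exact: h
| h : forall i, L1 _ _ |- _=> exact: h
end | done].

Ltac mfx ::= match goal with
| h : L1 _ _ |- _=> exact: (L1_meas h)
| |- measurable_fun _ (fun x=> Ex _ _)=> apply: meas_Ex
end.
Notation L1by M:= (@L1_bd _ _ _ _ _ M).
Notation L1le g:= (@L1_le _ _ _ _ _ g).

(** * Jump times of a counting path and sums over them *)

Section jump_times.
Context {R : realType}.
Implicit Types (n : R -> nat) (h : R -> R).
(** The time of the jump from i to i + 1. For i >= n 1 the set is empty and the infimum is 0 by
    default, a value that [psum] never reads. *)
Definition jtime n (i : nat) : R:= inf [set t | 0 <= t <= 1 /\ (i < n t)%N].
(** Integral over ]0, 1] against the path. An upper limit t is imposed by an indicator in the
    integrand, so that the number of terms never depends on t. *)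
Definition psum n h : R:= \sum_(i < n 1) h (jtime n i).
Section path.
Variables (n : R -> nat) (hn : counting_path n).
Lemma cnt_le s t : 0 <= s -> s <= t -> t <= 1 -> (n s <= n t)%N.
by have [_ + _ _]:= hn; apply. Qed.
Lemma jtime01 i : 0 <= jtime n i <= 1.
rewrite /jtime; set E:= [set t | _].
have [->|/set0P[t Et]]:= eqVneq E set0; first by rewrite inf0 lexx ler01.
apply/andP; split; first by apply: lb_le_inf; [exists t|move=> x [/andP[]]].
have [/andP[t0 t1] _]:= Et; apply: le_trans t1; apply: ge_inf=> //.
by exists 0=> x [/andP[]].
Qed.
(** Right continuity makes the infimum attained, so [jtime] and [n] are adjoint; later comparisons
    of jump times with t reduce to comparisons of integers. *)
Lemma jtime_le i t : (i < n 1)%N -> 0 <= t <= 1 -> (jtime n i <= t) = (i < n t)%N.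
move=> in1 /andP[t0 t1].
pose E:= [set t | 0 <= t <= 1 /\ (i < n t)%N].
have E1 : E 1 by split=> //; rewrite ler01 lexx.
have Elb : has_lbound E by exists 0=> x [/andP[]].
have /andP[r0 r1]:= jtime01 i.
apply/idP/idP; last by move=> it; apply: (ge_inf Elb); split=> //; rewrite t0 t1.
move=> rt; apply: leq_trans (cnt_le r0 rt t1).
have [->//|r1']:= eqVneq (jtime n i) 1.
have {}r1' : jtime n i < 1 by lra.
have [_ _ rc _]:= hn.
have rr : 0 <= jtime n i < 1 by rewrite r0 r1'.
(* A point s to the right of the infimum at which n still has its value; some time of the defining
   set lies below s. *)
have [s [[ns rs] s1]] : exists s, (n s = n (jtime n i) /\ jtime n i < s) /\ s <= 1.
apply: (@filter_ex _ (jtime n i)^'+).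
apply: filterI; last exact: nbhs_right_le.
by apply: filterI; [exact: rc|exact: nbhs_right_gt].
rewrite -ns; have sr : 0 < s - jtime n i by rewrite subr_gt0.
have iE : has_inf E by split; [exists 1|].
have [e [/andP[e0 e1] ie] es]:= inf_adherent sr iE.
apply: (leq_trans ie); apply: cnt_le=> //.
lra.
Qed.
Lemma jtime_gt0 i : (i < n 1)%N -> 0 < jtime n i.
move=> in1; rewrite lt_neqAle; have /andP[-> _]:= jtime01 i; rewrite andbT.
apply/eqP=> r0; have:= jtime_le in1 (t:= 0); rewrite -r0 lexx ler01=> /(_ isT).
by have [-> _ _ _]:= hn.
Qed.
(** Jumps have size one, so no level is skipped. *)
Lemma counting_jtime i : (i < n 1)%N -> n (jtime n i) = i.+1.
move=> in1; have /andP[r0 r1]:= jtime01 i; have rp:= jtime_gt0 in1.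
apply/eqP; rewrite eqn_leq -(jtime_le in1) ?lexx ?r0// andbT.
have [_ _ _ jp]:= hn.
have [s [[ns sr] s0]] : exists s, ((n (jtime n i) <= (n s).+1)%N /\ s < jtime n i) /\ 0 < s.
apply: (@filter_ex _ (jtime n i)^'-).
apply: filterI; last exact: nbhs_left_gt.
by apply: filterI; [apply: jp; rewrite rp|exact: nbhs_left_lt].
apply: (leq_trans ns); rewrite ltnS leqNgt -jtime_le//.
by rewrite -ltNge.
lra.
Qed.
Lemma jtime_mono i j : (i < j)%N -> (j < n 1)%N -> jtime n i < jtime n j.
move=> ij jn; have in1:= ltn_trans ij jn.
rewrite ltNge jtime_le ?jtime01// counting_jtime//.
by rewrite ltnS -ltnNge.
Qed.
Lemma jtime_inj i j : (i < n 1)%N -> (j < n 1)%N -> jtime n i = jtime n j -> i = j.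
by move=> i1 j1 /(congr1 n); rewrite !counting_jtime// => -[]. Qed.
Lemma jump_timesE : jump_times n = jtime n @` `I_(n 1).
apply/seteqP; split=> [t [/andP[t0 t1] nt]|_ [i /= in1 <-]].
have nt0 : (0 < n t)%N by have [s /(leq_ltn_trans _) ->] : exists s, (n s < n t)%N by exact: (@filter_ex _ t^'-).
have itn1 : ((n t).-1 < n 1)%N.
 by rewrite prednK//; apply: cnt_le=> //; nn.
exists (n t).-1=> //.
have : jtime n (n t).-1 <= t by rewrite jtime_le// ?prednK ?leqnn// (ltW t0) t1.
rewrite le_eqVlt=> /orP[/eqP//|rt]; exfalso.
have /andP[r0 r1]:= jtime01 (n t).-1.
have [s [[ns st] rs]] : exists s, ((n s < n t)%N /\ s < t) /\ jtime n (n t).-1 <= s.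
 apply: (@filter_ex _ t^'-).
 apply: filterI; last exact: nbhs_left_ge.
 by apply: filterI; [exact: nt|exact: nbhs_left_lt].
have s01 : 0 <= s <= 1 by lra.
by move: rs; rewrite jtime_le// prednK// leqNgt ns.
have rp:= jtime_gt0 in1; have /andP[r0 r1]:= jtime01 i.
split; first by rewrite rp.
near=> s; rewrite counting_jtime// ltnS leqNgt -jtime_le// -?ltNge.
by [].
apply/andP; split; first by apply: ltW; near: s; exact: nbhs_left_gt.
by apply: le_trans r1; apply: ltW; near: s; exact: nbhs_left_lt.
Unshelve. all: by end_near. Qed.
Lemma int_countingE h t : 0 <= t <= 1 ->
int_counting n h t = psum n (fun s=> (s <= t)%R%:R * h s).
move=> t01; have /andP[t0 t1]:= t01; rewrite /int_counting.
have -> : jump_times n `&` [set s | s <= t] = jtime n @` `I_(n t).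
rewrite jump_timesE; apply/seteqP; split=> [_ [[i /= in1 <-] it]|_ [i /= it <-]].
 by exists i=> //=; rewrite -jtime_le.
have in1 : (i < n 1)%N by apply: leq_trans it _; exact: cnt_le.
by split; [exists i|rewrite /= jtime_le].
have nt1 : (n t <= n 1)%N by exact: cnt_le.
rewrite fsbig_image; last first.
move=> i j; rewrite !inE /= => it jt; apply: jtime_inj.
 exact: leq_trans it nt1.
exact: leq_trans jt nt1.
rewrite -fsbig_ord /psum (big_ord_widen _ (fun i=> h (jtime n i)) nt1).
rewrite big_mkcond; apply: eq_bigr=> i _; rewrite jtime_le//.
by case: ifP; rewrite ?mul1r ?mul0r.
Qed.
Lemma psum_count a b : 0 <= a -> a <= b -> b <= 1 ->
psum n (fun s=> (a < s <= b)%R%:R) = (n b)%:R - (n a)%:R.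
move=> a0 ab b1; have b0:= le_trans a0 ab; have a1:= le_trans ab b1.
have E c : 0 <= c -> c <= 1 -> (n c)%:R = psum n (fun s=> (s <= c)%R%:R).
move=> c0 c1; have nc1 : (n c <= n 1)%N by exact: cnt_le.
rewrite -{1}(card_ord (n c)) -sum1_card natr_sum (big_ord_widen _ (fun=> 1%:R) nc1).
rewrite big_mkcond; apply: eq_bigr=> i _; rewrite jtime_le ?c0//.
by case: ifP.
rewrite !E// /psum -sumrB; apply: eq_bigr=> i _.
rewrite -[LHS]addr0 ltNge.
case: (leP (jtime n i) a)=> ja /=; last by rewrite subr0 addr0.
by rewrite (le_trans ja ab) subrr addr0.
Qed.
Lemma psumD h1 h2 : psum n (fun s=> h1 s + h2 s) = psum n h1 + psum n h2.
by rewrite /psum -big_split. Qed.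
Lemma psumZ c h : psum n (fun s=> c * h s) = c * psum n h.
by rewrite /psum mulr_sumr. Qed.
Lemma psum_le h1 h2 : (forall s, 0 < s <= 1 -> h1 s <= h2 s) -> psum n h1 <= psum n h2.
move=> h12; apply: ler_sum=> i _; apply: h12.
by rewrite jtime_gt0//; have /andP[]:= jtime01 i.
Qed.
Lemma eq_psum h1 h2 : (forall s, 0 < s <= 1 -> h1 s = h2 s) -> psum n h1 = psum n h2.
move=> h12; apply: eq_bigr=> i _; apply: h12.
by rewrite jtime_gt0//; have /andP[]:= jtime01 i.
Qed.
Lemma psum_norm h : `|psum n h| <= psum n (fun s=> `|h s|).
exact: ler_norm_sum. Qed.
Lemma psum_bd h M : bdd h M -> `|psum n h| <= M * (n 1)%:R.
move=> hM; apply: le_trans (psum_norm h) _.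
apply: (@le_trans _ _ (\sum_(i < n 1) M)); first exact: ler_sum.
by rewrite sumr_const card_ord mulr_natr.
Qed.
Lemma psum_ge0 h : (forall s, 0 <= h s) -> 0 <= psum n h.
by move=> h0; apply: sumr_ge0. Qed.
(* Telescoping over the jumps: each jump in ]a, b] raises the increment by one. *)
Lemma psum_telescope (phi : R -> R) a b : 0 <= a -> a <= b -> b <= 1 ->
psum n (fun s=> (a < s <= b)%R%:R *
 (phi (psum n (fun u=> (a < u < s)%R%:R) + 1) - phi (psum n (fun u=> (a < u < s)%R%:R)))) =
phi ((n b)%:R - (n a)%:R) - phi 0.
move=> a0 ab b1; have b0:= le_trans a0 ab; have a1:= le_trans ab b1.
(* The jumps between a and the jump of rank i, both excluded, are those of rank n a to i - 1. *)
have cnt i : (i < n 1)%N -> (n a <= i)%N ->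
 psum n (fun u=> (a < u < jtime n i)%R%:R) = (i - n a)%:R.
move=> i1 ai; have /andP[r0 r1]:= jtime01 i.
have -> : psum n (fun u=> (a < u < jtime n i)%R%:R) = \sum_(j < n 1) ((n a <= j < i)%N)%:R.
 apply: eq_bigr=> j _; congr (_%:R); congr nat_of_bool; congr andb.
  by rewrite ltNge jtime_le ?a0// -leqNgt.
 apply/idP/idP=> [|ji]; last exact: jtime_mono.
 rewrite ltNge; apply: contraR; rewrite -leqNgt leq_eqVlt=> /orP[/eqP->//|ij].
 exact/ltW/jtime_mono.
rewrite -natr_sum; congr (_%:R).
rewrite -(big_mkord xpredT (fun j=> ((n a <= j < i)%N : nat))).
rewrite (big_cat_nat (n:= i))//=; last exact: ltnW.
rewrite (big_cat_nat (n:= n a))//= big_nat_cond big1 ?add0n; last first.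
 by move=> j /andP[/andP[_ ja] _]; rewrite leqNgt ja.
rewrite [X in (_ + X)%N]big_nat_cond [X in (_ + X)%N]big1 ?addn0; last first.
 by move=> j /andP[/andP[ij _] _]; rewrite [(j < i)%N]ltnNge ij andbF.
rewrite big_nat_cond (eq_bigr (fun=> 1%N)) -?big_nat_cond; last first.
 by move=> j /andP[/andP[-> ->] _].
by rewrite sum_nat_const_nat muln1.
have nab : (n a <= n b)%N by exact: cnt_le.
have nb1 : (n b <= n 1)%N by exact: cnt_le.
pose F i:= phi (i - n a).+1%:R - phi (i - n a)%:R.
have -> : psum n (fun s=> (a < s <= b)%R%:R *
 (phi (psum n (fun u=> (a < u < s)%R%:R) + 1) - phi (psum n (fun u=> (a < u < s)%R%:R)))) =
 \sum_(i < n 1) ((n a <= i < n b)%N)%:R * F i.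
apply: eq_bigr=> i _.
have -> : (a < jtime n i <= b) = (n a <= i < n b)%N.
 by rewrite ltNge !jtime_le ?a0 ?b0// -leqNgt.
by case: andP=> [[ai ib]|]; rewrite ?mul0r// !mul1r cnt// natr1.
rewrite -(big_mkord xpredT (fun i=> ((n a <= i < n b)%N)%:R * F i)).
rewrite (big_cat_nat (n:= n b))//= (big_cat_nat (n:= n a))//=.
rewrite big_nat_cond big1 ?add0r; last first.
by move=> j /andP[/andP[_ ja] _]; rewrite leqNgt ja mul0r.
rewrite [X in _ + X]big_nat_cond [X in _ + X]big1 ?addr0; last first.
by move=> j /andP[/andP[ij _] _]; rewrite [(j < n b)%N]ltnNge ij andbF mul0r.
rewrite big_nat_cond (eq_bigr F) -?big_nat_cond; last first.
by move=> j /andP[/andP[-> ->] _]; rewrite mul1r.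
rewrite -(subnK nab) addnC; move: (n b - n a)%N=> m.
rewrite natrD addrAC subrr add0r.
elim: m=> [|m IH]; first by rewrite addn0 big_geq// subrr.
rewrite addnS big_nat_recr ?leq_addr//= IH /F addKn.
lra.
Qed.
End path.
End jump_times.
Lemma meas_fun_le_sets d (T : mType d) (R : realType) (f : T -> R) :
(forall e, measurable [set w | f w <= e]) -> mT f.
move=> mle; apply: (measurability _ (RGenInftyO.measurableE R))=> _ [_ [c ->] <-]; rewrite setTI.
rewrite (_ : _ @^-1` _ = \bigcup_k [set w | f w <= c - k.+1%:R^-1]).
exact: bigcupT_measurable.
apply/seteqP; split=> w /=; rewrite in_itv /=.
move=> jc; have [k hk] : exists k : nat, (k.+1%:R)^-1 < c - f w.
 have:= @ltr_add_invr R 0 (c - f w); rewrite subr_gt0=> /(_ jc)[k].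
 by rewrite add0r; exists k.
by exists k=> //=; rewrite lerBrDr -lerBrDl ltW.
move=> [k _] /= hk; apply: (le_lt_trans hk).
by rewrite ltrBlDr ltrDl invr_gt0.
Qed.
Lemma grid_ex (R : realType) (m : nat) (s : R) : (0 < m)%N -> 0 < s <= 1 ->
exists2 k : nat, (k < m)%N & k%:R / m%:R < s <= k.+1%:R / m%:R.
move=> m0 /andP[s0 s1].
have mr : 0 < m%:R :> R by rewrite ltr0n.
have ex : exists j : nat, s <= j%:R / m%:R by exists m; rewrite divff ?gt_eqF.
case: (ex_minnP ex)=> -[|k] kP kmin.
lra.
exists k; last by rewrite kP andbT ltNge; apply/negP=> /kmin; rewrite ltnn.
rewrite -ltnS; apply: (leq_ltn_trans _ (ltnSn m)); apply: kmin.
by rewrite divff ?gt_eqF.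
Qed.

(** * Time as a uniform random variable *)

Section uniform01.
Context {R : realType}.
Let idTR : measurableTypeR R -> R:= idfun.

#[local] HB.instance Definition _ :=
@isMeasurableFun.Build _ _ _ _ idTR (@measurable_id _ _ setT).
(* The law of the identity: it moves the uniform law from [measurableTypeR R] to
the canonical measurable structure of [R]. *)
Definition U01 : prob R R :=
distribution (uniform_prob (@ltr01 R)) (idTR : {RV (uniform_prob (@ltr01 R)) >-> R}).
(** Processes are constrained on [0, 1] only, and predictable rectangles open after time 0. This
    factor sets everything else to 0; integrals do not change, because {0} is null for dt and
    carries no jump. *)
Definition unitp (s : R) : R:= (0 < s <= 1)%R%:R.
Lemma meas_itvR (a b : R) : mT (fun s : R=> (a < s <= b)%R%:R : R).
rewrite (_ : (fun _=> _) = \1_`]a, b]).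
mf.
by apply/funext=> s; rewrite indicE mem_setE in_itv.
Qed.
Lemma int_U01 (f : R -> \bar R) : mT f -> (forall x, 0 <= f x)%E ->
(\int[U01]_x f x = \int[lebesgue_measure]_(x in `[0%R, 1%R]) f x)%E.
move=> mf f0; rewrite /U01 ge0_integral_distribution//.
by rewrite integral_uniform// subr0 invr1 mul1e.
Qed.
Lemma Ex_U01 (f : R -> R) : mT f ->
Ex U01 f = \int[lebesgue_measure]_(x in `[0, 1]) f x.
move=> mf; have mp : mT (EFin \o f) by exact/mEFinP.
rewrite /Ex /Rintegral; congr fine; rewrite [LHS]integralE [RHS]integralE.
congr (_ - _)%E.
by rewrite int_U01//; exact: measurable_funepos.
by rewrite int_U01//; exact: measurable_funeneg.
Qed.
Lemma L1_U01 (f : R -> R) : mT f ->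
lebesgue_measure.-integrable `[0, 1] (EFin \o f) -> L1 U01 f.
move=> mf /integrableP[_ fi]; apply/integrableP; split; first exact/mEFinP.
rewrite int_U01//; apply: mcompT=> //; exact/mEFinP.
Qed.
Lemma Ex_U01_le (f : R -> R) t : 0 <= t <= 1 -> mT f ->
Ex U01 (fun s=> (s <= t)%R%:R * f s) = \int[lebesgue_measure]_(s in `[0, t]) f s.
move=> /andP[t0 t1] mf; rewrite Ex_U01; last first.
apply: mfunM=> //; apply: meas_bool.
by apply: mfun_le=> //; mf.
rewrite Rintegral_mkcond [RHS]Rintegral_mkcond; apply: eq_Rintegral=> s _.
rewrite !patchE !mem_setE !in_itv /=.
case: (leP 0 s)=> //= s0; case: (leP s t)=> st; rewrite ?mul1r ?mul0r.
by rewrite (le_trans st).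
by case: ifP.
Qed.
Lemma Ex_U01_itv a b : 0 <= a -> a <= b -> b <= 1 ->
Ex U01 (fun s=> (a < s <= b)%R%:R) = b - a.
move=> a0 ab b1; rewrite Ex_U01; last exact: meas_itvR.
rewrite (_ : (fun s : R=> (a < s <= b)%R%:R) = \1_`]a, b]); last first.
by apply/funext=> s; rewrite indicE mem_setE in_itv.
rewrite /Rintegral integral_indic//= setIidl; last first.
move=> s /=; rewrite !in_itv /= => /andP[sa sb].
lra.
rewrite lebesgue_measure_itv /= lte_fin; case: ifPn=> //=.
lra.
Qed.
Lemma Ex_U01_unitp (f : R -> R) : mT f ->
Ex U01 (fun s=> unitp s * f s) = Ex U01 f.
move=> mf; have mu : mT unitp by exact: meas_itvR.
rewrite !Ex_U01//; last mf.
rewrite /Rintegral -!(integral_itv_obnd_cbnd (r:= 0)).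
- congr fine; apply: eq_integral=> s; rewrite inE /= in_itv /= => s01.
by rewrite /unitp s01 mul1r.
- mf.
- mf.
Qed.
End uniform01.

(** * Measurability of jump times and of jump sums *)

Section jumps.
Context {R : realType} d (T : mType d) (N : R -> T -> nat).
Hypotheses (hN : forall w, counting_path (N ^~ w))
(mN : forall t, 0 <= t <= 1 -> mT (fun w=> (N t w)%:R : R)).
Definition jsum (K : R * T -> R) (w : T) : R:= psum (N ^~ w) (fun s=> K (s, w)).
Definition tint (K : R * T -> R) (w : T) : R:= Ex U01 (fun s=> K (s, w)).
Lemma meas_ltN i t : 0 <= t <= 1 -> measurable [set w | (i < N t w)%N].
move=> t01; have:= mN t01 measurableT (measurable_itv `]i%:R, +oo[ : measurable (`]i%:R, +oo[%classic : set R)).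
rewrite setTI; congr measurable; apply/seteqP; split=> w /=; rewrite in_itv /= andbT ltr_nat//.
Qed.
Lemma meas_jtime i : mT (fun w=> jtime (N ^~ w) i).
have J w:= jtime01 (N ^~ w) i.
apply: meas_fun_le_sets=> e.
have [e0|e0]:= ltP e 0.
 rewrite (_ : [set _ | _] = set0)//; apply/seteqP; split=> // w /=.
 by rewrite leNgt (lt_le_trans e0)//; have /andP[]:= J w.
have [e1|e1]:= ltP e 1; last first.
 rewrite (_ : [set _ | _] = setT)//; apply/seteqP; split=> // w _ /=.
 by apply: le_trans e1; have /andP[]:= J w.
have e01 : 0 <= e <= 1 by rewrite e0 ltW.
(* The second set consists of the paths with at most i jumps, for which [jtime] has its default
   value 0. *)
rewrite (_ : [set _ | _] = [set w | (i < N e w)%N] `|` ~` [set w | (i < N 1 w)%N]).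
 by apply: measurableU; [|apply: measurableC]; apply: meas_ltN=> //; rewrite ler01 lexx.
apply/seteqP; split=> w /=.
 have [iN|iN]:= boolP (i < N 1 w)%N; last by right; exact/negP.
 by rewrite (jtime_le (hN w))//; left.
move=> [ie|/negP ie].
 rewrite (jtime_le (hN w))//; apply: (leq_trans ie).
 by apply: (cnt_le (hN w))=> //; nn.
rewrite /jtime (_ : [set t | _] = set0) ?inf0//; apply/seteqP; split=> // t [/andP[t0 t1] it].
by case/negP: ie; apply: leq_trans it _; exact: (cnt_le (hN w)).
Qed.
(** The extra coordinate will hold the training data. The sum is a limit of sums over fixed ranks,
    which no longer change once the rank passes [N 1 w]. *)
Lemma meas_jsum2 d' (S : mType d') (K : S * (R * T) -> R) :
mT K ->
mT (fun p : S * T=> psum (N ^~ p.2) (fun s=> K (p.1, (s, p.2)))).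
move=> mK.
pose F i (p : S * T) : R:= (i < N 1 p.2)%N%:R * K (p.1, (jtime (N ^~ p.2) i, p.2)).
have mF i : mT (F i).
apply: mfunM.
 rewrite (_ : (fun _=> _) = \1_(snd @^-1` [set w | (i < N 1 w)%N])).
  apply: mindic; rewrite -[X in measurable X]setTI; apply: msnd=> //.
  by apply: meas_ltN; rewrite ler01 lexx.
 apply/funext=> p; rewrite indicE; congr (_%:R); congr nat_of_bool.
 by apply/idP/idP; rewrite inE.
apply: (mcompT mK); apply/mpair=> //.
apply/mpair=> //; apply: (mcompT (meas_jtime i))=> //.
apply: (@mfun_cvg _ _ R setT (fun m p=> \sum_(i < m) F i p)).
move=> m; apply: msum=> i; mf.
move=> p _; apply: cvg_near_cst; exists (N 1 p.2)=> // m /= Nm.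
rewrite /psum (big_ord_widen _ (fun i=> K (p.1, (jtime (N ^~ p.2) i, p.2))) Nm).
rewrite [RHS]big_mkcond; apply: eq_bigr=> i _; rewrite /F.
by case: ifP; rewrite ?mul1r ?mul0r.
Qed.
Lemma m_jsum K : mT K -> mT (jsum K).
move=> mK.
have:= @meas_jsum2 _ unit (fun p=> K p.2).
have m1 : mT (fun p : unit * (R * T)=> K p.2) by mf.
by move=> /(_ m1) /(mpair2 tt).
Qed.
End jumps.

(** * Predictable sigma-algebras *)

Section sigma_wrt.
Context {R : realType} (T : pointedType) (C : set (set T)).
Hypothesis sC : sigma_algebra setT C.
Lemma sigma_setI : setI_closed C.
by rewrite -(sigmaTE sC)=> A B mA mB; exact: measurableI. Qed.
Lemma meas_wrtP (f : T -> R) :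
measurable_wrt C f <-> mT (f : sigmaT C -> R).
split=> [fC _ B mB|mf _ [B mB <-]].
by rewrite [measurable](sigmaTE sC); apply: fC; exists B.
by rewrite -(sigmaTE sC); exact: mf.
Qed.
End sigma_wrt.
Section predictable.
Context {R : realType} d (T : mType d).
Implicit Types (H F : R -> set (set T)) (K : R * T -> R).
(** Unlike [predictable_sets], there is no rectangle at time 0 and the generated sigma-algebra lives
    on the whole of [R * T]: a process multiplied by [unitp] is then measurable in the ordinary
    sense, and the generators form a pi-system. *)
Definition pgen H : set (set (R * T)) :=
[set B | exists s t A, [/\ 0 <= s, s <= t, t <= 1, H s A & B = `]s, t] `*` A]].
Notation predT H:= (sigmaT (pgen H)).
Definition filt H : Prop :=
(forall t, 0 <= t <= 1 -> sigma_algebra setT (H t) /\ H t `<=` measurable) /\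
(forall s t, 0 <= s -> s <= t -> t <= 1 -> H s `<=` H t).
Lemma pgen_setI H : filt H -> setI_closed (pgen H).
move=> [sH Hm] _ _ [s [t [A [s0 st t1 HA ->]]]] [s' [t' [A' [s0' st' t1' HA' ->]]]].
(* For disjoint intervals M = m, and ]m, m] yields the empty rectangle, which is still a
   generator. *)
pose m:= Num.max s s'; pose M:= Num.max m (Num.min t t').
have m0 : 0 <= m by rewrite le_max s0.
have m1 : m <= 1 by rewrite ge_max (le_trans st t1) (le_trans st' t1').
have M1 : M <= 1 by rewrite ge_max m1 ge_min t1.
exists m, M, (A `&` A'); split=> //; first by rewrite le_max lexx.
apply: sigma_setI; first by have []:= sH m; rewrite ?m0.
 by apply: (Hm s)=> //; rewrite le_max lexx.
by apply: (Hm s')=> //; rewrite le_max lexx orbT.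
rewrite -setXI; congr (_ `*` _); apply/seteqP; split=> u /=; rewrite !in_itv /=.
move=> [/andP[su ut] /andP[su' ut']].
by rewrite /M /m gt_max su su' /= le_max le_min ut ut' orbT.
rewrite /M /m gt_max le_max le_min=> /andP[/andP[su su'] /orP[|/andP[-> ->]]].
by rewrite le_max=> /orP[]; rewrite leNgt ?su ?su'.
by rewrite su su'.
Qed.
Lemma pgen_measurable H : filt H -> <<s pgen H >> `<=` (measurable : set (set (R * T))).
move=> [sH Hm]; apply: smallest_sub; first exact: sigma_algebra_measurable.
move=> _ [s [t [A [s0 st t1 HA ->]]]]; apply: measurableX=> //.
have s01 : 0 <= s <= 1 by lra.
by have [_]:= sH s s01; exact.
Qed.
Lemma pred_id H : filt H -> mT (idfun : R * T -> predT H).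
by move=> fH _ B mB; rewrite setTI; exact: (pgen_measurable fH mB). Qed.
Lemma pred_meas H K : filt H -> mT (K : predT H -> R) ->
mT K.
move=> fH mK _ B mB; have:= mK measurableT B mB.
by rewrite !setTI; exact: pgen_measurable.
Qed.
Lemma pred_sub H H' K : (forall t, 0 <= t <= 1 -> H t `<=` H' t) ->
mT (K : predT H -> R) -> mT (K : predT H' -> R).
move=> HH' mK _ B mB; have:= mK measurableT B mB.
rewrite !setTI /=; move: (_ @^-1` _); apply: smallest_sub.
exact: smallest_sigma_algebra.
move=> _ [s [t [A [s0 st t1 HA ->]]]]; apply: sub_sig.
by exists s, t, A; split=> //; apply: HH'=> //; rewrite s0 (le_trans st).
Qed.
Lemma pred_rect H s t (f : T -> R) : filt H -> 0 <= s -> s <= t -> t <= 1 ->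
measurable_wrt (H s) f ->
mT ((fun p=> (s < p.1 <= t)%R%:R * f p.2) : predT H -> R).
move=> [sH Hm] s0 st t1 mf _ B mB; rewrite setTI.
have [sHs _] : sigma_algebra setT (H s) /\ H s `<=` measurable.
by apply: sH; rewrite s0 (le_trans st).
have mI A : H s A -> measurable (`]s, t] `*` A : set (predT H)).
by move=> HA; apply: sub_sig; exists s, t, A.
have HfB : H s (f @^-1` B) by apply: mf; exists B; rewrite ?setTI.
have HT : H s setT.
by rewrite -(sigmaTE sHs); mf.
rewrite (_ : _ @^-1` B = (`]s, t] `*` (f @^-1` B)) `|`
((~` (`]s, t] `*` setT)) `&` [set _ | B 0])).
apply: measurableU; first exact: mI.
apply: measurableI; first by apply: measurableC; exact: mI.
have [B0|B0]:= pselect (B 0).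
 by rewrite (_ : [set _ | _] = setT)//; apply/seteqP; split.
by rewrite (_ : [set _ | _] = set0)//; apply/seteqP; split.
apply/seteqP; split=> -[u w] /=; rewrite in_itv /=.
case: (boolP (s < u <= t))=> ut; rewrite ?mul1r ?mul0r=> fB; first by left.
by right; split=> // -[].
move=> [[-> fB]|[/not_andP[/negP/negbTE ->|//] B0]]; first by rewrite mul1r.
by rewrite mul0r.
Qed.
Lemma pred_unitp H : filt H -> mT ((fun p=> unitp p.1) : predT H -> R).
move=> fH; rewrite (_ : (fun _=> _) = fun p=> (0 < p.1 <= 1)%R%:R * (cst 1 : T -> R) p.2).
apply: pred_rect=> //.
have [sH _]:= fH; have [sH0 _] : sigma_algebra setT (H 0) /\ H 0 `<=` measurable.
 by apply: sH; rewrite lexx ler01.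
by apply/(meas_wrtP sH0); mf.
by apply/funext=> p; rewrite mulr1.
Qed.
(* Left limits of adapted processes, sampled at the left endpoints of a grid. *)
Lemma pred_lim H (Y Z : R -> T -> R) : filt H -> adapted H Y ->
(forall w t, 0 < t <= 1 -> Y s w @[s --> t^'-] --> Z t w) ->
mT ((fun p=> unitp p.1 * Z p.1 p.2) : predT H -> R).
move=> fH aY YZ.
pose S m (p : R * T) : R:= \sum_(k < m.+1)
(k%:R / m.+1%:R < p.1 <= k.+1%:R / m.+1%:R)%R%:R * Y (k%:R / m.+1%:R) p.2.
have g01 m k : (k <= m.+1)%N -> 0 <= k%:R / m.+1%:R :> R /\ k%:R / m.+1%:R <= 1 :> R.
move=> km; split; first nn.
by rewrite ler_pdivr ?ltr0n// mul1r ler_nat.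
apply: (@mfun_cvg _ (predT H) R setT S).
move=> m; rewrite /S; apply: msum=> k.
have [k0 k1]:= g01 m k (ltnW (ltn_ord k)).
have [_ k1']:= g01 m k.+1 (ltn_ord k).
apply: pred_rect=> //; last by apply: aY; rewrite k0.
by rewrite ler_pM2r ?invr_gt0 ?ltr0n// ler_nat.
move=> -[t w] _ /=.
have [t01|t01]:= boolP (0 < t <= 1); last first.
rewrite /unitp (negbTE t01) mul0r; apply: cvg_near_cst; exists 0%N=> // m _.
rewrite /S big1// => k _ /=; case: (boolP (_ < _ <= _))=> [/andP[kt tk]|_]; last by rewrite mul0r.
have [k0 k1]:= g01 m k (ltnW (ltn_ord k)).
have [_ k1']:= g01 m k.+1 (ltn_ord k).
by case/negP: t01; rewrite (le_lt_trans k0 kt) (le_trans tk).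
rewrite /unitp t01 mul1r.
apply/cvgrPdist_le=> e e0.
have /cvgrPdist_le /(_ e e0):= YZ w t t01.
move=> [r /= r0 rP].
have [M hM] : exists M : nat, (M.+1%:R)^-1 < r.
have:= @ltr_add_invr R 0 r r0=> -[k]; rewrite add0r; by exists k.
exists M=> // m /= Mm.
have [k km /andP[kt tk]]:= grid_ex (ltn0Sn m) t01.
have -> : S m (t, w) = Y (k%:R / m.+1%:R) w.
rewrite /S (bigD1 (Ordinal km))//= kt tk mul1r big1 ?addr0// => j jk.
case: (boolP (_ < t <= _))=> [/andP[jt tj]|_]; last by rewrite mul0r.
case/eqP: jk; apply: val_inj=> /=; apply/eqP; rewrite eqn_leq.
have:= lt_le_trans jt tk; have:= lt_le_trans kt tj.
by rewrite !ltr_pM2r ?invr_gt0 ?ltr0n// !ltr_nat !ltnS=> -> ->.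
apply: rP=> //=; rewrite ger0N ?subr_ge0 ?(ltW kt)//.
apply: (@le_lt_trans _ _ m.+1%:R^-1).
by rewrite lerBlDr (le_trans tk)// -[in leLHS]natr1 mulrDl mul1r addrC.
by apply: le_lt_trans hM; rewrite lef_pV2 ?posrE ?ltr0n// ler_nat.
Qed.
Local Notation D0:= (`]0%R, 1%R] `*` [set: T]).
Let mD0 H : filt H -> measurable (D0 : set (predT H)).
move=> fH; have:= pred_unitp fH measurableT (measurable_set1 1).
rewrite setTI; congr measurable; apply/seteqP; split=> -[t w] /=.
by rewrite in_itv /= /unitp; case: (_ < _ <= _)=> //= /esym/eqP; rewrite oner_eq0.
by rewrite in_itv /= /unitp=> -[-> _].
Qed.
(** Passes from the sigma-algebra on [0, 1] x T to the one on the whole space: rectangles at time 0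
    miss ]0, 1], and the others lie inside it. *)
Lemma pred_trace H B : filt H -> predictable_sets H B -> measurable (B `&` D0 : set (predT H)).
move=> fH; move: B.
apply: (@smallest_sub _ (sigma_algebra (`[0, 1] `*` setT)) _
[set B : set (R * T) | measurable (B `&` D0 : set (predT H))]).
split=> /=.
- by rewrite set0I.
- move=> A mA; rewrite (_ : _ `&` D0 = D0 `\` (A `&` D0)).
  by apply: measurableD=> //; exact: mD0.
 apply/seteqP; split=> -[t w] /=; rewrite !in_itv /=.
  by move=> [[_ nA] tw]; split=> // -[].
 move=> [[/andP[t0 t1] _] nA]; split; last by rewrite t0 t1.
 by rewrite (ltW t0) t1; split=> // At; apply: nA; rewrite t0 t1.
- by move=> A mA; rewrite setI_bigcupl; exact: bigcupT_measurable.
move=> _ [[A HA <-]|[s [t [A [s0 st t1 HA ->]]]]] /=.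
rewrite (_ : _ `&` _ = set0)//; apply/seteqP; split=> // -[t w] /= [[-> _]].
by rewrite in_itv /= ltxx=> -[].
rewrite setIidl; first by apply: sub_sig; exists s, t, A.
move=> [u w] /=; rewrite !in_itv /= => -[/andP[su ut] _].
lra.
Qed.
Lemma predictable_unitp H (Y : R -> T -> R) : filt H -> predictable H Y ->
mT ((fun p=> unitp p.1 * Y p.1 p.2) : predT H -> R).
move=> fH pY _ B mB; rewrite setTI.
have mY : measurable ((`[0, 1] `*` setT) `&` (fun p=> Y p.1 p.2) @^-1` B `&` D0 : set (predT H)).
by apply: pred_trace=> //; apply: pY; exists B.
rewrite (_ : _ @^-1` B = ((`[0, 1] `*` setT) `&` (fun p=> Y p.1 p.2) @^-1` B `&` D0) `|`
(~` D0 `&` [set _ | B 0])).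
apply: measurableU=> //; apply: measurableI.
 by apply: measurableC; exact: mD0.
have [B0|B0]:= pselect (B 0).
 by rewrite (_ : [set _ | _] = setT)//; apply/seteqP; split.
by rewrite (_ : [set _ | _] = set0)//; apply/seteqP; split.
apply/seteqP; split=> -[t w] /=; rewrite !in_itv /= /unitp.
case: (boolP (0 < t <= 1))=> [/andP[t0 t1]|t01]; rewrite ?mul1r ?mul0r=> YB.
 by left; rewrite (ltW t0).
by right; split=> // -[].
move=> [[[_ YB] [-> _]]|[/not_andP[/negP/negbTE ->|//] B0]]; first by rewrite mul1r.
by rewrite mul0r.
Qed.
(** The same trace argument with the training data as a further coordinate; sections at fixed
    training data are then predictable. *)
Lemma fitted_unitp (S : pointedType) (g : set (set S)) H (Y : S -> R -> T -> R) : filt H ->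
preimage_set_system (setT `*` (`[0, 1] `*` setT))
  (fun p : S * (R * T)=> Y p.1 p.2.1 p.2.2) measurable
 `<=` <<s setT `*` (`[0, 1] `*` setT),
    [set C | exists A B, [/\ <<s g >> A,
                 predictable_sets H B & C = A `*` B]] >> ->
mT
 ((fun p=> unitp p.2.1 * Y p.1 p.2.1 p.2.2) : sigmaT g * predT H -> R).
move=> fH pY.
have mE : measurable (setT `*` D0 : set (sigmaT g * predT H)).
by apply: measurableX=> //; exact: mD0.
have tr C : <<s setT `*` (`[0, 1] `*` setT),
    [set C | exists A B, [/\ <<s g >> A,
                 predictable_sets H B & C = A `*` B]] >> C ->
 measurable (C `&` (setT `*` D0) : set (sigmaT g * predT H)).
move: C; apply: (@smallest_sub _ (sigma_algebra (setT `*` (`[0, 1] `*` setT))) _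
[set C : set (S * (R * T)) |
  measurable (C `&` (setT `*` D0) : set (sigmaT g * predT H))]).
 split=> /=.
 - by rewrite set0I.
 - move=> A mA; rewrite (_ : _ `&` _ = (setT `*` D0) `\` (A `&` (setT `*` D0))).
   exact: measurableD.
  apply/seteqP; split=> -[s [t w]] /=; rewrite !in_itv /=.
   by move=> [[_ nA] tw]; split=> // -[].
  move=> [[_ [/andP[t0 t1] _]] nA]; split; last by rewrite t0 t1.
  by rewrite (ltW t0) t1; split=> // At; apply: nA; rewrite t0 t1.
 - by move=> A mA; rewrite setI_bigcupl; exact: bigcupT_measurable.
move=> _ [A [B [gA HB ->]]] /=; rewrite -setXI setIT.
by apply: measurableX=> //; exact: pred_trace.
move=> _ B mB; rewrite setTI.
have:= tr _ (pY _ (ex_intro2 _ _ B mB erefl)).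
set E:= (_ `&` _ `&` _)=> mEE.
rewrite (_ : _ @^-1` B = E `|` (~` (setT `*` D0) `&` [set _ | B 0])).
apply: measurableU=> //; apply: measurableI; first exact: measurableC.
have [B0|B0]:= pselect (B 0).
 by rewrite (_ : [set _ | _] = setT)//; apply/seteqP; split.
by rewrite (_ : [set _ | _] = set0)//; apply/seteqP; split.
apply/seteqP; split=> -[s [t w]]; rewrite /E /= !in_itv /= /unitp.
case: (boolP (0 < t <= 1))=> [/andP[t0 t1]|t01]; rewrite ?mul1r ?mul0r=> YB.
 by left; rewrite (ltW t0).
by right; split=> // -[_ []].
move=> [[[_ YB] [_ [-> _]]]|[nD B0]]; first by rewrite mul1r.
case: (boolP (0 < t <= 1))=> t01; last by rewrite mul0r.
by case: nD.
Qed.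
End predictable.
Notation predT H:= (sigmaT (pgen H)).

(** * Functionals determined on a pi-system *)

Lemma cvg_norm_le {R : realType} (u : nat -> R) (l M : R) : bdd u M ->
u n @[n --> \oo] --> l -> `|l| <= M.
move=> uM /cvg_norm cl; rewrite -(cvg_lim _ cl)//; apply: limr_le; [by apply: cvgP cl|exact: nearW].
Qed.
(** What expected jump sums and weighted integrals have in common, so that one uniqueness theorem
    serves both. *)
Definition linear_dct {R : realType} (X : pointedType) (G : set (set X)) (A : (X -> R) -> R) :=
(forall (f g : sigmaT G -> R) a M, mT f -> mT g -> bdd f M -> bdd g M ->
 A (fun x=> f x + a * g x) = A f + a * A g) /\
(forall (f_ : nat -> sigmaT G -> R) (f : X -> R) M, (forall n, mT (f_ n)) -> (forall n x, `|f_ n x| <= M) ->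
 (forall x, f_ n x @[n --> \oo] --> f x) -> A (f_ n) @[n --> \oo] --> A f).
(** Agreement on the constant 1 is asked separately, since the whole space need not belong to the
    pi-system. *)
Lemma linear_dct_eq {R : realType} (X : pointedType) (G : set (set X)) (A B : (X -> R) -> R) :
setI_closed G -> linear_dct G A -> linear_dct G B -> A (cst 1) = B (cst 1) ->
(forall C, G C -> A \1_C = B \1_C) ->
forall (f : sigmaT G -> R) M, mT f -> bdd f M -> A f = B f.
move=> GI [lA cA] [lB cB] E1 EG f M mf fM.
suff [] : [/\ mT f, (exists K : R, forall x, `|f x| <= K) & A f = B f] by [].
apply: (@monotone_class_fun R X G (fun f : sigmaT G -> R=> [/\ mT f,
(exists K : R, forall x, `|f x| <= K) & A f = B f]) _ _ _ _ _ f M)=> //.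
- by split=> //; exists 1=> x; rewrite normr1.
- move=> C GC; split; [|by exists 1=> x; exact: indic_le1|exact: EG].
by apply: mindic; exact: sub_sig.
- move=> g h a [mg [Kg gK] gE] [mh [Kh hK] hE]; split; first mf.
+ exists (Kg + `|a| * Kh)=> x; apply: le_trans (ler_normD _ _) _.
 by rewrite lerD// normrM lerM2l.
+ by rewrite (lA _ _ _ (Num.max Kg Kh))// ?(lB _ _ _ (Num.max Kg Kh)) ?gE ?hE// => x; rewrite le_max ?gK ?hK ?orbT.
- move=> g_ g K gP g01 gg.
have gK n x : `|g_ n x| <= K by have /andP[g0 g1]:= g01 n x; rewrite ger0N.
have mg_ n : mT (g_ n : sigmaT G -> R) by have []:= gP n.
have cAg:= cA _ _ _ mg_ gK gg; split; first by apply: (mfun_cvg mg_)=> x _; exact: gg.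
+ by exists K=> x; exact: cvg_norm_le (gK ^~ x) (gg x).
+ apply: (cvg_unique _ cAg)=> //; rewrite (_ : (fun n=> _) = fun n=> B (g_ n)); first exact: cB mg_ gK gg.
 by apply/funext=> n; have []:= gP n.
Qed.
Lemma linear_dct_int {R : realType} (X : pointedType) (G : set (set X)) d (T : mType d)
 (mu : {measure set T -> \bar R}) (Y : T -> sigmaT G) (h : T -> R) : mT Y -> mu.-integrable setT (EFin \o h) ->
linear_dct G (fun f=> \int[mu]_w (f (Y w) * h w)).
move=> mY ih; have mh : mT h by move/integrableP: ih=> [/mEFinP].
have i (f : sigmaT G -> R) M : mT f -> bdd f M -> mu.-integrable setT (EFin \o (fun w=> f (Y w) * h w)).
move=> mf fM; apply: (le_integrable _ _ _ (integrableZl measurableT M (integrable_abse ih)))=> //.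
 by apply/mEFinP; mf.
move=> w _; rewrite /= lee_fin normrM [leRHS]ger0N ?ler_wpM2r//.
by rewrite mulr_ge0// (le_trans _ (fM (Y w))).
split=> [f g a M mf mg fM gM|f_ f M mf fM ff].
rewrite -RintegralZl//; last exact: i mg gM.
rewrite -RintegralD//; [|exact: i mf fM|].
 by apply: eq_Rintegral=> w _; rewrite mulrDl mulrA.
rewrite (_ : EFin \o _ = fun w=> a%:E * (g (Y w) * h w)%:E)%E//; apply: integrableZl=> //; exact: i mg gM.
have fM' x : `|f x| <= M by exact: cvg_norm_le (fM ^~ x) (ff x).
have mf' : mT (f : sigmaT G -> R) by apply: (mfun_cvg mf)=> x _; exact: ff.
have fin:= i _ _ mf' fM'; apply: (proj2 (A:= \forall n \near \oo, (\int[mu]_w (f_ n (Y w) * h w)%:E)%E \is a fin_num)).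
apply/fine_cvgP; rewrite fineK; last exact: integrable_fin_num.
apply: (@dominated_cvg _ _ _ mu setT measurableT (fun n=> EFin \o (fun w=> f_ n (Y w) * h w))
(EFin \o (fun w=> f (Y w) * h w)) (fun w=> M%:E * `|(h w)%:E|)%E).
- by move=> n; have /integrableP[]:= i _ _ (mf n) (fM n).
- by move=> w _; apply: cvg_EFin; [exact: nearW|apply: cvgMr_tmp; exact: ff].
- by [].
- by apply: integrableZl=> //; exact: integrable_abse.
- by move=> n w _; rewrite /= lee_fin normrM ler_wpM2r.
Qed.
Lemma measurable_gen (X : pointedType) (G : set (set X)) d (T : mType d) (Y : T -> X) :
(forall B, G B -> measurable (Y @^-1` B)) -> mT (Y : T -> sigmaT G).
move=> h _ B mB; rewrite setTI; move: B mB; apply: smallest_sub=> //.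
split=> /=; first by rewrite preimage_set0.
by move=> A mA; rewrite setTD -preimage_setC; exact: measurableC.
by move=> F mF; rewrite preimage_bigcup; exact: bigcup_measurable.
Qed.
(** The weights may change sign: this is uniqueness for signed measures. With weight 0 on one side
    it proves orthogonality relations, with constant weights the equality of laws. *)
Lemma Ex_pi_weight {R : realType} d1 (T1 : mType d1) (P1 : prob T1 R)
 d2 (T2 : mType d2) (P2 : prob T2 R) (X : pointedType) (G : set (set X))
 (Y1 : T1 -> X) (Y2 : T2 -> X) (h1 : T1 -> R) (h2 : T2 -> R) : setI_closed G ->
(forall B, G B -> measurable (Y1 @^-1` B)) -> (forall B, G B -> measurable (Y2 @^-1` B)) ->
L1 P1 h1 -> L1 P2 h2 -> Ex P1 h1 = Ex P2 h2 ->
(forall B, G B -> Ex P1 (fun w=> \1_B (Y1 w) * h1 w) = Ex P2 (fun w=> \1_B (Y2 w) * h2 w)) ->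
forall (f : sigmaT G -> R) M, mT f -> bdd f M ->
Ex P1 (fun w=> f (Y1 w) * h1 w) = Ex P2 (fun w=> f (Y2 w) * h2 w).
move=> GI /measurable_gen m1 /measurable_gen m2 L1 L2 E1 EG f M mf fM.
apply: (linear_dct_eq GI (linear_dct_int m1 L1) (linear_dct_int m2 L2) _ EG mf fM).
rewrite -[LHS]/(Ex P1 _) -[RHS]/(Ex P2 _) (_ : (fun _=> _) = h1); last by apply/funext=> w; rewrite mul1r.
by rewrite E1; eqEx=> w; rewrite mul1r.
Qed.

(** * The enlarged filtration *)

Section enlarged.
Context {R : realType} d (T : mType d) (P : prob T R).
Variables (F : R -> set (set T)) (X : R -> T -> R).
Hypotheses (uF : usual_filtration P F)
(mX : forall t, 0 <= t <= 1 -> mT (X t)).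
Lemma usual_filt : filt F.
by have []:= uF. Qed.
Lemma sub_enlarge t : 0 <= t <= 1 -> F t `<=` enlarge F X t.
move=> /andP[t0 t1] A FA s; rewrite /= in_itv /= => st.
apply: sub_sig; left; have [_ Fm _ _]:= uF.
move: st=> [/andP[ts s1]|->]; apply: (Fm t)=> //.
nn.
Qed.
Lemma filt_enlarge : filt (enlarge F X).
split=> [t t01|s t s0 st t1].
split; first by apply: sigma_algebra_bigcap=> s _; by [].
move=> A /(_ 1) /= => HA; have {}HA:= HA (or_intror erefl).
move: A HA; apply: smallest_sub; first exact: sigma_algebra_measurable.
rewrite subUset; split; first by have [H _ _ _]:= uF; have []:= H 1; rewrite ?ler01 ?lexx.
apply: smallest_sub; first exact: sigma_algebra_measurable.
move=> A [u]; rewrite /= in_itv /= => u01 [B mB <-].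
exact: mX.
move=> A HA u; rewrite /= in_itv /= => ut; apply: HA; rewrite /= in_itv /=.
lra.
Qed.
End enlarged.

(** * From the local martingale property to the compensator identity *)

Section compensator.
Context {R : realType} d (T : mType d) (P : prob T R).
Context (N : R -> T -> nat) (H : R -> set (set T)).
Hypotheses (hN : forall w, counting_path (N ^~ w))
(mN : forall t, 0 <= t <= 1 -> mT (fun w=> (N t w)%:R : R))
(fH : filt H).
Notation Q:= (U01 \x P)%E.
(** The form in which the martingale hypothesis is used: the jump measure of [N] and l dt x P have
    the same mass against bounded predictable integrands. *)
Definition compensates (l : R * T -> R) : Prop :=
[/\ L1 P (fun w=> (N 1 w)%:R), L1 Q l,
  mT (l : predT H -> R) &
  forall (K : R * T -> R) M, mT (K : predT H -> R) ->
   bdd K M -> Ex P (jsum N K) = Ex Q (fun p=> K p * l p)].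
Lemma jsum_bd (K : R * T -> R) (M : R) w : bdd K M -> `|jsum N K w| <= M * (N 1 w)%:R.
by move=> KM; apply: psum_bd. Qed.
Lemma jsum_cst1 w : jsum N (cst 1) w = (N 1 w)%:R.
by rewrite /jsum /psum sumr_const card_ord. Qed.
Section from_martingale.
Variable l : R -> T -> R.
Hypotheses (ml : predictable H l)
(li : {ae P, forall w,
lebesgue_measure.-integrable `[0, 1] (fun s=> (l s w)%:E)})
(lM : local_martingale P H (compensated N l)).
Let lp (p : R * T) : R:= unitp p.1 * l p.1 p.2.
Hypothesis l_pos : L1 Q (fun p=> Num.max (lp p) 0).
Let mlp : mT (lp : predT H -> R).
exact: predictable_unitp. Qed.
Let mlp' : mT lp.
exact: pred_meas mlp. Qed.
Let mlpw w : mT (fun s=> lp (s, w)).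
mf. Qed.
Let unitp_itv s : (0 < s <= 1) -> unitp s = 1 :> R.
by rewrite /unitp=> ->. Qed.
Let int_lp w c : 0 <= c <= 1 ->
lebesgue_measure.-integrable `[0, 1] (fun s=> (l s w)%:E) ->
\int[lebesgue_measure]_(s in `[0, c]) l s w = Ex U01 (fun s=> (s <= c)%R%:R * lp (s, w)).
move=> /andP[c0 c1] il.
rewrite Ex_U01_le// ?c0// /Rintegral.
have E s : s \in `]0, c]%classic -> (l s w)%:E = (lp (s, w))%:E.
rewrite inE /= in_itv /= => /andP[s0 sc].
by rewrite /lp /= unitp_itv ?mul1r// s0 (le_trans sc).
have ml2 : measurable_fun (`]0, c]%classic : set R) (fun s=> (lp (s, w))%:E).
mf.
rewrite -!integral_itv_obnd_cbnd//; last first.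
by apply: (eq_measurable_fun _ _ ml2)=> s /E.
by congr fine; apply: eq_integral=> s /E.
Qed.
(** Kept in the extended reals: the integral of the negative part is not known to be finite before
    the identity on ]0, 1] x T is proved. *)
Let Ipos (c : R * T -> R) w:= (\int[U01]_u (c (u, w) * Num.max (lp (u, w)) 0)%:E)%E.
Let Ineg (c : R * T -> R) w:= (\int[U01]_u (c (u, w) * Num.max (- lp (u, w)) 0)%:E)%E.
Let mpos : mT (fun p=> Num.max (lp p) 0).
mf. Qed.
Let mneg : mT (fun p=> Num.max (- lp p) 0).
mf.
Qed.
Let mIpos (c : R * T -> R) : mT c -> (forall p, 0 <= c p) -> mT (Ipos c).
move=> mc c0.
apply: (@fubini_measG _ _ _ _ R U01 (fun p=> (c p * Num.max (lp p) 0)%:E)).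
mf.
by move=> p; rewrite lee_fin mulr_ge0// le_max lexx orbT.
Qed.
Let mIneg (c : R * T -> R) : mT c -> (forall p, 0 <= c p) -> mT (Ineg c).
move=> mc c0.
apply: (@fubini_measG _ _ _ _ R U01 (fun p=> (c p * Num.max (- lp p) 0)%:E)).
mf.
by move=> p; rewrite lee_fin mulr_ge0// le_max lexx orbT.
Qed.
Let Ipos_ge0 (c : R * T -> R) w : (forall p, 0 <= c p) -> (0 <= Ipos c w)%E.
by move=> c0; apply: integral_ge0=> u _; rewrite lee_fin mulr_ge0// le_max lexx orbT.
Qed.
Let Ineg_ge0 (c : R * T -> R) w : (forall p, 0 <= c p) -> (0 <= Ineg c w)%E.
by move=> c0; apply: integral_ge0=> u _; rewrite lee_fin mulr_ge0// le_max lexx orbT.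
Qed.
Let max_ge0 (x : R) : 0 <= Num.max x 0.
by rewrite le_max lexx orbT. Qed.
Let int_Ipos (c' : R * T -> R) : mT c' -> (forall p, 0 <= c' p) ->
(\int[P]_w Ipos c' w = \int[Q]_p (c' p * Num.max (lp p) 0)%:E)%E.
move=> mc' c'0; rewrite (fubini_tonelli2 (fun p=> (c' p * Num.max (lp p) 0)%:E))//.
mf.
by move=> p; rewrite lee_fin mulr_ge0// le_max lexx orbT.
Qed.
Let int_Ineg (c' : R * T -> R) : mT c' -> (forall p, 0 <= c' p) ->
(\int[P]_w Ineg c' w = \int[Q]_p (c' p * Num.max (- lp p) 0)%:E)%E.
move=> mc' c'0; rewrite (fubini_tonelli2 (fun p=> (c' p * Num.max (- lp p) 0)%:E))//.
mf.
by move=> p; rewrite lee_fin mulr_ge0// le_max lexx orbT.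
Qed.
Section rectangle.
Variables (a b : R) (A : set T).
Hypotheses (a0 : 0 <= a) (ab : a <= b) (b1 : b <= 1) (HA : H a A).
Let mA : measurable A.
by have [+ _]:= fH=> /(_ a); rewrite a0 (le_trans ab)// => /(_ isT)[_]; exact. Qed.
Let c (p : R * T) : R:= (a < p.1 <= b)%R%:R * \1_A p.2.
Let c01 p : 0 <= c p <= 1.
rewrite /c indicE; case: (_ < _ <= _); case: (_ \in _);
by rewrite ?mul1r ?mul0r ?lexx ?ler01.
Qed.
Let mc : mT c.
apply: mfunM; first by apply: (mcompT (meas_itvR a b)).
by apply: mcompT=> //; mf.
Qed.
Variable tau : nat -> T -> R.
Hypotheses (tau_nd : forall k w, 0 <= tau k w <= tau k.+1 w)
(tau_st : forall k t, 0 <= t <= 1 -> H t [set w | tau k w <= t])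
(tau_ev : {ae P, forall w, exists k, 1 <= tau k w})
(tau_mg : forall k, martingale P H (fun t w=> compensated N l (Num.min t (tau k w)) w)).
(** The rectangle cut at the localizing time; it increases with k and equals the full rectangle once
    [tau k] reaches 1. *)
Let ck k (p : R * T) : R:= c p * (p.1 <= Num.min (tau k p.2) 1)%R%:R.
Let mtau k : mT (fun w=> Num.min (tau k w) 1).
apply: meas_fun_le_sets=> e.
have [e0|e0]:= ltP e 0.
rewrite (_ : [set _ | _] = set0)//; apply/seteqP; split=> // w /=.
rewrite leNgt (lt_le_trans e0)// le_min ler01 andbT.
by have /andP[]:= tau_nd k w.
have [e1|e1]:= ltP e 1; last first.
rewrite (_ : [set _ | _] = setT)//; apply/seteqP; split=> // w _ /=.
by rewrite ge_min e1 orbT.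
rewrite (_ : [set _ | _] = [set w | tau k w <= e]).
have e01 : 0 <= e <= 1 by rewrite e0 ltW.
by have [+ _]:= fH=> /(_ e e01)[_]; apply; exact: tau_st.
by apply/seteqP; split=> w /=; rewrite ge_min [1 <= e]leNgt e1 orbF.
Qed.
Let mck k : mT (ck k).
apply: mfunM=> //; apply: meas_bool; apply: mfun_le=> //.
mf.
Qed.
Let ck_ge0 k p : 0 <= ck k p.
by rewrite mulr_ge0//; have /andP[]:= c01 p. Qed.
Let tau_mono w i j : (i <= j)%N -> tau i w <= tau j w.
elim: j=> [|j IH]; first by rewrite leqn0=> /eqP->.
rewrite leq_eqVlt ltnS=> /predU1P[->//|/IH h].
by apply: le_trans h _; have /andP[]:= tau_nd j w.
Qed.
Let ck_nd p i j : (i <= j)%N -> ck i p <= ck j p.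
move=> ij; rewrite lerM2l//; first by have /andP[]:= c01 p.
rewrite ler_nat; case: (leP p.1 (Num.min (tau i p.2) 1))=> // h.
rewrite (le_trans h)// le_min ge_min (tau_mono _ ij) /=.
by rewrite ge_min lexx orbT.
Qed.
Let ck_ev w k : 1 <= tau k w -> forall u, ck k (u, w) = c (u, w).
move=> t1 u; rewrite /ck /= (min_idPr t1).
rewrite /c /=; case: (boolP (a < u <= b))=> [/andP[_ ub]|_]; last by rewrite !mul0r.
by rewrite (le_trans ub b1) mulr1.
Qed.
Let D k w : R:= compensated N l (Num.min b (tau k w)) w - compensated N l (Num.min a (tau k w)) w.
Let ckE k u w : ck k (u, w) = \1_A w * (Num.min a (tau k w) < u <= Num.min b (tau k w))%R%:R.
rewrite /ck /c /= mulrC mulrA mulrC; congr (_ * _); rewrite -natrM mulnb; congr (_%:R); congr nat_of_bool.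
rewrite gt_min !le_min.
case: (leP u (tau k w))=> ut /=; rewrite ?andbF ?orbF ?andbT//.
by case: (leP u b)=> ub; rewrite ?andbF// (le_trans ub b1).
Qed.
(** The negative part of the intensity stands on the side of the jumps, so that no difference of
    possibly infinite terms occurs. *)
Let D_id k w : lebesgue_measure.-integrable `[0, 1] (fun s=> (l s w)%:E) ->
((jsum N (ck k) w)%:E + Ineg (ck k) w = (\1_A w * D k w)%:E + Ipos (ck k) w)%E.
move=> il; have /andP[t0 _]:= tau_nd k w.
have L1lp : L1 U01 (fun s=> lp (s, w)).
apply: L1_U01=> //; apply: (le_integrable _ _ _ il)=> //.
 have mm : measurable_fun (`[0%R, 1%R]%classic : set R) (fun s=> (lp (s, w))%:E).
  by apply: measurable_funTS; apply/mEFinP.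
 mf.
move=> s _ /=; rewrite lee_fin /lp /= normrM ler_piMl//.
by rewrite /unitp; case: (_ < _ <= _); rewrite ?normr1 ?normr0.
set a':= Num.min a (tau k w); set b':= Num.min b (tau k w).
have a'0 : 0 <= a' by rewrite le_min a0.
have ab' : a' <= b' by rewrite le_min !ge_min ab lexx orbT.
have b'1 : b' <= 1 by rewrite ge_min b1.
have b'0:= le_trans a'0 ab'; have a'1:= le_trans ab' b'1.
have iJ : jsum N (ck k) w = \1_A w * ((N b' w)%:R - (N a' w)%:R).
rewrite -(psum_count (hN w))// -psumZ; apply: (eq_psum (hN w))=> s _.
exact: ckE.
have L1c (f : R -> R) : L1 U01 f -> L1 U01 (fun u=> ck k (u, w) * f u).
move=> fi; apply: (L1le (fun u=> `|f u|)).
- apply: mfunM; last exact: L1_meas fi.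
 mf.
- exact: L1_norm.
- move=> u; rewrite normrM ler_piMl// ger0N// ckE indicE.
 by case: (_ \in _); case: (_ < _ <= _); rewrite ?mul1r ?mul0r ?ler01 ?lexx.
have L1p : L1 U01 (fun u=> Num.max (lp (u, w)) 0).
apply: (L1le (fun s=> `|lp (s, w)|)).
- mf.
- exact: L1_norm.
- by move=> u; rewrite ger0N ?le_max ?lexx ?orbT// ge_max ler_norm normr_ge0.
have L1n : L1 U01 (fun u=> Num.max (- lp (u, w)) 0).
apply: (L1le (fun s=> `|lp (s, w)|)).
- exact: (mpair1 w mneg).
- exact: L1_norm.
- move=> u; rewrite ger0N ?le_max ?lexx ?orbT// ge_max normr_ge0 andbT.
 by rewrite -normrN ler_norm.
rewrite /Ineg /Ipos -(EFin_Ex (L1c _ L1n)) -(EFin_Ex (L1c _ L1p)) -!EFinD; congr (_%:E).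
rewrite iJ /D /compensated -/a' -/b' !int_lp// ?a'0 ?b'0 ?a'1//.
have iD : Ex U01 (fun s=> (s <= b')%R%:R * lp (s, w)) - Ex U01 (fun s=> (s <= a')%R%:R * lp (s, w)) =
Ex U01 (fun s=> (a' < s <= b')%R%:R * lp (s, w)).
have L1i e : L1 U01 (fun s=> (s <= e)%R%:R * lp (s, w)).
 apply: (L1le (fun s=> `|lp (s, w)|)).
 - apply: mfunM=> //; apply: meas_bool.
  by apply: mfun_le=> //.
 - exact: L1_norm.
 - by move=> u; rewrite normrM ler_piMl//; case: (u <= e); rewrite ?normr1 ?normr0 ?ler01.
rewrite -ExB//; eqEx=> s; rewrite -mulrBl; congr (_ * _).
rewrite ltNge; case: (leP s a')=> sa /=; last by rewrite subr0.
by rewrite (le_trans sa ab') subrr.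
have iX : \1_A w * Ex U01 (fun s=> (a' < s <= b')%R%:R * lp (s, w)) =
Ex U01 (fun u=> ck k (u, w) * Num.max (lp (u, w)) 0) -
Ex U01 (fun u=> ck k (u, w) * Num.max (- lp (u, w)) 0).
rewrite -ExB; try exact: L1c.
rewrite -ExZ; last first.
 apply: (L1le (fun s=> `|lp (s, w)|)).
 - by apply: mfunM=> //; exact: meas_itvR.
 - exact: L1_norm.
 - by move=> u; rewrite normrM ler_piMl// ger0N//; case: (_ < _ <= _); rewrite ?ler01.
eqEx=> u; rewrite -mulrBr -max0_split ckE mulrA//.
move: iD iX; set eb:= Ex _ _; set ea:= Ex _ _; set e1:= Ex _ _.
set e2:= Ex _ _; set e3:= Ex _ _=> iD iX.
have -> : (N b' w)%:R - eb - ((N a' w)%:R - ea) = (N b' w)%:R - (N a' w)%:R - e1.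
by rewrite -iD; ring.
lra.
Qed.
Let ctr01 k p : 0 <= ck k p <= 1.
case: p=> u w; rewrite ckE indicE.
by case: (_ \in _); case: (_ < _ <= _); rewrite ?mul1r ?mul0r ?ler01 ?lexx.
Qed.
Let D_int k : P.-integrable setT (fun w=> (\1_A w * D k w)%:E) /\
(\int[P]_w (\1_A w * D k w)%:E = 0)%E.
have [iY iZ _ E]:= tau_mg k a0 ab b1.
set Y:= EFin \o _ in iY; set Z:= EFin \o _ in iZ.
have AE (f : T -> R) : (fun w=> (\1_A w * f w)%:E) = ((EFin \o f) \_ A).
apply/funext=> w; rewrite patchE indicE; case: (_ \in _); rewrite ?mul1r ?mul0r//.
have iAY : P.-integrable A Y by exact: integrableS iY.
have iAZ : P.-integrable A Z by exact: integrableS iZ.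
have YZ : EFin \o D k = (Y \- Z)%E by [].
split.
by rewrite AE -integrable_mkcond// YZ; exact: integrableB.
rewrite AE -integral_mkcond YZ integralB// (E A HA) subee//.
exact: integrable_fin_num.
Qed.
Let Ipos_L1 k : P.-integrable setT (Ipos (ck k)).
apply/integrableP; split; first exact: mIpos.
under eq_integral do rewrite gee0_abs ?Ipos_ge0//.
rewrite int_Ipos//; have /integrableP[_]:= l_pos; apply: le_lt_trans.
apply: ge0_le_integral=> //.
- by move=> p _; rewrite lee_fin mulr_ge0// le_max lexx orbT.
- mf.
- by apply: mcompT=> //; exact/mEFinP.
- move=> p _ /=; rewrite lee_fin (ger0N (max_ge0 _)) ler_piMl//.
by have /andP[]:= ctr01 k p.
Qed.
Let Fk k w:= ((jsum N (ck k) w)%:E + Ineg (ck k) w)%E.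
Let mFk k : mT (Fk k).
apply: emeasurable_funD; last exact: mIneg.
by apply/mEFinP; exact: m_jsum.
Qed.
Let int_k k : (\int[P]_w Fk k w = \int[P]_w Ipos (ck k) w)%E.
have [iD D0]:= D_int k.
have iI:= Ipos_L1 k.
transitivity (\int[P]_w ((\1_A w * D k w)%:E + Ipos (ck k) w))%E; last first.
by rewrite integralD// D0 add0e.
apply: (@ae_eq_integral _ _ _ P setT)=> //.
- by apply: emeasurable_funD; [exact: measurable_int iD|exact: mIpos].
- by apply: filterS li=> w iw _; exact: D_id.
Qed.
Let Fk_ge0 k w : (0 <= Fk k w)%E.
apply: adde_ge0; last exact: Ineg_ge0.
by rewrite lee_fin; exact: psum_ge0.
Qed.
Let Ipos_nd w i j : (i <= j)%N -> (Ipos (ck i) w <= Ipos (ck j) w)%E.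
move=> ij; apply: ge0_le_integral=> //.
- by move=> p _; rewrite lee_fin mulr_ge0// le_max lexx orbT.
- by apply/mEFinP; exact: (mpair1 w (mfunM (mck i) mpos)).
- by apply/mEFinP; exact: (mpair1 w (mfunM (mck j) mpos)).
- by move=> u _; rewrite lee_fin ler_wpM2r ?le_max ?lexx ?orbT// ck_nd.
Qed.
Let Fk_nd w i j : (i <= j)%N -> (Fk i w <= Fk j w)%E.
move=> ij; apply: leeD.
by rewrite lee_fin; apply: psum_le=> // s _; exact: ck_nd.
apply: ge0_le_integral=> //.
- by move=> p _; rewrite lee_fin mulr_ge0// le_max lexx orbT.
- by apply/mEFinP; exact: (mpair1 w (mfunM (mck i) mneg)).
- by apply/mEFinP; exact: (mpair1 w (mfunM (mck j) mneg)).
- by move=> u _; rewrite lee_fin ler_wpM2r ?le_max ?lexx ?orbT// ck_nd.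
Qed.
(** The monotone limit is identified almost everywhere, because on almost every path [tau k] reaches
    1 at a finite k. *)
Let mono_limit (f_ : nat -> T -> \bar R) (f : T -> \bar R) :
(forall n, mT (f_ n)) -> (forall n w, (0 <= f_ n w)%E) ->
(forall w i j, (i <= j)%N -> (f_ i w <= f_ j w)%E) -> mT f ->
(forall w k, 1 <= tau k w -> f_ k w = f w) ->
(\int[P]_w f w = limn (fun n=> \int[P]_w f_ n w))%E.
move=> mf f0 fnd mff fe; rewrite -monotone_convergence//; last by move=> w _ i j; exact: fnd.
have cf w : f_ n w @[n --> \oo] --> limn (f_ ^~ w).
by apply: ereal_nondecreasing_is_cvgn=> i j; exact: fnd.
apply: ae_eq_integral=> //.
by apply: (emeasurable_fun_cvg f_)=> // w _; exact: cf.
apply: filterS tau_ev=> w [k kw] _; apply/esym/cvg_lim=> //.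
apply: cvg_near_cst; exists k=> // n /= kn.
by apply: fe; apply: (le_trans kw); exact: tau_mono.
Qed.
Lemma rectangle_id :
(\int[P]_w ((jsum N c w)%:E + Ineg c w) = \int[P]_w Ipos c w)%E.
have c0 p : 0 <= c p by have /andP[]:= c01 p.
have ckc k w : 1 <= tau k w -> (fun u=> ck k (u, w)) = (fun u=> c (u, w)).
by move=> t1; apply/funext=> u; exact: ck_ev.
rewrite (mono_limit (f_:= Fk))//.
- rewrite (mono_limit (f_:= fun k=> Ipos (ck k)))//.
+ by congr (limn _); apply/funext=> k; exact: int_k.
+ by move=> k; exact: mIpos.
+ by move=> k w; exact: Ipos_ge0.
+ exact: mIpos.
+ by move=> w k t1; apply: eq_integral=> u _; rewrite ck_ev.
- apply: emeasurable_funD; last exact: mIneg.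
by apply/mEFinP; exact: m_jsum.
- move=> w k t1; rewrite /Fk; congr (_ + _)%E.
 by congr (_%:E); apply: eq_bigr=> i _; rewrite ck_ev.
by apply: eq_integral=> u _; rewrite ck_ev.
Qed.
End rectangle.
Let rect (a b : R) (A : set T) (p : R * T) : R:= (a < p.1 <= b)%R%:R * \1_A p.2.
Let rectP a b A : 0 <= a -> a <= b -> b <= 1 -> H a A ->
[/\ mT (rect a b A), forall p, 0 <= rect a b A p <= 1 &
(\int[P]_w ((jsum N (rect a b A) w)%:E + Ineg (rect a b A) w) =
 \int[P]_w Ipos (rect a b A) w)%E].
move=> a0 ab b1 HA; split.
- have mA : measurable A.
 by have [+ _]:= fH=> /(_ a); rewrite a0 (le_trans ab)// => /(_ isT)[_]; exact.
apply: mfunM; first by apply: (mcompT (meas_itvR a b)).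
by apply: mcompT=> //; mf.
- move=> p; rewrite /rect indicE.
by case: (_ < _ <= _); case: (_ \in _); rewrite ?mul1r ?mul0r ?lexx ?ler01.
- have [tau [tau_nd tau_st tau_ev tau_mg]]:= lM.
exact: (@rectangle_id a b A a0 ab b1 HA tau).
Qed.
Let HT : H 0 setT.
have [sH _]:= fH; have [sH0 _] : sigma_algebra setT (H 0) /\ H 0 `<=` measurable.
by apply: sH; rewrite lexx ler01.
by rewrite -(sigmaTE sH0); mf.
Qed.
Let N1E : jsum N (rect 0 1 setT) = fun w=> (N 1 w)%:R.
apply/funext=> w; rewrite -jsum_cst1; apply: (eq_psum (hN w))=> s s01.
by rewrite /rect /= s01 indicT mulr1.
Qed.
(** On ]0, 1] x T the identity reads E N_1 + E int l^- = E int l^+. The right side is finite by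
    [l_pos], which bounds both terms on the left. *)
Let Ineg_fin : (\int[P]_w Ineg (rect 0 1 setT) w < +oo)%E /\ L1 P (fun w=> (N 1 w)%:R).
have [mr r01 rE]:= rectP (lexx 0) ler01 (lexx 1) HT.
have r0 p : 0 <= rect 0 1 setT p by have /andP[]:= r01 p.
have fin : (\int[P]_w Ipos (rect 0 1 setT) w < +oo)%E.
rewrite int_Ipos//; have /integrableP[_]:= l_pos; apply: le_lt_trans.
apply: ge0_le_integral=> //.
- by move=> p _; rewrite lee_fin mulr_ge0// le_max lexx orbT.
- mf.
- by apply: mcompT=> //; exact/mEFinP.
- move=> p _ /=; rewrite lee_fin (ger0N (max_ge0 _)) ler_piMl//.
 by have /andP[]:= r01 p.
have j0 w : 0 <= jsum N (rect 0 1 setT) w by exact: psum_ge0.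
have mj : mT (jsum N (rect 0 1 setT)) by exact: m_jsum.
move: fin; rewrite -rE ge0_integralD//.
- move=> fin; split.
 apply: le_lt_trans fin; rewrite leeDr// integral_ge0// => w _; rewrite lee_fin; exact: j0.
rewrite -N1E; apply/integrableP; split; first exact/mEFinP.
rewrite (eq_integral (fun w=> (jsum N (rect 0 1 setT) w)%:E)); last first.
 by move=> w _ /=; rewrite ger0N.
apply: le_lt_trans fin; rewrite leeDl// integral_ge0// => w _.
exact: Ineg_ge0.
- by move=> w _; rewrite lee_fin; exact: j0.
- mf.
- by move=> w _; exact: Ineg_ge0.
- exact: mIneg.
Qed.
Let lp_rect p : rect 0 1 setT p * Num.max (- lp p) 0 = Num.max (- lp p) 0.
rewrite /rect /lp /unitp indicT mulr1; case: (_ < _ <= _); rewrite ?mul1r//.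
by rewrite !mul0r oppr0 maxxx.
Qed.
Let l_neg : L1 Q (fun p=> Num.max (- lp p) 0).
have [mr r01 _]:= rectP (lexx 0) ler01 (lexx 1) HT.
have r0 p : 0 <= rect 0 1 setT p by have /andP[]:= r01 p.
have [fin _]:= Ineg_fin.
apply/integrableP; split; first exact/mEFinP.
move: fin; rewrite int_Ineg//; congr (_ < _)%E; apply: eq_integral=> p _ /=.
by rewrite lp_rect ger0N// le_max lexx orbT.
Qed.
Let lp_L1 : L1 Q lp.
rewrite (_ : lp = fun p=> Num.max (lp p) 0 - Num.max (- lp p) 0).
exact: L1B.
by apply/funext=> p; exact: max0_split.
Qed.
Let rect_id a b A : 0 <= a -> a <= b -> b <= 1 -> H a A ->
Ex P (jsum N (rect a b A)) = Ex Q (fun p=> rect a b A p * lp p).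
move=> a0 ab b1 HA; have [mr r01 rE]:= rectP a0 ab b1 HA.
have r0 p : 0 <= rect a b A p by have /andP[]:= r01 p.
have j0 w : 0 <= jsum N (rect a b A) w by exact: psum_ge0.
have mj : mT (jsum N (rect a b A)) by exact: m_jsum.
have L1r f : L1 Q f -> L1 Q (fun p=> rect a b A p * f p).
move=> fi; apply: (L1le (fun p=> `|f p|)).
- by apply: mfunM=> //; exact: L1_meas fi.
- exact: L1_norm.
- by move=> p; rewrite normrM ler_piMl// ger0N//; have /andP[]:= r01 p.
have jL1 : L1 P (jsum N (rect a b A)).
apply: (L1le (fun w=> (N 1 w)%:R))=> //; first by have []:= Ineg_fin.
move=> w; rewrite -[leRHS]mul1r; apply: jsum_bd=> p.
by rewrite ger0N//; have /andP[]:= r01 p.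
move: rE; rewrite ge0_integralD//.
- rewrite int_Ineg// int_Ipos// -!EFin_Ex//; try exact: L1r.
move=> [] E; rewrite -[LHS](addrK (Ex Q (fun p=> rect a b A p * Num.max (- lp p) 0))) E.
rewrite -ExB; try exact: L1r.
eqEx=> p; rewrite -mulrBr; congr (_ * _); apply/esym; exact: max0_split.
- by move=> w _; rewrite lee_fin; exact: j0.
- mf.
- by move=> w _; exact: Ineg_ge0.
- exact: mIneg.
Qed.
(** From rectangles to bounded predictable integrands by [linear_dct_eq]; jump sums are dominated by
    a multiple of [N 1]. *)
Lemma compensates_intensity : compensates lp.
have [_ N1L1]:= Ineg_fin.
split=> // K M mK KM.
have bdP (f : R * T -> R) (M' : R) : mT f -> bdd f M' ->
 L1 P (jsum N f).
move=> mf fM; apply: (L1le (fun w=> M' * (N 1 w)%:R)).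
- exact: m_jsum.
- exact: L1Z.
- by move=> w; exact: jsum_bd.

have mid : mT (id : R * T -> predT H).
by apply: measurable_gen=> B GB; apply: (pgen_measurable fH); exact: sub_sig.
apply: (@linear_dct_eq _ _ (pgen H) (fun f=> Ex P (jsum N f)) (fun f=> Ex Q (fun p=> f p * lp p)) _ _ _ _ _ K M mK KM).
- exact: pgen_setI.
- split=> [f g e Mf /(pred_meas fH) mf /(pred_meas fH) mg fM gM|f_ f M' mf fM ff].
 rewrite (_ : jsum N _ = fun w=> jsum N f w + e * jsum N g w); last first.
  by apply/funext=> w; rewrite /jsum psumD psumZ.
 have jf:= bdP _ _ mf fM; have jg:= bdP _ _ mg gM.
 by rewrite ExD//; [rewrite ExZ|exact: L1Z].
apply: (proj2 (@Ex_dct _ _ _ _ _ _ (fun w=> M' * (N 1 w)%:R) _ _ _ _)).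
+ by move=> n; apply: m_jsum=> //; exact: pred_meas (mf n).
+ by move=> w; apply: cvg_sum_seq=> i; exact: ff.
+ exact: L1Z.
+ by move=> n w; exact: jsum_bd.
- exact: (linear_dct_int mid lp_L1).
- rewrite (_ : jsum N (cst 1) = jsum N (rect 0 1 setT)); last first.
 by rewrite N1E; apply/funext=> w; rewrite jsum_cst1.
rewrite rect_id//; eqEx=> p /=.
rewrite /rect /lp /unitp indicT mulr1; case: (_ < _ <= _); rewrite ?mul1r//.
by rewrite !mul0r.
- move=> _ [a [b [A [a0 ab b1 HA ->]]]].
have E : \1_(`]a, b] `*` A) = rect a b A :> (R * T -> R).
 apply/funext=> -[u w]; rewrite /rect !indicE /= -natrM mulnb; congr (_%:R); congr nat_of_bool.
 apply/idP/andP; rewrite inE /=; first by rewrite in_itv /= => -[h1 h2]; rewrite inE.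
 by move=> [h1 h2]; rewrite inE; split=> //=; rewrite in_itv.
by rewrite E; exact: rect_id.
Qed.
End from_martingale.
End compensator.

(** * Sign, bounds, uniqueness and extension of compensators *)

Section compensates_theory.
Context {R : realType} d (T : mType d) (P : prob T R).
Context (N : R -> T -> nat).
Hypotheses (hN : forall w, counting_path (N ^~ w))
(mN : forall t, 0 <= t <= 1 -> mT (fun w=> (N t w)%:R : R)).
Notation Q:= (U01 \x P)%E.
Lemma compensates_meas H l : filt H -> compensates P N H l -> mT l.
by move=> fH [_ _ ml _]; exact: pred_meas ml. Qed.
(** Test with the indicator of l < 0: the jump sum is nonnegative and the integral nonpositive. *)
Lemma compensates_ge0 H l : filt H -> compensates P N H l -> {ae Q, forall p, 0 <= l p}.
move=> fH cl; have [_ lL1 ml lE]:= cl.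
have mK : mT ((fun p=> (l p < 0)%R%:R) : predT H -> R).
mf.
have K1 p : `|(l p < 0)%R%:R| <= 1 :> R by case: (_ < _); rewrite ?normr1 ?normr0.
have E:= lE _ _ mK K1.
pose g p:= - ((l p < 0)%R%:R * l p).
have g0 p : 0 <= g p.
by rewrite /g; case: ltP=> lp; rewrite ?mul1r ?mul0r ?oppr0// oppr_ge0 ltW.
have Kl : L1 Q (fun p=> (l p < 0)%R%:R * l p).
apply: (L1le (fun p=> `|l p|)); [|exact: L1_norm|].
 by apply: mfunM; [exact: (pred_meas fH mK)|exact: L1_meas lL1].
by move=> p; rewrite normrM ler_piMl.
have gE : Ex Q g = 0.
apply/eqP; rewrite eq_le Ex_ge0// andbT /g ExN// -E oppr_le0.
by apply: Ex_ge0=> w; exact: psum_ge0.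
have:= Ex_eq0 (L1N Kl) g0 gE.
apply: filterS=> p /eqP; rewrite oppr_eq0 mulf_eq0=> /orP[|/eqP->//].
by case: (ltP (l p) 0)=> //; rewrite oner_eq0.
Qed.
(** The indicator of C < l is predictable for the smaller filtration, hence for the larger one, and
    against it [l] and [l'] have the same integral. This carries the bound of the G-intensity over
    to the F-intensity. *)
Lemma compensates_le H H' l l' (C : R) : filt H -> filt H' ->
(forall t, 0 <= t <= 1 -> H t `<=` H' t) ->
compensates P N H l -> compensates P N H' l' -> 0 <= C -> {ae Q, forall p, l' p <= C} ->
{ae Q, forall p, l p <= C}.
move=> fH fH' HH' cl cl' C0 lC; have [_ lL1 ml lE]:= cl; have [_ lL1' ml' lE']:= cl'.
have mK : mT ((fun p=> (C < l p)%R%:R) : predT H -> R).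
mf.
have K1 p : `|(C < l p)%R%:R| <= 1 :> R by case: (_ < _); rewrite ?normr1 ?normr0.
have KL1 f : L1 Q f -> L1 Q (fun p=> (C < l p)%R%:R * f p).
move=> fi; apply: (L1le (fun p=> `|f p|)); [|exact: L1_norm|].
 by apply: mfunM; [exact: (pred_meas fH mK)|exact: L1_meas fi].
by move=> p; rewrite normrM ler_piMl.
have E : Ex Q (fun p=> (C < l p)%R%:R * l p) = Ex Q (fun p=> (C < l p)%R%:R * l' p).
rewrite -(lE _ _ mK K1) -(lE' _ _ (pred_sub HH' mK) K1)//.
pose g p:= (C < l p)%R%:R * (l p - C).
have g0 p : 0 <= g p.
by rewrite /g; case: ltP=> lp; rewrite ?mul1r ?mul0r// subr_ge0 ltW.
have gL1 : L1 Q g by apply: KL1; apply: L1B=> //; exact: L1_cst.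
have gE : Ex Q g = 0.
apply/eqP; rewrite eq_le Ex_ge0// andbT.
rewrite (_ : Ex Q g = Ex Q (fun p=> (C < l p)%R%:R * (l' p - C))); last first.
 have L1c : L1 Q (fun p=> (C < l p)%R%:R * C) by apply: KL1; exact: L1_cst.
 rewrite (_ : g = fun p=> (C < l p)%R%:R * l p - (C < l p)%R%:R * C); last first.
  by apply/funext=> p; rewrite /g mulrBr.
 by rewrite ExB// ?E -?ExB//; [eqEx=> p; rewrite mulrBr|exact: KL1..].
rewrite -(Ex_cst Q 0).
have gL1' : L1 Q (fun p=> (C < l p)%R%:R * (l' p - C)).
 by apply: KL1; apply: L1B=> //; exact: L1_cst.
(* The comparison with [C] holds almost everywhere only; [h] is a version that is nonpositive
   everywhere. *)
pose h p:= Num.min ((C < l p)%R%:R * (l' p - C)) 0.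
have hL1 : L1 Q h.
 apply: (L1le (fun p=> `|(C < l p)%R%:R * (l' p - C)|)).
 - by apply: measurable_minr; [exact: L1_meas gL1'|mf].
 - exact: L1_norm.
 - by move=> p; rewrite /h /Num.min; case: ifP=> _; rewrite ?normr0.
rewrite (@Ex_ae _ _ _ _ _ h); [|exact: L1_meas gL1'|exact: L1_meas hL1|].
 by apply: Ex_le=> //; [exact: L1_cst|move=> p; rewrite ge_min lexx orbT].
apply: filterS lC=> p lpC; apply/esym/min_idPl.
by rewrite mulr_ge0_le0// subr_le0.
have:= Ex_eq0 gL1 g0 gE.
apply: filterS=> p /eqP; rewrite mulf_eq0 subr_eq0=> /orP[|/eqP->//].
by case: (ltP C (l p))=> //; rewrite oner_eq0.
Qed.
Lemma compensates_ae H l l' : filt H -> compensates P N H l ->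
mT (l' : predT H -> R) -> {ae Q, forall p, l p = l' p} ->
compensates P N H l'.
move=> fH [N1 lL1 ml lE] ml' ll'; have ml'2:= pred_meas fH ml'.
split=> //.
exact: L1_ae lL1.
move=> K M mK KM; rewrite (lE K M mK KM); apply: Ex_ae.
- by apply: mfunM; [exact: pred_meas mK|exact: L1_meas lL1].
- by apply: mfunM=> //; exact: pred_meas mK.
- by apply: filterS ll'=> p ->.
Qed.
(** Test with the indicators of l' < l and of l < l'. Under H_0 this identifies the two
    intensities. *)
Lemma compensates_uniq H l l' : filt H -> compensates P N H l -> compensates P N H l' ->
{ae Q, forall p, l p = l' p}.
move=> fH [N1 lL1 ml lE] [_ lL1' ml' lE'].
have half k k' : mT (k : predT H -> R) -> mT (k' : predT H -> R) ->
 L1 Q k -> L1 Q k' ->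
 (forall (K : R * T -> R) M, mT (K : predT H -> R) ->
   bdd K M -> Ex Q (fun p=> K p * k p) = Ex Q (fun p=> K p * k' p)) ->
 {ae Q, forall p, k p <= k' p}.
move=> mk mk' kL1 kL1' kE.
have mK : mT ((fun p=> (k' p < k p)%R%:R) : predT H -> R).
 mf.
have K1 p : `|(k' p < k p)%R%:R| <= 1 :> R by case: (_ < _); rewrite ?normr1 ?normr0.
have KL1 f : L1 Q f -> L1 Q (fun p=> (k' p < k p)%R%:R * f p).
 move=> fi; apply: (L1le (fun p=> `|f p|)); [|exact: L1_norm|].
  by apply: mfunM; [exact: (pred_meas fH mK)|exact: L1_meas fi].
 by move=> p; rewrite normrM ler_piMl.
have g0 p : 0 <= (k' p < k p)%R%:R * (k p - k' p).
 by case: ltP=> lp; rewrite ?mul1r ?mul0r// subr_ge0 ltW.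
have gE : Ex Q (fun p=> (k' p < k p)%R%:R * (k p - k' p)) = 0.
 rewrite (_ : (fun _=> _) = fun p=> (k' p < k p)%R%:R * k p - (k' p < k p)%R%:R * k' p).
  by rewrite ExB ?(kE _ _ mK K1) ?subrr//; exact: KL1.
 by apply/funext=> p; rewrite mulrBr.
have:= Ex_eq0 (KL1 _ (L1B kL1 kL1')) g0 gE.
apply: filterS=> p /eqP; rewrite mulf_eq0 subr_eq0=> /orP[|/eqP->//].
by case: (ltP (k' p) (k p))=> //; rewrite oner_eq0.
have h1 : {ae Q, forall p, l p <= l' p}.
by apply: half=> // K M mK KM; rewrite -(lE K M mK KM) -(lE' K M mK KM).
have h2 : {ae Q, forall p, l' p <= l p}.
by apply: half=> // K M mK KM; rewrite -(lE K M mK KM) -(lE' K M mK KM).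
by apply: filterS2 h1 h2=> p a b; apply/le_anti; rewrite a b.
Qed.
Section bounded.
Variables (H : R -> set (set T)) (b : R * T -> R) (C : R).
Hypotheses (fH : filt H)
(cb : compensates P N H b)
(b0C : forall p, 0 <= b p <= C).
Let mb : mT b.
exact: compensates_meas cb. Qed.
Let N1L1 : L1 P (fun w=> (N 1 w)%:R).
by have []:= cb. Qed.
Let C0 (p : R * T) : 0 <= C.
by have /andP[h1 h2]:= b0C p; exact: le_trans h2. Qed.
Lemma L1_mulb (K : R * T -> R) : L1 Q K -> L1 Q (fun p=> K p * b p).
move=> KL1; apply: (L1le (fun p=> C * `|K p|)).
- by apply: mfunM=> //; exact: L1_meas KL1.
- by apply: L1Z; exact: L1_norm.
- move=> p; have /andP[b0 bC]:= b0C p.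
by rewrite normrM (ger0N b0) mulrC ler_wpM2r.
Qed.
(** Truncate K at m: Fatou gives integrability of the full jump sum, which then dominates the
    truncated ones. *)
Lemma compensator_ge0 (K : R * T -> R) : mT (K : predT H -> R) -> (forall p, 0 <= K p) ->
L1 Q K -> L1 P (jsum N K) /\ Ex P (jsum N K) = Ex Q (fun p=> K p * b p).
move=> mK K0 KL1; have [_ _ _ bE]:= cb.
have mK':= pred_meas fH mK.
pose Km (m : nat) p:= Num.min (K p) m%:R.
have Km0 m p : 0 <= Km m p by rewrite le_min K0 ler0n.
have mKm m : mT (Km m : predT H -> R).
by apply: measurable_minr=> //; mf.
have Kmb m p : `|Km m p| <= m%:R by rewrite ger0N// ge_min lexx orbT.
have KmK m p : `|Km m p| <= K p by rewrite ger0N// ge_min lexx.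
have Kcv p : Km m p @[m --> \oo] --> K p.
have [k hk] : exists k : nat, K p <= k%:R.
 by exists (Num.bound (K p)); rewrite ltW// archi_boundP.
apply: cvg_near_cst; exists k=> // m /= km; apply/min_idPl.
by apply: le_trans hk _; rewrite ler_nat.
have jL1 m : L1 P (jsum N (Km m)).
apply: (L1le (fun w=> m%:R * (N 1 w)%:R)); [|exact: L1Z|].
 by apply: m_jsum=> //; exact: pred_meas (mKm m).
by move=> w; exact: jsum_bd.
have KL1m m : L1 Q (Km m) by apply: (L1_le (pred_meas fH (mKm m)) KL1).
have [_ cQ] : L1 Q (fun p=> K p * b p) /\
 Ex Q (fun p=> Km m p * b p) @[m --> \oo] --> Ex Q (fun p=> K p * b p).
apply: (@Ex_dct _ _ _ _ _ _ (fun p=> K p * b p)); last 1 first.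
- move=> m p; have /andP[b0 _]:= b0C p.
 by rewrite normrM (ger0N b0) ler_wpM2r.
- by move=> m; apply: mfunM=> //; exact: pred_meas (mKm m).
- by move=> p; apply: cvgMr_tmp; exact: Kcv.
- exact: L1_mulb.
have [jK jle] : L1 P (jsum N K) /\ Ex P (jsum N K) <= Ex Q (fun p=> K p * b p).
apply: (@Ex_fatou _ _ _ _ (fun m=> jsum N (Km m)))=> //.
- by move=> m w; exact: psum_ge0.
- by move=> w; apply: cvg_sum_seq=> i; exact: Kcv.
- move=> m; rewrite (bE _ _ (mKm m) (Kmb m)).
 apply: Ex_le; [exact: L1_mulb..|move=> p].
 have /andP[b0 _]:= b0C p; rewrite ler_wpM2r//.
 by rewrite ge_min lexx.
split=> //.
have [_ cP] : L1 P (jsum N K) /\ Ex P (jsum N (Km m)) @[m --> \oo] --> Ex P (jsum N K).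
apply: (@Ex_dct _ _ _ _ _ _ (jsum N K))=> //.
- by move=> m; exact: L1_meas (jL1 m).
- by move=> w; apply: cvg_sum_seq=> i; exact: Kcv.
- move=> m w; apply: (le_trans (psum_norm _ _)).
 by apply: (psum_le (hN w))=> s _.
apply: (cvg_unique _ cP)=> //.
rewrite (_ : (fun m=> Ex P (jsum N (Km m))) = fun m=> Ex Q (fun p=> Km m p * b p))//.
by apply/funext=> m; exact: bE (mKm m) (Kmb m).
Qed.
(** Meant for integrands that involve [N] itself, as in the moment bounds and the isometry; these
    are not bounded. *)
Lemma compensator_ext (K : R * T -> R) : mT (K : predT H -> R) ->
L1 Q K -> L1 P (jsum N K) /\ Ex P (jsum N K) = Ex Q (fun p=> K p * b p).
move=> mK KL1.
have [p1 p2] : L1 P (jsum N (fun p=> Num.max (K p) 0)) /\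
 Ex P (jsum N (fun p=> Num.max (K p) 0)) = Ex Q (fun p=> Num.max (K p) 0 * b p).
apply: compensator_ge0.
- mf.
- by move=> p; rewrite le_max lexx orbT.
- exact: L1_max0.
have mN' : mT ((fun p=> - K p) : predT H -> R) by mf.
have [n1 n2] : L1 P (jsum N (fun p=> Num.max (- K p) 0)) /\
 Ex P (jsum N (fun p=> Num.max (- K p) 0)) = Ex Q (fun p=> Num.max (- K p) 0 * b p).
apply: compensator_ge0.
- mf.
- by move=> p; rewrite le_max lexx orbT.
- by apply: L1_max0; exact: L1N.
have E : jsum N K = fun w=> jsum N (fun p=> Num.max (K p) 0) w - jsum N (fun p=> Num.max (- K p) 0) w.
apply/funext=> w; rewrite /jsum /psum -sumrB; apply: eq_bigr=> i _.
exact: max0_split.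
have Kp:= L1_max0 KL1; have Kn:= L1_max0 (L1N KL1).
rewrite E; split; first exact: L1B.
rewrite ExB// p2 n2 -ExB; [|exact: L1_mulb..].
by eqEx=> p; rewrite -mulrBl -max0_split.
Qed.
End bounded.
End compensates_theory.

(** * Predictability of running integrals *)

Lemma indic_rect (R : realType) (T : Type) (a b : R) (A : set T) :
\1_(`]a, b] `*` A) = (fun p=> (a < p.1 <= b)%R%:R * \1_A p.2) :> (R * T -> R).
apply/funext=> -[u w]; rewrite !indicE /= -natrM mulnb; congr (_%:R); congr nat_of_bool.
apply/idP/andP; rewrite inE /=; first by rewrite in_itv /= => -[h1 h2]; rewrite inE.
by move=> [h1 h2]; rewrite inE; split=> //=; rewrite in_itv.
Qed.
Lemma min_max_dist (R : realType) (a b u v : R) :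
`|Num.min (Num.max u a) b - Num.min (Num.max v a) b| <= `|u - v|.
have dmax x y : `|Num.max x a - Num.max y a| <= `|x - y|.
have h1:= ler_norm (x - y); have h2:= ler_norm (y - x); rewrite distrC in h2.
by rewrite ler_norml; case: (leP x a)=> ?; case: (leP y a)=> ?; apply/andP; split; lra.
apply: le_trans (dmax u v); move: (Num.max u a) (Num.max v a)=> x y.
have h1:= ler_norm (x - y); have h2:= ler_norm (y - x); rewrite distrC in h2.
by rewrite ler_norml; case: (leP x b)=> ?; case: (leP y b)=> ?; apply/andP; split; lra.
Qed.
Section predictable_integrals.
Context {R : realType} d (T : mType d) (P : prob T R).
Context (N : R -> T -> nat) (H : R -> set (set T)).
Hypotheses (hN : forall w, counting_path (N ^~ w))
(mN : forall t, 0 <= t <= 1 -> mT (fun w=> (N t w)%:R : R))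
(aN : adapted H (fun t w=> (N t w)%:R : R))
(fH : filt H).
(** Only jumps strictly before p.1 count: the left limit of the running sum is what is predictable.
    The integral against time has no atoms, and [tpre] can include the endpoint. *)
Definition jpre (K : R * T -> R) (p : R * T) : R :=
psum (N ^~ p.2) (fun v=> (v < p.1)%R%:R * K (v, p.2)).
Definition tpre (K : R * T -> R) (p : R * T) : R :=
Ex U01 (fun v=> (v <= p.1)%R%:R * K (v, p.2)).
Let clamp_itv (a b u : R) : a <= b -> a <= Num.min (Num.max u a) b <= b.
by move=> ab; rewrite le_min le_max lexx orbT ab /= ge_min lexx orbT. Qed.
Let sigmaH t : 0 <= t <= 1 -> sigma_algebra setT (H t).
by move=> t01; have [+ _]:= fH=> /(_ t t01)[]. Qed.
(** For a rectangle the sum is the left limit of the adapted process 1_A (N_c - N_a), where c is the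
    current time clamped to [a, b]; general integrands follow by monotone classes. *)
Lemma pred_jpre (K : R * T -> R) M : mT (K : predT H -> R) ->
bdd K M ->
mT ((fun p=> unitp p.1 * jpre K p) : predT H -> R).
move=> mK KM.
apply: (@monotone_class_fun R _ (pgen H) (fun K=> mT
((fun p=> unitp p.1 * jpre K p) : predT H -> R)) _ _ _ _ _ K M)=> //.
- exact: pgen_setI.
- apply: (pred_lim (Y:= fun t w=> (N t w)%:R) (Z:= fun t w=>
 psum (N ^~ w) (fun v=> (v < t)%R%:R * cst 1 (v, w))))=> // w t /andP[t0 t1].
have E : \forall s \near t^'-, psum (N ^~ w) (fun v=> (v <= s)%R%:R) = (N s w)%:R.
 near=> s.
 have s0 : 0 <= s by apply: ltW; near: s; exact: nbhs_left_gt.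
 have s1 : s <= 1 by apply: le_trans t1; apply: ltW; near: s; exact: nbhs_left_lt.
 have:= psum_count (hN w) (lexx 0) s0 s1.
 have [-> _ _ _]:= hN w; rewrite subr0=> <-; apply: (eq_psum (hN w))=> v /andP[v0 _].
 by rewrite v0.
apply: cvg_trans; first exact: (near_eq_cvg E).
apply: cvg_sum_seq=> i; set v:= jtime _ _; rewrite mulr1.
have [vt|tv]:= ltP v t; apply: cvg_near_cst; near=> s.
 by rewrite (_ : v <= s)//; near: s; exact: nbhs_left_ge.
rewrite leNgt (_ : s < v)//; apply: lt_le_trans tv.
by [].
- move=> _ [a [b [A [a0 ab b1 HA ->]]]].
pose c s:= Num.min (Num.max s a) b.
have c01 s : 0 <= c s <= 1.
 by have /andP[ac cb]:= clamp_itv s ab; rewrite (le_trans a0 ac) (le_trans cb).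
apply: (pred_lim (Y:= fun s w=> \1_A w * ((N (c s) w)%:R - (N a w)%:R)) (Z:= fun t w=>
 psum (N ^~ w) (fun v=> (v < t)%R%:R * \1_(`]a, b] `*` A) (v, w))))=> //.
 move=> s s01; have /andP[s0 s1]:= s01; have sHs:= sigmaH s01.
 apply/(meas_wrtP sHs).
 (* Up to time a the process vanishes, so that A, which is known only from time a on, does not spoil
    adaptedness. *)
 have [sa|sa]:= leP s a.
  rewrite (_ : (fun _=> _) = cst 0); first mf.
  by apply/funext=> w; rewrite /c (max_idPr sa) (min_idPl ab) subrr mulr0.
 have [_ Hm]:= fH.
 have aNs u : 0 <= u -> u <= s -> mT
   ((fun w=> (N u w)%:R) : sigmaT (H s) -> R).
  move=> u0 us; apply/(meas_wrtP sHs)=> B BB; apply: (Hm u)=> //.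
  by apply: aN=> //; rewrite u0 (le_trans us).
 apply: mfunM.
  apply: mindic; rewrite [measurable](sigmaTE sHs).
  by apply: (Hm a)=> //; nn.
 apply: mfunB; apply: aNs=> //; last nn.
  by have /andP[]:= c01 s.
 by rewrite /c ge_min (max_idPl (ltW sa)) lexx.
move=> w t /andP[t0 t1].
have -> : psum (N ^~ w) (fun v=> (v < t)%R%:R * \1_(`]a, b] `*` A) (v, w)) =
  psum (N ^~ w) (fun v=> \1_A w * ((a < v <= b) && (v < t))%R%:R).
 apply: (eq_psum (hN w))=> v _; rewrite indic_rect /=.
 by case: (_ < _ <= _); case: (_ < _)=> /=; rewrite ?mul1r ?mul0r ?mulr1 ?mulr0.
rewrite (_ : (fun s=> _) = fun s=> psum (N ^~ w) (fun v=> \1_A w * (a < v <= c s)%R%:R)); last first.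
 apply/funext=> s; rewrite psumZ psum_count//; first by have /andP[]:= clamp_itv s ab.
 by have /andP[]:= c01 s.
apply: cvg_sum_seq=> i; set v:= jtime _ _.
have [vt|tv]:= ltP v t; apply: cvg_near_cst; near=> s; congr (_ * _%:R); rewrite /c le_min le_max ?andbT ?andbF.
 by rewrite (_ : v <= s) ?orTb//; near: s; exact: nbhs_left_ge.
rewrite leNgt (_ : s < v) /=; first by rewrite leNgt; case: (a < v).
by apply: lt_le_trans tv; near: s; exact: nbhs_left_lt.
- move=> f g e mf mg; rewrite (_ : (fun _=> _) = fun p=> unitp p.1 * jpre f p + e * (unitp p.1 * jpre g p)).
 mf.
apply/funext=> p; rewrite /jpre mulrCA -mulrDr; congr (_ * _); rewrite -psumZ -psumD.
by apply: (eq_psum (hN p.2))=> v _; ring.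
- move=> f_ f M' mf f01 ff; apply: (@mfun_cvg _ (predT H) R setT _ _ mf).
move=> p _; apply: cvgMl_tmp; apply: cvg_sum_seq=> i; apply: cvgMl_tmp; exact: ff.
Unshelve. all: by end_near. Qed.
(** As for [pred_jpre]; on a rectangle the integral is 1_A times the clamped time minus a, which is
    continuous in time. *)
Lemma pred_tpre (K : R * T -> R) M : mT (K : predT H -> R) ->
bdd K M ->
mT ((fun p=> unitp p.1 * tpre K p) : predT H -> R).
move=> mK KM.
have m1 u : mT (fun v : R=> (v <= u)%R%:R : R).
mf.
have L1t (f : R * T -> R) (M' u : R) w : mT f -> bdd f M' ->
 L1 U01 (fun v=> (v <= u)%R%:R * f (v, w)).
move=> mf fM; apply: (L1by M').
 mf.
move=> v; rewrite normrM; apply: le_trans (fM (v, w)); rewrite ler_piMl//.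
by case: (v <= u); rewrite ?normr1 ?normr0.
suff [] : [/\ mT K, (exists M', forall p, `|K p| <= M') &
mT ((fun p=> unitp p.1 * tpre K p) : predT H -> R)] by [].
have cst1 : mT (cst 1 : R * T -> R) by mf.
have gen a b A : 0 <= a -> a <= b -> b <= 1 -> H a A ->
mT ((fun p=> unitp p.1 * tpre \1_(`]a, b] `*` A) p) : predT H -> R).
move=> a0 ab b1 HA.
pose c s:= Num.min (Num.max s a) b.
rewrite (_ : (fun _=> _) = (fun p=> unitp p.1 * (\1_A p.2 * (c p.1 - a)))); last first.
 apply/funext=> -[t w]; rewrite /tpre /=; congr (_ * _).
 have /andP[ac cb]:= clamp_itv t ab.
 rewrite -(Ex_U01_itv a0 ac (le_trans cb b1)) -ExZ; last first.
  apply: (L1by 1); first exact: meas_itvR.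
  by move=> v; case: (_ < _ <= _); rewrite ?normr1 ?normr0.
 eqEx=> v; rewrite indic_rect /= mulrA mulrC; congr (_ * _).
 rewrite -natrM mulnb; congr (_%:R); congr nat_of_bool.
 rewrite /c le_min le_max; case: (ltP a v)=> av /=; rewrite ?andbF//.
 by rewrite orbF.
apply: (pred_lim (Y:= fun s w=> \1_A w * (c s - a)) (Z:= fun s w=> \1_A w * (c s - a)))=> //.
 move=> s s01; have /andP[s0 s1]:= s01; have sHs:= sigmaH s01.
 apply/(meas_wrtP sHs).
 have [sa|sa]:= leP s a.
  rewrite (_ : (fun _=> _) = cst 0); first mf.
  by apply/funext=> w; rewrite /c (max_idPr sa) (min_idPl ab) subrr mulr0.
 have [_ Hm]:= fH.
 apply: mfunM; last mf.
 apply: mindic; rewrite [measurable](sigmaTE sHs).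
 by apply: (Hm a)=> //; nn.
move=> w t t01; apply: cvgMl_tmp; apply: cvgB; last exact: cvg_cst.
apply/cvgrPdist_le=> e e0; near=> s.
apply: le_trans (min_max_dist _ _ _ _) _.
rewrite ger0N; first by apply: ltW; near: s; exact: nbhs_left_ltBl.
by rewrite subr_ge0 ltW//; near: s; by [].
apply: (@monotone_class_fun R _ (pgen H) (fun K=> [/\ mT K,
(exists M', forall p, `|K p| <= M') & mT
((fun p=> unitp p.1 * tpre K p) : predT H -> R)]) _ _ _ _ _ K M)=> //.
- exact: pgen_setI.
- split=> //; first by exists 1=> p; rewrite normr1.
have [sH _]:= fH.
have HT : H 0 setT.
 have s0 : sigma_algebra setT (H 0) by apply: sigmaH; rewrite lexx ler01.
 by rewrite -(sigmaTE s0); mf.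
have:= gen 0 1 setT (lexx 0) ler01 (lexx 1) HT; congr measurable_fun.
apply/funext=> p; congr (_ * _); rewrite /tpre.
rewrite -[RHS]Ex_U01_unitp; last by apply: mfunM=> //; mf.
eqEx=> v; rewrite indic_rect /= indicT mulr1 /unitp mulrC; congr (_ * _).
by rewrite mulr1.
- move=> _ [a [b [A [a0 ab b1 HA ->]]]]; split; last exact: gen.
 apply: mindic; apply: measurableX=> //.
 by have [+ _]:= fH=> /(_ a); rewrite a0 (le_trans ab)// => /(_ isT)[_]; exact.
by exists 1=> p; exact: indic_le1.
- move=> f g e [mf [Mf fM] fE] [mg [Mg gM] gE]; split.
+ mf.
+ exists (Mf + `|e| * Mg)=> p; apply: le_trans (ler_normD _ _) _.
 by rewrite lerD// normrM lerM2l.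
+ rewrite (_ : (fun _=> _) = fun p=> unitp p.1 * tpre f p + e * (unitp p.1 * tpre g p)).
  mf.
 apply/funext=> -[t w]; rewrite /tpre /= mulrCA -mulrDr; congr (_ * _).
 rewrite -ExZ; last exact: (L1t _ _ _ _ mg gM).
 rewrite -ExD; [|exact: (L1t _ _ _ _ mf fM)|by apply: L1Z; exact: (L1t _ _ _ _ mg gM)].
 by eqEx=> v; ring.
- move=> f_ f M' fP f01 ff.
have mf : mT f.
 by apply: (@mfun_cvg _ _ R setT f_)=> [n|p _]; [have []:= fP n|exact: ff].
split=> //.
 exists M'=> p; have cx : `|f_ n p| @[n --> \oo] --> `|f p| by apply: cvg_norm; exact: ff.
 rewrite -(cvg_lim _ cx)//; apply: limr_le; first by apply/cvg_ex; exists `|f p|.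
 by apply: nearW=> n; have /andP[f0 fM]:= f01 n p; rewrite ger0N.
apply: (@mfun_cvg _ (predT H) R setT (fun n p=> unitp p.1 * tpre (f_ n) p)).
 by move=> n; have []:= fP n.
move=> [t w] _; apply: cvgMl_tmp.
suff [] : L1 U01 (fun v=> (v <= t)%R%:R * f (v, w)) /\
  Ex U01 (fun v=> (v <= t)%R%:R * f_ n (v, w)) @[n --> \oo] -->
  Ex U01 (fun v=> (v <= t)%R%:R * f (v, w)) by [].
apply: (@Ex_dct _ _ _ _ _ _ (fun=> M')).
+ move=> n; apply: mfunM=> //.
 by apply: (mpair1 w); have []:= fP n.
+ by move=> v; apply: cvgMl_tmp; exact: ff.
+ exact: L1_cst.
+ move=> n v; rewrite normrM; have /andP[f0 fM]:= f01 n (v, w).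
 apply: le_trans fM; rewrite (ger0N f0) ler_piMl//.
 by case: (v <= t); rewrite ?normr1 ?normr0.
Unshelve. all: by end_near. Qed.
End predictable_integrals.

(** * Moments of counting increments and the isometry *)

Lemma exprS_sub_le (R : realDomainType) (x : R) k : 0 <= x ->
0 <= (x + 1) ^+ k.+1 - x ^+ k.+1 <= k.+1%:R * (x + 1) ^+ k.
move=> x0; have x1 : 0 <= x + 1 by rewrite addr_ge0.
elim: k=> [|k /andP[IH0 IH]].
lra.
have -> : (x + 1) ^+ k.+2 - x ^+ k.+2 = (x + 1) ^+ k.+1 + x * ((x + 1) ^+ k.+1 - x ^+ k.+1).
by rewrite exprS [x ^+ k.+2]exprS; ring.
rewrite addr_ge0 ?exprn_ge0 ?mulr_ge0//=.
rewrite [leRHS](_ : _ = (x + 1) ^+ k.+1 + (x + 1) * (k.+1%:R * (x + 1) ^+ k)); last first.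
by rewrite -[k.+2%:R]natr1 exprS; ring.
by rewrite lerD2l; apply: le_trans (lerM2l x0 IH) _; rewrite ler_wpM2r ?lerDl// mulr_ge0// exprn_ge0.
Qed.
Lemma exprS_add1_le (R : realDomainType) (x : R) k : 0 <= x -> x ^+ k.+1 + 1 <= (x + 1) ^+ k.+1.
move=> x0; have x1 : 0 <= x + 1 by rewrite addr_ge0.
elim: k=> [|k IH]; first by [].
rewrite [leRHS]exprS; apply: le_trans (lerM2l x1 IH).
rewrite [x ^+ k.+2]exprS [leRHS](_ : _ = x * x ^+ k.+1 + 1 + (x + x ^+ k.+1)); last by ring.
by rewrite lerDl addr_ge0// exprn_ge0.
Qed.
(* Integration by parts for the square of a finite-variation path with jump part
[psum n f] and continuous part [int g]; the left limits of both parts appear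
against the jumps because the continuous part does not see them. *)
Lemma square_by_parts (R : realType) (n : R -> nat) (f g : R -> R) (M : R) :
counting_path n -> mT g -> bdd g M ->
let A s:= psum n (fun v=> (v < s)%R%:R * f v) in
let B s:= Ex U01 (fun v=> (v <= s)%R%:R * g v) in
(psum n f - Ex U01 g) ^+ 2 =
psum n (fun s=> 2 * (A s - B s) * f s + f s ^+ 2) -
Ex U01 (fun s=> 2 * (A s - B s) * g s).
move=> hn mg gM A B.
have M0 : 0 <= M by exact: le_trans (gM 0).
have mlt u : mT (fun v : R=> (u < v)%R%:R : R).
mf.
have mle u : mT (fun v : R=> (v <= u)%R%:R : R).
mf.
have b1 (c : bool) : `|c%:R| <= 1 :> R by case: c; rewrite ?normr1 ?normr0.
have Lind (h : R -> bool) : mT (fun v=> (h v)%:R : R) -> L1 U01 (fun v=> (h v)%:R * g v).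
move=> mh; apply: (L1by M); first mf.
by move=> v; rewrite normrM; apply: le_trans (gM v); rewrite ler_piMl.
have gL1 : L1 U01 g by exact: L1_bd gM.
have mA : mT A.
by apply: msum=> i; apply: mfunM=> //; mf.
have mBB : mT (fun p : R * R=> (p.2 <= p.1)%R%:R * g p.2).
apply: mfunM; last mf.
mf.
have mB : mT B.
exact: (meas_Ex U01 mBB).
have Bbd s : `|B s| <= M.
apply: Ex_bd; first mf.
by move=> v; rewrite normrM; apply: le_trans (gM v); rewrite ler_piMl.
have Abd s : `|A s| <= \sum_(i < n 1) `|f (jtime n i)|.
by apply: le_trans (psum_norm _ _) _; apply: ler_sum=> i _; rewrite normrM ler_piMl.
have AL1 : L1 U01 (fun s=> A s * g s).
apply: (L1by ((\sum_(i < n 1) `|f (jtime n i)|) * M)); first mf.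
by move=> s; rewrite normrM ler_pM.
have BL1 : L1 U01 (fun s=> B s * g s).
apply: (L1by (M * M)); first mf.
by move=> s; rewrite normrM ler_pM.
(* At the jump of rank i, A is the sum over smaller ranks: this expands the square of a finite
   sum. *)
have sqA : psum n f ^+ 2 = psum n (fun s=> 2 * A s * f s + f s ^+ 2).
have Ai i : (i < n 1%R)%N -> A (jtime n i) = \sum_(j < i) f (jtime n j).
 move=> i1; rewrite /A /psum (big_ord_widen _ (fun j=> f (jtime n j)) (ltnW i1)).
 rewrite [RHS]big_mkcond; apply: eq_bigr=> j _.
 case: (ltnP j i)=> ij; first by rewrite (jtime_mono hn ij i1) mul1r.
 rewrite ltNge (_ : jtime n i <= jtime n j) ?mul0r//.
 move: ij; rewrite leq_eqVlt=> /predU1P[->//|ij]; exact/ltW/(jtime_mono hn).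
transitivity (\sum_(i < n 1) (2 * (\sum_(j < i) f (jtime n j)) * f (jtime n i) + f (jtime n i) ^+ 2)); last first.
 by apply: eq_bigr=> i _; rewrite Ai.
rewrite /psum; elim: (n 1)=> [|m IH]; first by rewrite !big_ord0 expr0n.
by rewrite big_ord_recr [RHS]big_ord_recr /= sqrrD IH; ring.
(* The integral over the square is twice the integral over a triangle, by Fubini. *)
have sqB : Ex U01 g ^+ 2 = Ex U01 (fun s=> 2 * (B s * g s)).
rewrite ExZ//.
have bdg (p : R * R) : `|((p.2 <= p.1)%R%:R * g p.2) * g p.1| <= M * M.
 rewrite normrM ler_pM// normrM; apply: le_trans (gM p.2); by rewrite ler_piMl.
have mgg : mT (fun p : R * R=> ((p.2 <= p.1)%R%:R * g p.2) * g p.1).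
 mf.
have e1 : Ex U01 (fun s=> B s * g s) = Ex U01 (fun s=> g s * Ex U01 (fun v=> (s <= v)%R%:R * g v)).
 transitivity (Ex (U01 \x U01)%E (fun p : R * R=> ((p.2 <= p.1)%R%:R * g p.2) * g p.1)).
  rewrite (Ex_pair_bd _ _ mgg bdg); eqEx=> s /=.
  rewrite mulrC -ExZ; last exact: (Lind (fun v=> v <= s)).
  by eqEx=> v; ring.
 rewrite (Ex_pair2_bd _ _ mgg bdg); eqEx=> v /=.
 rewrite -ExZ; last first.
  by apply: (Lind (fun s=> v <= s)); apply: meas_bool; exact: mfun_le.
 by eqEx=> s; ring.
rewrite mulrDl mul1r {2}e1 -ExD//; last first.
 apply: (L1by (M * M)).
  apply: mfunM=> //.
  have m2 : mT (fun p : R * R=> (p.1 <= p.2)%R%:R * g p.2).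
   apply: mfunM; last mf.
   mf.
  exact: (meas_Ex U01 m2).
 move=> s; rewrite normrM ler_pM//; apply: Ex_bd.
  mf.
 by move=> v; rewrite normrM; apply: le_trans (gM v); rewrite ler_piMl.
rewrite expr2 -ExZ//; eqEx=> s.
rewrite mulrC [B s * g s]mulrC -mulrDr; congr (_ * _).
rewrite /B -ExD; last 2 first.
- exact: (Lind (fun v=> v <= s)).
- by apply: (Lind (fun v=> s <= v)); apply: meas_bool; exact: mfun_le.
apply: Ex_ae=> //.
 apply: mfunD; apply: mfunM=> //.
 mf.
(* The two triangles overlap on the diagonal only, and a point has measure 0. *)
exists [set s]; split.
- mf.
- rewrite -(setIT [set s]) -integral_indic// int_U01.
 + rewrite integral_indic//=.
  apply: (@subset_measure0 _ _ _ (@lebesgue_measure R) _ [set s])=> //.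
   by apply: measurableI=> //; mf.
  by exact: lebesgue_measure_set1.
 + mf.
 + mf.
- move=> v /= vs; apply/eqP; apply: contra_notT vs=> vs.
 rewrite -mulrDl -natrD; case: ltgtP vs=> //= _ _; by rewrite mul1r.
(* Of a jump and a time, one comes first; a tie is counted in B. *)
have crossAB : psum n f * Ex U01 g = psum n (fun s=> B s * f s) + Ex U01 (fun s=> A s * g s).
have -> : Ex U01 (fun s=> A s * g s) =
 \sum_(i < n 1) Ex U01 (fun s=> (jtime n i < s)%R%:R * f (jtime n i) * g s).
 rewrite -Ex_sum; last first.
  move=> i; rewrite (_ : (fun _=> _) = fun s=> f (jtime n i) * ((jtime n i < s)%R%:R * g s)).
   by apply: L1Z; exact: (Lind (fun v=> jtime n i < v)).
  by apply/funext=> s; ring.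
 by eqEx=> s; rewrite /A /psum mulr_suml.
rewrite /psum mulr_suml -big_split; apply: eq_bigr=> i _ /=.
rewrite [B _ * _]mulrC.
rewrite (_ : (fun s=> _) = fun s=> f (jtime n i) * ((jtime n i < s)%R%:R * g s)); last first.
 by apply/funext=> s; ring.
rewrite ExZ; last exact: (Lind (fun v=> jtime n i < v)).
rewrite -mulrDr; congr (_ * _); rewrite /B -ExD; last 2 first.
- exact: (Lind (fun v=> v <= _)).
- exact: (Lind (fun v=> jtime n i < v)).
eqEx=> s; rewrite -mulrDl ltNge.
by case: (s <= _); rewrite ?addr0 ?add0r ?mul1r.
rewrite sqrrB sqA sqB crossAB.
have -> : psum n (fun s=> 2 * (A s - B s) * f s + f s ^+ 2) =
 psum n (fun s=> 2 * A s * f s + f s ^+ 2) - 2 * psum n (fun s=> B s * f s).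
rewrite -psumZ /psum -sumrB; apply: eq_bigr=> i _; ring.
have -> : Ex U01 (fun s=> 2 * (A s - B s) * g s) =
 2 * Ex U01 (fun s=> A s * g s) - Ex U01 (fun s=> 2 * (B s * g s)).
rewrite -ExZ// -ExB; [|exact: L1Z..].
by eqEx=> s; ring.
ring.
Qed.
Section jump_martingale.
Context {R : realType} d (T : mType d) (P : prob T R).
Context (N : R -> T -> nat) (H : R -> set (set T)) (b : R * T -> R) (C : R).
Hypotheses (hN : forall w, counting_path (N ^~ w))
(mN : forall t, 0 <= t <= 1 -> mT (fun w=> (N t w)%:R : R))
(aN : adapted H (fun t w=> (N t w)%:R : R))
(fH : filt H)
(cb : compensates P N H b)
(b0C : forall p, 0 <= b p <= C).
Notation Q:= (U01 \x P)%E.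
Let mb : mT b.
exact: compensates_meas fH cb. Qed.
(** Bounds the k-th moment of one plus an increment of [N]; the recursion is the bound obtained in
    [step], with t - s replaced by 1. *)
Fixpoint count_const (c : R) (k : nat) : R :=
if k is k'.+1 then 1 + c * (k'.+1%:R * 2 ^+ k') * count_const c k' else 1.
Section increments.
Variables (s t : R).
Hypotheses (s0 : 0 <= s) (st : s <= t) (t1 : t <= 1).
Let t0 : 0 <= t. exact: le_trans st. Qed.
Let s1 : s <= 1. exact: le_trans t1. Qed.
Let D w : R:= (N t w)%:R - (N s w)%:R.
Let D0 w : 0 <= D w.
by rewrite subr_ge0 ler_nat; exact: (cnt_le (hN w)). Qed.
Let mD : mT D.
by apply: mfunB; apply: mN; rewrite ?t0 ?s0. Qed.
Let K0 (q : R * T) : R:= (s < q.1 <= 1)%R%:R.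
Let mK0 : mT (K0 : predT H -> R).
rewrite (_ : K0 = fun p=> (s < p.1 <= 1)%R%:R * (cst 1 : T -> R) p.2).
apply: pred_rect=> //; have [sH _]:= fH.
have sHs : sigma_algebra setT (H s) by have []:= sH s; rewrite ?s0 ?s1.
by apply/(meas_wrtP sHs); mf.
by apply/funext=> p; rewrite mulr1.
Qed.
Let K01 p : `|K0 p| <= 1.
by rewrite /K0; case: (_ < _ <= _); rewrite ?normr1 ?normr0. Qed.
(** A predictable integrand whose sum over jumps telescopes to (D + 1)^(k+1) - 1, because [jpre]
    counts the jumps of ]s, u[ seen just before u. *)
Let Kstep k (p : R * T) : R :=
(s < p.1 <= t)%R%:R * ((jpre N K0 p + 1 + 1) ^+ k.+1 - (jpre N K0 p + 1) ^+ k.+1).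
Let jpre_ge0 p : 0 <= jpre N K0 p.
by apply: psum_ge0=> v; rewrite mulr_ge0. Qed.
Let jpre_le u w : u <= t -> jpre N K0 (u, w) <= D w.
move=> ut; rewrite /D -(psum_count (hN w) s0 st t1).
apply: (psum_le (hN w))=> v _ /=; rewrite /K0 /=.
case: (ltP v u)=> vu; last by rewrite mul0r ler0n.
by rewrite mul1r (le_trans (ltW vu) ut) (le_trans (ltW vu) (le_trans ut t1)).
Qed.
Let mKstep k : mT (Kstep k : predT H -> R).
have m1:= pred_jpre hN aN fH mK0 K01.
have -> : Kstep k = fun p=> (s < p.1 <= t)%R%:R *
((unitp p.1 * jpre N K0 p + 1 + 1) ^+ k.+1 - (unitp p.1 * jpre N K0 p + 1) ^+ k.+1).
apply/funext=> p; rewrite /Kstep /unitp; case: (boolP (s < p.1 <= t)); rewrite ?mul0r//.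
by move=> /andP[sp pt]; rewrite (le_lt_trans s0 sp) (le_trans pt t1) !mul1r.
apply: mfunM.
rewrite (_ : (fun _=> _) = fun p=> (s < p.1 <= t)%R%:R * (cst 1 : T -> R) p.2).
 apply: pred_rect=> //; have [sH _]:= fH.
 have sHs : sigma_algebra setT (H s) by have []:= sH s; rewrite ?s0 ?s1.
 by apply/(meas_wrtP sHs); mf.
by apply/funext=> p; rewrite mulr1.
mf.
Qed.
Let jsum_Kstep k w : jsum N (Kstep k) w = (D w + 1) ^+ k.+1 - 1.
have:= psum_telescope (hN w) (fun x=> (x + 1) ^+ k.+1) s0 st t1.
rewrite add0r expr1n=> <-; apply: (eq_psum (hN w))=> v /andP[v0 v1]; rewrite /Kstep /=.
have -> // : jpre N K0 (v, w) = psum (N ^~ w) (fun u=> (s < u < v)%R%:R).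
apply: (eq_psum (hN w))=> u /andP[u0 u1]; rewrite /K0 /= u1 andbT.
by case: (u < v); rewrite ?mul1r ?mul0r ?andbT ?andbF.
Qed.
Let C0 : 0 <= C.
by have /andP[h1 h2]:= b0C (0, point); exact: le_trans h2. Qed.
(** Compensate the telescoping sum: on ]s, t] the integrand is at most (k+1) (2 (D + 1))^k and the
    intensity at most [C], which bounds a moment by the preceding one times t - s. *)
Let step k : L1 P (fun w=> (D w + 1) ^+ k) ->
[/\ L1 P (fun w=> (D w + 1) ^+ k.+1), L1 P (fun w=> D w ^+ k.+1),
Ex P (fun w=> (D w + 1) ^+ k.+1) <=
 1 + C * (k.+1%:R * 2 ^+ k) * Ex P (fun w=> (D w + 1) ^+ k) * (t - s) &
Ex P (fun w=> D w ^+ k.+1) <=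
 C * (k.+1%:R * 2 ^+ k) * Ex P (fun w=> (D w + 1) ^+ k) * (t - s)].
move=> IH; pose c : R:= k.+1%:R * 2 ^+ k.
have c0 : 0 <= c by rewrite mulr_ge0// exprn_ge0.
pose G (p : R * T) : R:= (s < p.1 <= t)%R%:R * (c * (D p.2 + 1) ^+ k).
have D1 w : 0 <= D w + 1 by nn.
have G0 p : 0 <= G p by rewrite mulr_ge0// mulr_ge0// exprn_ge0.
have K0G p : 0 <= Kstep k p <= G p.
rewrite /Kstep /G; case: (boolP (s < p.1 <= t)); last by rewrite !mul0r lexx.
case: p=> u w /= /andP[su ut]; rewrite !mul1r.
have A1 : 0 <= jpre N K0 (u, w) + 1 by nn.
have /andP[-> h]:= exprS_sub_le k A1; apply: (le_trans h).
rewrite /c -mulrA lerM2l// -exprMn.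
have hA:= jpre_ge0 (u, w); have hD:= jpre_le w ut.
by rewrite lerXn2r ?nnegrE//; move: (jpre N K0 (u, w)) (D w) hA hD=> ? ? ? ?; lra.
have mG : mT G.
apply: mfunM; first by apply: (mcompT (meas_itvR s t)).
apply: mfunM; first mf.
apply: mfunX; apply: mfunD; last mf.
mf.
have GP u : L1 P (fun w=> G (u, w)) by rewrite /G /=; do 2 apply: L1Z.
have EG u : Ex P (fun w=> G (u, w)) = (s < u <= t)%R%:R * (c * Ex P (fun w=> (D w + 1) ^+ k)).
by rewrite /G /= ExZ ?ExZ//; exact: L1Z.
have ind1 : L1 U01 (fun u : R=> (s < u <= t)%R%:R : R).
apply: (L1by 1); first exact: meas_itvR.
by move=> u; case: (_ < _ <= _); rewrite ?normr1 ?normr0.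
have GL1 : L1 Q G.
apply: L1_pair_ge0=> //; rewrite (_ : (fun x=> _) = fun u=>
 (c * Ex P (fun w=> (D w + 1) ^+ k)) * (s < u <= t)%R%:R); first exact: L1Z.
by apply/funext=> u; rewrite EG mulrC.
have EQG : Ex Q G = c * Ex P (fun w=> (D w + 1) ^+ k) * (t - s).
rewrite Ex_pair//; under eq_fun do rewrite EG mulrC.
by rewrite ExZ// Ex_U01_itv.
have KL1 : L1 Q (Kstep k).
apply: (L1_le (pred_meas fH (@mKstep k)) GL1)=> p; have /andP[h1 h2]:= K0G p.
by rewrite ger0N.
have [jL1 jE]:= compensator_ext hN mN fH cb b0C (@mKstep k) KL1.
have jle : Ex P (jsum N (Kstep k)) <= C * c * Ex P (fun w=> (D w + 1) ^+ k) * (t - s).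
rewrite jE -[C * c]/(C * c) -mulrA -[C * c * _]mulrA (mulrA c) -EQG -ExZ//; apply: Ex_le.
- by apply: (L1_mulb fH cb b0C (K:= Kstep k)).
- exact: L1Z.
- move=> p; have /andP[h1 h2]:= K0G p; have /andP[h3 h4]:= b0C p.
 by rewrite mulrC ler_pM.
have eqj : jsum N (Kstep k) = fun w=> (D w + 1) ^+ k.+1 - 1.
by apply/funext=> w; by [].
have L1a : L1 P (fun w=> (D w + 1) ^+ k.+1).
rewrite (_ : (fun _=> _) = fun w=> jsum N (Kstep k) w + 1).
 by apply: L1D=> //; exact: L1_cst.
by apply/funext=> w; rewrite eqj subrK.
have L1b : L1 P (fun w=> D w ^+ k.+1).
apply: (L1_le _ L1a); first mf.
by move=> w; rewrite ger0N ?exprn_ge0// lerXn2r ?nnegrE// lerDl.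
split=> //.
rewrite addrC -lerBlDr -[X in _ - X](Ex_cst P 1) -ExB//; last exact: L1_cst.
by rewrite -eqj.
apply: le_trans jle; rewrite eqj; apply: Ex_le=> //.
by apply: L1B=> //; exact: L1_cst.
by move=> w; rewrite lerBrDr exprS_add1_le.
Qed.
Lemma count_const_ge0 k : 0 <= count_const C k.
by elim: k=> //= k IH; rewrite addr_ge0// !mulr_ge0// exprn_ge0. Qed.
Let moment1 k : L1 P (fun w=> (D w + 1) ^+ k) /\
Ex P (fun w=> (D w + 1) ^+ k) <= count_const C k.
elim: k=> [|k [IH1 IH2]].
have -> : (fun w=> (D w + 1) ^+ 0) = fun=> 1 :> R by [].
by rewrite Ex_cst; split=> //; exact: L1_cst.
have [h1 _ h3 _]:= step IH1; split=> //; apply: (le_trans h3); rewrite /= lerD2l.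
have c0 : 0 <= C * (k.+1%:R * 2 ^+ k) by nn.
have E0 : 0 <= Ex P (fun w=> (D w + 1) ^+ k).
by apply: Ex_ge0=> w; rewrite exprn_ge0// addr_ge0.
apply: (@le_trans _ _ (C * (k.+1%:R * 2 ^+ k) * Ex P (fun w=> (D w + 1) ^+ k))).
by rewrite ler_piMr ?mulr_ge0//; have:= s0; have:= t1; lra.
by rewrite lerM2l.
Qed.
(** Linear in t - s for every k, as it must be for jumps of size one. *)
Lemma count_pow k : L1 P (fun w=> D w ^+ k.+1) /\
Ex P (fun w=> D w ^+ k.+1) <= C * (k.+1%:R * 2 ^+ k) * count_const C k * (t - s).
have [m1 m2]:= moment1 k; have [_ h2 _ h4]:= step m1; split=> //.
apply: (le_trans h4); rewrite ler_wpM2r ?subr_ge0// lerM2l//.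
nn.
Qed.
End increments.
Lemma L1_N1 k : L1 P (fun w=> (N 1 w)%:R ^+ k).
case: k=> [|k]; first by under eq_fun do rewrite expr0; exact: L1_cst.
have [h _]:= count_pow (lexx 0) ler01 (lexx 1) k.
move: h; congr L1; apply/funext=> w; have [-> _ _ _]:= hN w.
by rewrite subr0.
Qed.
(** Square by parts, then compensate both jump sums: the cross term 2 (A - B) K cancels against its
    compensator and K^2 remains. The cross term contains [N] and is not bounded, hence the use of
    [compensator_ext]. *)
Lemma compensated_isometry (K : R * T -> R) M :
mT (K : predT H -> R) -> bdd K M ->
let X w:= jsum N K w - tint (fun p=> K p * b p) w in
[/\ mT X, L1 P (fun w=> X w ^+ 2), Ex P X = 0 &
  Ex P (fun w=> X w ^+ 2) = Ex Q (fun p=> K p ^+ 2 * b p)].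
move=> mK KM X; have mK':= pred_meas fH mK.
have M0 : 0 <= M by exact: le_trans (normr_ge0 (K (0, point))) (KM _).
have C0 : 0 <= C by have /andP[h1 h2]:= b0C (0, point); exact: le_trans h2.
have Cb p : `|b p| <= C by have /andP[h1 h2]:= b0C p; rewrite ger0N.
pose Kb p:= K p * b p.
have mKb : mT (Kb : predT H -> R).
by apply: mfunM=> //; have []:= cb.
have mKb':= pred_meas fH mKb.
have KbM p : `|Kb p| <= M * C by rewrite normrM ler_pM.
pose A:= jpre N K; pose B:= tpre Kb.
have mA:= pred_jpre hN aN fH mK KM.
have mB:= pred_tpre fH mKb KbM.
pose K1 p:= 2 * (unitp p.1 * A p - unitp p.1 * B p) * K p.
have mK1 : mT (K1 : predT H -> R).
apply: mfunM=> //; apply: mfunM; first mf.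
mf.
have uni (x : R) : `|unitp x| <= 1 :> R by rewrite /unitp; case: (_ < _ <= _); rewrite ?normr1 ?normr0.
have b1 (c : bool) : `|c%:R| <= 1 :> R by case: c; rewrite ?normr1 ?normr0.
have Abd p : `|A p| <= M * (N 1 p.2)%:R.
apply: psum_bd=> v; rewrite normrM; apply: le_trans (KM (v, p.2)); by rewrite ler_piMl.
have Bbd p : `|B p| <= M * C.
apply: Ex_bd.
 apply: mfunM; last mf.
 mf.
by move=> v; rewrite normrM; apply: le_trans (KbM (v, p.2)); rewrite ler_piMl.
(* Envelope of K1: A is at most M N_1, B at most M C. *)
pose G (p : R * T):= 2 * (M * (N 1 p.2)%:R + M * C) * M.
have K1G p : `|K1 p| <= G p.
rewrite /K1 /G !normrM ger0N//; apply: ler_pM=> //; rewrite ?mulr_ge0//.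
rewrite lerM2l// -mulrBr normrM; apply: (@le_trans _ _ `|A p - B p|); first by rewrite ler_piMl.
by apply: le_trans (ler_normB _ _) _; exact: lerD.
have N1L1 : L1 P (fun w=> (N 1 w)%:R) by have []:= cb.
have gL1 : L1 P (fun w=> 2 * (M * (N 1 w)%:R + M * C) * M).
rewrite (_ : (fun _=> _) = fun w=> M * (2 * (M * (N 1 w)%:R + M * C))).
 by do 2 apply: L1Z; apply: L1D; [exact: L1Z|exact: L1_cst].
by apply/funext=> w; rewrite mulrC.
have GL1 : L1 Q G.
apply: L1_pair_ge0=> //.
- exact: (mcompT (L1_meas gL1)).
- by move=> p; rewrite !mulr_ge0// addr_ge0// mulr_ge0.
- exact: (L1_cst U01 (Ex P (fun w=> G (0, w)))).
have K1L1 : L1 Q K1:= L1_le (pred_meas fH mK1) GL1 K1G.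
have K2M p : `|K p ^+ 2| <= M ^+ 2 by rewrite normrX lerXn2r ?nnegrE.
have mK2 : mT ((fun p=> K p ^+ 2) : predT H -> R) by mf.
have K2L1 : L1 Q (fun p=> K p ^+ 2):= L1_bd Q (pred_meas fH mK2) K2M.
have [j1 j2]:= compensator_ext hN mN fH cb b0C mK1 K1L1.
have [j3 j4]:= compensator_ext hN mN fH cb b0C mK2 K2L1.
have XE w : X w ^+ 2 = jsum N K1 w + jsum N (fun p=> K p ^+ 2) w -
 Ex U01 (fun s=> K1 (s, w) * b (s, w)).
have mk : mT (fun s=> Kb (s, w)):= mpair1 w mKb'.
rewrite /X /tint (square_by_parts (fun s=> K (s, w)) (hN w) mk (fun s=> KbM (s, w))).
rewrite -psumD; congr (_ - _).
 by apply: (eq_psum (hN w))=> s s01; rewrite /K1 /unitp /= s01 !mul1r.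
rewrite -[LHS]Ex_U01_unitp; last first.
 apply: mfunM=> //; apply: mfunM; first mf.
 apply: mfunB.
  apply: msum=> i; apply: mfunM; last mf.
  mf.
 have mBB : mT (fun p : R * R=> (p.2 <= p.1)%R%:R * Kb (p.2, w)).
  apply: mfunM; last mf.
  mf.
 exact: (meas_Ex U01 mBB).
by eqEx=> s; rewrite /K1 /A /B /jpre /tpre /Kb /=; ring.
have K1b : L1 Q (fun p=> K1 p * b p):= L1_mulb fH cb b0C K1L1.
have K1bw w : L1 U01 (fun s=> K1 (s, w) * b (s, w)).
apply: (L1by (G (0, w) * C)).
 by apply: mfunM; [exact: (mpair1 w (pred_meas fH mK1))|
  mf].
by move=> s; rewrite normrM ler_pM//; exact: K1G (s, w).
have t1 : L1 P (fun w=> Ex U01 (fun s=> K1 (s, w) * b (s, w))).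
exact: L1_pair2 K1b K1bw.
have mX : mT X.
apply: mfunB; first exact: m_jsum.
exact: (meas_Ex2 U01 mKb').
have X2 : (fun w=> X w ^+ 2) = fun w=> jsum N K1 w + jsum N (fun p=> K p ^+ 2) w -
 Ex U01 (fun s=> K1 (s, w) * b (s, w)) by apply/funext.
have KbL1 : L1 Q Kb by exact: L1_bd mKb' KbM.
have jK : L1 P (jsum N K).
apply: (L1le (fun w=> M * (N 1 w)%:R)); [exact: m_jsum|exact: L1Z|].
by move=> w; exact: jsum_bd.
have tK : L1 P (tint Kb).
apply: (L1by (M * C)).
 exact: (meas_Ex2 U01 mKb').
move=> w; apply: Ex_bd=> [|s]; first mf.
exact: KbM.
split=> //.
- by rewrite X2; apply: L1B=> //; exact: L1D.
- rewrite ExB// (_ : Ex P (jsum N K) = Ex Q Kb); last first.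
 by have [_ _ _ cE]:= cb; exact: cE mK KM.
by rewrite (Ex_pair2_bd _ _ mKb' KbM) subrr.
- rewrite X2 ExB//; last exact: L1D.
rewrite ExD// j2 j4 -(Ex_pair2 K1b K1bw).
by rewrite addrAC subrr add0r.
Qed.
End jump_martingale.

(** * Independence in the sample *)

Section sample.
Context {R : realType} d (T : mType d) (P : prob T R).
Context dS (S : mType dS) (PS : prob S R) (n : nat) (Z : 'I_n -> S -> T).
Hypothesis iidZ : iid_sample P PS Z.
Definition obs_gen (I : {set 'I_n}) : set (set S) :=
\bigcup_(j in [set j | j \in I]) preimage_set_system setT (Z j) measurable.
Notation obsT I:= (sigmaT (obs_gen I)).
Lemma meas_obs j : mT (Z j).
by have [_ + _ _]:= iidZ; apply. Qed.
Lemma obs_law j A : measurable A -> PS (Z j @^-1` A) = P A.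
by have [_ _ + _]:= iidZ; apply. Qed.
Lemma obs_gen_sub I : <<s obs_gen I >> `<=` (measurable : set (set S)).
apply: smallest_sub; first exact: sigma_algebra_measurable.
by move=> _ [j _ [B mB <-]]; exact: meas_obs.
Qed.
Lemma meas_obs_id I : mT (idfun : S -> obsT I).
by move=> _ B mB; rewrite setTI; exact: (obs_gen_sub mB). Qed.
Lemma meas_obs_in (I : {set 'I_n}) j : j \in I ->
mT (Z j : obsT I -> T).
by move=> jI _ B mB; apply: sub_sig; exists j=> //; exists B. Qed.
Lemma meas_obs_sub (I I' : {set 'I_n}) : (forall j, j \in I -> j \in I') ->
mT (idfun : obsT I' -> obsT I).
move=> II' _ B mB; rewrite setTI /=; move: B mB; apply: smallest_sub.
exact: smallest_sigma_algebra.
by move=> _ [j /= jI [B mB <-]]; apply: sub_sig; exists j; [exact: II'|exists B].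
Qed.
(** The law of the sample restricted to the observations in I. Conditional expectations given these
    observations become partial integrals for [obsP I \x P]. *)
Definition obsP I : prob (obsT I) R:= image_law PS (@meas_obs_id I).
Lemma obs_idM I d' (U : mType d') (f : obsT I -> U) :
mT f -> mT (f : S -> U).
by move=> mf _ B mB; have:= mf measurableT B mB; rewrite !setTI; exact: obs_gen_sub. Qed.
Lemma Ex_obsP I (f : obsT I -> R) : L1 (obsP I) f -> Ex (obsP I) f = Ex PS f.
by move=> fi; exact/esym/(Ex_law (P:= PS) (@meas_obs_id I) (P':= obsP I)). Qed.
Lemma L1_obsP I (f : obsT I -> R) : mT f -> L1 (obsP I) f <-> L1 PS f.
move=> mf; split=> h; first exact: (L1_law (@meas_obs_id I) (P':= obsP I)) h.
exact: (L1_law_inv (@meas_obs_id I) (P':= obsP I)) h.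
Qed.
Let cyl (I : {set 'I_n}) : set (set S) :=
[set A | exists2 B : 'I_n -> set T, (forall j, measurable (B j)) &
 A = \bigcap_(j in [set j | j \in I]) (Z j @^-1` B j)].
Let cyl_setI I : setI_closed (cyl I).
move=> _ _ [B mB ->] [B' mB' ->]; exists (fun j=> B j `&` B' j).
by move=> j; exact: measurableI.
by rewrite -bigcapI.
Qed.
Let cyl_gen I A : <<s obs_gen I >> A -> <<s cyl I >> A.
apply: smallest_sub; first by [].
move=> _ [j /= jI [B mB <-]]; apply: sub_sig.
exists (fun i=> if i == j then B else setT).
by move=> i; case: ifP.
rewrite setTI; apply/seteqP; split=> s /=.
by move=> Bs i iI; rewrite /=; case: eqP=> [->|].
by move=> /(_ j jI) /=; rewrite eqxx.
Qed.
(** Independence is given for products of sets; it extends from cylinders to the sigma-algebra they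
    generate, with the indicator of the event on [Z j] as weight. *)
Lemma obs_indep (I : {set 'I_n}) j A B : j \notin I -> <<s obs_gen I >> A -> measurable B ->
PS (A `&` Z j @^-1` B) = (PS A * P B)%E.
move=> jI sA mB; have mA:= obs_gen_sub sA.
have mZB : measurable (Z j @^-1` B) by rewrite -[X in measurable X]setTI; exact: meas_obs.
suff : Ex PS (fun s=> \1_A s * \1_(Z j @^-1` B) s) = Ex PS \1_A * fine (P B).
rewrite (_ : (fun s=> _) = \1_(A `&` Z j @^-1` B)); last first.
 by apply/funext=> s; rewrite indicI.
rewrite !Ex_indic//; last exact: measurableI.
move=> E; rewrite -[LHS]fineK; last by rewrite fin_num_measure//; exact: measurableI.
by rewrite E EFinM !fineK ?fin_num_measure.
have LI (C : set S) : measurable C -> L1 PS (\1_C : S -> R).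
by move=> mC; apply: (L1by 1)=> [|x]; [exact: mindic|exact: indic_le1].
have ZE (f : S -> R) : L1 PS f -> Ex PS (fun s=> f s * fine (P B)) = Ex PS f * fine (P B).
by move=> Lf; rewrite mulrC -ExZ//; eqEx=> s; rewrite mulrC.
have mcyl : mT (\1_A : sigmaT (cyl I) -> R) by apply: mindic; exact: cyl_gen.
have mD D : cyl I D -> measurable D.
move=> [C mC ->]; apply: (obs_gen_sub (I:= I)).
have:= @fin_bigcap_measurable _ (obsT I) _ [set j | j \in I] (fun j=> Z j @^-1` C j).
apply; first by [].
by move=> i /= iI; apply: sub_sig; exists i=> //; exists (C i); rewrite ?setTI.
rewrite -ZE; last exact: LI.
apply: (@Ex_pi_weight _ _ _ PS _ _ PS _ (cyl I) id id _ _ _ mD mD (LI _ mZB) _ _ _ _ 1 mcyl).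
- exact: cyl_setI.
- exact: L1_cst.
- by rewrite Ex_indic// obs_law// Ex_cst.
- move=> D cD; have {mD}:= mD _ cD; case: cD=> C mC ->; set D':= \bigcap_(j in _) _=> mD.
rewrite -[LHS]/(Ex PS (fun s=> \1_D' s * \1_(Z j @^-1` B) s)) -[RHS]/(Ex PS (fun s=> \1_D' s * fine (P B))) ZE; last exact: LI.
rewrite (_ : (fun s=> _ * \1__ _) = \1_(D' `&` Z j @^-1` B)); last first.
 by apply/funext=> s; rewrite indicI.
rewrite !Ex_indic//; last exact: measurableI.
pose E B' i:= if i == j then B' else if i \in I then C i else setT.
have mE B' : measurable B' -> forall i, measurable (E B' i).
 by move=> mB' i; rewrite /E; case: ifP=> // _; case: ifP.
have DE B' : D' `&` Z j @^-1` B' = \bigcap_(i in [set: 'I_n]) (Z i @^-1` E B' i).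
 apply/seteqP; split=> s.
  move=> [Ds Bs] i _ /=; rewrite /E; case: eqP=> [->//|_].
  by case: ifP=> // iI; exact: Ds.
 move=> h; split; last by have:= h j Logic.I; rewrite /E /= eqxx.
 move=> i /= iI; have:= h i Logic.I; rewrite /E /=; case: eqP=> [ij|_]; last by rewrite iI.
 by move: jI; rewrite -ij iI.
have [_ _ _ ind]:= iidZ.
have prodE B' : measurable B' -> PS (D' `&` Z j @^-1` B') =
  (P B' * \prod_(i < n | i != j) PS (Z i @^-1` (E setT i)))%E.
 move=> mB'; rewrite DE ind; last exact: mE.
 rewrite (bigD1 j)//= {1}/E eqxx obs_law//; congr (_ * _)%E.
 by apply: eq_bigr=> i /negbTE ij; rewrite /E ij.
have:= prodE setT measurableT; rewrite setIT [X in (X * _)%E](@probability_setT _ _ _ P) mul1e.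
by rewrite prodE// => <-; rewrite fineM ?fin_num_measure// mulrC.
- by move=> x; exact: indic_le1.
Qed.
Section transfer.
Variables (I : {set 'I_n}) (j : 'I_n).
Hypothesis jI : j \notin I.
Let phi (s : S) : obsT I * T:= (s, Z j s).
Let mphi : mT phi.
by apply/mpair; [exact: meas_obs_id|exact: meas_obs]. Qed.
Let phi_law A : measurable A -> PS (phi @^-1` A) = (obsP I \x P)%E A.
move=> mA; apply/esym.
apply: (@product_measure_unique _ _ _ _ _ _ _ (pushforward PS phi))=> // B C mB mC.
transitivity (PS (B `&` Z j @^-1` C)); last exact: (obs_indep jI mB mC).
by [].
Qed.
(** Given the observations in I, [Z j] is a fresh draw from [P]: expectations over the sample become
    iterated integrals. *)
Lemma obs_transfer (f : obsT I * T -> R) : L1 (obsP I \x P)%E f ->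
L1 PS (fun s=> f (s, Z j s)) /\ Ex PS (fun s=> f (s, Z j s)) = Ex (obsP I \x P)%E f.
by move=> fi; split; [exact: (L1_law mphi phi_law fi)|exact: (Ex_law mphi phi_law fi)]. Qed.
End transfer.
End sample.
Notation obsT Z I:= (sigmaT (obs_gen Z I)).

(** * Moments of sums of conditionally centred terms *)

Section sample_sums.
Context {R : realType} d (T : mType d) (P : prob T R).
Context dS (S : mType dS) (PS : prob S R) (n : nat) (Z : 'I_n -> S -> T).
Hypothesis iidZ : iid_sample P PS Z.
Variables (I0 : {set 'I_n}) (Phi : obsT Z I0 * T -> R).
Hypotheses (mPhi : mT Phi)
(Phi2 : forall s, L1 P (fun w=> Phi (s, w) ^+ 2))
(Phi0 : forall s, Ex P (fun w=> Phi (s, w)) = 0).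
Definition ssum (L : seq 'I_n) (s : S) : R:= \sum_(j <- L) Phi (s, Z j s).
Let m2 (s : S) : R:= Ex P (fun w=> Phi (s, w) ^+ 2).
Let mPhis s : mT (fun w=> Phi (s, w)).
mf. Qed.
Let Phi1 s : L1 P (fun w=> Phi (s, w)).
apply: (L1le (fun w=> 1 + Phi (s, w) ^+ 2))=> //.
by apply: L1D=> //; exact: L1_cst.
move=> w; move: (Phi (s, w))=> x; rewrite -real_normK ?num_real//.
have:= sqr_ge0 (`|x| - 1 / 2); rewrite !expr2; lra.
Qed.
Let mPhi_in (I : {set 'I_n}) : (forall j, j \in I0 -> j \in I) ->
mT (Phi : obsT Z I * T -> R).
move=> sub; have mg : mT (fun p : obsT Z I * T=> (p.1, p.2) : obsT Z I0 * T).
apply/mpair; last mf.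
by apply: (mcompT (meas_obs_sub (Z:= Z) sub)); mf.
move=> _ B mB; rewrite setTI; have:= mg measurableT _ (mPhi measurableT mB).
by rewrite !setTI; congr measurable; apply/seteqP; split=> -[].
Qed.
Lemma meas_ssum (L : seq 'I_n) (I : {set 'I_n}) : (forall j, j \in I0 -> j \in I) ->
(forall j, j \in L -> j \in I) -> mT (ssum L : obsT Z I -> R).
move=> sub; rewrite /ssum; elim: L=> [|j L IH] LI.
by under eq_fun do rewrite big_nil; exact: mcst.
under eq_fun do rewrite big_cons; apply: mfunD; last first.
by apply: IH=> i iL; apply: LI; rewrite inE iL orbT.
apply: (mcompT (mPhi_in sub)); apply/mpair=> //.
by apply: meas_obs_in; apply: LI; rewrite inE eqxx.
Qed.
Let big (L : seq 'I_n) : {set 'I_n}:= I0 :|: [set j in L].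
Let big_sub L j : j \in I0 -> j \in big L. by rewrite inE=> ->. Qed.
Let big_in L j : j \in L -> j \in big L. by rewrite !inE=> ->; rewrite orbT. Qed.
Let mm2 (I : {set 'I_n}) : (forall j, j \in I0 -> j \in I) ->
mT (m2 : obsT Z I -> R).
move=> sub; apply: (meas_Ex P (f:= fun p : obsT Z I * T=> Phi p ^+ 2)).
by apply: mfunX; exact: mPhi_in.
Qed.
(** Observations are added one at a time; given the training data and the observations already
    added, the new term is centred and the cross term vanishes. *)
Lemma ssum_sqr L : uniq L -> (forall j, j \in L -> j \notin I0) -> L1 PS m2 ->
L1 PS (fun s=> ssum L s ^+ 2) /\ Ex PS (fun s=> ssum L s ^+ 2) = (size L)%:R * Ex PS m2.
move=> + + m2L; elim: L=> [_ _|j L IH /= /andP[jL uL] LI0].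
have -> : (fun s=> ssum [::] s ^+ 2) = fun=> 0 :> R.
 by apply/funext=> s; rewrite /ssum big_nil expr0n.
by rewrite Ex_cst mul0r; split=> //; exact: L1_cst.
have [|IH1 IH2]:= IH uL; first by move=> i iL; apply: LI0; rewrite inE iL orbT.
pose I:= big L.
have jI : j \notin I by rewrite !inE negb_or jL andbT LI0// inE eqxx.
have mU : mT (ssum L : obsT Z I -> R).
by apply: meas_ssum=> i; [exact: big_sub|exact: big_in].
have mP : mT (Phi : obsT Z I * T -> R) by apply: mPhi_in=> i; exact: big_sub.
have mm : mT (m2 : obsT Z I -> R) by apply: mm2=> i; exact: big_sub.
pose f (p : obsT Z I * T) : R:= (ssum L p.1 + Phi p) ^+ 2.
have mf : mT f.
by apply: mfunX; apply: mfunD=> //; mf.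
have fE s : (fun w=> f (s, w)) = fun w=> ssum L s ^+ 2 + (2 * ssum L s) * Phi (s, w) + Phi (s, w) ^+ 2.
by apply/funext=> w; rewrite /f /=; ring.
have fs s : L1 P (fun w=> f (s, w)).
by rewrite fE; apply: L1D=> //; apply: L1D; [exact: L1_cst|exact: L1Z].
have Efs s : Ex P (fun w=> f (s, w)) = ssum L s ^+ 2 + m2 s.
rewrite fE ExD//; last by apply: L1D; [exact: L1_cst|exact: L1Z].
by rewrite ExD ?Ex_cst ?ExZ ?Phi0 ?mulr0 ?addr0//; [exact: L1_cst|exact: L1Z].
have i1 : L1 (obsP iidZ I) (fun s=> ssum L s ^+ 2) by apply/L1_obsP=> //; mf.
have i2 : L1 (obsP iidZ I) m2 by apply/L1_obsP.
have fL1 : L1 (obsP iidZ I \x P)%E f.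
apply: L1_pair_ge0=> //; first by move=> p; exact: sqr_ge0.
by rewrite (_ : (fun s=> _) = fun s=> ssum L s ^+ 2 + m2 s); [exact: L1D|apply/funext].
have [h1 h2]:= obs_transfer jI fL1.
have E : (fun s=> ssum (j :: L) s ^+ 2) = fun s=> f (s, Z j s).
by apply/funext=> s; rewrite /ssum big_cons /f /= addrC.
rewrite E h2; split=> //; rewrite Ex_pair//.
rewrite (_ : (fun s=> _) = fun s=> ssum L s ^+ 2 + m2 s); last by apply/funext.
by rewrite ExD// !Ex_obsP// IH2 -natr1 mulrDl mul1r.
Qed.
(** The same induction for fourth powers. The term linear in the number of observations is kept
    apart, because it is the one that limits chaining. *)
Lemma ssum_pow4 (K2 K4 : R) L : uniq L -> (forall j, j \in L -> j \notin I0) ->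
(forall s, m2 s <= K2) -> (forall s, L1 P (fun w=> Phi (s, w) ^+ 4)) ->
(forall s, Ex P (fun w=> Phi (s, w) ^+ 4) <= K4) ->
L1 PS (fun s=> ssum L s ^+ 4) /\
Ex PS (fun s=> ssum L s ^+ 4) <= 8 * K2 ^+ 2 * (size L)%:R ^+ 2 + 3 * K4 * (size L)%:R.
move=> uL LI0 m2K P4 P4K.
have m20 s : 0 <= m2 s by apply: Ex_ge0=> w; nn.
have K20 : 0 <= K2:= le_trans (m20 point) (m2K point).
have m2L : L1 PS m2.
apply: (L1by K2); last by move=> s; rewrite ger0N.
by apply: (obs_idM iidZ (I:= I0)); exact: mm2.
elim: L uL LI0=> [_ _|j L IH /= /andP[jL uL] LI0].
have -> : (fun s=> ssum [::] s ^+ 4) = fun=> 0 :> R.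
 by apply/funext=> s; rewrite /ssum big_nil expr0n.
by rewrite Ex_cst expr0n !mulr0 addr0; split=> //; exact: L1_cst.
have LI0' i : i \in L -> i \notin I0 by move=> iL; apply: LI0; rewrite inE iL orbT.
have [IH1 IH2]:= IH uL LI0'.
have [S1 S2]:= ssum_sqr uL LI0' m2L.
pose I:= big L.
have jI : j \notin I by rewrite !inE negb_or jL andbT LI0// inE eqxx.
have mU : mT (ssum L : obsT Z I -> R).
by apply: meas_ssum=> i; [exact: big_sub|exact: big_in].
have mP : mT (Phi : obsT Z I * T -> R) by apply: mPhi_in=> i; exact: big_sub.
pose f (p : obsT Z I * T) : R:= (ssum L p.1 + Phi p) ^+ 4.
have mf : mT f.
by apply: mfunX; apply: mfunD=> //; mf.
have f0 p : 0 <= f p by rewrite /f (_ : 4 = 2 * 2)%N// exprM sqr_ge0.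
(* An upper bound of (x + y)^4 without the term x y^3, which would call for a third moment: the
   difference is 2 y^2 (x - y)^2. The term linear in y has mean 0. *)
pose G s w : R:= ssum L s ^+ 4 + (4 * ssum L s ^+ 3) * Phi (s, w) +
(8 * ssum L s ^+ 2) * Phi (s, w) ^+ 2 + 3 * Phi (s, w) ^+ 4.
have fG s w : f (s, w) <= G s w.
rewrite /f /G /=; move: (ssum L s) (Phi (s, w))=> x y.
rewrite -subr_ge0 (_ : _ - _ = 2 * (y * (x - y)) ^+ 2); last by ring.
nn.
have GL s : L1 P (G s).
by apply: L1D; [apply: L1D; [apply: L1D; [exact: L1_cst|exact: L1Z]|exact: L1Z]|exact: L1Z].
have EG s : Ex P (G s) <= ssum L s ^+ 4 + 8 * K2 * ssum L s ^+ 2 + 3 * K4.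
rewrite ExD; [|by apply: L1D; [apply: L1D; [exact: L1_cst|exact: L1Z]|exact: L1Z]|exact: L1Z].
rewrite ExD; [|by apply: L1D; [exact: L1_cst|exact: L1Z]|exact: L1Z].
rewrite ExD; [|exact: L1_cst|exact: L1Z].
rewrite Ex_cst !ExZ// Phi0 mulr0 addr0 lerD ?lerM2l// lerD2l.
by rewrite [leRHS]mulrAC; apply: lerM2l; [rewrite mulr_ge0// sqr_ge0|exact: m2K].
have fs s : L1 P (fun w=> f (s, w)).
apply: (L1_le _ (GL s)); first mf.
by move=> w; rewrite ger0N.
have i1 : L1 (obsP iidZ I) (fun s=> ssum L s ^+ 2) by apply/L1_obsP=> //; mf.
have i2 : L1 (obsP iidZ I) (fun s=> ssum L s ^+ 4) by apply/L1_obsP=> //; mf.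
have bL : L1 (obsP iidZ I) (fun s=> ssum L s ^+ 4 + 8 * K2 * ssum L s ^+ 2 + 3 * K4).
by apply: L1D; [apply: L1D=> //; exact: L1Z|exact: L1_cst].
have Efb s : Ex P (fun w=> f (s, w)) <= ssum L s ^+ 4 + 8 * K2 * ssum L s ^+ 2 + 3 * K4.
by apply: le_trans (EG s); apply: Ex_le.
have EfL : L1 (obsP iidZ I) (fun s=> Ex P (fun w=> f (s, w))).
apply: (L1_le _ bL); first exact: meas_Ex.
by move=> s; rewrite ger0N//; exact: Ex_ge0.
have fL1 : L1 (obsP iidZ I \x P)%E f by apply: L1_pair_ge0.
have [h1 h2]:= obs_transfer jI fL1.
have E : (fun s=> ssum (j :: L) s ^+ 4) = fun s=> f (s, Z j s).
by apply/funext=> s; rewrite /ssum big_cons /f /= addrC.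
rewrite E h2; split=> //; rewrite Ex_pair//.
apply: le_trans (Ex_le EfL bL Efb) _.
rewrite ExD; [|by apply: L1D=> //; exact: L1Z|exact: L1_cst].
rewrite ExD//; last exact: L1Z.
rewrite ExZ// Ex_cst !Ex_obsP// S2.
have m2E : Ex PS m2 <= K2 by rewrite -[leRHS](Ex_cst PS); apply: Ex_le=> //; exact: L1_cst.
apply: (@le_trans _ _ (8 * K2 ^+ 2 * (size L)%:R ^+ 2 + 3 * K4 * (size L)%:R +
 8 * K2 * ((size L)%:R * K2) + 3 * K4)).
by rewrite lerD2r lerD// lerM2l ?mulr_ge0// lerM2l.
rewrite -[(size L).+1%:R]natr1; move: ((size L)%:R : R) (ler0n R (size L))=> r r0.
rewrite -subr_ge0 (_ : _ - _ = 8 * K2 ^+ 2 * (r + 1)); last by ring.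
nn.
Qed.
End sample_sums.

(** * Taylor bounds for sine, cosine and exponential *)

Section taylor.
Context {R : realType}.
Implicit Types (f df : R -> R) (x y : R).
Lemma incr_of_derive f df : (forall x, is_derive x 1 f (df x)) ->
(forall x, 0 <= x -> 0 <= df x) -> forall x, 0 <= x -> f 0 <= f x.
move=> fd df0 x x0.
have [|c + E]:= MVT_segment x0 (fun y _=> fd y).
by apply: derivable_within_continuous=> y _; by [].
rewrite in_itv /= => /andP[c0 _]; rewrite -subr_ge0 E subr0.
by rewrite mulr_ge0// df0.
Qed.
(** The Taylor bounds form a chain in which each is the derivative of the next; this adds one
    monomial to a function of known derivative. *)
Lemma derive_monomial f (df : R) b n x : is_derive x 1 f df ->
is_derive x 1 (fun y=> f y + b * y ^+ n.+1) (df + b * (n.+1%:R * x ^+ n)).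
move=> fd; have:= is_deriveD fd (is_deriveZ b (is_deriveX n.+1 (is_derive_id x 1))).
rewrite (_ : (fun y=> _) = f + b \*: id ^+ n.+1)=> [h|]; last first.
apply/funext=> y; congr (_ + b * _).
by elim: n.+1=> // k IH; rewrite !exprS IH.
by apply: (is_derive_eq h); rewrite /GRing.scale /= mulr1.
Qed.
Lemma lipschitz_of_derive f df : (forall x, is_derive x 1 f (df x)) ->
bdd df 1 -> forall x y, `|f x - f y| <= `|x - y|.
move=> fd df1 x y.
wlog xy : x y / y <= x.
by move=> H; case: (leP y x)=> [|/ltW] /H; rewrite // distrC [leRHS]distrC.
have [|c _ ->]:= MVT_segment xy (fun y _=> fd y).
by apply: derivable_within_continuous=> z _; by [].
by rewrite normrM ler_piMl.
Qed.
Lemma cosN1 x : `|cos x| <= 1.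
by rewrite ler_norml cos_geN1 cos_le1. Qed.
Lemma sinN1 x : `|sin x| <= 1.
by rewrite ler_norml sin_geN1 sin_le1. Qed.
Lemma cos_lipschitz x y : `|cos x - cos y| <= `|x - y|.
apply: (@lipschitz_of_derive _ (fun x=> - sin x))=> z; rewrite normrN.
exact: sinN1.
Qed.
Lemma sin_lipschitz x y : `|sin x - sin y| <= `|x - y|.
by apply: (@lipschitz_of_derive _ cos)=> z; exact: cosN1. Qed.
Let sin_le x : 0 <= x -> sin x <= x.
move=> x0; rewrite -subr_ge0 addrC.
have:= @incr_of_derive (fun y=> - sin y + 1 * y ^+ 1) (fun y=> - cos y + 1 * (1%:R * y ^+ 0)).
rewrite sin0 expr1 mulr0 oppr0 addr0=> h; rewrite -[X in _ + X]mul1r -[X in 1 * X]expr1; apply: h=> //.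
- by move=> y; apply: derive_monomial; by [].
- by move=> y _; rewrite expr0 !mulr1 addrC subr_ge0 cos_le1.
Qed.
Let cos_ge x : 0 <= x -> 1 <= cos x + 2^-1 * x ^+ 2.
have:= @incr_of_derive (fun y=> cos y + 2^-1 * y ^+ 2) (fun y=> - sin y + 2^-1 * (2%:R * y ^+ 1)).
rewrite cos0 expr0n mulr0 addr0; apply.
- by move=> y; exact: derive_monomial.
- by move=> y /sin_le; rewrite expr1 mulKf// addrC subr_ge0.
Qed.
Let sin_ge x : 0 <= x -> x <= sin x + 6^-1 * x ^+ 3.
have:= @incr_of_derive (fun y=> sin y + (-1) * y ^+ 1 + 6^-1 * y ^+ 3)
(fun y=> cos y + (-1) * (1%:R * y ^+ 0) + 6^-1 * (3%:R * y ^+ 2)).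
rewrite sin0 expr1 expr0n !mulr0 !addr0=> h /h; rewrite expr1=> {}h.
rewrite -subr_ge0 (_ : _ - x = sin x + -1 * x + 6^-1 * x ^+ 3); last by ring.
apply: h.
- by move=> y; apply: derive_monomial; exact: derive_monomial.
- by move=> y /cos_ge; rewrite expr0 -subr_ge0; congr (_ <= _); field.
Qed.
Let cos_le x : 0 <= x -> cos x <= 1 - 2^-1 * x ^+ 2 + 24^-1 * x ^+ 4.
have:= @incr_of_derive (fun y=> - cos y + 2^-1 * y ^+ 2 + (- 24^-1) * y ^+ 4)
(fun y=> sin y + 2^-1 * (2%:R * y ^+ 1) + (- 24^-1) * (4%:R * y ^+ 3)).
Abort.
Let cos_le x : 0 <= x -> cos x <= 1 - 2^-1 * x ^+ 2 + 24^-1 * x ^+ 4.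
have:= @incr_of_derive (fun y=> - cos y + (- 2^-1) * y ^+ 2 + 24^-1 * y ^+ 4)
(fun y=> - - sin y + (- 2^-1) * (2%:R * y ^+ 1) + 24^-1 * (4%:R * y ^+ 3)).
rewrite cos0 !expr0n !mulr0 !addr0=> h /h {}h.
have : -1 <= - cos x + (- 2^-1) * x ^+ 2 + 24^-1 * x ^+ 4.
apply: h=> [y|y /sin_ge].
- by apply: derive_monomial; apply: derive_monomial; by [].
- lra.
by lra.
Qed.
Lemma sin_taylor1 x : `|sin x - x| <= `|x| ^+ 3.
wlog x0 : x / 0 <= x.
move=> H; have [/H//|/ltW]:= leP 0 x; rewrite -oppr_ge0=> /H.
by rewrite sinN -opprD !normrN.
rewrite (ger0N x0) distrC ger0N ?subr_ge0 ?sin_le//.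
have:= sin_ge x0; have : 0 <= x ^+ 3 by nn.
by lra.
Qed.
Lemma sin_taylor0 x : `|sin x - x| <= x ^+ 2.
wlog x0 : x / 0 <= x.
move=> H; have [/H//|/ltW]:= leP 0 x; rewrite -oppr_ge0=> /H.
by rewrite sinN -opprD normrN sqrrN.
have [x1|/ltW x1]:= leP x 1.
apply: le_trans (sin_taylor1 x) _; rewrite ger0N//.
by rewrite ler_wiXn2l.
rewrite distrC ger0N ?subr_ge0 ?sin_le//.
have:= sin_geN1 x; have:= cos_ge x0; have:= cos_le1 x.
have [x2|x2]:= leP 2 x; first by rewrite expr2; nra.
have:= sin_ge x0; rewrite !exprS expr0 mulr1; nra.
Qed.
Lemma cos_taylor2 x : `|cos x - (1 - x ^+ 2 / 2)| <= x ^+ 4.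
wlog x0 : x / 0 <= x.
move=> H; have [/H//|/ltW]:= leP 0 x; rewrite -oppr_ge0=> /H.
by rewrite cosN (_ : 4 = 2 * 2)%N// !exprM sqrrN.
have:= cos_ge x0; have:= cos_le x0.
have : 0 <= x ^+ 4 by nn.
by move=> *; rewrite ler_norml; lra.
Qed.
Lemma expRN_taylor1 x : 0 <= x -> `|expR (- x) - (1 - x)| <= x ^+ 2.
move=> x0.
have h : 0 <= expR (- x) - (1 - x) by rewrite subr_ge0; exact: expR_ge1Dx.
rewrite ger0N//.
have:= @incr_of_derive (fun y=> - expR (- y) + (-1) * y ^+ 1 + 1 * y ^+ 2)
(fun y=> - (expR (- y) * -1) + (-1) * (1%:R * y ^+ 0) + 1 * (2%:R * y ^+ 1)).
rewrite !expr0n !mulr0 !addr0 oppr0 expR0=> H.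
suff : -1 <= - expR (- x) + -1 * x ^+ 1 + 1 * x ^+ 2 by rewrite expr1; lra.
apply: H=> // [y|y y0].
- do 2 apply: derive_monomial; apply: is_deriveN.
- by have:= expR_ge1Dx (- y); rewrite expr1 expr0; lra.
Qed.
End taylor.

(** * A central limit theorem with a rate, for cosines *)

Section clt.
Context {R : realType} d (T : mType d) (P : prob T R).
Context dS (S : mType dS) (PS : prob S R) (n : nat) (Z : 'I_n -> S -> T).
Hypothesis iidZ : iid_sample P PS Z.
Variables (psi : T -> R) (M : R).
Hypotheses (mpsi : mT psi)
(psi4 : L1 P (fun w=> psi w ^+ 4))
(psi0 : Ex P psi = 0)
(psiM : Ex P (fun w=> psi w ^+ 4) <= M).
Let v:= Ex P (fun w=> psi w ^+ 2).
Let sqr_le_pow4 (x : R) : x ^+ 2 <= (1 + x ^+ 4) / 2.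
by have:= sqr_ge0 (x ^+ 2 - 1); rewrite sqrrB -exprM; lra. Qed.
Let psi2 : L1 P (fun w=> psi w ^+ 2).
apply: (L1le (fun w=> 2^-1 * (1 + psi w ^+ 4))).
- mf.
- by apply: L1Z; apply: L1D=> //; exact: L1_cst.
- by move=> w; rewrite ger0N ?sqr_ge0// mulrC; by [].
Qed.
Let abs_le (x : R) : `|x| <= 1 + x ^+ 2.
by rewrite -real_normK ?num_real//; have:= sqr_ge0 (`|x| - 1 / 2); rewrite !expr2; lra. Qed.
Let psi1 : L1 P psi.
by apply: (L1le (fun w=> 1 + psi w ^+ 2))=> //; apply: L1D=> //; exact: L1_cst. Qed.
Let v_ge0 : 0 <= v. by apply: Ex_ge0=> w; nn. Qed.
Let M_ge0 : 0 <= M.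
by apply: le_trans psiM; apply: Ex_ge0=> w; rewrite (_ : 4 = 2 * 2)%N// exprM sqr_ge0. Qed.
Let v_le : v <= (1 + M) / 2.
apply: (@le_trans _ _ (Ex P (fun w=> 2^-1 * (1 + psi w ^+ 4)))).
apply: Ex_le=> //; first by apply: L1Z; apply: L1D=> //; exact: L1_cst.
by move=> w; rewrite mulrC; by [].
by rewrite ExZ ?ExD ?Ex_cst; [rewrite mulrC ler_pM2r ?lerD2l| | |]; rewrite ?invr_gt0//;
try (apply: L1D=> //); exact: L1_cst.
Qed.
Let v2_le : v ^+ 2 <= M.
apply: le_trans psiM; rewrite -subr_ge0.
suff -> : Ex P (fun w=> psi w ^+ 4) - v ^+ 2 = Ex P (fun w=> (psi w ^+ 2 - v) ^+ 2).
by apply: Ex_ge0=> w; nn.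
rewrite (_ : (fun w=> (_ - v) ^+ 2) = fun w=> psi w ^+ 4 + (- (2 * v)) * psi w ^+ 2 + v ^+ 2).
rewrite ExD; [|by apply: L1D=> //; exact: L1Z|exact: L1_cst].
by rewrite ExD//; [rewrite ExZ// Ex_cst -/v; ring|exact: L1Z].
by apply/funext=> w; ring.
Qed.
(** Expansion of a single factor: the cosine agrees with the Gaussian factor up to order a^4 and,
    since the mean is 0, the sine is of order a^3. The constants depend on the fourth moment
    only. *)
Let trig_step (a : R) : 0 < a <= 1 ->
`|Ex P (fun w=> cos (a * psi w)) - expR (- (a ^+ 2 * v / 2))| <= a ^+ 4 * (2 * M) /\
`|Ex P (fun w=> sin (a * psi w))| <= a ^+ 3 * (1 + M) * 2.
move=> /andP[a0 a1].
have mc : mT (fun w=> cos (a * psi w)).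
apply: (mcompT (f:= cos)); last mf.
by apply: cont_meas; exact: continuous_cos.
have ms : mT (fun w=> sin (a * psi w)).
apply: (mcompT (f:= sin)); last mf.
by apply: cont_meas; exact: continuous_sin.
have Lc : L1 P (fun w=> cos (a * psi w)).
by apply: (L1by 1)=> // w; exact: cosN1.
have Ls : L1 P (fun w=> sin (a * psi w)).
by apply: (L1by 1)=> // w; exact: sinN1.
split.
- have e1 : `|Ex P (fun w=> cos (a * psi w)) - (1 - a ^+ 2 * v / 2)| <= a ^+ 4 * M.
 have L2 : L1 P (fun w=> (- (a ^+ 2 / 2)) * psi w ^+ 2) by exact: L1Z.
 have -> : 1 - a ^+ 2 * v / 2 = Ex P (fun w=> 1 + (- (a ^+ 2 / 2)) * psi w ^+ 2).
  by rewrite ExD ?ExZ ?Ex_cst -/v//; [ring|exact: L1_cst].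
 rewrite -ExB//; last by apply: L1D=> //; exact: L1_cst.
 apply: le_trans (Ex_norm _) _.
  by apply: L1B=> //; apply: L1D=> //; exact: L1_cst.
 apply: (@le_trans _ _ (Ex P (fun w=> a ^+ 4 * psi w ^+ 4))).
  apply: Ex_le; [|exact: L1Z|].
   by apply: L1_norm; apply: L1B=> //; apply: L1D=> //; exact: L1_cst.
  move=> w; rewrite -exprMn; apply: le_trans (cos_taylor2 _).
  by rewrite le_eqVlt; apply/orP; left; apply/eqP; congr (`|_|); rewrite exprMn; ring.
 by rewrite ExZ// lerM2l// exprn_ge0// ltW.
have e2 : `|expR (- (a ^+ 2 * v / 2)) - (1 - a ^+ 2 * v / 2)| <= a ^+ 4 * M.
 have z0 : 0 <= a ^+ 2 * v / 2 by nn.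
 apply: le_trans (expRN_taylor1 z0) _.
 rewrite (_ : (a ^+ 2 * v / 2) ^+ 2 = a ^+ 4 * (v ^+ 2 / 4)); last by field.
 apply: lerM2l; [nn|rewrite ler_pdivr//].
 by apply: le_trans v2_le _; have:= M_ge0; lra.
rewrite (_ : _ - _ = (Ex P (fun w=> cos (a * psi w)) - (1 - a ^+ 2 * v / 2)) -
 (expR (- (a ^+ 2 * v / 2)) - (1 - a ^+ 2 * v / 2))); last by ring.
by apply: le_trans (ler_normB _ _) _; lra.
- have La : L1 P (fun w=> a * psi w) by exact: L1Z.
have -> : Ex P (fun w=> sin (a * psi w)) = Ex P (fun w=> sin (a * psi w) - a * psi w).
 by rewrite ExB// ExZ// psi0 mulr0 subr0.
apply: le_trans (Ex_norm _) _; first exact: L1B.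
have L3 : L1 P (fun w=> a ^+ 3 * (1 + psi w ^+ 4 + psi w ^+ 2)).
 by apply: L1Z; apply: L1D=> //; apply: L1D=> //; exact: L1_cst.
apply: (@le_trans _ _ (Ex P (fun w=> a ^+ 3 * (1 + psi w ^+ 4 + psi w ^+ 2)))).
 apply: Ex_le=> //; first by apply: L1_norm; exact: L1B.
 move=> w; apply: le_trans (sin_taylor1 _) _.
 rewrite normrM (gtr0_norm a0) exprMn lerM2l ?exprn_ge0 ?ltW//.
 rewrite -(real_normK (num_real (psi w))) (_ : psi w ^+ 4 = `|psi w| ^+ 4); last first.
  by rewrite -[RHS]normrX ger0N// (_ : 4 = 2 * 2)%N// exprM sqr_ge0.
 move: `|psi w| (normr_ge0 (psi w))=> x x0.
 have:= sqr_ge0 (x ^+ 2 - x / 2); have:= sqr_ge0 x.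
 rewrite sqrrB -!exprM exprMn; rewrite (_ : x ^+ 2 * (x / 2) *+ 2 = x ^+ 3); last by field.
 by lra.
rewrite ExZ; last by apply: L1D=> //; apply: L1D=> //; exact: L1_cst.
rewrite ExD//; last by apply: L1D=> //; exact: L1_cst.
rewrite ExD ?Ex_cst -/v//; last exact: L1_cst.
rewrite -mulrA lerM2l ?exprn_ge0 ?ltW//; have:= v_le; have:= psiM; have:= M_ge0; lra.
Qed.
Let I0 : {set 'I_n}:= finset.set0.
Let SS (L : seq 'I_n) (s : S) : R:= \sum_(j <- L) psi (Z j s).
Let mSS L (I : {set 'I_n}) : (forall j, j \in L -> j \in I) ->
mT (SS L : sigmaT (obs_gen Z I) -> R).
move=> LI; pose Phi (p : sigmaT (obs_gen Z I0) * T):= psi p.2.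
apply: (@meas_ssum _ _ _ _ _ _ _ _ Phi _ L I)=> //.
mf.
by move=> j; rewrite inE.
Qed.
(** The free phase b lets cosines do the work of complex exponentials. Terms are replaced one by one
    by Gaussian factors, at a cost of order a^3 each with a = (size L)^(-1/2), whence the rate. *)
Lemma clt_cos (L : seq 'I_n) (b : R) : uniq L -> (0 < size L)%N ->
`|Ex PS (fun s=> cos (b + (Num.sqrt (size L)%:R)^-1 * \sum_(j <- L) psi (Z j s))) -
 expR (- (v / 2)) * cos b| <= (2 + 4 * M) / Num.sqrt (size L)%:R.
move=> uL L0; set r : R:= (size L)%:R; set a:= (Num.sqrt r)^-1.
have r1 : 1 <= r by rewrite ler1n.
have sr1 : 1 <= Num.sqrt r by rewrite -sqrtr1 ler_sqrt.
have a0 : 0 < a by rewrite invr_gt0 (lt_le_trans ltr01).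
have a1 : a <= 1 by rewrite invf_le1// (lt_le_trans ltr01).
have a2 : a ^+ 2 * r = 1.
by rewrite exprVn sqr_sqrtr ?mulVf// ?gt_eqF// (lt_le_trans _ r1)// (le_trans _ r1).
have [/[dup]t1 t2 t3]:= trig_step (a:= a) ltac:(by rewrite a0 a1).
set q:= expR (- (a ^+ 2 * v / 2)) in t1 t2.
have q01 : 0 <= q <= 1.
by rewrite expR_ge0 /= -expR0 ler_expR oppr_le0 divr_ge0// mulr_ge0// sqr_ge0.
(* Adding an observation turns the cosine into a combination of a cosine, treated by induction, and
   a sine whose coefficient is small. *)
suff main : forall K b, uniq K -> `|Ex PS (fun s=> cos (b + a * SS K s)) - q ^+ size K * cos b| <=
 (size K)%:R * (a ^+ 4 * (2 * M) + a ^+ 3 * (1 + M) * 2).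
have -> : expR (- (v / 2)) = q ^+ size L.
 rewrite /q -expRM_natr; congr expR; rewrite -/r mulNr; congr (- _).
 by rewrite mulrAC -[LHS]mul1r -a2; ring.
apply: le_trans (main L b uL) _; rewrite -/r -/a.
have -> : r * (a ^+ 4 * (2 * M) + a ^+ 3 * (1 + M) * 2) = (a ^+ 2 * r) * (a ^+ 2 * (2 * M) + a * (1 + M) * 2).
 by ring.
rewrite a2 mul1r [leRHS]mulrC expr2.
have : 0 <= a * (1 - a) by apply: mulr_ge0; [nn|rewrite subr_ge0].
by have:= M_ge0; nra.
elim=> [b' _|j K IH b' /= /andP[jK uK]].
rewrite expr0 !mul1r mul0r /SS; under eq_fun do rewrite big_nil mulr0 addr0.
by rewrite Ex_cst subrr normr0.
pose I : {set 'I_n}:= [set i in K].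
have jI : j \notin I by rewrite inE.
have mK : mT (SS K : sigmaT (obs_gen Z I) -> R).
by apply: mSS=> i; rewrite inE.
pose f (p : sigmaT (obs_gen Z I) * T) : R:= cos (b' + a * (SS K p.1 + psi p.2)).
have mcos : mT (@cos R).
by apply: cont_meas; exact: continuous_cos.
have msin : mT (@sin R).
by apply: cont_meas; exact: continuous_sin.
have mf : mT f.
apply: (mcompT mcos); apply: mfunD=> //; apply: mfunM=> //.
apply: mfunD.
 mf.
mf.
have f1 p : `|f p| <= 1 by exact: cosN1.
have fL1 : L1 (obsP iidZ I \x P)%E f by exact: (L1_bd _ mf f1).
have [h1 h2]:= obs_transfer jI fL1.
have -> : (fun s=> cos (b' + a * SS (j :: K) s)) = fun s=> f (s, Z j s).
by apply/funext=> s; rewrite /SS big_cons /f /= addrC [psi _ + _]addrC addrC.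
rewrite h2 (Ex_pair_bd _ _ mf f1).
have mBc : mT ((fun s=> cos (b' + a * SS K s)) : sigmaT (obs_gen Z I) -> R).
mf.
have mBs : mT ((fun s=> sin (b' + a * SS K s)) : sigmaT (obs_gen Z I) -> R).
mf.
have LBc : L1 (obsP iidZ I) (fun s=> cos (b' + a * SS K s)).
by apply: (L1_bd _ mBc)=> s; exact: cosN1.
have LBs : L1 (obsP iidZ I) (fun s=> sin (b' + a * SS K s)).
by apply: (L1_bd _ mBs)=> s; exact: sinN1.
have mpa : mT (fun w=> a * psi w) by mf.
have Lc : L1 P (fun w=> cos (a * psi w)).
by apply: (L1_bd _ (mcompT mcos mpa))=> w; exact: cosN1.
have Ls : L1 P (fun w=> sin (a * psi w)).
by apply: (L1_bd _ (mcompT msin mpa))=> w; exact: sinN1.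
set ec:= Ex P (fun w=> cos (a * psi w)) in t1 t2.
set es:= Ex P (fun w=> sin (a * psi w)) in t3.
have -> : (fun s=> Ex P (fun w=> f (s, w))) =
 fun s=> ec * cos (b' + a * SS K s) - es * sin (b' + a * SS K s).
apply/funext=> s; rewrite /f /=.
under eq_fun do rewrite mulrDr addrA cosD.
rewrite ExB; [|exact: L1Z|exact: L1Z].
by rewrite !ExZ// -/ec -/es mulrC [X in _ - X]mulrC.
rewrite ExB; [|exact: L1Z|exact: L1Z].
rewrite !ExZ// !Ex_obsP//.
have IHb:= IH b' uK.
set A:= Ex PS (fun s=> cos _) in IHb *; set B:= Ex PS _.
have A1 : `|A| <= 1 by apply: Ex_bd=> [|s]; [exact: (obs_idM iidZ mBc)|exact: cosN1].
have B1 : `|B| <= 1 by apply: Ex_bd=> [|s]; [exact: (obs_idM iidZ mBs)|exact: sinN1].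
rewrite exprS (_ : _ - _ = (ec - q) * A + q * (A - q ^+ size K * cos b') - es * B); last by ring.
set e:= a ^+ 4 * (2 * M) + a ^+ 3 * (1 + M) * 2.
rewrite [leRHS](_ : _ = (size K)%:R * e + e); last by rewrite -natr1 mulrDl mul1r.
have /andP[q0 q1]:= q01.
apply: le_trans (ler_normB _ _) _; apply: le_trans (lerD (ler_normD _ _) (lexx _)) _.
rewrite !normrM (ger0N q0).
have h3 : `|ec - q| * `|A| <= a ^+ 4 * (2 * M) by apply: le_trans t2; rewrite ler_piMr.
have h4 : `|es| * `|B| <= a ^+ 3 * (1 + M) * 2 by apply: le_trans t3; rewrite ler_piMr.
have h5 : q * `|A - q ^+ size K * cos b'| <= (size K)%:R * (a ^+ 4 * (2 * M) + a ^+ 3 * (1 + M) * 2).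
by apply: le_trans IHb; rewrite ler_piMl.
rewrite -/e in h5; apply: (le_trans (lerD (lerD h3 h5) h4)); rewrite /e; lra.
Qed.
End clt.

(** * Trigonometric polynomials *)

Section trigp.
Context {R : realType} (I : finType).
Implicit Types (A K b c : R) (a v : I -> R) (f g : (I -> R) -> R).
(* [trigp K A f]: f is a trigonometric polynomial whose frequencies are bounded
by A and whose coefficients have absolute sum at most K. *)
Inductive trigp : R -> R -> ((I -> R) -> R) -> Prop :=
| trigp_cos A b a : bdd a A -> trigp 1 A (fun v=> cos (b + \sum_i a i * v i))
| trigp_lin K K' A c c' f g : trigp K A f -> trigp K' A g ->
 trigp (`|c| * K + `|c'| * K') A (fun v=> c * f v + c' * g v)
| trigp_weak K K' A A' f : K <= K' -> A <= A' -> trigp K A f -> trigp K' A' f.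
Lemma trigp_ge0 K A f : trigp K A f -> 0 <= K.
elim=> [//|K1 K2 A' c c' f' g _ K10 _ K20|K1 K2 A1 A2 f' K12 _ _ K10].
nn.
lra.
Qed.
Let dot a v:= \sum_i a i * v i.
Let trigp_cosM A A' b b' a a' : bdd a A -> bdd a' A' ->
trigp 1 (A + A') (fun v=> cos (b + dot a v) * cos (b' + dot a' v)).
move=> aA aA'.
have -> : (fun v=> cos (b + dot a v) * cos (b' + dot a' v)) =
 fun v=> 2^-1 * cos ((b + b') + dot (fun i=> a i + a' i) v) +
     2^-1 * cos ((b - b') + dot (fun i=> a i - a' i) v).
apply/funext=> v.
have -> : (b + b') + dot (fun i=> a i + a' i) v = (b + dot a v) + (b' + dot a' v).
 rewrite /dot; under eq_bigr do rewrite mulrDl.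
 by rewrite big_split /=; ring.
have -> : (b - b') + dot (fun i=> a i - a' i) v = (b + dot a v) - (b' + dot a' v).
 rewrite /dot; under eq_bigr do rewrite mulrBl.
 by rewrite sumrB; ring.
by move: (b + dot a v) (b' + dot a' v)=> x y; rewrite cosD cosB; field.
have h : trigp (`|2^-1| * 1 + `|2^-1| * 1) (A + A')
 (fun v=> 2^-1 * cos ((b + b') + dot (fun i=> a i + a' i) v) +
     2^-1 * cos ((b - b') + dot (fun i=> a i - a' i) v)).
apply: trigp_lin; apply: trigp_cos=> i.
 by apply: le_trans (ler_normD _ _) _; exact: lerD.
by apply: le_trans (ler_normB _ _) _; exact: lerD.
apply: trigp_weak h=> //; rewrite ger0N//; lra.
Qed.
(** Product-to-sum formula: frequency bounds add, coefficient bounds multiply. *)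
Lemma trigpM K K' A A' f g : trigp K A f -> trigp K' A' g -> trigp (K * K') (A + A') (fun v=> f v * g v).
move=> fT; elim: fT K' A' g=> {K A f}.
- move=> A b a aA K' A' g; elim=> {K' A' g}.
+ by move=> A' b' a' aA'; rewrite mul1r; exact: trigp_cosM.
+ move=> K1 K2 A' c c' f g _ IH1 _ IH2; rewrite !mul1r in IH1 IH2 *.
 rewrite (_ : (fun v=> _) = fun v=> c * (cos (b + dot a v) * f v) + c' * (cos (b + dot a v) * g v)).
  exact: trigp_lin.
 by apply/funext=> v; rewrite /dot; ring.
+ move=> K1 K2 A1 A2 f K12 A12 _ IH; apply: trigp_weak IH; first by rewrite !mul1r.
 by rewrite lerD2l.
- move=> K1 K2 A c c' f1 f2 _ IH1 _ IH2 K' A' g gT.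
rewrite (_ : (fun v=> _) = fun v=> c * (f1 v * g v) + c' * (f2 v * g v)).
 rewrite mulrDl -!mulrA; apply: trigp_lin; [exact: IH1|exact: IH2].
by apply/funext=> v; ring.
- move=> K1 K2 A1 A2 f K12 A12 _ IH K' A' g gT.
apply: trigp_weak (IH _ _ _ gT); last by rewrite lerD2r.
by rewrite ler_wpM2r// (trigp_ge0 gT).
Qed.
Lemma trigp_cst c A : 0 <= A -> trigp `|c| A (fun=> c).
move=> A0; have h : trigp (`|c| * 1 + `|0 : R| * 1) A
 (fun v=> c * cos (0 + dot (fun=> 0) v) + 0 * cos (0 + dot (fun=> 0) v)).
by apply: trigp_lin; apply: trigp_cos=> i; rewrite normr0.
rewrite normr0 mul0r addr0 mulr1 in h; move: h; congr trigp; apply/funext=> v.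
by rewrite /dot; under eq_bigr do rewrite mul0r; rewrite big1// addr0 cos0; ring.
Qed.
(** These are the probabilities p and 1 - p that enter [bern]; the sine is a cosine of phase - pi /
    2. *)
Lemma trigp_sin c i : 0 <= c ->
trigp 1 c (fun v=> (1 + sin (c * v i)) / 2) /\ trigp 1 c (fun v=> 1 - (1 + sin (c * v i)) / 2).
move=> c0.
have h x : x = 2^-1 \/ x = - 2^-1 -> trigp 1 c (fun v=> 2^-1 * 1 + x * sin (c * v i)).
move=> xE; have:= @trigp_lin _ _ c 2^-1 x _ _ (trigp_cst 1 c0)
 (@trigp_cos c (- (pi / 2)) (fun j=> if j == i then c else 0) _).
rewrite normr1 !mulr1 (_ : `|x| = 2^-1); last first.
 by case: xE=> ->; rewrite ?normrN ger0N.
rewrite (_ : `|2^-1| = 2^-1 :> R) ?ger0N// (_ : 2^-1 + 2^-1 = 1); last by field.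
move=> H; rewrite (_ : (fun v=> _) = fun v=> 2^-1 * 1 + x * cos (- (pi / 2) +
  \sum_j (if j == i then c else 0) * v j)).
 by rewrite mulr1; apply: H=> j; case: ifP; rewrite ?ger0N// normr0.
apply/funext=> v; rewrite mulr1; suff -> : \sum_j (if j == i then c else 0) * v j = c * v i.
 by rewrite [- _ + _]addrC cosBpihalf.
by rewrite (bigD1 i)//= eqxx big1 ?addr0// => j /negbTE ->; rewrite mul0r.
split.
- by move: (h _ (or_introl erefl)); congr trigp; apply/funext=> v; field.
- by move: (h _ (or_intror erefl)); congr trigp; apply/funext=> v; field.
Qed.
End trigp.

(** * Bernstein approximation by trigonometric polynomials *)

Section bernstein.
Context {R : realType}.
Implicit Types (p x : R) (phi psi : nat -> R).
(* [bern D phi p] is the mean of [phi] under the binomial law (D, p). *)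
Fixpoint bern (D : nat) (phi : nat -> R) p : R :=
if D is D'.+1 then p * bern D' (fun k=> phi k.+1) p + (1 - p) * bern D' phi p else phi 0%N.
Lemma bern_lin D phi psi c c' p :
bern D (fun k=> c * phi k + c' * psi k) p = c * bern D phi p + c' * bern D psi p.
by elim: D phi psi=> //= D IH phi psi; rewrite !IH; ring. Qed.
Lemma bern_cst D x p : bern D (fun=> x) p = x.
by elim: D=> //= D IH; rewrite IH; ring. Qed.
(** The binomial variance around a free centre x: the induction on D shifts the centre by 1. *)
Lemma bern_sqr D x p : bern D (fun k=> (k%:R - x) ^+ 2) p = (D%:R * p - x) ^+ 2 + D%:R * p * (1 - p).
elim: D x=> [|D IH] x /=; first by ring.
rewrite IH (_ : (fun k=> _) = fun k=> (k%:R - (x - 1)) ^+ 2); last first.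
by apply/funext=> k; rewrite -natr1; congr (_ ^+ 2); ring.
by rewrite IH -[D.+1%:R]natr1; ring.
Qed.
Lemma bern_le D phi psi p : 0 <= p <= 1 -> (forall k, phi k <= psi k) -> bern D phi p <= bern D psi p.
move=> /andP[p0 p1]; elim: D phi psi=> //= D IH phi psi h.
by apply: lerD; apply: lerM2l; rewrite ?subr_ge0//; apply: IH.
Qed.
Lemma bern_norm D phi p : 0 <= p <= 1 -> `|bern D phi p| <= bern D (fun k=> `|phi k|) p.
move=> /andP[p0 p1]; elim: D phi=> //= D IH phi.
have q0 : 0 <= 1 - p by rewrite subr_ge0.
apply: le_trans (ler_normD _ _) _; rewrite !normrM (ger0N p0) (ger0N q0).
by apply: lerD; apply: lerM2l; rewrite ?subr_ge0//; apply: IH.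
Qed.
Variables (c : R) (D : nat).
Hypotheses (c0 : 0 < c) (D0 : (0 < D)%N).
(** For small c the sine is nearly linear, so x is close to (2 p - 1) / c with p = sinp x, and
    [bnode] evaluates this at a frequency k / D. Bernstein polynomials in p are thus trigonometric
    in x, and approximate Lipschitz functions on the whole line. *)
Definition sinp x : R:= (1 + sin (c * x)) / 2.
Definition bnode (k : nat) : R:= (2 * (k%:R / D%:R) - 1) / c.
Lemma sinp01 x : 0 <= sinp x <= 1.
rewrite /sinp; have:= sin_geN1 (c * x); have:= sin_le1 (c * x); lra. Qed.
(** c x^2 is the linearization error of the sine; the other two terms bound the binomial deviation,
    of variance at most 1 / (c^2 D), by Young's inequality. *)
Lemma bnode_err x eps : 0 < eps ->
bern D (fun k=> `|bnode k - x|) (sinp x) <= c * x ^+ 2 + eps + (eps * c ^+ 2 * D%:R)^-1.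
move=> e0; set p:= sinp x.
have DR : (0 : R) < D%:R by rewrite ltr0n.
apply: (@le_trans _ _ (bern D (fun k=> 1 * (c * x ^+ 2 + eps) +
 (4 / (eps * c ^+ 2 * D%:R ^+ 2)) * (k%:R - D%:R * p) ^+ 2) p)).
apply: bern_le=> [|k]; first exact: sinp01.
have -> : bnode k - x = 2 * (k%:R - D%:R * p) / (c * D%:R) + (sin (c * x) - c * x) / c.
 rewrite /bnode /p /sinp; field.
 by rewrite !gt_eqF.
apply: le_trans (ler_normD _ _) _; rewrite addrC mul1r -addrA lerD//.
 rewrite normrM normfV (gtr0_norm c0) ler_pdivr//.
 by apply: le_trans (sin_taylor0 _) _; rewrite le_eqVlt; apply/orP; left; apply/eqP; ring.
set y:= k%:R - _; rewrite (_ : _ / _ * _ = (2 * y / (c * D%:R)) ^+ 2 / eps); last first.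
 lra.
set z:= 2 * y / _; rewrite -(real_normK (num_real z)).
rewrite -(ler_pM2r e0) mulrDl divfK ?gt_eqF//.
by have:= sqr_ge0 (`|z| - eps / 2); have:= sqr_ge0 eps; rewrite !expr2; lra.
rewrite bern_lin bern_cst bern_sqr subrr expr0n add0r mul1r lerD2l.
have /andP[p0 p1]:= sinp01 x; rewrite -/p in p0 p1.
rewrite (_ : _ * _ = (4 * p * (1 - p)) * (eps * c ^+ 2 * D%:R)^-1); last first.
by field; rewrite !gt_eqF.
rewrite ler_piMl//; last by have:= sqr_ge0 (2 * p - 1); rewrite sqrrB; lra.
nn.
Qed.
Section multi.
Variable I : finType.
Fixpoint mbern (s : seq I) (F : seq R -> R) (v : I -> R) : R :=
if s is i :: s' then bern D (fun k=> mbern s' (fun u=> F (bnode k :: u)) v) (sinp (v i))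
else F [::].
Definition l1_lipschitz (F : seq R -> R):= forall u u' : seq R, size u = size u' ->
`|F u - F u'| <= \sum_(p <- zip u u') `|p.1 - p.2|.
(** Coordinates are replaced one at a time. The bound grows with v but holds everywhere, so second
    moments are enough to integrate it. *)
Lemma mbern_err s F v eps : 0 < eps -> l1_lipschitz F ->
`|mbern s F v - F (map v s)| <=
\sum_(i <- s) (c * v i ^+ 2 + eps + (eps * c ^+ 2 * D%:R)^-1).
move=> e0; elim: s F=> [|i s IH] F FL /=; first by rewrite subrr normr0 big_nil.
rewrite big_cons; set X:= \sum_(_ <- s) _ in IH *.
have -> : F (v i :: map v s) = bern D (fun=> F (v i :: map v s)) (sinp (v i)) by rewrite bern_cst.
rewrite -[X in `|X - _|]mul1r -mulN1r -bern_lin.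
apply: le_trans (bern_norm _ _ (sinp01 _)) _.
apply: (@le_trans _ _ (bern D (fun k=> 1 * X + 1 * `|bnode k - v i|) (sinp (v i)))).
apply: bern_le=> [|k]; first exact: sinp01.
rewrite mul1r mulN1r (_ : _ - _ = (mbern s (fun u=> F (bnode k :: u)) v - F (bnode k :: map v s)) +
 (F (bnode k :: map v s) - F (v i :: map v s))); last by ring.
apply: le_trans (ler_normD _ _) _; rewrite !mul1r lerD//.
 apply: IH=> u u' uu'; apply: le_trans (FL _ _ _) _; first by rewrite /= uu'.
 by rewrite /= big_cons /= subrr normr0 add0r.
apply: le_trans (FL _ _ _) _=> //=; rewrite big_cons /= -[leRHS]addr0 lerD2l.
by rewrite le_eqVlt; apply/orP; left; apply/eqP; elim: (map v s)=> [|y t]; rewrite /= ?big_nil// big_cons subrr normr0 add0r.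
rewrite bern_lin bern_cst !mul1r addrC lerD2r; exact: bnode_err.
Qed.
Lemma trigp_bern n (phi : nat -> (I -> R) -> R) K A i : (forall k, trigp K A (phi k)) ->
trigp (2 ^+ n * K) (n%:R * c + A) (fun v=> bern n (phi ^~ v) (sinp (v i))).
move=> h; elim: n phi h=> [|n IH] phi h /=; first by rewrite mul1r mul0r add0r; exact: h.
have [s1 s2]:= trigp_sin i (ltW c0).
have h1:= trigpM s1 (IH (fun k=> phi k.+1) (fun k=> h k.+1)).
have h2:= trigpM s2 (IH phi h).
have:= trigp_lin 1 1 h1 h2; rewrite normr1 !mul1r=> H.
rewrite (_ : (fun v=> _) = fun v=>
1 * ((1 + sin (c * v i)) / 2 * bern n (fun k=> phi k.+1 v) (sinp (v i))) +
1 * ((1 - (1 + sin (c * v i)) / 2) * bern n (phi ^~ v) (sinp (v i)))); last first.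
by apply/funext=> v; rewrite !mul1r.
apply: trigp_weak H; first by rewrite exprS mulr2n; lra.
lra.
Qed.
(** Both bounds depend only on c, D and the number of coordinates, hence not on the law of the
    data. *)
Lemma trigp_mbern s F : bdd F 1 ->
trigp (2 ^+ (D * size s)) ((size s)%:R * D%:R * c) (mbern s F).
elim: s F=> [|i s IH] F F1 /=.
by rewrite muln0 expr0 !mul0r; apply: trigp_weak (trigp_cst I (F [::]) (lexx 0)).
have:= trigp_bern D i (fun k=> IH (fun u=> F (bnode k :: u)) (fun u=> F1 _)).
apply: trigp_weak; first by rewrite mulnS exprD.
by rewrite -natr1; lra.
Qed.
End multi.
End bernstein.
Section trigp_Ex.
Context {R : realType} (I : finType).
Lemma meas_lincomb d (T : mType d) (Y : I -> T -> R) (a : I -> R) :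
(forall i, mT (Y i)) -> mT (fun w=> \sum_i a i * Y i w).
by move=> mY; apply: msum=> i; mf. Qed.
Lemma trigp_bd K A (phi : (I -> R) -> R) v : trigp K A phi -> `|phi v| <= K.
elim=> {K A phi} [A b a _|K1 K2 A c c' f g _ h1 _ h2|K1 K2 A1 A2 f K12 _ _ h].
- exact: cosN1.
- by apply: le_trans (ler_normD _ _) _; rewrite !normrM lerD// lerM2l.
- exact: le_trans h K12.
Qed.
Lemma meas_trigp K A (phi : (I -> R) -> R) d (T : mType d) (Y : I -> T -> R) :
(forall i, mT (Y i)) -> trigp K A phi ->
mT (fun w=> phi (fun i=> Y i w)).
move=> mY; elim=> {K A phi} [A b a _|K1 K2 A c c' f g _ h1 _ h2|K1 K2 A1 A2 f _ _ _ h] //.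
- apply: (mcompT meas_cos_R); apply: mfunD=> //.
mf.
- mf.
Qed.
(** Reduces the comparison of two laws to single cosines, at the price of the coefficient sum K. *)
Lemma trigp_compare K A (phi : (I -> R) -> R) delta
 d1 (T1 : mType d1) (P1 : prob T1 R) (Y1 : I -> T1 -> R)
 d2 (T2 : mType d2) (P2 : prob T2 R) (Y2 : I -> T2 -> R) :
(forall i, mT (Y1 i)) -> (forall i, mT (Y2 i)) ->
0 <= delta ->
(forall a b, bdd a A ->
 `|Ex P1 (fun w=> cos (b + \sum_i a i * Y1 i w)) -
  Ex P2 (fun w=> cos (b + \sum_i a i * Y2 i w))| <= delta) ->
trigp K A phi ->
`|Ex P1 (fun w=> phi (fun i=> Y1 i w)) - Ex P2 (fun w=> phi (fun i=> Y2 i w))| <= K * delta.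
move=> mY1 mY2 d0 + phiT; elim: phiT=> {K A phi}.
- by move=> A b a aA h; rewrite mul1r; exact: h.
- move=> K1 K2 A c c' f g fT h1 gT h2 h.
have L1f d' (T' : mType d') (P' : prob T' R) (Y : I -> T' -> R) K phi :
  (forall i, mT (Y i)) -> trigp K A phi -> L1 P' (fun w=> phi (fun i=> Y i w)).
 by move=> mY pT; apply: (L1_bd _ (meas_trigp mY pT))=> w; exact: trigp_bd pT.
have Lf1:= L1f _ _ P1 _ _ _ mY1 fT; have Lg1:= L1f _ _ P1 _ _ _ mY1 gT.
have Lf2:= L1f _ _ P2 _ _ _ mY2 fT; have Lg2:= L1f _ _ P2 _ _ _ mY2 gT.
rewrite !ExD ?ExZ//; do ?exact: L1Z.
set a1:= Ex _ _; set a2:= Ex _ _; set b1:= Ex _ _; set b2:= Ex _ _.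
rewrite (_ : _ - _ = c * (a1 - b1) + c' * (a2 - b2)); last by ring.
apply: le_trans (ler_normD _ _) _; rewrite !normrM mulrDl -!mulrA lerD//.
 by rewrite lerM2l//; exact: h1.
by rewrite lerM2l//; exact: h2.
- move=> K1 K2 A1 A2 f K12 A12 fT IH h.
apply: (@le_trans _ _ (K1 * delta)); last by rewrite ler_wpM2r.
by apply: IH=> a b aA; apply: h=> i; exact: le_trans A12.
Qed.
End trigp_Ex.

(** * Cosine transform of the normal law *)

Section normal_cos.
Context {R : realType} (s : R).
Hypothesis s0 : 0 < s.
Local Notation mu:= (@lebesgue_measure R).
Let p : R -> R:= normal_pdf 0 s.
Let c : R:= (s ^+ 2 *+ 2)^-1.
Let pE x : p x = normal_peak s * expR (- (c * x ^+ 2)).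
rewrite /p normal_pdfE ?gt_eqF// /normal_fun /c subr0; congr (_ * expR _).
by rewrite mulrC mulrN.
Qed.
Let p_ge0 x : 0 <= p x. exact: normal_pdf_ge0. Qed.
Let cE : c = (s ^+ 2 * 2)^-1. by rewrite mulr_natr. Qed.
Let c0 : 0 < c. by rewrite invr_gt0 mulrn_wgt0// exprn_gt0. Qed.
Let c2 : c * 2 = (s ^+ 2)^-1.
by rewrite cE; field; rewrite gt_eqF. Qed.
Let p_derive (x : R) : is_derive x (1 : R) p (- (x / s ^+ 2) * p x).
have h1 : is_derive x 1 (fun y=> - (c * y ^+ 2)) (- (c * 2 * x)).
have:= @derive_monomial R (fun=> 0) 0 (- c) 1 x _.
rewrite (_ : (fun y=> 0 + - c * y ^+ 2) = fun y=> - (c * y ^+ 2)); last first.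
 by apply/funext=> y; rewrite add0r mulNr.
move=> h; apply: (is_derive_eq (h (is_derive_cst 0 x 1))).
by rewrite expr1; ring.
have h2 : is_derive (- (c * x ^+ 2)) 1 (expR : R -> R) (expR (- (c * x ^+ 2))).
exact: is_derive_expR.
have h3:= is_deriveZ (normal_peak s) (is_derive1_comp (f:= expR) (g:= fun y=> - (c * y ^+ 2)) h2 h1).
rewrite (_ : p = normal_peak s \*: (expR \o (fun y=> - (c * y ^+ 2)))); last first.
by apply/funext=> y; rewrite pE.
apply: (is_derive_eq h3); rewrite (_ : x / s ^+ 2 = c * 2 * x); last by rewrite c2 mulrC.
transitivity (- (c * 2 * x) * (normal_peak s * expR (- (c * x ^+ 2))))=> //.
by rewrite /GRing.scale /=; ring.
Qed.
(** A multiple of the normal density of variance 2 s^2: one half of the exponent of p is enough to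
    absorb the factor 1 + |x|. *)
Let q x : R:= normal_peak s * (1 + (2 * s) ^+ 2) / normal_peak (Num.sqrt 2 * s) *
normal_pdf 0 (Num.sqrt 2 * s) x.
Let int_q : mu.-integrable setT (EFin \o q).
rewrite /q (_ : EFin \o _ = fun x=> (normal_peak s * (1 + (2 * s) ^+ 2) / normal_peak (Num.sqrt 2 * s))%:E *
(normal_pdf 0 (Num.sqrt 2 * s) x)%:E)%E; last by []; rewrite /= EFinM.
by apply: integrableZl=> //; exact: integrable_normal_pdf.
Qed.
Let p_le x : (1 + `|x|) * p x <= 2 * q x.
have r0 : 0 < Num.sqrt 2 * s by nn.
rewrite /q pE normal_pdfE ?gt_eqF// /normal_fun subr0.
set P:= normal_peak (Num.sqrt 2 * s); have P0 : P != 0 by rewrite gt_eqF// normal_peak_gt0// gt_eqF.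
rewrite [(Num.sqrt 2 * s) ^+ 2]exprMn sqr_sqrtr//.
have -> : - x ^+ 2 / (2 * s ^+ 2 *+ 2) = - (c / 2 * x ^+ 2).
by rewrite -[_ *+ 2]mulr_natr cE; field; rewrite gt_eqF.
set y:= c / 2 * x ^+ 2.
have -> : c * x ^+ 2 = y + y by rewrite /y; field.
rewrite opprD expRD.
rewrite (_ : _ * (1 + _) / P * _ = normal_peak s * (1 + (2 * s) ^+ 2) * expR (- y)); last by field.
have -> : (1 + `|x|) * (normal_peak s * (expR (- y) * expR (- y))) =
normal_peak s * expR (- y) * ((1 + `|x|) * expR (- y)) by ring.
have -> : 2 * (normal_peak s * (1 + (2 * s) ^+ 2) * expR (- y)) =
normal_peak s * expR (- y) * (2 * (1 + (2 * s) ^+ 2)) by ring.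
apply: lerM2l; first by rewrite mulr_ge0 ?expR_ge0 ?normal_peak_ge0.
have y0 : 0 <= y by rewrite mulr_ge0 ?sqr_ge0// divr_ge0 ?ltW.
have ey : expR (- y) <= (1 + y)^-1.
rewrite expRN lef_pV2 ?posrE ?expR_gt0 ?expR_ge1Dx//.
by rewrite ltr_wpDr.
apply: le_trans (lerM2l _ ey) _; first nn.
rewrite ler_pdivr ?ltr_wpDr//.
have xE : x ^+ 2 = (2 * s) ^+ 2 * y.
by rewrite /y cE; field; rewrite gt_eqF.
have : `|x| <= 1 + x ^+ 2.
by rewrite -real_normK ?num_real//; have:= sqr_ge0 (`|x| - 1 / 2); rewrite !expr2; lra.
rewrite xE; have : 0 <= (2 * s) ^+ 2 by exact: sqr_ge0.
nra.
Qed.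
Let mp : mT p. exact: measurable_normal_pdf. Qed.
Let int_le (f : R -> R) K : mT f -> 0 <= K ->
(forall x, `|f x| <= K * ((1 + `|x|) * p x)) -> mu.-integrable setT (EFin \o f).
move=> mf K0 h.
apply: (@le_integrable _ _ _ mu setT measurableT (EFin \o f) (fun x=> (K * 2)%:E * (q x)%:E)%E).
- exact/mEFinP.
- move=> x _; rewrite /= lee_fin.
apply: (@le_trans _ _ (K * (2 * q x))); last by rewrite mulrA ler_norm.
by apply: le_trans (h x) _; apply: lerM2l=> //; exact: p_le.
- exact: integrableZl.
Qed.
Let ms : mT (@sin R).
by apply: cont_meas; exact: continuous_sin. Qed.
Let maff b a : mT (fun x : R=> b + a * x).
mf. Qed.
Let C b a x:= cos (b + a * x) * p x.
Let Sn b a x:= x * (sin (b + a * x) * p x).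
Let mC b a : mT (C b a).
by apply: mfunM=> //; mf. Qed.
Let mSn b a : mT (Sn b a).
by do 2 apply: mfunM=> //; mf. Qed.
Let C_le b a x : `|C b a x| <= 1 * ((1 + `|x|) * p x).
rewrite mul1r normrM (ger0N (p_ge0 x)) ler_wpM2r//.
by apply: le_trans (cosN1 _) _; rewrite lerDl.
Qed.
Let Sn_le b a x : `|Sn b a x| <= 1 * ((1 + `|x|) * p x).
rewrite mul1r !normrM (ger0N (p_ge0 x)) mulrA ler_wpM2r//.
by apply: (@le_trans _ _ `|x|); rewrite ?ler_piMr ?sinN1// lerDr.
Qed.
Let intC b a : mu.-integrable setT (EFin \o C b a).
exact: (int_le (mC b a) ler01 (C_le b a)). Qed.
Let intSn b a : mu.-integrable setT (EFin \o Sn b a).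
exact: (int_le (mSn b a) ler01 (Sn_le b a)). Qed.
Let I (f : R -> R):= Rintegral mu setT f.
Let aff_derive b a (x : R) : is_derive x (1 : R) (fun x=> b + a * x) a.
have:= @derive_monomial R (fun=> b) 0 a 0 x (is_derive_cst b x 1).
by rewrite expr0 add0r !mulr1; congr is_derive.
Qed.
Let H b a x:= sin (b + a * x) * p x.
Let H_derive b a (x : R) : is_derive x (1 : R) (H b a) (a * C b a x - (s ^+ 2)^-1 * Sn b a x).
have hs : is_derive (b + a * x) 1 (sin : R -> R) (cos (b + a * x)) by exact: is_derive_sin.
have h1:= is_derive1_comp (f:= sin) (g:= fun x=> b + a * x) hs (aff_derive b a x).
have h2:= is_deriveM h1 (p_derive x).
apply: (is_derive_eq h2); rewrite /GRing.scale /= /C /Sn.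
by ring.
Qed.
Let H_bd b a x : `|H b a x| <= p x.
by rewrite normrM (ger0N (p_ge0 x)) ler_piMl// sinN1. Qed.
Let p_cvg (e : R) : `|e| = 1 -> p (e * n.+1%:R) @[n --> \oo] --> 0.
move=> e1; apply: (@squeeze_cvgr _ _ _ _ (fun=> 0) (fun n=> normal_peak s * c^-1 * n.+1%:R^-1)).
- apply: nearW=> n; rewrite p_ge0 pE /= -mulrA; apply: lerM2l; first exact: normal_peak_ge0.
rewrite exprMn -(real_normK (num_real e)) e1 expr1n mul1r.
rewrite -invfM expRN lef_pV2 ?posrE ?expR_gt0 ?mulr_gt0//.
apply: le_trans (expR_ge1Dx _); rewrite ler_wpDl//; apply: lerM2l; first nn.
by rewrite expr2 ler_peMr// ler1n.
- exact: cvg_cst.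
- rewrite -[X in _ --> X](mulr0 (normal_peak s * c^-1)); apply: cvgMl_tmp.
exact: cvg_harmonic.
Qed.
(** The integrand is the derivative of H, which vanishes at infinity. *)
Let I_H' b a : I (fun x=> a * C b a x - (s ^+ 2)^-1 * Sn b a x) = 0.
set h:= fun x=> _.
have hE : EFin \o h = (fun x=> (a * C b a x)%:E - ((s ^+ 2)^-1 * Sn b a x)%:E)%E by [].
have ih : mu.-integrable setT (EFin \o h).
rewrite hE; apply: integrableB=> //.
 by under eq_fun do rewrite EFinM; apply: integrableZl=> //; exact: intC.
by under eq_fun do rewrite EFinM; apply: integrableZl=> //; exact: intSn.
pose A n : set R:= `[- n.+1%:R, n.+1%:R]%classic.
pose g n x:= \1_(A n) x * h x.
have mh : mT h.
by apply: mfunB; apply: mfunM.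
have ch : continuous h.
have cder (f df : R -> R) : (forall x : R, is_derive x (1 : R) f (df x)) -> continuous f.
 by move=> fd x; apply/differentiable_continuous/derivable1_diffP; by [].
have cp : continuous p by exact: cder p_derive.
have caff : continuous (fun x=> b + a * x) by exact: cder (aff_derive b a).
move=> x; apply: cvgB; apply: cvgMl_tmp.
 apply: cvgM; last exact: cp.
 by apply: (cvg_comp _ _ (caff x)); exact: continuous_cos.
apply: cvgM; first exact: cvg_id.
apply: cvgM; last exact: cp.
by apply: (cvg_comp _ _ (caff x)); exact: continuous_sin.
have gI n : (\int[mu]_x (g n x)%:E = (H b a n.+1%:R - H b a (- n.+1%:R))%:E)%E.
transitivity (\int[mu]_(x in A n) (h x)%:E)%E.
 rewrite [RHS]integral_mkcond; apply: eq_integral=> x _.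
 by rewrite /g patchE indicE; case: ifP=> _; rewrite ?mul1r ?mul0r.
rewrite (continuous_FTC2 (F:= H b a)) ?EFinB//.
- by apply: lt_trans (ltr0Sn _ _); rewrite oppr_lt0 ltr0n.
- exact: continuous_subspaceT.
- have cH x : {for x, continuous (H b a)}.
  by apply/differentiable_continuous/derivable1_diffP; apply: ex_derive; exact: H_derive.
 split.
 + by move=> x _; apply: ex_derive; by [].
 + exact/cvg_at_right_filter/cH.
 + exact/cvg_at_left_filter/cH.
- by move=> x _; rewrite derive1E; apply: derive_val; by [].
have gh x : g n x @[n --> \oo] --> h x.
apply: cvg_near_cst; near=> n; rewrite /g indicE mem_set ?mul1r// /A /= in_itv /= -ler_norml.
by near: n; exists (Num.truncn `|x|)=> // m /= xm; apply: ltW; apply: lt_le_trans (truncnS_gt _) _;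
 rewrite ler_nat ltnS.
have mg n : mT (g n).
by rewrite /g; apply: mfunM=> //; apply: mindic; exact: measurable_itv.
have cg : (\int[mu]_x (g n x)%:E)%E @[n --> \oo] --> (\int[mu]_x (h x)%:E)%E.
apply: (@dominated_cvg _ _ _ mu setT measurableT (fun n=> EFin \o g n) (EFin \o h) (fun x=> `|(h x)%:E|%E)).
- by move=> n; apply/mEFinP; mf.
- by move=> x _; apply: cvg_EFin; [exact: nearW|exact: gh].
- by [].
- exact: integrable_abse.
- move=> n x _; rewrite /= lee_fin /g indicE; case: (_ \in _); rewrite ?mul1r ?mul0r ?normr0//.
have : (\int[mu]_x (h x)%:E = 0)%E.
apply: (cvg_unique _ cg)=> //.
rewrite (_ : (fun n=> _) = fun n=> (H b a n.+1%:R - H b a (- n.+1%:R))%:E); last exact/funext.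
apply: cvg_EFin; first exact: nearW.
rewrite -[X in _ --> X](subr0 0); apply: cvgB.
 by apply: norm_cvg0; apply: (@squeeze_cvgr _ _ _ _ (fun=> 0) (fun n=> p (1 * n.+1%:R)));
  [apply: nearW=> n; rewrite normr_ge0 mul1r H_bd//|exact: cvg_cst|exact: (p_cvg (normr1 R))].
apply: norm_cvg0; apply: (@squeeze_cvgr _ _ _ _ (fun=> 0) (fun n=> p (-1 * n.+1%:R)));
  [apply: nearW=> n; rewrite normr_ge0 mulN1r H_bd//|exact: cvg_cst|exact: (p_cvg (normrN1 R))].
by rewrite /I /Rintegral=> ->.
Unshelve. all: end_near.
Qed.
Let I_Sn b a : I (Sn b a) = s ^+ 2 * a * I (C b a).
have:= I_H' b a; rewrite /I RintegralB//.
- rewrite !RintegralZl//.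
by move/subr0_eq=> h; rewrite -mulrA h mulVKf// gt_eqF// exprn_gt0.
- by rewrite (_ : EFin \o _ = fun x=> a%:E * (C b a x)%:E)%E//; apply: integrableZl=> //; exact: intC.
- by rewrite (_ : EFin \o _ = fun x=> ((s ^+ 2)^-1)%:E * (Sn b a x)%:E)%E//; apply: integrableZl=> //; exact: intSn.
Qed.
Let dC b x a : is_derive a (1 : R) (fun a=> C b a x) (- Sn b a x).
have hc : is_derive (b + a * x) 1 (cos : R -> R) (- sin (b + a * x)) by exact: is_derive_cos.
have h0 : is_derive a (1 : R) (fun a=> b + a * x) x.
by have:= aff_derive b x a; congr is_derive; apply/funext=> y; rewrite mulrC.
have h1:= is_deriveZ (p x) (is_derive1_comp (f:= cos) (g:= fun a=> b + a * x) hc h0).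
rewrite (_ : (fun a=> _) = p x \*: (cos \o (fun a=> b + a * x))); last first.
by apply/funext=> y; rewrite /C mulrC.
by apply: (is_derive_eq h1); rewrite /GRing.scale /Sn /=; ring.
Qed.
(** Differentiation under the integral, dominated by (1 + |x|) p; [I_Sn] turns the result into a
    linear differential equation in a. *)
Let I_C_derive b a : is_derive a (1 : R) (fun a=> I (C b a)) (- (s ^+ 2 * a * I (C b a))).
have Ia : `]a - 1, a + 1[%classic a by rewrite /= in_itv /= ltrBlDr ltrDl ltr01.
have h1 : forall x, `]a - 1, a + 1[%classic x -> mu.-integrable setT (EFin \o C b x).
mf.
have h2 : forall x y, `]a - 1, a + 1[%classic x -> setT y -> derivable ((C b) ^~ y) x 1.
mf.
have h3 y : 0 <= (1 + `|y|) * p y by nn.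
have h4 : mu.-integrable setT (EFin \o (fun y=> (1 + `|y|) * p y)).
apply: (@int_le _ 1)=> //; last by move=> x; rewrite mul1r ger0N.
mf.
have d1 x y : partial1of2 (C b) x y = - Sn b x y.
by rewrite partial1of2E; apply: derive_val; exact: dC.
have h5 : forall x y, `]a - 1, a + 1[%classic x -> setT y -> `|partial1of2 (C b) x y| <= (1 + `|y|) * p y.
by move=> x y _ _; rewrite d1 normrN -[leRHS]mul1r; exact: Sn_le.
have D:= derivable_under_integral measurableT Ia h1 h2 h3 h4 h5.
have E:= differentiation_under_integral measurableT Ia h1 h2 h3 h4 h5.
split=> //; rewrite -derive1E E -I_Sn /I.
transitivity (Rintegral mu setT (fun x=> -1 * Sn b a x)); last first.
by rewrite RintegralZl ?mulN1r//; exact: intSn.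
by apply: eq_Rintegral; move=> x _; rewrite d1 mulN1r.
Qed.
(** The solution of that equation: its product with exp(s^2 a^2 / 2) is constant in a. *)
Let I_CE b a : I (C b a) = expR (- (a ^+ 2 * s ^+ 2 / 2)) * cos b.
pose e (a : R):= expR (s ^+ 2 / 2 * a ^+ 2).
have e_derive (x : R) : is_derive x (1 : R) e (e x * (s ^+ 2 * x)).
have h1 : is_derive x (1 : R) (fun y=> s ^+ 2 / 2 * y ^+ 2) (s ^+ 2 * x).
 have:= @derive_monomial R (fun=> 0) 0 (s ^+ 2 / 2) 1 x (is_derive_cst 0 x 1).
 rewrite (_ : (fun y=> 0 + _) = fun y=> s ^+ 2 / 2 * y ^+ 2); last by apply/funext=> y; rewrite add0r.
 by move=> h; apply: (is_derive_eq h); rewrite expr1; field.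
have h2 : is_derive (s ^+ 2 / 2 * x ^+ 2) 1 (expR : R -> R) (e x) by exact: is_derive_expR.
exact: (is_derive1_comp (f:= expR) (g:= fun y=> s ^+ 2 / 2 * y ^+ 2) h2 h1).
have : I (C b a) * e a = I (C b 0) * e 0.
apply: (@is_derive_0_is_cst _ (fun a=> I (C b a) * e a))=> x.
by apply: (is_derive_eq (is_deriveM (I_C_derive b x) (e_derive x))); rewrite /GRing.scale /=; ring.
have -> : I (C b 0) = cos b.
have -> : C b 0 = fun x=> cos b * p x by apply/funext=> x; rewrite /C mul0r addr0.
rewrite /I RintegralZl//; last exact: integrable_normal_pdf.
by rewrite /Rintegral integral_normal_pdf mulr1.
rewrite {2}/e expr0n mulr0 expR0 mulr1=> <-.
rewrite /e mulrCA -expRD (_ : _ + _ = 0) ?expR0 ?mulr1//.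
by ring.
Qed.
Let Np : prob (measurableTypeR R) R:= normal_prob 0 s.
Let Ex_normal_prob (f : R -> R) M : mT f -> bdd f M ->
Ex Np f = I (fun x=> f x * p x).
move=> mf fM.
have mf' : mT (f : sigmaT (@measurable _ (measurableTypeR R)) -> R).
by move=> _ B mB; rewrite setTI; apply: sub_sig; rewrite -[X in measurable X]setTI; exact: mf.
have mid : mT (id : R -> sigmaT (@measurable _ (measurableTypeR R))) by exact: measurable_gen.
have -> : Ex Np f = \int[Np]_x (f (id x) * 1) by eqEx=> x; rewrite mulr1.
apply: (linear_dct_eq _ (linear_dct_int (mu:= Np) mid (L1_cst Np 1))
(linear_dct_int (mu:= mu) mid (integrable_normal_pdf 0 s)) _ _ mf' fM).
- by move=> A B; exact: measurableI.
- rewrite -[LHS]/(Ex Np (fun=> 1 * 1)) Ex_cst mulr1 -[RHS]/(Rintegral mu setT (fun x=> 1 * p x)).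
rewrite (_ : (fun x=> _) = p); last by apply/funext=> x; rewrite mul1r.
by rewrite /Rintegral integral_normal_pdf.
- move=> B mB; rewrite -[LHS]/(Ex Np (fun x=> \1_B x * 1)) (_ : (fun x=> _ * 1) = \1_B); last first.
 by apply/funext=> x; rewrite mulr1.
rewrite Ex_indic// /Rintegral; congr fine.
transitivity (\int[mu]_(x in B) (p x)%:E)%E=> //; rewrite [LHS]integral_mkcond.
by apply: eq_integral=> x _; rewrite patchE indicE; case: ifP=> _; rewrite ?mul1r ?mul0r.
Qed.
Lemma normal_prob_cos b a :
Ex (normal_prob 0 s : prob (measurableTypeR R) R) (fun x=> cos (b + a * x)) = expR (- (a ^+ 2 * s ^+ 2 / 2)) * cos b.
rewrite -I_CE (@Ex_normal_prob _ 1)//; last by move=> x; exact: cosN1.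
mf.
Qed.
End normal_cos.

(** * Uniqueness of laws from cosine transforms *)

Section clip01.
Context {R : realType}.
Definition clip01 (x : R) : R:= Num.max 0 (Num.min 1 x).
Lemma clip01_itv x : 0 <= clip01 x <= 1.
by rewrite /clip01 le_max lexx ge_max ler01 ge_min lexx. Qed.
Lemma clip01_lipschitz x y : `|clip01 x - clip01 y| <= `|x - y|.
rewrite ler_norml /clip01 /Num.min /Num.max; have:= ler_norm (x - y); have:= ler_norm (- (x - y)).
rewrite normrN; move: `|x - y| => z.
by case: (ltP 1 x)=> ?; case: (ltP 1 y)=> ?; do ?case: (ltP 0 _)=> ?; lra.
Qed.
Lemma meas_clip01 : mT clip01.
by apply: measurable_maxr=> //; exact: measurable_minr. Qed.
(** A product of ramps of slope n that increases with n to the indicator of the box u_i < c_i. *)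
Fixpoint softbox (n : nat) (cs us : seq R) : R :=
match cs, us with
| c :: cs', u :: us'=> clip01 (n%:R * (c - u)) * softbox n cs' us'
| _, _=> 1
end.
Lemma softbox_itv n cs us : 0 <= softbox n cs us <= 1.
elim: cs us=> [|c cs IH] [|u us] /=; rewrite ?ler01 ?lexx//.
have /andP[h0 h1]:= clip01_itv (n%:R * (c - u)); have /andP[g0 g1]:= IH us.
by rewrite mulr_ge0// mulr_ile1.
Qed.
Lemma softbox_lipschitz n cs us us' : size us = size us' ->
`|softbox n cs us - softbox n cs us'| <= n%:R * \sum_(p <- zip us us') `|p.1 - p.2|.
have nn (us1 us2 : seq R) : 0 <= \sum_(p <- zip us1 us2) `|p.1 - p.2| :> R by nn.
elim: cs us us'=> [us us' _|c cs IH [|u us] [|u' us'] //= ].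
by rewrite /= subrr normr0 mulr_ge0.
by rewrite subrr normr0 big_nil mulr0.
move=> -[s12].
have /andP[h0 h1]:= clip01_itv (n%:R * (c - u)); have /andP[g0 g1]:= softbox_itv n cs us'.
rewrite big_cons /= [leRHS]mulrDr; set a:= clip01 _; set b:= softbox _ _ _; set a':= clip01 _; set b':= softbox _ _ _.
rewrite (_ : a * b - a' * b' = b' * (a - a') + a * (b - b')); last by ring.
apply: le_trans (ler_normD _ _) _; rewrite !normrM (ger0N h0) (ger0N g0).
apply: lerD; last by apply: le_trans (IH us us' s12); rewrite ler_piMl.
apply: (@le_trans _ _ `|a - a'|); first by rewrite ler_piMl.
apply: le_trans (clip01_lipschitz _ _) _.
by rewrite -mulrBr normrM ger0N// lerM2l// [leRHS]distrC (_ : c - u - (c - u') = u' - u)//; ring.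
Qed.
End clip01.
Section trig_unique.
Context {R : realType} (I : finType).
Section one.
Context d (T : mType d) (P : prob T R) (X : I -> T -> R) (Y : T -> R).
Hypotheses (mX : forall i, mT (X i)) (LY : L1 P Y).
Let mY:= L1_meas LY.
Lemma L1_bdM (f : T -> R) M : mT f -> bdd f M ->
L1 P (fun w=> f w * Y w).
move=> mf fM; apply: (L1le (fun w=> M * `|Y w|)).
- mf.
- by apply: L1Z; exact: L1_norm.
- by move=> w; rewrite normrM ler_wpM2r.
Qed.
Lemma meas_softbox n cs (s : seq I) :
mT (fun w=> softbox n cs [seq X i w | i <- s]).
elim: s cs=> [|i s IH] [|c cs] //=.
apply: mfunM=> //; apply: (mcompT meas_clip01).
mf.
Qed.
Lemma Ex_softbox_cvg (c : I -> R) (s : seq I) :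
Ex P (fun w=> softbox n (map c s) [seq X i w | i <- s] * Y w) @[n --> \oo] -->
Ex P (fun w=> (all (fun i=> X i w < c i) s)%:R * Y w).
apply: (proj2 (@Ex_dct _ _ _ P _ _ (fun w=> `|Y w|) _ _ _ _)).
- by move=> n; apply: mfunM=> //; exact: meas_softbox.
- move=> w; apply: cvgMr_tmp; elim: s=> [|i s IH] /=; first exact: cvg_cst.
rewrite -mulnb natrM; apply: cvgM=> //; case: (ltP (X i w) (c i))=> xc; apply: cvg_near_cst.
near=> n; rewrite /clip01 min_l ?max_r//.
 rewrite -ler_pdivr ?subr_gt0// mul1r.
 by near: n; exists (Num.truncn (c i - X i w)^-1).+1=> // m /= xm;
  apply: ltW; apply: lt_le_trans (truncnS_gt _) _; rewrite ler_nat.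
near=> n; rewrite /clip01 max_l//.
by rewrite ge_min mulr_ge0_le0 ?orbT// subr_le0.
- exact: L1_norm.
- move=> n w; rewrite normrM ler_piMl//.
by have /andP[h0 h1]:= softbox_itv n (map c s) [seq X i w | i <- s]; rewrite ger0N.
Unshelve. all: end_near. Qed.
Hypothesis LXY : forall i, L1 P (fun w=> X i w ^+ 2 * Y w).
Definition mbern_const : R:= \sum_(i <- enum I) Ex P (fun w=> X i w ^+ 2 * `|Y w|).
Lemma Ex_mbern_err (F : seq R -> R) c D eps : 0 < c -> (0 < D)%N -> 0 < eps ->
l1_lipschitz F -> bdd F 1 ->
mT (fun w=> F [seq X i w | i <- enum I]) ->
`|Ex P (fun w=> F [seq X i w | i <- enum I] * Y w) -
 Ex P (fun w=> mbern c D (enum I) F (fun i=> X i w) * Y w)| <=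
c * mbern_const + (eps + (eps * c ^+ 2 * D%:R)^-1) * ((size (enum I))%:R * Ex P (fun w=> `|Y w|)).
move=> c0 D0 e0 FL F1 mF.
have mB:= meas_trigp mX (trigp_mbern D c0 (enum I) F1).
have B1 w:= trigp_bd (fun i=> X i w) (trigp_mbern D c0 (enum I) F1).
have LF:= L1_bdM mF (fun w=> F1 _); have LB:= L1_bdM mB B1.
rewrite -ExB//; apply: le_trans (Ex_norm (L1B LF LB)) _.
set K:= eps + _.
have LX i : L1 P (fun w=> X i w ^+ 2 * `|Y w|).
have:= L1_norm (LXY i); congr L1; apply/funext=> w.
by rewrite normrM ger0N ?sqr_ge0.
have -> : c * mbern_const + K * ((size (enum I))%:R * Ex P (fun w=> `|Y w|)) =
 Ex P (fun w=> \sum_(i <- enum I) (c * (X i w ^+ 2 * `|Y w|) + K * `|Y w|)).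
rewrite Ex_sum; last by move=> i; apply: L1D; apply: L1Z=> //; exact: L1_norm.
rewrite (eq_bigr (fun i=> c * Ex P (fun w=> X i w ^+ 2 * `|Y w|) + K * Ex P (fun w=> `|Y w|))).
 by rewrite big_split /= -mulr_sumr big_const_seq count_predT iter_addr_0 -mulr_natl /mbern_const; ring.
by move=> i _; rewrite ExD ?ExZ//; do ?apply: L1Z=> //; exact: L1_norm.
apply: Ex_le.
- by apply: L1_norm; exact: L1B.
- by apply: L1_sum=> i; apply: L1D; apply: L1Z=> //; exact: L1_norm.
- move=> w; rewrite -mulrBl normrM distrC.
apply: le_trans (ler_wpM2r (normr_ge0 _) (mbern_err c0 D0 _ _ e0 FL)) _.
rewrite mulr_suml; apply: ler_sum=> i _; rewrite /K; lra.
Qed.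
End one.
Context d1 (T1 : mType d1) (P1 : prob T1 R) (X1 : I -> T1 -> R) (Y1 : T1 -> R).
Context d2 (T2 : mType d2) (P2 : prob T2 R) (X2 : I -> T2 -> R) (Y2 : T2 -> R).
Hypotheses (mX1 : forall i, mT (X1 i)) (LY1 : L1 P1 Y1)
(mX2 : forall i, mT (X2 i)) (LY2 : L1 P2 Y2)
(LXY1 : forall i, L1 P1 (fun w=> X1 i w ^+ 2 * Y1 w))
(LXY2 : forall i, L1 P2 (fun w=> X2 i w ^+ 2 * Y2 w))
(cosE : forall a b, Ex P1 (fun w=> cos (b + \sum_i a i * X1 i w) * Y1 w) =
Ex P2 (fun w=> cos (b + \sum_i a i * X2 i w) * Y2 w)).
Let trigpE K A (phi : (I -> R) -> R) : trigp K A phi ->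
Ex P1 (fun w=> phi (fun i=> X1 i w) * Y1 w) = Ex P2 (fun w=> phi (fun i=> X2 i w) * Y2 w).
elim=> {K A phi} [A b a _|K K' A c c' f g fT IHf gT IHg|K K' A A' f _ _ _ //]; first exact: cosE.
have lin d (T : mType d) (P : prob T R) (X : I -> T -> R) (Y : T -> R) :
 (forall i, mT (X i)) -> L1 P Y ->
 Ex P (fun w=> (c * f (fun i=> X i w) + c' * g (fun i=> X i w)) * Y w) =
 c * Ex P (fun w=> f (fun i=> X i w) * Y w) + c' * Ex P (fun w=> g (fun i=> X i w) * Y w).
move=> mX LY; rewrite -!ExZ -?ExD; first by eqEx=> w; ring.
- by apply: L1Z; apply: L1_bdM LY _ _ (meas_trigp mX fT) _=> w; exact: trigp_bd fT.
- by apply: L1Z; apply: L1_bdM LY _ _ (meas_trigp mX gT) _=> w; exact: trigp_bd gT.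
- by apply: L1_bdM LY _ _ (meas_trigp mX gT) _=> w; exact: trigp_bd gT.
- by apply: L1_bdM LY _ _ (meas_trigp mX fT) _=> w; exact: trigp_bd fT.
by rewrite !lin// IHf IHg.
Qed.
(** Lipschitz functions of the coordinates are approximated by trigonometric polynomials, on which
    both sides agree. D is chosen last, after c and eps. *)
Let lipE (F : seq R -> R) : l1_lipschitz F -> bdd F 1 ->
mT (fun w=> F [seq X1 i w | i <- enum I]) ->
mT (fun w=> F [seq X2 i w | i <- enum I]) ->
Ex P1 (fun w=> F [seq X1 i w | i <- enum I] * Y1 w) =
Ex P2 (fun w=> F [seq X2 i w | i <- enum I] * Y2 w).
move=> FL F1 mF1 mF2; apply/eqP; rewrite -subr_eq0 -normr_le0; apply/ler_addgt0Pr=> e e0; rewrite add0r.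
pose A:= mbern_const P1 X1 Y1 + mbern_const P2 X2 Y2.
pose B:= (size (enum I))%:R * Ex P1 (fun w=> `|Y1 w|) + (size (enum I))%:R * Ex P2 (fun w=> `|Y2 w|).
have A0 : 0 <= A.
by apply: addr_ge0; apply: sumr_ge0=> i _; apply: Ex_ge0=> w; rewrite mulr_ge0 ?sqr_ge0.
have B0 : 0 <= B by apply: addr_ge0; rewrite mulr_ge0//; apply: Ex_ge0.
have small x : 0 <= x -> exists2 y : R, 0 < y & y * x <= e / 3.
move=> x0; exists (e / (3 * (x + 1))); first nn.
have x1 : 0 < x + 1 by rewrite ltr_wpDl.
rewrite mulrAC ler_pdivr ?mulr_gt0// mulrA divfK//.
lra.
have [c c0 hA]:= small A A0; have [eps eps0 hB]:= small B B0.
(* Makes the error term 1 / (eps c^2 D) at most eps. *)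
pose D:= (Num.truncn ((eps * c ^+ 2)^-1 / eps)).+1.
have e1:= Ex_mbern_err mX1 LY1 LXY1 c0 (ltn0Sn _ : (0 < D)%N) eps0 FL F1 mF1.
have e2:= Ex_mbern_err mX2 LY2 LXY2 c0 (ltn0Sn _ : (0 < D)%N) eps0 FL F1 mF2.
have D0 : (0 < D)%N by [].
rewrite -(trigpE (trigp_mbern D c0 (enum I) F1)) in e2.
set m:= Ex P1 (fun w=> mbern _ _ _ _ _ * _) in e1 e2.
have h : (eps * c ^+ 2 * D%:R)^-1 <= eps.
have q0 : 0 < eps * c ^+ 2 by nn.
have:= truncnS_gt ((eps * c ^+ 2)^-1 / eps); rewrite -/D ltr_pdivrMr// => /ltW h.
by rewrite invfM ler_pdivr ?ltr0n//; apply: le_trans h _; rewrite mulrC.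
have -> : Ex P1 (fun w=> F [seq X1 i w | i <- enum I] * Y1 w) - Ex P2 (fun w=> F [seq X2 i w | i <- enum I] * Y2 w)
 = (Ex P1 (fun w=> F [seq X1 i w | i <- enum I] * Y1 w) - m) -
  (Ex P2 (fun w=> F [seq X2 i w | i <- enum I] * Y2 w) - m) by ring.
apply: le_trans (ler_normB _ _) _; apply: le_trans (lerD e1 e2) _.
apply: (@le_trans _ _ (c * A + (eps + eps) * B)).
rewrite /A /B [leRHS](_ : _ = c * mbern_const P1 X1 Y1 +
(eps + eps) * ((size (enum I))%:R * Ex P1 (fun w=> `|Y1 w|)) + (c * mbern_const P2 X2 Y2 +
(eps + eps) * ((size (enum I))%:R * Ex P2 (fun w=> `|Y2 w|)))); last by ring.
by apply: lerD; rewrite lerD2l; apply: ler_wpM2r; rewrite ?lerD2l//; rewrite mulr_ge0//; apply: Ex_ge0.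
by lra.
Qed.
(** The weights [Y1] and [Y2] may be signed. With [Y1] an increment and [Y2] equal to 0 this yields
    orthogonality to the past, with both equal to 1 the equality of laws. *)
Lemma trig_unique (c : I -> R) :
Ex P1 (fun w=> [forall i, X1 i w < c i]%:R * Y1 w) =
Ex P2 (fun w=> [forall i, X2 i w < c i]%:R * Y2 w).
have allE T (X : I -> T -> R) w : [forall i, X i w < c i] = all (fun i=> X i w < c i) (enum I).
apply/forallP/allP=> [h i _|h i]; first exact: h.
by apply: h; rewrite mem_enum.
under eq_fun do rewrite allE; under [in RHS]eq_fun do rewrite allE.
have c1:= Ex_softbox_cvg mX1 LY1 (c:= c) (s:= enum I).
have c2:= Ex_softbox_cvg mX2 LY2 (c:= c) (s:= enum I).
apply: (cvg_unique _ c1)=> //; move: c2; apply: cvg_trans; apply: near_eq_cvg.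
near=> n; have n0 : (0 < n)%N by near: n; exists 1%N.
have nR : n%:R != 0 :> R by rewrite pnatr_eq0 -lt0n.
(* The factor 1 / n makes [softbox] 1-Lipschitz, as [lipE] requires. *)
have:= @lipE (fun u=> n%:R^-1 * softbox n (map c (enum I)) u) _ _ _ _.
have sc d (T : mType d) (P : prob T R) (X : I -> T -> R) (Y : T -> R) :
(forall i, mT (X i)) -> L1 P Y ->
Ex P (fun w=> n%:R^-1 * softbox n (map c (enum I)) [seq X i w | i <- enum I] * Y w) =
n%:R^-1 * Ex P (fun w=> softbox n (map c (enum I)) [seq X i w | i <- enum I] * Y w).
move=> mX LY; rewrite -ExZ; first by eqEx=> w; rewrite mulrA.
apply: (L1_bdM LY (M:= 1)); first exact: meas_softbox.
move=> w; have /andP[h0 h1]:= softbox_itv n (map c (enum I)) [seq X i w | i <- enum I].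
by rewrite ger0N.
rewrite !sc// => H; apply: (mulfI (x:= n%:R^-1)); first by rewrite invr_eq0.
apply/esym; apply: H.
- move=> u u' uu'; rewrite -mulrBr normrM ger0N ?invr_ge0// ler_pdivrMl ?ltr0n//.
exact: softbox_lipschitz.
- move=> u; have /andP[h0 h1]:= softbox_itv n (map c (enum I)) u.
by rewrite ger0N ?mulr_ge0 ?invr_ge0// mulr_ile1 ?invr_ge0// invf_le1 ?ltr0n// ler1n.
- by apply: mfunM=> //; exact: meas_softbox.
- by apply: mfunM=> //; exact: meas_softbox.
Unshelve. all: end_near. Qed.
End trig_unique.
Section pi_system.
Context {R : realType}.
Lemma Ex_pi_system d1 (T1 : mType d1) (P1 : prob T1 R)
 d2 (T2 : mType d2) (P2 : prob T2 R) (X : pointedType) (G : set (set X))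
 (Y1 : T1 -> X) (Y2 : T2 -> X) : setI_closed G ->
(forall B, G B -> measurable (Y1 @^-1` B)) -> (forall B, G B -> measurable (Y2 @^-1` B)) ->
(forall B, G B -> Ex P1 (fun w=> \1_B (Y1 w)) = Ex P2 (fun w=> \1_B (Y2 w))) ->
forall (f : sigmaT G -> R) M, mT f -> bdd f M ->
Ex P1 (fun w=> f (Y1 w)) = Ex P2 (fun w=> f (Y2 w)).
move=> GI m1 m2 GE f M mf fM.
have e d (T : mType d) (P : prob T R) (g : T -> R) : Ex P g = Ex P (fun w=> g w * 1).
by eqEx=> w; rewrite mulr1.
rewrite [LHS]e [RHS]e; apply: (@Ex_pi_weight _ _ _ P1 _ _ P2 _ G Y1 Y2 _ _ GI m1 m2 _ _ _ _ _ M)=> //; [exact: L1_cst|exact: L1_cst|by rewrite !Ex_cst|].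
by move=> B GB; rewrite -[LHS]e -[RHS]e; exact: GE.
Qed.
(* The half-lines form a pi-system generating the Borel sets of the line. *)
Lemma Ex_halfline d1 (T1 : mType d1) (P1 : prob T1 R) (Y1 : T1 -> R)
 d2 (T2 : mType d2) (P2 : prob T2 R) (Y2 : T2 -> R) :
mT Y1 -> mT Y2 ->
(forall c, Ex P1 (fun w=> (Y1 w < c)%R%:R) = Ex P2 (fun w=> (Y2 w < c)%R%:R)) ->
forall (f : R -> R) M, mT f -> bdd f M ->
Ex P1 (fun w=> f (Y1 w)) = Ex P2 (fun w=> f (Y2 w)).
move=> mY1 mY2 h f M mf fM.
pose G : set (set R):= [set A | exists c : R, A = [set x | x < c]].
have mG c : measurable ([set x | x < c] : set R).
by rewrite (_ : mkset _ = `]-oo, c[%classic)//; apply/seteqP; split=> x; rewrite /= in_itv.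
apply: (@Ex_pi_system _ _ P1 _ _ P2 R G _ _ _ _ _ _ _ M)=> //.
- move=> _ _ [a ->] [b ->]; exists (Num.min a b); apply/seteqP; split=> x /=; rewrite lt_min.
 by move=> [-> ->].
by move/andP.
- by move=> _ [c ->]; rewrite -[X in measurable X]setTI; exact: mY1.
- by move=> _ [c ->]; rewrite -[X in measurable X]setTI; exact: mY2.
- move=> _ [c ->]; have iE T (Y : T -> R) : (fun w=> \1_[set x : R | x < c] (Y w)) = fun w=> (Y w < c)%R%:R :> R.
 by apply/funext=> w; rewrite indicE; congr (nat_of_bool _)%:R; apply/idP/idP=> [/set_mem|/mem_set].
by rewrite !iE.
- have mid : mT (idfun : sigmaT G -> R).
 apply: (measurability _ (RGenInftyO.measurableE R))=> _ [_ [a ->] <-].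
 rewrite setTI; apply: sub_sig; exists a.
 by [].
mf.
Qed.
End pi_system.
Section law_unique.
Context {R : realType}.
Context d1 (T1 : mType d1) (P1 : prob T1 R) (X1 X1' : T1 -> R).
Context d2 (T2 : mType d2) (P2 : prob T2 R) (X2 X2' : T2 -> R).
Hypotheses (mX1 : mT X1) (mX1' : mT X1')
(mX2 : mT X2) (mX2' : mT X2')
(L1X : L1 P1 (fun w=> X1 w ^+ 2)) (L1X' : L1 P1 (fun w=> X1' w ^+ 2))
(L2X : L1 P2 (fun w=> X2 w ^+ 2)) (L2X' : L1 P2 (fun w=> X2' w ^+ 2))
(cosE : forall b a a', Ex P1 (fun w=> cos (b + (a * X1 w + a' * X1' w))) =
Ex P2 (fun w=> cos (b + (a * X2 w + a' * X2' w)))).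
Let G : set (set (R * R)):= [set A | exists a b : R, A = [set x | x.1 < a] `&` [set x | x.2 < b]].
Let pick T (X X' : T -> R) (i : bool):= if i then X else X'.
Let box a b : Ex P1 (fun w=> ((X1 w < a) && (X1' w < b))%R%:R) = Ex P2 (fun w=> ((X2 w < a) && (X2' w < b))%R%:R).
have:= @trig_unique R bool _ T1 P1 (pick X1 X1') (fun=> 1) _ T2 P2 (pick X2 X2') (fun=> 1) _ _ _ _ _ _ _
(fun i=> if i then a else b).
have fE T (X X' : T -> R) : (fun w=> [forall i : bool, pick X X' i w < (if i then a else b)]%:R * 1) =
 fun w=> ((X w < a) && (X' w < b))%R%:R :> R.
apply/funext=> w; rewrite mulr1; congr (nat_of_bool _)%:R.
apply/forallP/andP=> [h|[h1 h2] []]; [split|by []|by []]; [exact: (h true)|exact: (h false)].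
rewrite !fE; apply.
- by case.
- exact: L1_cst.
- by case.
- exact: L1_cst.
- by case; under eq_fun do rewrite mulr1.
- by case; under eq_fun do rewrite mulr1.
- move=> c e; have sE T (X X' : T -> R) : (fun w=> cos (e + \sum_i c i * pick X X' i w) * 1) =
  fun w=> cos (e + (c true * X w + c false * X' w)).
 by apply/funext=> w; rewrite mulr1 big_bool.
by rewrite !sE.
Qed.
Lemma law2_unique (f : R * R -> R) M : mT f -> bdd f M ->
Ex P1 (fun w=> f (X1 w, X1' w)) = Ex P2 (fun w=> f (X2 w, X2' w)).
move=> mf fM.
have m1 : mT (fst : sigmaT G -> R).
apply: (measurability _ (RGenInftyO.measurableE R))=> _ [_ [a ->] <-].
rewrite setTI (_ : _ @^-1` _ = \bigcup_(n in [set: nat]) ([set x | x.1 < a] `&` [set x | x.2 < n%:R])).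
 by apply: bigcup_measurable=> n _; apply: sub_sig; exists a, n%:R.
apply/seteqP; split=> -[x y]; rewrite /= in_itv /=; last by case=> n _ [].
by move=> xa; exists (Num.truncn y).+1=> //; split=> //=; exact: truncnS_gt.
have m2 : mT (snd : sigmaT G -> R).
apply: (measurability _ (RGenInftyO.measurableE R))=> _ [_ [a ->] <-].
rewrite setTI (_ : _ @^-1` _ = \bigcup_(n in [set: nat]) ([set x | x.1 < n%:R] `&` [set x | x.2 < a])).
 by apply: bigcup_measurable=> n _; apply: sub_sig; exists n%:R, a.
apply/seteqP; split=> -[x y]; rewrite /= in_itv /=; last by case=> n _ [].
by move=> ya; exists (Num.truncn x).+1=> //; split=> //=; exact: truncnS_gt.
have mid : mT (fun x : sigmaT G=> (x.1, x.2) : R * R).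
mf.
have mf' : mT (f : sigmaT G -> R).
have:= mcompT mf mid; congr measurable_fun; first by apply/funext=> -[].
have p1 : mT (fun w=> (X1 w, X1' w)) by mf.
have p2 : mT (fun w=> (X2 w, X2' w)) by mf.
have mG (a b : R) : measurable ([set x : R * R | x.1 < a] `&` [set x | x.2 < b]).
apply: measurableI.
 rewrite (_ : mkset _ = setT `&` fst @^-1` `]-oo, a[%classic); first exact: mfst.
 by rewrite setTI; apply/seteqP; split=> x; rewrite /= in_itv.
rewrite (_ : mkset _ = setT `&` snd @^-1` `]-oo, b[%classic); first exact: msnd.
by rewrite setTI; apply/seteqP; split=> x; rewrite /= in_itv.
apply: (@Ex_pi_system _ _ _ P1 _ _ P2 _ G (fun w=> (X1 w, X1' w)) (fun w=> (X2 w, X2' w)) _ _ _ _ f M)=> //.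
- move=> _ _ [a [b ->]] [a' [b' ->]]; exists (Num.min a a'), (Num.min b b').
apply/seteqP; split=> x /=; rewrite !lt_min; first by move=> [[-> ->] [-> ->]].
by move=> [/andP[? ?] /andP[? ?]].
- by move=> _ [a [b ->]]; rewrite -[X in measurable X]setTI; exact: p1.
- by move=> _ [a [b ->]]; rewrite -[X in measurable X]setTI; exact: p2.
- move=> _ [a [b ->]].
have iE T (X X' : T -> R) : (fun w=> \1_([set x : R * R | x.1 < a] `&` [set x | x.2 < b]) (X w, X' w)) =
  fun w=> ((X w < a) && (X' w < b))%R%:R :> R.
 apply/funext=> w; rewrite indicE; congr (nat_of_bool _)%:R.
 by apply/idP/idP=> [/set_mem[/= -> ->]//|/andP[h1 h2]]; exact: mem_set.
by rewrite !iE box.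
Qed.
End law_unique.

(** * The quantile transform *)

Lemma Ex_U01_oo (R : realType) (f : R -> R) : mT f ->
Ex U01 (fun s=> (0 < s < 1)%R%:R * f s) = Ex U01 f.
move=> mf.
have mi : mT (fun s : R=> (0 < s < 1)%R%:R : R).
rewrite (_ : (fun _=> _) = \1_`]0, 1[); first mf.
by apply/funext=> s; rewrite indicE mem_setE in_itv.
have m2 : mT (fun s : R=> (0 < s < 1)%R%:R * f s) by mf.
rewrite !Ex_U01// /Rintegral -!(integral_itv_obnd_cbnd (r:= 0));
try by apply: measurable_funTS; apply/mEFinP.
rewrite -!(integral_itv_bndo_bndc (r:= 1)); try by apply: measurable_funTS; apply/mEFinP.
congr fine; apply: eq_integral=> s; rewrite inE /= in_itv /= => s01.
by rewrite s01 mul1r.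
Qed.
Section quantile.
Context {R : realType} (N : prob (measurableTypeR R) R).
Let Phi x:= fine (N `]-oo, x]%classic).
Let Phi_mono x y : x <= y -> Phi x <= Phi y.
move=> xy; apply: fine_le; rewrite ?fin_num_measure//.
by apply: le_measure; rewrite ?inE//; exact: subset_itvl.
Qed.
Let Phi01 x : 0 <= Phi x <= 1.
rewrite fine_ge0//= -[leRHS]/(fine 1); apply: fine_le; rewrite ?fin_num_measure//.
exact: probability_le1.
Qed.
Let Phi_lim (F : nat -> set R) : (forall n, measurable (F n)) -> nondecreasing_seq F ->
fine (N (F n)) @[n --> \oo] --> fine (N (\bigcup_n F n)).
move=> mF ndF; have mU : measurable (\bigcup_n F n) by exact: bigcup_measurable.
apply: fine_cvg; rewrite fineK ?fin_num_measure//.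
exact: nondecreasing_cvg_mu.
Qed.
Let Phi_top u : u < 1 -> exists x, u <= Phi x.
move=> u1; have:= @Phi_lim (fun n=> `]-oo, n%:R]%classic) (fun n=> measurable_itv _) _.
have -> : \bigcup_n `]-oo, n%:R]%classic = [set: R].
apply/seteqP; split=> // x _; exists (Num.truncn x).+1=> //=.
by rewrite in_itv /= ltW// truncnS_gt.
rewrite (@probability_setT _ _ _ N)=> /(_ _)/cvgr_ge/(_ u u1) H.
have [|n _ h]:= H _.
by move=> m n mn; apply/subsetPset; apply: subset_itvl; rewrite bnd_simp ler_nat.
by exists n%:R; apply: (h n)=> /=.
Qed.
Let Phi_bot u : 0 < u -> exists x, Phi x < u.
move=> u0; have:= @Phi_lim (fun n=> `]- n%:R, +oo[%classic) (fun n=> measurable_itv _) _.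
have -> : \bigcup_n `]- n%:R, +oo[%classic = [set: R].
apply/seteqP; split=> // x _; exists (Num.truncn (- x)).+1=> //=.
by rewrite in_itv /= andbT ltrNl truncnS_gt.
have u1 : 1 - u < 1 by lra.
rewrite (@probability_setT _ _ _ N)=> /(_ _)/cvgr_gt/(_ (1 - u) u1) H.
have [|n _ h]:= H _.
by move=> m n mn; apply/subsetPset; apply: subset_itvr; rewrite bnd_simp lerN2 ler_nat.
exists (- n%:R); have:= h n (leqnn n); rewrite -setCitvl probability_setC// fineB ?fin_num_measure//=.
by rewrite -/(Phi _) ltrBlDr addrC -ltrBlDr opprB addrC subrK.
Qed.
(** Generalized inverse of the distribution function; the value is 0 outside ]0, 1[, where the set
    may be empty or unbounded below. *)
Definition quantile (u : R) : R:= if 0 < u < 1 then inf [set x | u <= Phi x] else 0.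
(** The strict inequality turns the infimum into an existence statement, and [seq_lt] into a
    countable one; measurability and the law of [quantile] both come from it. *)
Let quantile_lt u x : 0 < u < 1 -> (quantile u < x) = `[< exists2 y, y < x & u <= Phi y >].
move=> /[dup] u01 /andP[u0 u1]; rewrite /quantile u01.
have ne : [set x | u <= Phi x] !=set0 by have [y uy]:= Phi_top u1; exists y.
have lb : has_lbound [set x | u <= Phi x].
have [y yu]:= Phi_bot u0; exists y=> z /= uz; rewrite leNgt; apply/negP=> zy.
by have:= le_lt_trans (le_trans uz (Phi_mono (ltW zy))) yu; rewrite ltxx.
apply/idP/asboolP=> [ix|[y yx uy]].
have [y uy yx]:= inf_lt ne ix; exists y=> //.
exact: le_lt_trans (ge_inf lb uy) yx.
Qed.
Let seq_lt u x : (exists2 y, y < x & u <= Phi y) <-> exists n : nat, u <= Phi (x - n.+1%:R^-1).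
split=> [[y yx uy]|[n un]]; last first.
by exists (x - n.+1%:R^-1)=> //; rewrite ltrBlDr ltrDl invr_gt0.
exists (Num.truncn (x - y)^-1); apply: le_trans uy (Phi_mono _).
rewrite lerBrDr -lerBrDl -[leRHS]invrK lef_pV2 ?posrE ?invr_gt0 ?subr_gt0//.
exact/ltW/truncnS_gt.
Qed.
Lemma meas_quantile : mT quantile.
have mg : measurable ([set u | 0 < u < 1] : set R).
rewrite (_ : mkset _ = `]0, 1[%classic); first mf.
by [].
apply: (measurability _ (RGenInftyO.measurableE R))=> _ [_ [x ->] <-]; rewrite setTI.
rewrite (_ : _ @^-1` _ = ([set u | 0 < u < 1] `&` \bigcup_n `]-oo, Phi (x - n.+1%:R^-1)]%classic) `|`
 ((~` [set u | 0 < u < 1]) `&` [set _ | 0 < x])).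
apply: measurableU; apply: measurableI=> //.
- by apply: bigcup_measurable=> n _; mf.
- exact: measurableC.
- have [x0|x0]:= boolP (0 < x); first by rewrite (_ : mkset _ = setT)//; apply/seteqP; split.
 by rewrite (_ : mkset _ = set0)//; apply/seteqP; split=> // u; rewrite /= (negbTE x0).
apply/seteqP; split=> u; rewrite /= in_itv /=.
have [u01|u01]:= boolP (0 < u < 1); last by rewrite {1}/quantile (negbTE u01)=> x0; right.
rewrite quantile_lt// => /asboolP/seq_lt[n un]; left; split=> //.
by exists n=> //=; rewrite in_itv.
move=> [[u01 [n _ /=]]|[/negP/negbTE u01 x0]]; last by rewrite /quantile u01.
rewrite in_itv /= => un; rewrite quantile_lt//; apply/asboolP/seq_lt; exists n; exact: un.
Qed.
(** For u in ]0, 1[ the event quantile u < x is the increasing union of the events u <= Phi (x - 1 /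
    (n + 1)), whose probabilities are these values of Phi. *)
Lemma Ex_quantile (f : R -> R) M : mT f -> bdd f M ->
Ex U01 (fun u=> f (quantile u)) = Ex N f.
move=> mf fM.
have mq:= meas_quantile.
have mid : mT (idfun : measurableTypeR R -> R) by mf.
apply: (@Ex_halfline _ _ _ U01 quantile _ _ N idfun mq mid _ f M)=> // x.
have mlt d (T : mType d) (Y : T -> R) c : mT Y -> mT (fun w=> (Y w < c)%R%:R : R).
by move=> mY; apply: meas_bool; exact: mfun_lt.
have mle c : mT (fun w : R=> (w <= c)%R%:R : R).
mf.
have mi : mT (fun s : R=> (0 < s < 1)%R%:R : R).
rewrite (_ : (fun _=> _) = \1_`]0, 1[); first by [].
by apply/funext=> s; rewrite indicE mem_setE in_itv.
pose x_ n:= x - n.+1%:R^-1.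
have x_mono m n : (m <= n)%N -> x_ m <= x_ n.
by move=> mn; rewrite lerD2l lerN2 lef_pV2 ?posrE// ler_nat ltnS.
have c1 : Phi (x_ n) @[n --> \oo] --> Ex N (fun w=> (w < x)%R%:R).
have -> : Ex N (fun w=> (w < x)%R%:R) = fine (N (\bigcup_n `]-oo, x_ n]%classic)).
 rewrite -Ex_indic; last by apply: bigcup_measurable=> n _; mf.
 eqEx=> w; rewrite indicE; congr (nat_of_bool _)%:R.
 apply/idP/idP=> [wx|/set_mem[n _ /=]]; last first.
  by rewrite in_itv /= => /le_lt_trans; apply; rewrite ltrBlDr ltrDl.
 apply/mem_set; exists (Num.truncn (x - w)^-1)=> //=; rewrite in_itv /=.
 rewrite lerBrDr -lerBrDl -[leRHS]invrK lef_pV2 ?posrE ?invr_gt0 ?subr_gt0//.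
 exact/ltW/truncnS_gt.
apply: Phi_lim=> [n|m n mn]; first mf.
by apply/subsetPset; apply: subset_itvl; rewrite bnd_simp x_mono.
have PhiE n : Phi (x_ n) = Ex U01 (fun u=> (0 < u < 1)%R%:R * (u <= Phi (x_ n))%R%:R).
rewrite Ex_U01_oo// -Ex_U01_unitp//.
have /andP[p0 p1]:= Phi01 (x_ n).
rewrite -[LHS]subr0 -Ex_U01_itv//; eqEx=> u; rewrite /unitp -natrM mulnb.
congr (nat_of_bool _)%:R; case: (ltP 0 u)=> //= u0.
lra.
rewrite -Ex_U01_oo; last mf.
apply/esym; apply: (cvg_unique _ c1)=> //.
rewrite (_ : (fun n=> Phi (x_ n)) = fun n=> Ex U01 (fun u=> (0 < u < 1)%R%:R * (u <= Phi (x_ n))%R%:R)); last exact/funext.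
apply: (proj2 (@Ex_dct _ _ _ U01 _ _ (fun=> 1) _ _ _ _)).
- by move=> n; mf.
- move=> u; have [u01|_]:= boolP (0 < u < 1); last first.
 by apply: cvg_near_cst; apply: nearW=> n; rewrite !mul0r.
apply: cvgMl_tmp; rewrite quantile_lt//; case: asboolP=> [/seq_lt[m um]|h]; apply: cvg_near_cst.
 exists m=> // n /= mn; suff -> : u <= Phi (x_ n) by [].
 by apply: le_trans um (Phi_mono (x_mono _ _ mn)).
apply: nearW=> n; case: leP=> // un; exfalso; apply: h; apply/seq_lt; exists n; exact: un.
- exact: L1_cst.
- by move=> n u; rewrite -natrM mulnb; case: (_ && _); rewrite ?normr1 ?normr0.
Qed.
End quantile.

(** * Two independent uniforms from the digits of one *)

Section bits.
Context {R : realType}.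
Definition bit (u : R) : R:= (1 / 2 < u)%R%:R.
Definition bshift (u : R) : R:= 2 * u - bit u.
Lemma meas_bit : mT bit.
by apply: meas_bool; exact: mfun_lt. Qed.
Lemma meas_bshift : mT bshift.
by apply: mfunB; [mf|exact: meas_bit]. Qed.
Let meas_fun_oo : mT (fun s : R=> (0 < s < 1)%R%:R : R).
rewrite (_ : (fun _=> _) = \1_`]0, 1[); first mf.
by apply/funext=> s; rewrite indicE mem_setE in_itv.
Qed.
Lemma Ex_U01_lt (c : R) : Ex U01 (fun u=> (u < c)%R%:R) = clip01 c.
have mi c' : mT (fun u : R=> (u < c')%R%:R : R).
mf.
have /andP[c0 c1]:= clip01_itv c.
rewrite -Ex_U01_oo// Ex_U01; last by apply: mfunM=> //; apply: meas_fun_oo.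
have -> : (fun u : R=> (0 < u < 1)%R%:R * (u < c)%R%:R) = \1_`]0, clip01 c[ :> (R -> R).
apply/funext=> u; rewrite -natrM mulnb indicE mem_setE in_itv /=; congr (nat_of_bool _)%:R.
rewrite /clip01 lt_max lt_min; case: (ltP 0 u)=> //= u0; rewrite ltNge (ltW u0) /=.
by [].
rewrite /Rintegral integral_indic//= setIidl.
by rewrite lebesgue_measure_itv /= lte_fin; case: ltP=> //= h; [rewrite subr0|apply: le_anti; rewrite c0 h].
move=> u /=; rewrite !in_itv /= => /andP[u0 uc].
lra.
Qed.
(** Half the sum of a uniform number and an independent fair bit is uniform again; this is checked
    on half-lines. *)
Lemma Ex_doubling (f : R -> R) M : mT f -> bdd f M ->
Ex U01 f = (Ex U01 (fun u=> f (u / 2)) + Ex U01 (fun u=> f ((u + 1) / 2))) / 2.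
move=> mf fM.
pose Y (p : R * R):= (p.2 + bit p.1) / 2.
have mY : mT Y.
apply: mfunM=> //; apply: mfunD; first mf.
by apply: (mcompT meas_bit); mf.
have mid : mT (idfun : R -> R) by mf.
have split (g : R -> R) K : mT g -> bdd g K ->
 Ex (U01 \x U01)%E (fun p=> g (Y p)) = (Ex U01 (fun u=> g (u / 2)) + Ex U01 (fun u=> g ((u + 1) / 2))) / 2.
move=> mg gK; have mgY : mT (fun p=> g (Y p)) by exact: mcompT.
rewrite (Ex_pair_bd _ _ mgY (fun p=> gK _)).
set g0:= Ex U01 (fun u=> g (u / 2)); set g1:= Ex U01 _.
have -> : (fun v=> Ex U01 (fun u=> g (Y (v, u)))) = fun v=> g1 + (g0 - g1) * (1 - bit v).
 apply/funext=> v; rewrite /Y /bit /=; case: (1 / 2 < v); rewrite ?subrr ?mulr0 ?addr0//.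
 rewrite subr0 mulr1 addrC subrK; eqEx=> u; rewrite addr0//.
have Lb : L1 U01 (fun v : R=> 1 - bit v).
 apply: L1B; first exact: L1_cst.
 by apply: (L1_bd _ meas_bit (M:= 1))=> v; rewrite /bit; case: (_ < _); rewrite ?normr1 ?normr0.
rewrite ExD; [|exact: L1_cst|exact: L1Z]; rewrite Ex_cst ExZ//.
have -> : Ex U01 (fun v : R=> 1 - bit v) = 1 / 2.
 have:= @Ex_U01_itv R 0 (1 / 2) (lexx 0) ltac:(lra) ltac:(lra); rewrite subr0=> <-.
 rewrite -[LHS]Ex_U01_unitp; last first.
  by apply: mfunB=> //; exact: meas_bit.
 eqEx=> v; rewrite /unitp /bit.
 case: (ltP 0 v)=> v0 /=; last by rewrite mul0r.
 case: (leP v (1 / 2))=> v2 /=; last by rewrite subrr mulr0.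
 by rewrite subr0 mulr1 (le_trans v2)//; lra.
by field.
rewrite -(split f M)//.
apply: (@Ex_halfline _ _ _ U01 idfun _ _ (U01 \x U01)%E Y mid mY _ f M)=> // c.
have mlt : mT (fun u : R=> (u < c)%R%:R : R).
mf.
rewrite (split (fun u=> (u < c)%R%:R) 1)//; last by move=> u; case: (u < c); rewrite ?normr1 ?normr0.
have -> : (fun u : R=> (u / 2 < c)%R%:R) = fun u=> (u < 2 * c)%R%:R :> R.
by apply/funext=> u; rewrite ltr_pdivrMr// mulrC.
have -> : (fun u : R=> ((u + 1) / 2 < c)%R%:R) = fun u=> (u < 2 * c - 1)%R%:R :> R.
by apply/funext=> u; rewrite ltr_pdivrMr// mulrC ltrBrDr.
rewrite !Ex_U01_lt /clip01 /Num.max /Num.min.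
by case: (ltP 1 c)=> ?; case: (ltP 1 (2 * c))=> ?; case: (ltP 1 (2 * c - 1))=> ?; do ?case: (ltP 0 _)=> ?; lra.
Qed.
(* [ebits_ N u] is the number whose first N binary digits are the digits
of u of even rank. *)
Fixpoint ebits_ (N : nat) (u : R) : R :=
if N is N'.+1 then (bit u + ebits_ N' (bshift (bshift u))) / 2 else 0.
Lemma bit01 u : 0 <= bit u <= 1.
by rewrite /bit; case: (_ < _); rewrite ?lexx ?ler01. Qed.
Lemma ebits_01 N u : 0 <= ebits_ N u <= 1.
elim: N u=> [|N IH] u /=; first by rewrite lexx ler01.
have:= bit01 u; have:= IH (bshift (bshift u)); lra.
Qed.
Lemma even_bits_nd u : nondecreasing_seq (ebits_ ^~ u).
apply/nondecreasing_seqP=> N; elim: N u=> [|N IH] u.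
by have /andP[]:= ebits_01 1 u.
set v:= bshift (bshift u); have:= IH v.
change (ebits_ N v <= ebits_ N.+1 v -> (bit u + ebits_ N v) / 2 <= (bit u + ebits_ N.+1 v) / 2).
by lra.
Qed.
Definition ebits (u : R) : R:= lim (ebits_ N u @[N --> \oo]).
Definition obits (u : R) : R:= ebits (bshift u).
Lemma cvg_ebits u : ebits_ N u @[N --> \oo] --> ebits u.
apply: nondecreasing_is_cvgn; first exact: even_bits_nd.
by exists 1=> _ [N _ <-]; have /andP[]:= ebits_01 N u.
Qed.
Lemma even_bitsE u : ebits u = (bit u + obits (bshift u)) / 2.
have h : ebits_ N.+1 u @[N --> \oo] --> ebits u by rewrite (cvg_shiftS (ebits_ ^~ u)); exact: cvg_ebits.
apply: (cvg_unique _ h)=> //; apply: cvgMr_tmp; apply: cvgD; [exact: cvg_cst|exact: cvg_ebits].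
Qed.
Lemma ebits01 u : 0 <= ebits u <= 1.
have cu:= @cvg_ebits u; apply/andP; split.
by apply: limr_ge; [exact: cvgP cu|apply: nearW=> N; have /andP[]:= ebits_01 N u].
by apply: limr_le; [exact: cvgP cu|apply: nearW=> N; have /andP[]:= ebits_01 N u].
Qed.
Lemma meas_ebits : mT ebits.
apply: (mfun_cvg (h:= ebits_))=> [N|u _]; last exact: cvg_ebits.
elim: N=> [|N IH] //=; apply: mfunM=> //; apply: mfunD; first exact: meas_bit.
by apply: (mcompT IH); apply: (mcompT meas_bshift); exact: meas_bshift.
Qed.
Lemma meas_obits : mT obits.
exact: (mcompT meas_ebits meas_bshift). Qed.
Let mc b a a' (X X' : R -> R) : mT X -> mT X' ->
mT (fun u=> cos (b + (a * X u + a' * X' u))).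
move=> mX mX'; apply: (mcompT (@meas_cos_R R)).
mf.
Qed.
Let A b a a':= Ex U01 (fun u=> cos (b + (a * ebits u + a' * obits u))).
Let B b a a':= Ex (U01 \x U01)%E (fun p : R * R=> cos (b + (a * p.1 + a' * p.2))).
Let mB b a a' : mT (fun p : R * R=> cos (b + (a * p.1 + a' * p.2))).
apply: (mcompT (@meas_cos_R R)); apply: mfunD=> //.
mf.
Qed.
(** The first digit is a fair coin; removing it exchanges the two digit sequences and halves one
    frequency. [B_step] is the same recursion for an independent pair. *)
Let A_step b a a' : A b a a' = (A b a' (a / 2) + A (b + a / 2) a' (a / 2)) / 2.
rewrite /A (@Ex_doubling _ 1); [|exact: mc meas_ebits meas_obits|by move=> u; exact: cosN1].
have half (d : R) : d = 0 \/ d = 1 -> Ex U01 (fun u=> cos (b + (a * ebits ((u + d) / 2) + a' * obits ((u + d) / 2)))) =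
 Ex U01 (fun u=> cos (b + d * a / 2 + (a' * ebits u + a / 2 * obits u))).
move=> dE.
have mh : mT (fun u : R=> (u + d) / 2) by mf.
transitivity (Ex U01 (fun u=> unitp u * cos (b + (a * ebits ((u + d) / 2) + a' * obits ((u + d) / 2))))).
 by rewrite Ex_U01_unitp//; apply: (mc b a a' (mcompT meas_ebits mh) (mcompT meas_obits mh)).
transitivity (Ex U01 (fun u=> unitp u * cos (b + d * a / 2 + (a' * ebits u + a / 2 * obits u)))); last first.
 by rewrite Ex_U01_unitp//; exact: mc meas_ebits meas_obits.
eqEx=> u; rewrite /unitp; case: (boolP (0 < u <= 1))=> [/andP[u0 u1]|]; rewrite ?mul0r//.
rewrite !mul1r; have bE : bit ((u + d) / 2) = d.
 rewrite /bit; case: dE=> ->; case: ltP=> //; lra.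
have sE : bshift ((u + d) / 2) = u by rewrite /bshift bE; field.
by rewrite even_bitsE bE /obits sE; congr cos; ring.
have:= half 0 (or_introl erefl); have:= half 1 (or_intror erefl).
rewrite mul1r mul0r mul0r addr0=> <-; under eq_fun do rewrite addr0.
by move=> <-.
Qed.
Let B_step b a a' : B b a a' = (B b a' (a / 2) + B (b + a / 2) a' (a / 2)) / 2.
have b1 b' c c' p : `|cos (b' + (c * (p : R * R).1 + c' * p.2))| <= 1 :> R by exact: cosN1.
have split b' c c' : B b' c c' = Ex U01 (fun x=> Ex U01 (fun y=> cos (b' + (c * x + c' * y)))).
exact: (Ex_pair_bd _ _ (mB b' c c') (b1 b' c c')).
have split2 b' c c' : B b' c c' = Ex U01 (fun y=> Ex U01 (fun x=> cos (b' + (c * x + c' * y)))).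
exact: (Ex_pair2_bd _ _ (mB b' c c') (b1 b' c c')).
rewrite split !split2.
have mg b' c c' : mT (fun x : R=> Ex U01 (fun y=> cos (b' + (c * x + c' * y)))).
by have:= meas_Ex U01 (mB b' c c').
have g1 b' c c' (x : R) : `|Ex U01 (fun y : R=> cos (b' + (c * x + c' * y)))| <= 1.
apply: Ex_bd=> [|y]; last exact: cosN1.
mf.
apply: (etrans (Ex_doubling (mg b a a') (g1 b a a'))).
apply: (f_equal2 (fun x y : R=> (x + y) / 2)).
- eqEx=> x; eqEx=> y; by congr cos; field.
- eqEx=> x; eqEx=> y; by congr cos; field.
Qed.
Let K:= Ex U01 (fun u : R=> `|u|).
Let L1id : L1 U01 (fun u : R=> u).
apply: L1_U01; first mf.
apply: continuous_compact_integrable; first exact: segment_compact.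
by apply: continuous_subspaceT=> x; exact: cvg_id.
Qed.
Let near_cos c z : `|Ex U01 (fun u=> cos (c + z * u)) - cos c| <= `|z| * K.
have mu : mT (fun u : R=> cos (c + z * u)).
mf.
have Lu : L1 U01 (fun u=> cos (c + z * u)) by apply: (L1_bd _ mu)=> u; exact: cosN1.
rewrite -[cos c](Ex_cst U01) -ExB//; last exact: L1_cst.
have LB : L1 U01 (fun u=> cos (c + z * u) - cos c) by apply: L1B=> //; exact: L1_cst.
apply: le_trans (Ex_norm LB) _; rewrite -ExZ; last exact: L1_norm.
apply: Ex_le; [exact: L1_norm|by apply: L1Z; exact: L1_norm|].
by move=> u; apply: le_trans (cos_lipschitz _ _) _; rewrite addrAC subrr add0r normrM.
Qed.
Let K0 : 0 <= K. exact: Ex_ge0. Qed.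
(** Two steps of the common recursion halve both frequencies, and at small frequencies both
    transforms are close to cos b. *)
Let AB_le n b a a' : `|A b a a' - B b a a'| <= (`|a| + `|a'|) * (1 + 2 * K) / 2 ^+ n.
elim: n b a a'=> [|n IH] b a a'.
rewrite expr0 divr1.
have mA:= mc b a a' meas_ebits meas_obits.
have LA : L1 U01 (fun u=> cos (b + (a * ebits u + a' * obits u))).
 by apply: (L1_bd _ mA)=> u; exact: cosN1.
have hA : `|A b a a' - cos b| <= `|a| + `|a'|.
 rewrite -[cos b](Ex_cst U01) -ExB//; last exact: L1_cst.
 apply: Ex_bd=> [|u]; first mf.
 apply: le_trans (cos_lipschitz _ _) _; rewrite addrAC subrr add0r.
 apply: le_trans (ler_normD _ _) _; rewrite !normrM.
 have /andP[h1 h2]:= ebits01 u; have /andP[h3 h4]:= ebits01 (bshift u).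
 by rewrite lerD// ler_piMr// ger0N.
have hB : `|B b a a' - cos b| <= `|a| * K + `|a'| * K.
 rewrite /B (Ex_pair_bd _ _ (mB b a a') (fun p=> cosN1 _)).
 set g:= fun x=> Ex U01 _.
 have mg : mT g by exact: (meas_Ex U01 (mB b a a')).
 have g1 x : `|g x| <= 1.
  by apply: Ex_bd=> [|y]; [mf|exact: cosN1].
 have mu : mT (fun u : R=> cos (b + a * u)).
  mf.
 have Lu : L1 U01 (fun u=> cos (b + a * u)) by apply: (L1_bd _ mu)=> u; exact: cosN1.
 rewrite (_ : Ex U01 g - cos b = (Ex U01 (fun u=> cos (b + a * u)) - cos b) + (Ex U01 g - Ex U01 (fun u=> cos (b + a * u)))); last by ring.
 apply: le_trans (ler_normD _ _) _; apply: lerD; first by [].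
 rewrite -ExB//; last exact: L1_bd g1.
 apply: Ex_bd=> [|u]; first mf.
 by have:= near_cos (b + a * u) a'; congr (`|Ex _ _ - _| <= _); apply/funext=> y /=; rewrite addrA.
rewrite (_ : _ - _ = (A b a a' - cos b) - (B b a a' - cos b)); last by ring.
apply: le_trans (ler_normB _ _) _; have : 0 <= (`|a| + `|a'|) * K by rewrite mulr_ge0// addr_ge0.
by lra.
have step b' a1 a2 : `|A b' a1 a2 - B b' a1 a2| <= Num.max (`|A b' a2 (a1 / 2) - B b' a2 (a1 / 2)|)
(`|A (b' + a1 / 2) a2 (a1 / 2) - B (b' + a1 / 2) a2 (a1 / 2)|).
rewrite A_step B_step; set x:= A b' _ _; set y:= B b' _ _; set x':= A _ _ _; set y':= B _ _ _.
rewrite (_ : _ - _ = ((x - y) + (x' - y')) / 2); last by field.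
rewrite normrM (@ger0N _ 2^-1)//; have:= ler_normD (x - y) (x' - y').
have : `|x - y| <= Num.max `|x - y| `|x' - y'| by rewrite le_max lexx.
have : `|x' - y'| <= Num.max `|x - y| `|x' - y'| by rewrite le_max lexx orbT.
lra.
have h b' : `|A b' a' (a / 2) - B b' a' (a / 2)| <= (`|a| + `|a'|) * (1 + 2 * K) / 2 ^+ n.+1.
apply: le_trans (step _ _ _) _; rewrite ge_max.
have e : (`|a / 2| + `|a' / 2|) * (1 + 2 * K) / 2 ^+ n = (`|a| + `|a'|) * (1 + 2 * K) / 2 ^+ n.+1.
 by rewrite !normrM (@ger0N _ 2^-1)// exprS; field; rewrite expf_neq0.
by rewrite -e !IH.
by apply: le_trans (step _ _ _) _; rewrite ge_max !h.
Qed.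
(* The binary digits of even and odd rank of a uniform number form two
independent uniform numbers. *)
Lemma Ex_bits (f : R * R -> R) M : mT f -> bdd f M ->
Ex U01 (fun u=> f (ebits u, obits u)) = Ex U01 (fun x=> Ex U01 (fun y=> f (x, y))).
move=> mf fM; rewrite -(Ex_pair_bd U01 U01 mf fM).
have L2 (X : R -> R) : mT X -> (forall u, 0 <= X u <= 1) -> L1 U01 (fun u=> X u ^+ 2).
move=> mX X01; apply: (L1by 1); first mf.
by move=> u; have /andP[x0 x1]:= X01 u; rewrite ger0N ?sqr_ge0// expr_le1.
have Lsq : L1 U01 (fun u : R=> u ^+ 2).
apply: L1_U01; first mf.
apply: continuous_compact_integrable; first exact: segment_compact.
by apply: continuous_subspaceT=> x; exact: exprn_continuous.
have Lp (g : R * R -> R) : mT g -> (forall p, 0 <= g p) ->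
 (forall x, L1 U01 (fun y=> g (x, y))) -> L1 U01 (fun x=> Ex U01 (fun y=> g (x, y))) ->
 L1 (U01 \x U01)%E g by exact: L1_pair_ge0.
rewrite (_ : Ex (U01 \x U01)%E f = Ex (U01 \x U01)%E (fun p=> f (p.1, p.2))); last by eqEx=> -[].
apply: (@law2_unique _ _ _ U01 ebits obits _ _ (U01 \x U01)%E fst snd _ _ _ _ _ _ _ _ _
f M)=> //.
- exact: meas_ebits.
- exact: meas_obits.
- exact: (L2 _ meas_ebits ebits01).
- exact: (L2 _ meas_obits (fun u=> ebits01 _)).
- apply: Lp.
+ mf.
+ by move=> p; nn.
+ by move=> x; exact: (L1_cst _ (x ^+ 2)).
+ by rewrite /=; under eq_fun do rewrite Ex_cst.
- apply: Lp.
+ mf.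
+ by move=> p; nn.
+ mf.
+ exact: (L1_cst _ (Ex U01 (fun y : R=> y ^+ 2))).
- move=> b a a'; apply/eqP; rewrite -subr_eq0 -normr_le0; apply/ler_addgt0Pr=> e e0; rewrite add0r.
have:= AB_le (Num.truncn ((`|a| + `|a'|) * (1 + 2 * K) / e)).+1 b a a'.
move=> /le_trans; apply; set C:= _ * (1 + _); set n:= Num.truncn _.
have C0 : 0 <= C by rewrite mulr_ge0 ?addr_ge0 ?mulr_ge0.
rewrite ler_pdivr ?exprn_gt0// mulrC -ler_pdivr//.
apply: le_trans (ltW (truncnS_gt _)) _; rewrite -/n -natrX ler_nat.
exact/ltnW/ltn_expl.
Qed.
End bits.

(** * An independent Gaussian sequence and Gaussian moments *)

Section gauss_sequence.
Context {R : realType}.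
(* [gausslaw P Y v]: Y is a centred Gaussian variable of variance v, described by
its characteristic function. *)
Definition gausslaw d (T : mType d) (P : prob T R) (Y : T -> R) (v : R) : Prop :=
forall b a, Ex P (fun w=> cos (b + a * Y w)) = expR (- (a ^+ 2 * v / 2)) * cos b.
Let q : R -> R:= quantile (normal_prob 0 1).
(** One uniform number yields two independent ones: [ebits] becomes a normal variable, and [obits]
    is split again. *)
Fixpoint gseq (i : nat) (u : R) : R:= if i is i'.+1 then gseq i' (obits u) else q (ebits u).
Lemma meas_gseq i : mT (gseq i).
elim: i=> [|i IH]; first exact: (mcompT (meas_quantile _) (@meas_ebits R)).
exact: (mcompT IH (@meas_obits R)).
Qed.
Lemma meas_gsum n (a : nat -> R) : mT (fun u=> \sum_(i < n) a i * gseq i u).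
by apply: msum=> i; apply: mfunM=> //; exact: meas_gseq. Qed.
Lemma gausslaw_gseq n (a : nat -> R) :
gausslaw U01 (fun u=> \sum_(i < n) a i * gseq i u) (\sum_(i < n) a i ^+ 2).
suff H : forall (a : nat -> R) b, Ex U01 (fun u=> cos (b + \sum_(i < n) a i * gseq i u)) =
 expR (- ((\sum_(i < n) a i ^+ 2) / 2)) * cos b.
move=> b c; rewrite (_ : (fun u=> _) = fun u=> cos (b + \sum_(i < n) (c * a i) * gseq i u)).
  rewrite (H (fun i=> c * a i)); congr (expR (- (_ / 2)) * _); rewrite mulr_sumr.
  by apply: eq_bigr=> i _; rewrite exprMn.
 by apply/funext=> u; congr (cos (_ + _)); rewrite mulr_sumr; apply: eq_bigr=> i _; rewrite mulrA.
move=> {}a; elim: n a=> [|n IH] a b.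
 under eq_fun do rewrite big_ord0 addr0.
 by rewrite Ex_cst big_ord0 mul0r oppr0 expR0 mul1r.
pose f (p : R * R):= cos (b + (a 0%N * q p.1 + \sum_(i < n) a i.+1 * gseq i p.2)).
have mf : mT f.
 apply: (mcompT (@meas_cos_R R)); apply: mfunD=> //; apply: mfunD.
  apply: mfunM=> //; apply: (mcompT (meas_quantile _)); mf.
 by apply: (mcompT (meas_gsum n (fun i=> a i.+1))); mf.
have -> : (fun u=> cos (b + \sum_(i < n.+1) a i * gseq i u)) = fun u=> f (ebits u, obits u).
 by apply/funext=> u; rewrite /f big_ord_recl.
rewrite (Ex_bits mf (fun p=> cosN1 _)).
set e:= expR (- ((\sum_(i < n) a i.+1 ^+ 2) / 2)).
have -> : (fun x=> Ex U01 (fun y=> f (x, y))) = fun x=> e * cos (b + a 0%N * q x).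
 by apply/funext=> x; rewrite /f /=; under eq_fun do rewrite addrA; rewrite (IH (fun i=> a i.+1)).
have mc : mT (fun x : R=> cos (b + a 0%N * x)).
 mf.
have mcq:= mcompT mc (meas_quantile (normal_prob 0 1)).
rewrite ExZ; last by apply: (L1_bd _ mcq)=> x; exact: cosN1.
have:= Ex_quantile (normal_prob 0 1) mc (fun x=> cosN1 _); rewrite -/q=> ->.
rewrite (normal_prob_cos ltr01) expr1n mulr1 mulrA -expRD big_ord_recl; congr (expR _ * _).
lra.
Qed.
End gauss_sequence.
Section cos_ineq.
Context {R : realType}.
Lemma normr_sin_le (x : R) : `|sin x| <= `|x|.
by have:= sin_lipschitz x 0; rewrite sin0 !subr0. Qed.
Lemma cos_ge_quadratic (x : R) : 1 - x ^+ 2 / 2 <= cos x.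
have -> : cos x = 1 - 2 * sin (x / 2) ^+ 2.
have {1}-> : x = x / 2 + x / 2 by field.
by rewrite cosD -!expr2 cos2sin2; ring.
have : sin (x / 2) ^+ 2 <= (x / 2) ^+ 2.
by rewrite -(real_normK (num_real (sin _))) -[leRHS](real_normK (num_real _)) lerXn2r ?nnegrE// normr_sin_le.
by rewrite expr_div_n; lra.
Qed.
End cos_ineq.
Section gauss_moments.
Context {R : realType} d (T : mType d) (P : prob T R) (Y : T -> R) (v : R).
Hypotheses (mY : mT Y) (gY : gausslaw P Y v).
Let mcY a : mT (fun w=> cos (a * Y w)).
mf. Qed.
Let LcY a : L1 P (fun w=> cos (a * Y w)).
by apply: (L1_bd _ (mcY a))=> w; exact: cosN1. Qed.
Let EcY a : Ex P (fun w=> cos (a * Y w)) = expR (- (a ^+ 2 * v / 2)).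
by have:= gY 0 a; rewrite cos0 mulr1=> <-; eqEx=> w; rewrite add0r. Qed.
(** A second difference quotient of the cosine at 0: it lies below x^2 and tends to it, so that
    moments can be read off [gausslaw]. *)
Let h n x : R:= 2 * n.+1%:R ^+ 2 * (1 - cos (n.+1%:R^-1 * x)).
Let h_le n x : 0 <= h n x <= x ^+ 2.
rewrite /h; have N0 : (0 : R) < n.+1%:R by rewrite ltr0n.
rewrite mulr_ge0 ?mulr_ge0 ?sqr_ge0 ?subr_ge0 ?cos_le1//=.
rewrite (_ : x ^+ 2 = 2 * n.+1%:R ^+ 2 * ((n.+1%:R^-1 * x) ^+ 2 / 2)); last by field; rewrite gt_eqF.
apply: lerM2l; first mf.
by rewrite lerBlDr addrC -lerBlDr; exact: cos_ge_quadratic.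
Qed.
Let h_cvg x : h n x @[n --> \oo] --> x ^+ 2.
apply/cvgrPdist_le=> e e0; near=> n; rewrite /h.
have N0 : (0 : R) < n.+1%:R by nn.
set y:= n.+1%:R^-1 * x.
have -> : x ^+ 2 - 2 * n.+1%:R ^+ 2 * (1 - cos y) = 2 * n.+1%:R ^+ 2 * (cos y - (1 - y ^+ 2 / 2)).
by rewrite /y; field; rewrite gt_eqF.
rewrite normrM ger0N ?mulr_ge0 ?sqr_ge0//.
apply: le_trans (lerM2l _ (cos_taylor2 y)) _; first mf.
rewrite (_ : _ * y ^+ 4 = 2 * x ^+ 4 / n.+1%:R ^+ 2); last by rewrite /y; field; rewrite gt_eqF.
have x4 : 0 <= 2 * x ^+ 4 by rewrite mulr_ge0// (_ : 4 = 2 * 2)%N// exprM sqr_ge0.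
rewrite ler_pdivr ?exprn_gt0//; apply: (@le_trans _ _ (e * n.+1%:R)); last first.
by apply: lerM2l; [nn|rewrite expr2 ler_peMr ?ler1n// ltW].
rewrite [leRHS]mulrC -ler_pdivr//; near: n; exists (Num.truncn (2 * x ^+ 4 / e))=> // n /= nx.
by apply: ltW; apply: lt_le_trans (truncnS_gt _) _; rewrite ler_nat ltnS.
Unshelve. all: end_near. Qed.
Let mh n : mT (fun w=> h n (Y w)).
by apply: mfunM=> //; mf. Qed.
Let Lh n : L1 P (fun w=> h n (Y w)).
by apply: L1Z; apply: L1B=> //; exact: L1_cst. Qed.
Hypothesis v0 : 0 <= v.
Let one_expRN_le x : 1 - expR (- x) <= x :> R.
by have:= expR_ge1Dx (- x); lra. Qed.
(** Fatou along [h]: with m = n + 1, the expectation 2 m^2 (1 - exp(- v / (2 m^2))) is at most v. *)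
Lemma gausslaw_L2 : L1 P (fun w=> Y w ^+ 2).
apply: (proj1 (@Ex_fatou _ _ _ P (fun n w=> h n (Y w)) _ v _ _ _ _))=> [//|n w|w|n].
- by have /andP[]:= h_le n (Y w).
- exact: h_cvg.
rewrite /h ExZ; last by apply: L1B=> //; exact: L1_cst.
rewrite ExB//; last exact: L1_cst.
rewrite Ex_cst EcY; have N0 : (0 : R) < n.+1%:R by rewrite ltr0n.
apply: le_trans (lerM2l _ (one_expRN_le _)) _; first mf.
by rewrite le_eqVlt; apply/orP; left; apply/eqP; field; rewrite gt_eqF.
Qed.
Lemma gausslaw_var : Ex P (fun w=> Y w ^+ 2) = v.
have [_ c1]:= @Ex_dct _ _ _ P (fun n w=> h n (Y w)) _ _ mh (fun w=> @h_cvg (Y w)) gausslaw_L2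
(fun n w=> ltac:(have /andP[h0 h1]:= h_le n (Y w); by rewrite ger0N)).
apply: (cvg_unique _ c1)=> //.
apply/cvgrPdist_le=> e e0; near=> n.
rewrite /h ExZ; last by apply: L1B=> //; exact: L1_cst.
rewrite ExB//; last exact: L1_cst.
rewrite Ex_cst EcY; have N0 : (0 : R) < n.+1%:R by rewrite ltr0n.
set y:= n.+1%:R^-1 ^+ 2 * v / 2.
have y0 : 0 <= y by rewrite divr_ge0// mulr_ge0// sqr_ge0.
have -> : v - 2 * n.+1%:R ^+ 2 * (1 - expR (- y)) = 2 * n.+1%:R ^+ 2 * (expR (- y) - (1 - y)).
by rewrite /y; field; rewrite gt_eqF.
rewrite normrM ger0N ?mulr_ge0 ?sqr_ge0//.
apply: le_trans (lerM2l _ (expRN_taylor1 y0)) _; first mf.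
rewrite (_ : _ * y ^+ 2 = v ^+ 2 / 2 / n.+1%:R ^+ 2); last by rewrite /y; field; rewrite gt_eqF.
have x4 : 0 <= v ^+ 2 / 2 by nn.
rewrite ler_pdivr ?exprn_gt0//; apply: (@le_trans _ _ (e * n.+1%:R)); last first.
by apply: lerM2l; [nn|rewrite expr2 ler_peMr ?ler1n// ltW].
rewrite [leRHS]mulrC -ler_pdivr//; near: n; exists (Num.truncn (v ^+ 2 / 2 / e))=> // n /= nx.
by apply: ltW; apply: lt_le_trans (truncnS_gt _) _; rewrite ler_nat ltnS.
Unshelve. all: end_near. Qed.
(** Expand the square of [h] by the double angle formula and apply the Taylor bound of the
    exponential. The exact constant is 3; the value 8 is what the first-order bound gives. *)
Lemma gausslaw_pow4 : L1 P (fun w=> Y w ^+ 4) /\ Ex P (fun w=> Y w ^+ 4) <= 8 * v ^+ 2.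
have L2 n : L1 P (fun w=> h n (Y w) ^+ 2).
apply: (L1by ((2 * n.+1%:R ^+ 2 * 2) ^+ 2)); first mf.
move=> w; rewrite normrX lerXn2r ?nnegrE ?mulr_ge0 ?sqr_ge0// /h normrM ger0N ?mulr_ge0 ?sqr_ge0//.
apply: lerM2l; first mf.
by apply: le_trans (ler_normB _ _) _; rewrite normr1 lerD2l cosN1.
apply: (@Ex_fatou _ _ _ P (fun n w=> h n (Y w) ^+ 2))=> //.
- by move=> n w; nn.
- move=> w; rewrite (_ : Y w ^+ 4 = Y w ^+ 2 * Y w ^+ 2); last by rewrite -exprD.
by under eq_fun do rewrite expr2; apply: cvgM; exact: h_cvg.
move=> n; have N0 : (0 : R) < n.+1%:R by rewrite ltr0n.
have Lc2:= LcY (2 * n.+1%:R^-1).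
rewrite (_ : (fun w=> _) = fun w=> (4 * n.+1%:R ^+ 4) * ((3 / 2 - 2 * cos (n.+1%:R^-1 * Y w)) + 2^-1 * cos (2 * n.+1%:R^-1 * Y w))).
rewrite ExZ; last by apply: L1D; [apply: L1B; [exact: L1_cst|exact: L1Z]|exact: L1Z].
rewrite ExD; [|by apply: L1B; [exact: L1_cst|exact: L1Z]|exact: L1Z].
rewrite ExB; [|exact: L1_cst|exact: L1Z].
rewrite Ex_cst !ExZ// !EcY.
set x:= n.+1%:R^-1 ^+ 2 * v / 2.
have -> : (2 * n.+1%:R^-1) ^+ 2 * v / 2 = 4 * x by rewrite /x; field; rewrite gt_eqF.
have x0 : 0 <= x by rewrite divr_ge0// mulr_ge0// sqr_ge0.
have e1:= expR_ge1Dx (- x); have x40 : 0 <= 4 * x by nn.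
have e2:= expRN_taylor1 x40; have e3:= le_trans (ler_norm _) e2.
apply: (@le_trans _ _ (4 * n.+1%:R ^+ 4 * (8 * x ^+ 2))).
 apply: lerM2l; first mf.
 have e4 : (4 * x) ^+ 2 = 16 * x ^+ 2 by ring.
 by rewrite e4 in e3; lra.
by rewrite /x le_eqVlt; apply/orP; left; apply/eqP; field; rewrite gt_eqF.
apply/funext=> w; rewrite /h -mulrA mulrCA; set y:= n.+1%:R^-1 * Y w.
have -> : 2 * n.+1%:R^-1 * Y w = y + y by rewrite /y; ring.
have -> : cos (y + y) = 2 * cos y ^+ 2 - 1.
by rewrite cosD -!expr2 sin2cos2; ring.
by field.
Qed.
End gauss_moments.
Section cos_orthogonal.
Context {R : realType} d (T : mType d) (P : prob T R) (X Y : T -> R).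
Hypotheses (mX : mT X) (LY : L1 P Y).
Variable k : R -> R.
Hypotheses (kN : forall e, k (- e) = k e)
(cosXY : forall b e, Ex P (fun w=> cos (b + (X w + e * Y w))) = k e * cos b).
Let mY:= L1_meas LY.
Let ms : mT (@sin R).
by apply: cont_meas; exact: continuous_sin. Qed.
(* Differentiate [cosXY] at e = 0, where the even function k has derivative 0. *)
Lemma cos_orthogonal b : Ex P (fun w=> cos (b + X w) * Y w) = 0.
suff H b' : Ex P (fun w=> sin (b' + X w) * Y w) = 0.
by rewrite -(H (b + pi / 2)); eqEx=> w; rewrite addrAC sinDpihalf.
have mb c : mT (fun w=> c + X w) by mf.
have me e : mT (fun w=> e * Y w) by mf.
(* The factor m sin(Y / m), with m = n + 1, is dominated by |Y| and tends to Y; by the addition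
   formulas the product is a difference of two cosines as in [cosXY], at e and - e. *)
have mf n : mT (fun w=> sin (b' + X w) * (n.+1%:R * sin (n.+1%:R^-1 * Y w))).
mf.
have cE w : sin (b' + X w) * (n.+1%:R * sin (n.+1%:R^-1 * Y w)) @[n --> \oo] --> sin (b' + X w) * Y w.
apply: cvgMl_tmp; apply/cvgrPdist_le=> e e0; near=> n.
have N0 : (0 : R) < n.+1%:R by nn.
have {1}-> : Y w = n.+1%:R * (n.+1%:R^-1 * Y w) by rewrite mulrA divff ?mul1r// gt_eqF.
rewrite -mulrBr normrM gtr0_norm// distrC.
apply: le_trans (lerM2l (ltW N0) (sin_taylor0 _)) _.
rewrite (_ : _ * _ = Y w ^+ 2 / n.+1%:R); last by field; rewrite gt_eqF.
rewrite ler_pdivr// [leRHS]mulrC -ler_pdivr//; near: n; exists (Num.truncn (Y w ^+ 2 / e))=> // n /= nx.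
by apply: ltW; apply: lt_le_trans (truncnS_gt _) _; rewrite ler_nat ltnS.
have bE n w : `|sin (b' + X w) * (n.+1%:R * sin (n.+1%:R^-1 * Y w))| <= `|Y w|.
rewrite normrM; apply: le_trans (ler_piMl _ (sinN1 _)) _=> //.
rewrite normrM ger0N//; apply: le_trans (lerM2l _ (normr_sin_le _)) _=> //.
by rewrite normrM mulrA ger0N ?invr_ge0// divff ?mul1r// pnatr_eq0.
have [_ c1]:= Ex_dct mf cE (L1_norm LY) bE.
apply: (cvg_unique _ c1)=> //; rewrite (_ : (fun n=> _) = fun=> 0); first exact: cvg_cst.
apply/funext=> n; set e:= n.+1%:R^-1.
have mc e' : mT (fun w=> cos (b' + (X w + e' * Y w))).
apply: (mcompT (@meas_cos_R R)); apply: mfunD=> //; mf.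
have Lc e' : L1 P (fun w=> cos (b' + (X w + e' * Y w))).
by apply: (L1_bd _ (mc e'))=> w; exact: cosN1.
rewrite (_ : (fun w=> _) = fun w=> (- (n.+1%:R / 2)) *
 (cos (b' + (X w + e * Y w)) - cos (b' + (X w + (- e) * Y w)))).
by rewrite ExZ ?ExB ?cosXY ?kN ?subrr ?mulr0//; exact: L1B.
by apply/funext=> w; rewrite !addrA [- e * Y w]mulNr; move: (b' + X w) (e * Y w)=> x y; rewrite cosB cosD; field.
Unshelve. all: end_near. Qed.
End cos_orthogonal.

(** * Dyadic grids *)

Section misc.
Context {R : realType}.
(** Split at |x| = c. With the sum of all fourth powers in place of one of them, it bounds the
    maximum of many increments; chaining uses it at c = rho^L. *)
Lemma norm_le_pow4 (c x : R) : 0 < c -> `|x| <= c + x ^+ 4 / c ^+ 3.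
move=> c0; have [xc|/ltW xc]:= leP `|x| c.
by apply: le_trans xc _; rewrite lerDl; apply: divr_ge0; [exact: exprn_even_ge0|rewrite exprn_ge0// ltW].
apply: (@le_trans _ _ (x ^+ 4 / c ^+ 3)); last by rewrite lerDr ltW.
rewrite ler_pdivlMr ?exprn_gt0// (_ : x ^+ 4 = `|x| * `|x| ^+ 3).
by apply: lerM2l=> //; rewrite lerXn2r ?nnegrE// ltW.
by rewrite -exprS -[RHS]normrX ger0N// exprn_even_ge0.
Qed.
Lemma sum_double (V : nmodType) n (F : nat -> V) :
\sum_(i < (2 * n)%N) F i = \sum_(i < n) (F (2 * i)%N + F (2 * i).+1).
elim: n=> [|n IH]; first by rewrite muln0 !big_ord0.
by rewrite (_ : (2 * n.+1)%N = (2 * n).+2) ?big_ord_recr /= ?IH -?addrA//; lia.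
Qed.
Lemma within01_continuous (f : R -> R) :
(forall x e, 0 <= x <= 1 -> 0 < e -> exists2 dl : R, 0 < dl &
 forall y, 0 <= y <= 1 -> `|x - y| < dl -> `|f x - f y| < e) ->
{within `[0, 1], continuous f}.
move=> key; apply/continuous_within_itvP=> //.
split.
- move=> x; rewrite in_itv /= => /andP[x0 x1]; apply/cvgrPdist_lt=> e e0.
have [|dl dl0 h]:= key x e _ e0; first by rewrite !ltW.
near=> y; apply: h; last by near: y; exact: cvgr_dist_lt.
by apply/andP; split; apply: ltW; near: y; [exact: lt_nbhsr|exact: lt_nbhsl].
- apply/cvgrPdist_lt=> e e0; have [|dl dl0 h]:= key 0 e _ e0; first by rewrite lexx ler01.
near=> y; have y0 : 0 <= y by near: y; exact: nbhs_right_ge.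
apply: h; last by rewrite sub0r normrN ger0N//; near: y; by [].
by rewrite y0 /=; near: y; exact: nbhs_right_le.
- apply/cvgrPdist_lt=> e e0; have [|dl dl0 h]:= key 1 e _ e0; first by rewrite lexx ler01.
near=> y; have y1 : y <= 1 by near: y; exact: nbhs_left_le.
apply: h; first by rewrite y1 andbT; near: y; exact: nbhs_left_ge.
rewrite ger0N ?subr_ge0// ltrBlDr -ltrBlDl; near: y.
by apply: nbhs_left_gt; rewrite ltrBlDr ltrDl.
Unshelve. all: end_near. Qed.
(* The dyadic index of t at level L. *)
Definition dyidx (L : nat) (t : R) : nat:= Num.truncn (2 ^+ L * t).
Lemma dyidx_itv L t : 0 <= t -> (dyidx L t)%:R <= 2 ^+ L * t < (dyidx L t).+1%:R.
by move=> t0; apply: truncn_itv; rewrite mulr_ge0// exprn_ge0. Qed.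
Lemma dyidxS L t : 0 <= t -> dyidx L.+1 t = (2 * dyidx L t)%N \/ dyidx L.+1 t = (2 * dyidx L t).+1.
move=> t0; have /andP[h1 h2]:= dyidx_itv L t0; have /andP[h3 h4]:= dyidx_itv L.+1 t0.
rewrite exprS -mulrA in h3 h4.
have h5 : (2 * dyidx L t < (dyidx L.+1 t).+1)%N.
by rewrite -(ltr_nat R) natrM; apply: le_lt_trans h4; rewrite lerM2l.
have h6 : (dyidx L.+1 t < 2 * (dyidx L t).+1)%N.
by rewrite -(ltr_nat R) natrM; apply: le_lt_trans h3 _; rewrite ltr_pM2l.
lia.
Qed.
Lemma dyidx_le L t : 0 <= t <= 1 -> (dyidx L t <= 2 ^ L)%N.
move=> /andP[t0 t1]; have /andP[h1 _]:= dyidx_itv L t0.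
by rewrite -(ler_nat R) natrX; apply: le_trans h1 _; rewrite ler_piMr// exprn_ge0.
Qed.
Lemma dyidx_near L s t : 0 <= s -> s <= t -> t - s <= (2 ^+ L)^-1 ->
dyidx L t = dyidx L s \/ dyidx L t = (dyidx L s).+1.
move=> s0 st ts; have t0:= le_trans s0 st.
have /andP[h1 h2]:= dyidx_itv L s0; have /andP[h3 h4]:= dyidx_itv L t0.
have p0 : 0 < 2 ^+ L :> R by nn.
have h5 : (dyidx L s < (dyidx L t).+1)%N.
by rewrite -(ltr_nat R); apply: le_lt_trans h1 (le_lt_trans _ h4); rewrite lerM2l// ltW.
have h6 : (dyidx L t < (dyidx L s).+2)%N.
rewrite -(ltr_nat R); apply: le_lt_trans h3 _; rewrite -[(dyidx L s).+2%:R]natr1.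
apply: (@le_lt_trans _ _ (2 ^+ L * s + 1)); last by rewrite ltrD2r.
by rewrite -lerBlDl -mulrBr; apply: le_trans (lerM2l (ltW p0) ts) _; rewrite divff// gt_eqF.
lia.
Qed.
Lemma cvg_dyidx t : 0 <= t -> (2 ^+ L)^-1 * (dyidx L t)%:R @[L --> \oo] --> t.
move=> t0; apply/cvgrPdist_le=> e e0; near=> L.
have p0 : 0 < 2 ^+ L :> R by nn.
have /andP[h1 h2]:= dyidx_itv L t0.
have -> : t - (2 ^+ L)^-1 * (dyidx L t)%:R = (2 ^+ L)^-1 * (2 ^+ L * t - (dyidx L t)%:R).
by rewrite mulrBr mulKf// gt_eqF.
have d0 : 0 <= 2 ^+ L * t - (dyidx L t)%:R by rewrite subr_ge0.
rewrite ger0N; last nn.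
rewrite ler_pdivrMl//; apply: (@le_trans _ _ 1); first lra.
rewrite -ler_pdivr// div1r; near: L; exists (Num.truncn e^-1).+1=> // L /= eL.
apply: ltW; apply: lt_le_trans (truncnS_gt _) _; rewrite -natrX ler_nat.
by apply: leq_trans eL _; exact/ltnW/ltn_expl.
Unshelve. all: end_near. Qed.
End misc.

(** * Brownian motion on [0, 1] *)

Section brownian.
Context {R : realType}.
Let sg (L : nat) : R:= Num.sqrt (2 ^+ L)^-1.
Let sg2 L : sg L ^+ 2 = (2 ^+ L)^-1.
by rewrite sqr_sqrtr// invr_ge0 exprn_ge0. Qed.
(* Increments of the Brownian path over the dyadic intervals of level L, by
midpoint displacement. *)
Fixpoint dincr (L i : nat) (u : R) : R :=
if L is L'.+1 then
 (dincr L' i./2 u + (-1) ^+ odd i * sg L' * gseq (2 ^ L' + i./2) u) / 2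
else gseq 0 u.
Definition dsum L j u : R:= \sum_(i < j) dincr L i u.
Lemma meas_dincr L i : mT (dincr L i).
elim: L i=> [|L IH] i /=; first exact: (@meas_gseq R 0).
apply: mfunM=> //; apply: mfunD=> //; apply: mfunM=> //.
exact: meas_gseq.
Qed.
Lemma meas_dsum L j : mT (dsum L j).
by apply: msum=> i; exact: meas_dincr. Qed.
Lemma dincr_double L i u : dincr L.+1 (2 * i) u + dincr L.+1 (2 * i).+1 u = dincr L i u.
by rewrite /= mul2n doubleK uphalf_double odd_double /=; field. Qed.
Lemma dsum_double L j u : dsum L.+1 (2 * j) u = dsum L j u.
by rewrite /dsum (sum_double j (fun i=> dincr L.+1 i u)); apply: eq_bigr=> i _; exact: dincr_double. Qed.
Lemma gausslaw_dincr L m (c e : nat -> R) :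
gausslaw U01 (fun u=> \sum_(i < (2 ^ L)%N) c i * dincr L i u + \sum_(k < m) e k * gseq (2 ^ L + k) u)
 ((2 ^+ L)^-1 * \sum_(i < (2 ^ L)%N) c i ^+ 2 + \sum_(k < m) e k ^+ 2).
elim: L m c e=> [|L IH] m c e.
have:= gausslaw_gseq m.+1 (fun i=> if i is i'.+1 then e i' else c 0%N).
congr gausslaw; last by rewrite big_ord_recl /= expn0 expr0 invr1 mul1r big_ord1.
by apply/funext=> u; rewrite big_ord_recl expn0 big_ord1.
(* Sibling increments are rewritten by their sum, the increment of level L, and their difference,
   which is [sg L] times a fresh Gaussian variable. *)
pose e' k:= if (k < 2 ^ L)%N then (c (2 * k)%N - c (2 * k).+1) / 2 * sg L else e (k - 2 ^ L)%N.
pose c' i:= (c (2 * i)%N + c (2 * i).+1) / 2.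
have:= IH (2 ^ L + m)%N c' e'; congr gausslaw.
apply/funext=> u; rewrite big_split_ord /= expnS (sum_double _ (fun i=> c i * dincr L.+1 i u)) addrA; congr (_ + _).
 rewrite -big_split /=; apply: eq_bigr=> i _; rewrite /e' ltn_ord /c'.
 by rewrite mul2n doubleK uphalf_double odd_double /=; field.
apply: eq_bigr=> k _; rewrite /e' ltnNge leq_addr /= addKn; congr (_ * gseq _ u).
lia.
rewrite big_split_ord /= expnS (sum_double _ (fun i=> c i ^+ 2)) addrA; congr (_ + _).
rewrite !mulr_sumr -big_split /=; apply: eq_bigr=> i _.
rewrite /e' ltn_ord [(_ * sg L) ^+ 2]exprMn sg2 /c' [2 ^+ L.+1]exprS; field.
by [].
by apply: eq_bigr=> k _; rewrite /e' ltnNge leq_addr /= addKn.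
Qed.
Lemma gausslaw_dincr0 L (c : nat -> R) :
gausslaw U01 (fun u=> \sum_(i < (2 ^ L)%N) c i * dincr L i u) ((2 ^+ L)^-1 * \sum_(i < (2 ^ L)%N) c i ^+ 2).
have:= gausslaw_dincr L 0 c c; rewrite big_ord0 addr0; congr gausslaw.
by apply/funext=> u; rewrite big_ord0 addr0.
Qed.
Lemma dincr_pow4 L i : (i < 2 ^ L)%N ->
L1 U01 (fun u=> dincr L i u ^+ 4) /\ Ex U01 (fun u=> dincr L i u ^+ 4) <= 8 * ((2 ^+ L)^-1) ^+ 2.
move=> iL; apply: gausslaw_pow4; [exact: meas_dincr| |nn].
have:= gausslaw_dincr0 L (fun j=> (j == i)%:R).
have pick (F : nat -> R) : \sum_(j < (2 ^ L)%N) ((j : nat) == i)%:R * F j = F i.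
rewrite (bigD1 (Ordinal iL))//= eqxx mul1r big1 ?addr0// => j /eqP ji.
rewrite (_ : (_ == _) = false) ?mul0r//; apply/eqP=> jE; apply: ji; exact: val_inj.
congr gausslaw; first by apply/funext=> u; exact: (pick (fun j=> dincr L j u)).
rewrite (eq_bigr (fun j : 'I_(2 ^ L)=> ((j : nat) == i)%:R * 1)); first by rewrite (pick (fun=> 1)) mulr1.
by move=> j _; case: eqP; rewrite ?mulr1 ?expr1n ?expr0n.
Qed.
Definition rho : R:= 9 / 10.
Lemma rho_gt0 : 0 < rho. by rewrite /rho; lra. Qed.
Lemma rho_lt1 : rho < 1. by rewrite /rho; lra. Qed.
(* An integrable bound for the increments of level L: since rho^3 > 1/2, the
fourth moments of 2^L increments of variance 2^-L sum to less than rho^(4L). *)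
Definition dmax L u : R:= rho ^+ L + rho ^- (3 * L) * \sum_(i < (2 ^ L)%N) dincr L i u ^+ 4.
Let pow4_ge0 (x : R) : 0 <= x ^+ 4. by rewrite exprn_even_ge0. Qed.
Lemma dmax_ge0 L u : 0 <= dmax L u.
have r0 k : 0 <= rho ^+ k by rewrite exprn_ge0// ltW// rho_gt0.
by rewrite addr_ge0// mulr_ge0 ?invr_ge0//; nn.
Qed.
Lemma dincr_le L i u : (i < 2 ^ L)%N -> `|dincr L i u| <= dmax L u.
move=> iL; have r0 : 0 < rho ^+ L by rewrite exprn_gt0// rho_gt0.
apply: le_trans (norm_le_pow4 _ r0) _; rewrite lerD2l mulrC -exprM mulnC.
apply: lerM2l; first by rewrite invr_ge0 exprn_ge0// ltW// rho_gt0.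
by rewrite (bigD1 (Ordinal iL))//= lerDl; apply: sumr_ge0.
Qed.
Lemma L1_dmax L : L1 U01 (dmax L).
apply: L1D; first exact: L1_cst.
apply: L1Z; rewrite (_ : (fun _=> _) = fun u=> \sum_(i <- index_enum 'I_(2 ^ L)) dincr L i u ^+ 4)//.
by apply: L1_sum=> i; exact: (dincr_pow4 (ltn_ord i)).1.
Qed.
(** An increment of variance 2^-L has fourth moment at most 8 * 4^-L; over 2^L increments this sums
    to 8 * 2^-L, which is at most 8 rho^(4 L) since 2 rho^4 > 1. *)
Lemma Ex_dmax L : Ex U01 (dmax L) <= 9 * rho ^+ L.
have L4 (i : 'I_(2 ^ L)) : L1 U01 (fun u=> dincr L i u ^+ 4):= (dincr_pow4 (ltn_ord i)).1.
have Ls : L1 U01 (fun u=> \sum_(i < (2 ^ L)%N) dincr L i u ^+ 4) by exact: L1_sum.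
have r0:= rho_gt0.
rewrite /dmax ExD; [|exact: L1_cst|exact: L1Z].
rewrite Ex_cst ExZ// Ex_sum//.
rewrite (_ : 9 * _ = rho ^+ L + 8 * rho ^+ L); last by ring.
rewrite lerD2l; apply: (@le_trans _ _ (rho ^- (3 * L) * \sum_(i < (2 ^ L)%N) (8 * ((2 ^+ L)^-1) ^+ 2))).
apply: lerM2l; first nn.
by apply: ler_sum=> i _; exact: (dincr_pow4 (ltn_ord i)).2.
rewrite sumr_const card_ord -[_ *+ _]mulr_natl natrX.
have p0 : 2 ^+ L != 0 :> R by [].
rewrite (_ : 2 ^+ L * _ = 8 * (2 ^+ L)^-1); last by field.
rewrite mulrCA lerM2l// -invfM invf_ple ?posrE ?mulr_gt0 ?exprn_gt0//.
rewrite exprM -!exprMn -exprVn lerXn2r ?nnegrE ?mulr_ge0 ?exprn_ge0 ?invr_ge0 ?ltW//.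
by rewrite /rho; lra.
Qed.
Let rho0 L : 0 <= rho ^+ L. by rewrite exprn_ge0// ltW// rho_gt0. Qed.
(** Finite almost surely, since its mean is at most 9 / (1 - rho) = 90. *)
Definition dtot u : \bar R:= \sum_(L <oo) (dmax L u)%:E.
Definition bgood u : bool:= (dtot u < +oo)%E.
Let mdtot : mT dtot.
apply: ge0_emeasurable_sum=> [L u _ _|L _]; first by rewrite lee_fin dmax_ge0.
by apply/mEFinP; exact: L1_meas (L1_dmax L).
Qed.
Lemma meas_bgood : mT (fun u=> (bgood u)%:R : R).
apply: meas_bool; apply: measurable_fun_lte=> //; mf.
Qed.
Let geom_le n : \sum_(0 <= L < n) rho ^+ L <= 10 :> R.
suff -> : \sum_(0 <= L < n) rho ^+ L = 10 * (1 - rho ^+ n) :> R.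
by have:= rho0 n; lra.
elim: n=> [|n IH]; first by rewrite big_geq// expr0 subrr mulr0.
by rewrite big_nat_recr//= IH exprS /rho; field.
Qed.
Lemma ae_bgood : {ae U01, forall u : R, bgood u}.
have i0 : U01.-integrable setT dtot.
apply/integrableP; split=> //.
rewrite (eq_integral dtot); last first.
 by move=> u _; rewrite gee0_abs//; apply: nneseries_ge0=> L _ _; rewrite lee_fin dmax_ge0.
rewrite integral_nneseries//; last 2 first.
- by move=> L; apply/mEFinP; exact: L1_meas (L1_dmax L).
- by move=> L u _; rewrite lee_fin dmax_ge0.
apply: (@le_lt_trans _ _ (90%:R)%:E); last exact: ltry.
apply: lime_le; first by apply: is_cvg_nneseries=> L _ _; apply: integral_ge0=> u _; rewrite lee_fin dmax_ge0.
apply: nearW=> n; rewrite (eq_bigr (fun L=> (Ex U01 (dmax L))%:E)); last first.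
 by move=> L _; rewrite EFin_Ex//; exact: L1_dmax.
rewrite sumEFin lee_fin; apply: (@le_trans _ _ (\sum_(0 <= L < n) 9 * rho ^+ L)).
 by apply: ler_sum=> L _; exact: Ex_dmax.
by rewrite -mulr_sumr; have:= geom_le n; lra.
have:= integrable_ae measurableT i0; apply: filterS=> u /(_ Logic.I).
by rewrite /bgood fin_numE=> /andP[_]; rewrite ltey.
Qed.
Let dser u n : R:= \sum_(0 <= L < n) dmax L u.
Let dser_cvg u : bgood u -> cvgn (dser u).
move=> gu; have nd : nondecreasing_seq (dser u).
apply/nondecreasing_seqP=> n; rewrite /dser big_nat_recr//= lerDl; exact: dmax_ge0.
apply: nondecreasing_is_cvgn=> //; exists (fine (dtot u))=> _ [n _ <-].
rewrite -lee_fin fineK; last first.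
rewrite ge0_fin_numE//; apply: nneseries_ge0=> L _ _; rewrite lee_fin dmax_ge0//.
rewrite /dser -sumEFin; apply: nneseries_lim_ge=> L _ _; rewrite lee_fin dmax_ge0//.
Qed.
Let path L (t u : R) : R:= dsum L (dyidx L t) u.
Let path_step L t u : 0 <= t <= 1 -> `|path L.+1 t u - path L t u| <= dmax L.+1 u.
move=> /andP[t0 t1]; rewrite /path -(dsum_double L); have [->|E]:= dyidxS L t0.
by rewrite subrr normr0 dmax_ge0.
rewrite E /dsum big_ord_recr addrAC subrr add0r.
apply: dincr_le; rewrite -E; apply: dyidx_le; by rewrite t0.
Qed.
Let path_tail L n t u : 0 <= t <= 1 -> (L <= n)%N ->
`|path n t u - path L t u| <= dser u n.+1 - dser u L.+1.
move=> t01; elim: n=> [|n IH]; first by rewrite leqn0=> /eqP ->; rewrite !subrr normr0.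
rewrite leq_eqVlt=> /predU1P[->|]; first by rewrite !subrr normr0.
rewrite ltnS=> /IH h; rewrite {1}/dser big_nat_recr//= -/(dser u n.+1).
rewrite (_ : path n.+1 t u - path L t u = (path n.+1 t u - path n t u) + (path n t u - path L t u)); last by ring.
by apply: le_trans (ler_normD _ _) _; have:= path_step n u t01; lra.
Qed.
Let dsum_le u n : bgood u -> dser u n <= lim (dser u m @[m --> \oo]).
move=> gu; have cu:= dser_cvg gu; apply: limr_ge=> //; exists n=> // m /= nm.
rewrite /dser (big_cat_nat (leq0n n) nm)//= lerDl; apply: sumr_ge0=> L _; exact: dmax_ge0.
Qed.
Let path_cvg t u : 0 <= t <= 1 -> bgood u -> cvgn (fun L=> path L t u).
move=> t01 gu; apply/cauchy_cvgP/cauchy_exP=> e e0.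
have /cvgrPdist_lt/(_ _ e0)[L _ h] : dser u n.+1 @[n --> \oo] --> lim (dser u n @[n --> \oo]).
by rewrite (cvg_shiftS (dser u)); exact: dser_cvg.
exists (path L t u); exists L=> // n /= Ln.
rewrite /ball /= distrC; apply: le_lt_trans (path_tail u t01 Ln) _.
apply: le_lt_trans _ (h L (leqnn L)); apply: le_trans (ler_norm _).
by rewrite lerD2r dsum_le.
Qed.
(** Set to 0 where the level bounds are not summable, so that every path is continuous, as
    [gaussian_martingale] asks. *)
Definition BM (t u : R) : R:= if bgood u then lim (dsum L (dyidx L t) u @[L --> \oo]) else 0.
(** Twice the tail of the level bounds from L on: an integrable modulus of continuity at scale
    2^-L. *)
Definition BMosc L u : R:= if bgood u then
2 * (lim (\sum_(0 <= l < n) dmax l u @[n --> \oo]) - \sum_(0 <= l < L) dmax l u) else 0.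
Let cvg_BM t u : 0 <= t <= 1 -> bgood u -> path L t u @[L --> \oo] --> BM t u.
by move=> t01 gu; rewrite /BM gu; exact: path_cvg. Qed.
Let BM_path L t u : 0 <= t <= 1 -> bgood u ->
`|BM t u - path L t u| <= lim (dser u n @[n --> \oo]) - dser u L.+1.
move=> t01 gu.
have c1 : `|path n t u - path L t u| @[n --> \oo] --> `|BM t u - path L t u|.
by apply: cvg_norm; apply: cvgB; [exact: cvg_BM|exact: cvg_cst].
rewrite -(cvg_lim _ c1)//; apply: limr_le; first exact: cvgP c1.
exists L=> // n /= Ln; apply: le_trans (path_tail u t01 Ln) _.
by rewrite lerD2r dsum_le.
Qed.
Lemma BM_modulus L s t u : 0 <= s -> s <= t -> t <= 1 -> t - s <= (2 ^+ L)^-1 ->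
`|BM t u - BM s u| <= BMosc L u.
move=> s0 st t1 ts; rewrite /BMosc; case: ifP=> gu; last by rewrite /BM gu subrr normr0.
have h1:= BM_path L (_ : 0 <= t <= 1) gu; have h2:= BM_path L (_ : 0 <= s <= 1) gu.
have {}h1:= h1 ltac:(by lra); have {}h2:= h2 ltac:(by lra).
have h3 : `|path L t u - path L s u| <= dmax L u.
rewrite /path; have [->|E]:= dyidx_near s0 st ts; first by rewrite subrr normr0 dmax_ge0.
rewrite E /dsum big_ord_recr addrAC subrr add0r; apply: dincr_le; rewrite -E.
by apply: dyidx_le; rewrite t1 (le_trans s0).
rewrite (_ : BM t u - BM s u = (BM t u - path L t u) + (path L t u - path L s u) - (BM s u - path L s u)); last by ring.
apply: le_trans (ler_normB _ _) _; apply: le_trans (lerD (ler_normD _ _) (lexx _)) _.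
have:= dmax_ge0 L u; move: h1 h2; rewrite /dser !big_nat_recr//=; lra.
Qed.
Lemma BMosc_ge0 L u : 0 <= BMosc L u.
by rewrite /BMosc; case: ifP=> // gu; rewrite mulr_ge0// subr_ge0 dsum_le. Qed.
Lemma BMosc_cvg u : BMosc L u @[L --> \oo] --> 0.
rewrite /BMosc; case gu: (bgood u); last exact: cvg_cst.
rewrite -[X in _ --> X](mulr0 2); apply: cvgMl_tmp.
rewrite -[X in _ --> X](subrr (lim (dser u n @[n --> \oo]))); apply: cvgB; first exact: cvg_cst.
exact: dser_cvg.
Qed.
(** 180 is the product of the factor 2 in [BMosc], the 9 of [Ex_dmax] and the sum 10 of the
    geometric series of ratio rho. *)
Lemma L1_BMosc L : L1 U01 (BMosc L) /\ Ex U01 (BMosc L) <= 180 * rho ^+ L.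
have ms n : mT (fun u=> \sum_(0 <= l < n) dmax l u).
by apply: msum=> l; exact: L1_meas (L1_dmax l).
have Ls m n : L1 U01 (fun u=> \sum_(m <= l < n) dmax l u) by apply: L1_sum=> l; exact: L1_dmax.
pose f n u:= (bgood u)%:R * (2 * \sum_(L <= l < L + n) dmax l u).
have b0 n u : 0 <= \sum_(L <= l < L + n) dmax l u by apply: sumr_ge0=> l _; exact: dmax_ge0.
have mf n : mT (f n).
by apply: mfunM; [exact: meas_bgood|apply: mfunM=> //; exact: L1_meas (Ls _ _)].
have fle n u : `|f n u| <= 2 * \sum_(L <= l < L + n) dmax l u.
by rewrite /f; case: bgood; rewrite ?mul1r ?mul0r ?normr0 ?ger0N// mulr_ge0.
apply: (@Ex_fatou _ _ _ U01 f)=> [n|n u|u|n].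
- by apply: (L1_le (mf n) (L1Z 2 (Ls L (L + n)%N)))=> u; exact: fle.
- by rewrite /f mulr_ge0// mulr_ge0.
- rewrite /f /BMosc; case gu: (bgood u); last first.
 by rewrite (_ : (fun n=> _) = fun=> 0); [exact: cvg_cst|apply/funext=> n; rewrite mul0r].
have : dser u (n + L)%N - dser u L @[n --> \oo] --> lim (dser u n @[n --> \oo]) - dser u L.
 by apply: cvgB; [rewrite (cvg_shiftn L (dser u)); exact: dser_cvg|exact: cvg_cst].
move=> c1; rewrite (_ : (fun n=> _) = fun n=> 2 * (dser u (n + L)%N - dser u L)); first exact: cvgMl_tmp.
apply/funext=> n; rewrite mul1r /dser [(n + L)%N]addnC (big_cat_nat (leq0n L) (leq_addr n L))//=.
lra.
- apply: (@le_trans _ _ (Ex U01 (fun u=> 2 * \sum_(L <= l < L + n) dmax l u))).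
 apply: Ex_le; [by apply: (L1_le (mf n) (L1Z 2 (Ls L (L + n)%N)))=> u; exact: fle|exact: L1Z|].
 by move=> u; apply: le_trans (fle n u); exact: ler_norm.
rewrite ExZ// Ex_sum; last by move=> l; exact: L1_dmax.
apply: (@le_trans _ _ (2 * \sum_(L <= l < L + n) 9 * rho ^+ l)).
 by apply: lerM2l=> //; apply: ler_sum=> l _; exact: Ex_dmax.
rewrite -{1}[L]add0n big_addn addKn -mulr_sumr.
under eq_bigr do rewrite exprD.
rewrite -mulr_suml; have:= geom_le n; have:= rho0 L; nra.
Qed.
Lemma meas_BM t : 0 <= t <= 1 -> mT (BM t).
move=> t01; apply: (mfun_cvg (h:= fun L u=> (bgood u)%:R * path L t u))=> [L|u _].
by apply: mfunM; [exact: meas_bgood|exact: meas_dsum].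
case gu: (bgood u); last first.
by rewrite /BM gu (_ : (fun n=> _) = fun=> 0); [exact: cvg_cst|apply/funext=> n; rewrite mul0r].
by rewrite (_ : (fun n=> _) = fun L=> path L t u); [exact: cvg_BM|apply/funext=> n; rewrite mul1r].
Qed.
Lemma BM0 u : BM 0 u = 0.
rewrite /BM; case: ifP=> // gu; rewrite (_ : (fun L=> _) = fun=> 0); first exact: lim_cst.
by apply/funext=> L; rewrite /dyidx mulr0 truncn0 /dsum big_ord0.
Qed.
(** At level L the combination is one of dyadic increments, of known variance, and both sides pass
    to the limit. The minimum appears as the number of increments common to two times. *)
Lemma gausslaw_BM (I : finType) (a t : I -> R) : (forall i, 0 <= t i <= 1) ->
gausslaw U01 (fun u=> \sum_i a i * BM (t i) u) (\sum_i \sum_j a i * a j * Num.min (t i) (t j)).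
move=> t01 b c.
pose S L u:= \sum_i a i * path L (t i) u.
pose coef L (k : nat) : R:= \sum_i a i * (k < dyidx L (t i))%N%:R.
pose vL L:= (2 ^+ L)^-1 * \sum_(k < (2 ^ L)%N) coef L k ^+ 2.
have SE L u : S L u = \sum_(k < (2 ^ L)%N) coef L k * dincr L k u.
rewrite /S /coef; under [RHS]eq_bigr do rewrite mulr_suml.
rewrite exchange_big /=; apply: eq_bigr=> i _; under [RHS]eq_bigr do rewrite -mulrA.
rewrite -mulr_sumr; congr (_ * _); rewrite /path /dsum.
rewrite (big_ord_widen _ (fun k=> dincr L k u) (dyidx_le L (t01 i))) big_mkcond /=.
by apply: eq_bigr=> k _; case: ifP; rewrite ?mul1r ?mul0r.
have gS L : Ex U01 (fun u=> cos (b + c * S L u)) = expR (- (c ^+ 2 * vL L / 2)) * cos b.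
by under eq_fun do rewrite SE; exact: gausslaw_dincr0.
have mS L : mT (S L).
by apply: msum=> i; apply: mfunM=> //; exact: meas_dsum.
have mB : mT (fun u=> \sum_i a i * BM (t i) u).
by apply: msum=> i; apply: mfunM=> //; exact: meas_BM.
have maff (f : R -> R) : mT f -> mT (fun u=> cos (b + c * f u)).
by move=> mf; apply: (mcompT (@meas_cos_R R)); apply: mfunD=> //; mf.
have mg L : mT (fun u=> (bgood u)%:R * S L u).
by apply: mfunM=> //; exact: meas_bgood.
have c1 u : cos (b + c * ((bgood u)%:R * S L u)) @[L --> \oo] --> cos (b + c * \sum_i a i * BM (t i) u).
apply: (cvg_comp (fun L=> b + c * ((bgood u)%:R * S L u)) cos); last exact: continuous_cos.
apply: cvgD; first exact: cvg_cst.
apply: cvgMl_tmp; case gu: (bgood u); last first.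
 rewrite big1; last by move=> i _; rewrite /BM gu mulr0.
 by rewrite (_ : (fun n=> _) = fun=> 0); [exact: cvg_cst|apply/funext=> n; rewrite mul0r].
rewrite (_ : (fun n=> _) = fun L=> S L u); last by apply/funext=> n; rewrite mul1r.
rewrite /S; have:= @cvg_sum_seq R nat \oo _ I (index_enum I) (fun i L=> a i * path L (t i) u) (fun i=> a i * BM (t i) u).
by apply=> i; apply: cvgMl_tmp; apply: cvg_BM.
have [_ c2]:= @Ex_dct _ _ _ U01 (fun L u=> cos (b + c * ((bgood u)%:R * S L u))) _ (fun=> 1)
(fun L=> maff _ (mg L)) c1 (L1_cst _ 1) (fun L u=> cosN1 _).
apply: (cvg_unique _ c2)=> //.
have -> : (fun L=> Ex U01 (fun u=> cos (b + c * ((bgood u)%:R * S L u)))) = fun L=> expR (- (c ^+ 2 * vL L / 2)) * cos b.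
apply/funext=> L; rewrite -gS; apply: Ex_ae; [mf|exact: maff|].
by apply: filterS ae_bgood=> u ->; rewrite mul1r.
apply: cvgMr_tmp; apply: (cvg_comp (fun L=> - (c ^+ 2 * vL L / 2)) expR); last exact: continuous_expR.
apply: cvgN; apply: cvgMr_tmp; apply: cvgMl_tmp.
have -> : vL = fun L=> \sum_i \sum_j a i * a j * Num.min ((2 ^+ L)^-1 * (dyidx L (t i))%:R) ((2 ^+ L)^-1 * (dyidx L (t j))%:R).
apply/funext=> L; rewrite /vL /coef.
have p0 : 0 <= (2 ^+ L)^-1 :> R by nn.
transitivity ((2 ^+ L)^-1 * \sum_(k < (2 ^ L)%N) \sum_i \sum_j a i * a j * (k < minn (dyidx L (t i)) (dyidx L (t j)))%N%:R).
 congr (_ * _); apply: eq_bigr=> k _; rewrite expr2 mulr_suml; apply: eq_bigr=> i _.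
 rewrite mulr_sumr; apply: eq_bigr=> j _; rewrite leq_min -mulnb natrM; ring.
rewrite exchange_big mulr_sumr; apply: eq_bigr=> i _.
rewrite exchange_big mulr_sumr; apply: eq_bigr=> j _.
rewrite -mulr_sumr mulrCA -minr_pMr//; congr (_ * (_ * _)).
have m1 : (minn (dyidx L (t i)) (dyidx L (t j)) <= 2 ^ L)%N by rewrite geq_min dyidx_le.
have cnt m : (m <= 2 ^ L)%N -> \sum_(k < (2 ^ L)%N) (k < m)%N%:R = m%:R :> R.
 move=> mL; have:= @big_ord_widen R 0 +%R m (2 ^ L)%N (fun=> 1 : R) mL.
 rewrite sumr_const card_ord big_mkcond /= => ->.
 by apply: eq_bigr=> k _; case: ifP.
rewrite cnt//; case: (leqP (dyidx L (t i)) (dyidx L (t j)))=> h.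
 by rewrite min_l// ler_nat.
by rewrite min_r// ler_nat ltnW.
apply: cvg_sum_seq=> i; apply: cvg_sum_seq=> j; apply: cvgMl_tmp.
have /andP[ti0 _]:= t01 i; have /andP[tj0 _]:= t01 j.
have minE (x y : R) : Num.min x y = (x + y - `|x - y|) / 2.
by case: (leP x y)=> xy; [rewrite ler0_norm ?subr_le0//|rewrite gtr0_norm ?subr_gt0//]; lra.
under eq_fun do rewrite minE; rewrite minE; apply: cvgMr_tmp.
by apply: cvgB; [apply: cvgD|apply: cvg_norm; apply: cvgB]; exact: cvg_dyidx.
Qed.
End brownian.

(** * The Gaussian martingale with a given variance function *)

Section gaussian_martingale.
Context {R : realType} (V : R -> R) (kappa : R).
Hypotheses (kappa0 : 0 < kappa) (V0 : V 0 = 0)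
(Vincr : forall s t, 0 <= s -> s <= t -> t <= 1 -> 0 <= V t - V s <= kappa * (t - s)).
(** Dividing by the Lipschitz constant of V keeps the clock in [0, 1] and lets the modulus of
    continuity of [BM] apply at the same dyadic scale. *)
Definition gmart (t u : R) : R:= Num.sqrt kappa * BM (V t / kappa) u.
Let Vmono s t : 0 <= s -> s <= t -> t <= 1 -> V s <= V t.
by move=> s0 st t1; have /andP[+ _]:= Vincr s0 st t1; rewrite subr_ge0. Qed.
Let V01 t : 0 <= t <= 1 -> 0 <= V t / kappa <= 1.
move=> /andP[t0 t1]; have /andP[]:= Vincr (lexx 0) t0 t1; rewrite V0 !subr0=> h1 h2.
apply/andP; split; first by rewrite divr_ge0// ltW.
by rewrite ler_pdivr// mul1r (le_trans h2)// ler_piMr// ltW.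
Qed.
Lemma gmart_modulus L s t u : 0 <= s -> s <= t -> t <= 1 -> t - s <= (2 ^+ L)^-1 ->
`|gmart t u - gmart s u| <= Num.sqrt kappa * BMosc L u.
move=> s0 st t1 ts; rewrite -mulrBr normrM ger0N ?sqrtr_ge0//; apply: lerM2l=> //.
have t01 : 0 <= t <= 1 by rewrite t1 (le_trans s0). have s01 : 0 <= s <= 1 by rewrite s0 (le_trans st).
have /andP[h1 h2]:= V01 t01; have /andP[h3 h4]:= V01 s01; have /andP[h5 h6]:= Vincr s0 st t1.
apply: BM_modulus=> //; first by rewrite ler_pM2r ?invr_gt0// Vmono.
by apply: le_trans _ ts; rewrite -mulrBl ler_pdivr// mulrC.
Qed.
Lemma meas_gmart t : 0 <= t <= 1 -> mT (gmart t).
by move=> t01; apply: mfunM=> //; apply: meas_BM; exact: V01. Qed.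
Lemma gmart0 u : gmart 0 u = 0.
by rewrite /gmart V0 mul0r BM0 mulr0. Qed.
Lemma continuous_gmart u : {within `[0, 1], continuous (gmart ^~ u)}.
apply: within01_continuous=> x e /andP[x0 x1] e0.
have c : Num.sqrt kappa * BMosc L u @[L --> \oo] --> 0.
by rewrite -[X in _ --> X](mulr0 (Num.sqrt kappa)); apply: cvgMl_tmp; exact: BMosc_cvg.
have /cvgrPdist_lt/(_ _ e0)[L _ h]:= c.
exists (2 ^+ L)^-1; first by rewrite invr_gt0 exprn_gt0.
move=> y /andP[y0 y1] xy; have:= h L (leqnn L); rewrite sub0r normrN ger0N; last first.
by rewrite mulr_ge0 ?sqrtr_ge0 ?BMosc_ge0.
apply: le_lt_trans; have [yx|/ltW xy']:= leP y x.
by apply: gmart_modulus=> //; apply: ltW; apply: le_lt_trans (ler_norm _) xy.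
by rewrite distrC; apply: gmart_modulus=> //; apply: ltW; apply: le_lt_trans (ler_norm _) _; rewrite distrC.
Qed.
Lemma gausslaw_gmart (I : finType) (a t : I -> R) : (forall i, 0 <= t i <= 1) ->
gausslaw U01 (fun u=> \sum_i a i * gmart (t i) u) (\sum_i \sum_j a i * a j * V (Num.min (t i) (t j))).
move=> t01; have:= gausslaw_BM (fun i=> a i * Num.sqrt kappa) (fun i=> V01 (t01 i)); congr gausslaw.
by apply/funext=> u; apply: eq_bigr=> i _; rewrite /gmart mulrA.
apply: eq_bigr=> i _; apply: eq_bigr=> j _.
have /andP[i0 i1]:= t01 i; have /andP[j0 j1]:= t01 j.
have -> : Num.min (V (t i) / kappa) (V (t j) / kappa) = V (Num.min (t i) (t j)) / kappa.
case: (leP (t i) (t j))=> h; first by rewrite min_l// ler_pM2r ?invr_gt0// Vmono.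
by rewrite min_r// ler_pM2r ?invr_gt0// Vmono// ltW.
transitivity (a i * a j * (Num.sqrt kappa ^+ 2) * (V (Num.min (t i) (t j)) / kappa)); first by ring.
by rewrite sqr_sqrtr ?ltW//; field; rewrite gt_eqF.
Qed.
Let gauss1 t : 0 <= t <= 1 -> gausslaw U01 (gmart t) (V t).
move=> t01; have:= @gausslaw_gmart 'I_1 (fun=> 1) (fun=> t) (fun=> t01); rewrite !big_ord1 mul1r mul1r minxx.
by congr gausslaw; apply/funext=> u; rewrite big_ord1 mul1r.
Qed.
Let V_ge0 t : 0 <= t <= 1 -> 0 <= V t.
by move=> /andP[t0 t1]; rewrite -V0; exact: Vmono. Qed.
Let L2 t : 0 <= t <= 1 -> L1 U01 (fun u=> gmart t u ^+ 2).
by move=> t01; exact: (gausslaw_L2 (meas_gmart t01) (gauss1 t01)). Qed.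
Let L4 t : 0 <= t <= 1 -> L1 U01 (fun u=> gmart t u ^+ 4).
by move=> t01; exact: (gausslaw_pow4 (meas_gmart t01) (gauss1 t01) (V_ge0 t01)).1. Qed.
Lemma L1_gmart t : 0 <= t <= 1 -> L1 U01 (gmart t).
move=> t01; apply: (L1le (fun u=> 1 + gmart t u ^+ 2)); first exact: meas_gmart.
by apply: L1D; [exact: L1_cst|exact: L2].
move=> u; rewrite -(real_normK (num_real (gmart t u))).
by have:= sqr_ge0 (`|gmart t u| - 1 / 2); rewrite !expr2; lra.
Qed.
(** The value at a = 1 shows that the variance is nonnegative. Variance 0 is the degenerate case;
    otherwise the law is compared with [normal_prob] by [law2_unique], with 0 as second
    coordinate. *)
Lemma normal_rv_gausslaw (Y : R -> R) v : mT Y -> gausslaw U01 Y v -> normal_rv U01 Y.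
move=> mY gY; have v0 : 0 <= v.
have mc : mT (fun u=> cos (0 + 1 * Y u)).
 by apply: (mcompT (@meas_cos_R R)); apply: mfunD=> //; exact: mfunM.
have:= Ex_bd U01 mc (fun u=> cosN1 _); rewrite gY cos0 mulr1 expr1n mul1r ger0N ?expR_ge0//.
by rewrite -[leRHS]expR0 ler_expR; lra.
have LY:= gausslaw_L2 mY gY; have VY:= gausslaw_var mY gY v0.
split=> //; exists 0; move: v0; rewrite le_eqVlt=> /predU1P[vE|v0]; [left|right].
have:= Ex_eq0 LY (fun u=> sqr_ge0 _) (etrans VY (esym vE)).
by apply: filterS=> u /eqP; rewrite sqrf_eq0=> /eqP.
have s0 : 0 < Num.sqrt v by rewrite sqrtr_gt0.
exists (Num.sqrt v)=> // A mA; pose N : prob (measurableTypeR R) R:= normal_prob 0 (Num.sqrt v).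
have mid : mT (idfun : measurableTypeR R -> R) by exact: measurable_id.
have gN : gausslaw N (idfun : measurableTypeR R -> R) v.
by move=> b a; have:= normal_prob_cos s0 b a; rewrite sqr_sqrtr// ltW.
have LN:= gausslaw_L2 mid gN.
have mf : mT (fun p : R * R=> \1_A p.1 : R).
have mI : mT (\1_A : R -> R) by exact: mindic.
by apply: (mcompT mI); exact: mfst.
have f1 (p : R * R) : `|\1_A p.1 : R| <= 1 by exact: indic_le1.
have m0 d (T : mType d) : mT (fun _ : T=> 0 : R) by exact: mcst.
have L0 d (T : mType d) (P : prob T R) : L1 P (fun _ : T=> (0 : R) ^+ 2) by exact: L1_cst.
have:= law2_unique mY (m0 _ _) mid (m0 _ _) LY (L0 _ _ _) LN (L0 _ _ _) _ mf f1.
have mYA : measurable (Y @^-1` A) by rewrite -[X in measurable X]setTI; exact: mY.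
move=> /= H; have {}H : Ex U01 (\1_(Y @^-1` A) : R -> R) = Ex N \1_A.
by apply: H=> b a a'; under eq_fun do rewrite mulr0 addr0; under [in RHS]eq_fun do rewrite mulr0 addr0; rewrite gY gN.
move: H; rewrite !Ex_indic// => H.
by rewrite -[LHS]fineK ?fin_num_measure// H fineK// fin_num_measure.
Qed.
Section orthogonal.
Variables (k : nat) (tau a : 'I_k -> R) (s t : R).
Hypotheses (s0 : 0 <= s) (st : s <= t) (t1 : t <= 1) (taus : forall i, 0 <= tau i <= s).
Let t01 : 0 <= t <= 1. by rewrite t1 (le_trans s0). Qed.
Let s01 : 0 <= s <= 1. by rewrite s0 (le_trans st). Qed.
Let tau01 i : 0 <= tau i <= 1.
by have /andP[-> h]:= taus i; rewrite (le_trans h)//; have /andP[]:= s01. Qed.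
(** [gmart t] and [gmart s] have the same covariances with the past, so the variance of past + e *
    increment depends on e through e^2 only, and [cos_orthogonal] applies. *)
Lemma gmart_orthogonal b :
Ex U01 (fun u=> cos (b + \sum_i a i * gmart (tau i) u) * (gmart t u - gmart s u)) = 0.
pose vX:= \sum_i \sum_j a i * a j * V (Num.min (tau i) (tau j)).
apply: (@cos_orthogonal _ _ _ U01 (fun u=> \sum_i a i * gmart (tau i) u) (fun u=> gmart t u - gmart s u) _ _
(fun e=> expR (- ((vX + e ^+ 2 * (V t - V s)) / 2)))).
- by apply: msum=> i; apply: mfunM=> //; exact: meas_gmart.
- by apply: L1B; exact: L1_gmart.
- by move=> e; rewrite sqrrN.
move=> b' e; pose tt (i : 'I_k + bool):= match i with inl i=> tau i | inr c=> if c then t else s end.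
pose aa (i : 'I_k + bool):= match i with inl i=> a i | inr c=> if c then e else - e end.
have tt01 i : 0 <= tt i <= 1 by case: i=> [i|[]] /=.
have:= @gausslaw_gmart _ aa tt tt01 b' 1.
have -> : (fun w=> cos (b' + 1 * \sum_i aa i * gmart (tt i) w)) =
 fun w=> cos (b' + (\sum_i a i * gmart (tau i) w + e * (gmart t w - gmart s w))).
by apply/funext=> w; rewrite big_sumType /= big_bool /=; congr cos; ring.
move=> ->; congr (expR (- (_ / 2)) * _); rewrite expr1n mul1r big_sumType /= big_bool /=.
have -> : \sum_i \sum_j a i * aa j * V (Num.min (tau i) (tt j)) = vX.
rewrite /vX; apply: eq_bigr=> i _; rewrite big_sumType /= big_bool /=.
have /andP[_ h]:= taus i; rewrite !min_l ?(le_trans h st)//; ring.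
rewrite !big_sumType /= !big_bool /= !minxx (min_r st) (min_l st).
have E c : \sum_i c * a i * V (Num.min t (tau i)) = \sum_i c * a i * V (Num.min s (tau i)).
by apply: eq_bigr=> i _; have /andP[_ h]:= taus i; rewrite !min_r ?(le_trans h st).
rewrite E; have -> : \sum_i - e * a i * V (Num.min s (tau i)) = - \sum_i e * a i * V (Num.min s (tau i)).
by rewrite -sumrN; apply: eq_bigr=> i _; ring.
ring.
Qed.
End orthogonal.
Let pow_le (x y : R) : `|x ^+ 2 * y| <= x ^+ 4 + y ^+ 2.
rewrite normrM ger0N ?sqr_ge0// (_ : x ^+ 4 = (x ^+ 2) ^+ 2); last by rewrite -exprM.
rewrite -(real_normK (num_real y)); move: (x ^+ 2) (sqr_ge0 x) `|y| (normr_ge0 y)=> a a0 c c0.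
by have:= sqr_ge0 (a - c); rewrite sqrrB; nra.
Qed.
(** [trig_unique] with the increment as signed weight, against the weight 0. *)
Lemma gmart_box k (tau c : 'I_k -> R) s t : 0 <= s -> s <= t -> t <= 1 -> (forall i, 0 <= tau i <= s) ->
Ex U01 (fun u=> [forall i, gmart (tau i) u < c i]%:R * (gmart t u - gmart s u)) = 0.
move=> s0 st t1 taus; have t01 : 0 <= t <= 1 by rewrite t1 (le_trans s0).
have s01 : 0 <= s <= 1 by rewrite s0 (le_trans st).
have tau01 i : 0 <= tau i <= 1 by have /andP[-> h]:= taus i; rewrite (le_trans h)//; have /andP[]:= s01.
have LY : L1 U01 (fun u=> gmart t u - gmart s u) by apply: L1B; exact: L1_gmart.
have mg i:= meas_gmart (tau01 i).
have LY2 : L1 U01 (fun u=> (gmart t u - gmart s u) ^+ 2).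
apply: (L1le (fun u=> 2 * gmart t u ^+ 2 + 2 * gmart s u ^+ 2)).
- by apply: mfunX; exact: L1_meas LY.
- by apply: L1D; apply: L1Z; exact: L2.
- by move=> u; rewrite ger0N ?sqr_ge0//; have:= sqr_ge0 (gmart t u + gmart s u); rewrite sqrrD sqrrB; lra.
rewrite (@trig_unique R 'I_k _ _ U01 (fun i=> gmart (tau i)) (fun u=> gmart t u - gmart s u) _ _ U01
(fun i=> gmart (tau i)) (fun=> 0))//.
- by under eq_fun do rewrite mulr0; rewrite Ex_cst.
- exact: L1_cst.
- move=> i; apply: (L1le (fun u=> gmart (tau i) u ^+ 4 + (gmart t u - gmart s u) ^+ 2)).
+ by apply: mfunM; [exact: mfunX|exact: L1_meas LY].
+ by apply: L1D=> //; exact: L4.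
+ by move=> u; exact: pow_le.
- by move=> i; under eq_fun do rewrite mulr0; exact: L1_cst.
- move=> a b; rewrite gmart_orthogonal// -[LHS](Ex_cst U01); eqEx=> u; by rewrite mulr0.
Qed.
Let nat_filt_sub s : 0 <= s <= 1 -> natural_filtration gmart s `<=` measurable.
move=> /andP[s0 s1]; apply: smallest_sub; first exact: sigma_algebra_measurable.
move=> _ [r /= + [B mB <-]]; rewrite in_itv /= => /andP[r0 rs].
by apply: meas_gmart=> //; rewrite r0 (le_trans rs).
Qed.
(** Boxes over finitely many past times form a pi-system that generates the natural filtration. *)
Lemma gmart_increment s t A : 0 <= s -> s <= t -> t <= 1 -> natural_filtration gmart s A ->
Ex U01 (fun u=> \1_A u * (gmart t u - gmart s u)) = 0.
move=> s0 st t1 sA; have t01 : 0 <= t <= 1 by rewrite t1 (le_trans s0).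
have s01 : 0 <= s <= 1 by rewrite s0 (le_trans st).
have LY : L1 U01 (fun u=> gmart t u - gmart s u) by apply: L1B; exact: L1_gmart.
pose G : set (set R):= [set A | exists k (tau c : 'I_k -> R), (forall i, 0 <= tau i <= s) /\
A = [set u | [forall i, gmart (tau i) u < c i]]].
have Gsub B : G B -> natural_filtration gmart s B.
move=> [k [tau [c [taus ->]]]].
rewrite (_ : mkset _ = \bigcap_(i in [set: 'I_k]) (gmart (tau i) @^-1` `]-oo, c i[%classic)).
 apply: (@fin_bigcap_measurable _ (sigmaT _))=> [|i _].
  exact: finite_finset.
 apply: sub_sig; exists (tau i); first by rewrite /= in_itv /= taus.
 by exists `]-oo, c i[%classic=> //; rewrite setTI.
apply/seteqP; split=> u /=; first by move=> /forallP h i _ /=; rewrite in_itv /=.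
by move=> h; apply/forallP=> i; have:= h i Logic.I; rewrite /= in_itv.
have subG : natural_filtration gmart s `<=` <<s G >>.
apply: smallest_sub; first exact: smallest_sigma_algebra.
move=> _ [r /= + [B mB <-]]; rewrite in_itv /= => /andP[r0 rs].
have mr : mT (gmart r : sigmaT G -> R).
 apply: (measurability _ (RGenInftyO.measurableE R))=> _ [_ [x ->] <-].
 apply: sub_sig; exists 1%N, (fun=> r), (fun=> x); split; first by move=> _; rewrite r0.
 rewrite setTI; apply/seteqP; split=> u /=; rewrite in_itv /=.
  by move=> h; apply/forallP.
 by move=> /forallP/(_ ord0).
by have:= mr measurableT B mB; rewrite setTI.
have mG B : G B -> measurable B by move=> /Gsub; exact: nat_filt_sub.
have z (f : R -> R) : Ex U01 (fun u=> f u * 0) = 0.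
by rewrite -[RHS](Ex_cst U01 0); eqEx=> u; rewrite mulr0.
rewrite -[RHS](z \1_A); apply: (@Ex_pi_weight _ _ _ U01 _ _ U01 _ G id id _ (fun=> 0) _ mG mG LY _ _ _ _ 1).
- move=> _ _ [k [tau [c [taus ->]]]] [k' [tau' [c' [taus' ->]]]].
(* The intersection of two boxes is a box over the concatenated times. *)
pose mix T (x : 'I_k -> T) (x' : 'I_k' -> T) (i : 'I_(k + k')):= match fintype.split i with inl j=> x j | inr j=> x' j end.
exists (k + k')%N, (mix _ tau tau'), (mix _ c c'); split; first by move=> i; rewrite /mix; case: fintype.split.
apply/seteqP; split=> u /=.
 by move=> [/forallP h /forallP h']; apply/forallP=> i; rewrite /mix; case: fintype.split.
move=> /forallP h; split; apply/forallP=> i.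
 by have:= h (lshift k' i); rewrite /mix (unsplitK (inl i)).
by have:= h (rshift k i); rewrite /mix (unsplitK (inr i)).
- exact: L1_cst.
- rewrite Ex_cst; have:= @gmart_box 0 (fun=> 0) (fun=> 0) s t s0 st t1; move=> <-; last by case.
by eqEx=> u; rewrite (_ : [forall i, _]) ?mul1r//; apply/forallP=> -[].
- move=> _ [k [tau [c [taus ->]]]]; rewrite z -(gmart_box c s0 st t1 taus); eqEx=> u; congr (_ * _).
rewrite indicE; congr (nat_of_bool _)%:R; by apply/idP/idP=> [/set_mem|/mem_set].
- by apply: mindic; exact: subG.
- by move=> u; exact: indic_le1.
Qed.
Lemma gmart_gaussian_martingale : gaussian_martingale U01 V gmart.
split.
- exact: continuous_gmart.
- move=> k t a t01; apply: (@normal_rv_gausslaw _ (\sum_i \sum_j a i * a j * V (Num.min (t i) (t j)))).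
 by apply: msum=> i; apply: mfunM=> //; exact: meas_gmart.
exact: gausslaw_gmart.
- move=> s t s0 st t1; have t01 : 0 <= t <= 1 by rewrite t1 (le_trans s0).
have s01 : 0 <= s <= 1 by rewrite s0 (le_trans st).
have Lt:= L1_gmart t01; have Ls:= L1_gmart s01; split=> //.
 move=> _ [B mB <-]; rewrite setTI; apply: sub_sig.
 by exists s; [rewrite /= in_itv /= s0 lexx|exists B=> //; rewrite setTI].
move=> A sA; have mA:= nat_filt_sub s01 sA.
have mA' : mT (\1_A : R -> R) by exact: mindic.
have bA u : `|\1_A u| <= 1 :> R by exact: indic_le1.
have iE r : 0 <= r <= 1 -> (\int[U01]_(w in A) (gmart r w)%:E = (Ex U01 (fun u=> \1_A u * gmart r u))%:E)%E.
 move=> r01; rewrite EFin_Ex; last exact: (L1_bdM (L1_gmart r01) mA' bA).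
 rewrite integral_mkcond; apply: eq_integral=> u _; rewrite patchE indicE.
 by case: ifP=> _; rewrite ?mul1r ?mul0r.
rewrite !iE//; congr EFin; apply: subr0_eq; rewrite -ExB; last 2 first.
+ exact: (L1_bdM Lt mA' bA).
+ exact: (L1_bdM Ls mA' bA).
rewrite -(gmart_increment s0 st t1 sA); congr Ex; by apply/funext=> u; ring.
- move=> t t01; have Lt:= L1_gmart t01; have [t0 t1]:= andP t01.
have E0 : Ex U01 (gmart t) = 0.
 have:= @gmart_increment 0 t setT (lexx 0) t0 t1 _.
 under eq_fun do rewrite indicT mul1r gmart0 subr0; apply.
 exact: (@measurableT _ (sigmaT _)).
have E1 : ('E_U01[gmart t] = 0)%E by rewrite unlock -EFin_Ex// E0.
split=> //; rewrite /variance unlock E1 /=.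
rewrite unlock (_ : (fun w=> _) = fun u=> (gmart t u ^+ 2)%:E).
 by rewrite -EFin_Ex ?L2// (gausslaw_var (meas_gmart t01) (gauss1 t01) (V_ge0 t01)).
by apply/funext=> u; congr EFin; rewrite -[LHS]/((gmart t u - 0) * (gmart t u - 0)) subr0 expr2.
Qed.
End gaussian_martingale.

(** * Null sets, clipping and completeness *)

Section ae_tools.
Context {R : realType}.
Definition clip (c x : R) : R:= Num.max (- c) (Num.min c x).
Lemma clip_bd c x : 0 <= c -> `|clip c x| <= c.
by move=> c0; rewrite ler_norml /clip le_max lexx /= ge_max ge_min lexx andbT; lra. Qed.
Lemma clip_id c x : `|x| <= c -> clip c x = x.
by rewrite ler_norml=> /andP[h1 h2]; rewrite /clip min_r// max_r. Qed.
Lemma clip_lip c x y : `|clip c x - clip c y| <= `|x - y|.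
rewrite ler_norml /clip /Num.min /Num.max; have:= ler_norm (x - y); have:= ler_norm (- (x - y)).
rewrite normrN; move: `|x - y| => z.
by case: (ltP c x)=> ?; case: (ltP c y)=> ?; do ?case: (ltP (- c) _)=> ?; lra.
Qed.
Lemma meas_clip d (T : mType d) c (f : T -> R) :
mT f -> mT (fun x=> clip c (f x)).
by move=> mf; apply: measurable_maxr=> //; exact: measurable_minr. Qed.
Section pair.
Context d (T : mType d) (P : prob T R) d' (T' : mType d') (P' : prob T' R).
Lemma ae_exists (A : T -> Prop) : {ae P, forall x, A x} -> exists x, A x.
move=> [B [mB B0 AB]]; apply: contrapT=> h.
have : P setT = 0%E by rewrite -B0; congr (P _); apply/seteqP; split=> // x _; apply: AB=> /= Ax; apply: h; exists x.
by rewrite (@probability_setT _ _ _ P)=> /eqP; rewrite onee_eq0.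
Qed.
Lemma ae_snd (A : T' -> Prop) : {ae P', forall y, A y} -> {ae (P \x P')%E, forall p, A p.2}.
move=> [B [mB B0 AB]]; exists (setT `*` B); split; first exact: measurableX.
have -> : (P \x P')%E (setT `*` B) = (P setT * P' B)%E by exact: product_measure1E.
by rewrite [X in (_ * X)%E]B0 mule0.
by move=> [x y] /= h; split=> //; exact: AB.
Qed.
(** The truncated distance min(|f - g|, 1) has integral 0, hence so have almost all of its sections,
    in both directions. *)
Lemma ae_pair (f g : T * T' -> R) : mT f -> mT g ->
{ae (P \x P')%E, forall p, f p = g p} ->
{ae P, forall x, {ae P', forall y, f (x, y) = g (x, y)}} /\
{ae P', forall y, {ae P, forall x, f (x, y) = g (x, y)}}.
move=> mf mg fg; pose h p:= Num.min `|f p - g p| 1.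
have mh : mT h by apply: measurable_minr=> //; apply: mcompT=> //; mf.
have h0 p : 0 <= h p by rewrite le_min normr_ge0 ler01.
have h1 p : `|h p| <= 1 by rewrite ger0N// ge_min lexx orbT.
have E0 : Ex (P \x P')%E h = 0.
rewrite -[RHS](Ex_cst (P \x P')%E); apply: Ex_ae=> //; apply: filterS fg=> p fgp.
by rewrite /h fgp subrr normr0 min_l.
have eq0 x y : h (x, y) = 0 -> f (x, y) = g (x, y).
rewrite /h /Num.min; case: ltP=> [_ /eqP|_ /eqP]; last by rewrite oner_eq0.
by rewrite normr_eq0 subr_eq0=> /eqP.
split.
- have : {ae P, forall x, Ex P' (fun y=> h (x, y)) = 0}.
 apply: Ex_eq0; [|by move=> x; exact: Ex_ge0|by rewrite -(Ex_pair_bd _ _ mh h1)].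
 apply: (L1by 1); first exact: meas_Ex.
 by move=> x; apply: Ex_bd=> [|y]; [mf|exact: h1].
apply: filterS=> x E; have : {ae P', forall y, h (x, y) = 0}.
 apply: Ex_eq0=> //; apply: (L1by 1)=> [|y]; [mf|exact: h1].
by apply: filterS=> y; exact: eq0.
- have : {ae P', forall y, Ex P (fun x=> h (x, y)) = 0}.
 apply: Ex_eq0; [|by move=> x; exact: Ex_ge0|by rewrite -(Ex_pair2_bd _ _ mh h1)].
 apply: (L1by 1); first exact: meas_Ex2.
 by move=> y; apply: Ex_bd=> [|x]; [mf|exact: h1].
apply: filterS=> y E; have : {ae P, forall x, h (x, y) = 0}.
 apply: Ex_eq0=> //; apply: (L1by 1)=> [|x]; [mf|exact: h1].
by apply: filterS=> x; exact: eq0.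
Qed.
Hypothesis complete : P.-negligible `<=` measurable.
Lemma ae_measurable_set (A B : set T) : measurable B -> {ae P, forall x, A x <-> B x} -> measurable A.
move=> mB AB.
have mN : measurable (~` [set x | A x <-> B x]) by exact: complete.
rewrite (_ : A = (B `&` [set x | A x <-> B x]) `|` (A `&` ~` [set x | A x <-> B x])).
apply: measurableU; first by apply: measurableI=> //; rewrite -[X in measurable X]setCK; exact: measurableC.
by apply: complete; apply: negligibleS AB=> x [].
apply/seteqP; split=> x /=; last by move=> [[Bx [_ h]]|[]//]; exact: h.
move=> Ax; have [h|h]:= pselect (A x <-> B x); first by left; split=> //; exact/h.
by right.
Qed.
(** The integrals that define gamma and the variance involve functions that only agree almost surely
    with measurable ones; completeness makes them measurable. *)
Lemma fine_integral_ae (f : T -> R) (g : T -> R) : mT g ->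
{ae P, forall x, f x = g x} -> fine (\int[P]_x (f x)%:E)%E = Ex P g.
move=> mg fg.
have mf : mT f.
move=> _ B mB; rewrite setTI; apply: (@ae_measurable_set _ (g @^-1` B)).
 by rewrite -[X in measurable X]setTI; exact: mg.
by apply: filterS fg=> x /= ->.
exact: (Ex_ae mf mg fg).
Qed.
End pair.
Lemma Rintegral_unitp (f : R -> R) t : 0 <= t <= 1 -> mT (fun s=> unitp s * f s) ->
\int[lebesgue_measure]_(s in `[0, t]) f s = Ex U01 (fun s=> (s <= t)%R%:R * (unitp s * f s)).
move=> t01 mf; rewrite Ex_U01_le// /Rintegral.
have fE s : `]0, t]%classic s -> f s = unitp s * f s.
rewrite /= in_itv /= => /andP[s0 st]; have /andP[_ t1]:= t01.
by rewrite /unitp s0 (le_trans st t1) mul1r.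
rewrite -!(integral_itv_obnd_cbnd (r:= 0)).
- by congr fine; apply: eq_integral=> s; rewrite inE=> /fE {1}->.
- mf.
- apply/mEFinP; apply: (eq_measurable_fun (fun s=> unitp s * f s)).
 by move=> s; rewrite inE=> /fE.
mf.
Qed.
End ae_tools.

(** * Bounded predictable versions of the model *)

Section reduction.
Context {R : realType} d (T : mType d) (P : prob T R).
Notation Q:= (U01 \x P)%E.
Definition clip0 (c x : R) : R:= Num.max 0 (clip c x).
Lemma clip0_itv c x : 0 <= c -> 0 <= clip0 c x <= c.
by move=> c0; rewrite /clip0 le_max lexx ge_max c0; have:= clip_bd x c0; rewrite ler_norml=> /andP[]. Qed.
Lemma clip0_id c x : 0 <= x <= c -> clip0 c x = x.
by move=> /andP[x0 xc]; rewrite /clip0 clip_id ?max_r// ger0N. Qed.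
(* Bounded predictable versions of the G-intensity [b], of the F-intensity [l] and
of the residual process [g], as functions on time x sample space that vanish
outside ]0, 1]. *)
Record reduced (N : R -> T -> nat) (F H : R -> set (set T)) (lam G : R -> T -> R) (C C' : R)
 (b l g : R * T -> R) : Prop:= Reduced {
red_hN : forall w, counting_path (N ^~ w);
red_mN : forall t, 0 <= t <= 1 -> mT (fun w=> (N t w)%:R : R);
red_aN : adapted H (fun t w=> (N t w)%:R : R);
red_fF : filt F;
red_fH : filt H;
red_FH : forall t, 0 <= t <= 1 -> F t `<=` H t;
red_cb : compensates P N H b;
red_b : forall p, 0 <= b p <= C;
red_mg : mT (g : predT H -> R);
red_g : forall p, `|g p| <= C';
red_g0 : forall p, ~~ (0 < p.1 <= 1) -> g p = 0;
red_ml : mT (l : predT F -> R);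
red_l : forall p, 0 <= l p <= C;
red_bl : forall (K : R * T -> R) M, mT (K : predT F -> R) ->
 bdd K M -> Ex Q (fun p=> K p * b p) = Ex Q (fun p=> K p * l p);
red_gK : forall (K : R * T -> R) M, mT (K : predT F -> R) ->
 bdd K M -> Ex Q (fun p=> K p * g p) = 0;
red_gamma : forall t, 0 <= t <= 1 ->
 lcm_gamma P N lam G t = Ex Q (fun p=> (p.1 <= t)%R%:R * (g p * (b p - l p)));
red_var : forall t, 0 <= t <= 1 ->
 lcm_variance P N G t = Ex Q (fun p=> (p.1 <= t)%R%:R * (g p ^+ 2 * b p));
red_H0 : local_martingale P H (compensated N lam) -> {ae Q, forall p, b p = l p};
red_mlam : mT (fun p : R * T=> unitp p.1 * lam p.1 p.2);
red_mG : mT (fun p : R * T=> unitp p.1 * G p.1 p.2);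
red_lamE : {ae Q, forall p, unitp p.1 * lam p.1 p.2 = l p};
red_GE : {ae Q, forall p, unitp p.1 * G p.1 p.2 = g p} }.
Lemma pred_itv (HH : R -> set (set T)) (s t : R) : filt HH -> 0 <= s -> s <= t -> t <= 1 ->
mT ((fun p=> (s < p.1 <= t)%R%:R) : predT HH -> R).
move=> fHH s0 st t1; have [h _]:= fHH; have /h[[h0 h1 _] _] : 0 <= s <= 1 by rewrite s0 (le_trans st).
have HT : measurable_wrt (HH s) (cst 1 : T -> R).
move=> _ [B mB <-]; rewrite setTI preimage_cst; case: ifP=> _ //.
by have:= h1 _ h0; rewrite setD0.
by have:= pred_rect fHH s0 st t1 HT; congr measurable_fun; apply/funext=> p; rewrite mulr1.
Qed.
Context (F : R -> set (set T)) (N : R -> T -> nat) (X lam blam G : R -> T -> R) (C C' : R).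
Hypotheses (model : counting_model P F N X lam blam)
(resid : residual_process P F X G)
(C0 : 0 <= C) (C'0 : 0 <= C')
(blamC : {ae P, forall w, forall t : R, 0 <= t <= 1 -> blam t w <= C})
(GC : {ae P, forall w, forall t : R, 0 <= t <= 1 -> `|G t w| <= C'})
(lam1 : L1 Q (fun p=> unitp p.1 * lam p.1 p.2)).
Let H:= enlarge F X.
Let b (p : R * T):= clip0 C (unitp p.1 * blam p.1 p.2).
Let l (p : R * T):= clip0 C (unitp p.1 * lam p.1 p.2).
Let g (p : R * T):= clip C' (unitp p.1 * G p.1 p.2).
Let uF : usual_filtration P F. by case: model. Qed.
Let mX t : 0 <= t <= 1 -> mT (X t). by case: model=> _ _ [_ h] _ _; exact: h. Qed.
Let fF : filt F. exact: usual_filt uF. Qed.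
Let fH : filt H. exact: filt_enlarge uF mX. Qed.
Let FH t : 0 <= t <= 1 -> F t `<=` H t. by move=> t01; exact: (sub_enlarge (P:= P)). Qed.
Let hN w : counting_path (N ^~ w). by case: model=> _ [h _] _ _ _; exact: h. Qed.
Let aN : adapted H (fun t w=> (N t w)%:R : R).
by case: model=> _ [_ h] _ _ _ t t01 A /(h t t01 A); exact: FH. Qed.
Let mN t : 0 <= t <= 1 -> mT (fun w=> (N t w)%:R : R).
move=> t01 _ B mB; have [h _]:= fH; apply: (h t t01).2.
by apply: (aN t01); exists B.
Qed.
Let unit01 (s : R) : 0 < s <= 1 -> unitp s = 1 :> R.
by rewrite /unitp=> ->. Qed.
Let unit_case (s x : R) (A : R -> Prop) : A 0 -> (0 < s <= 1 -> A x) -> A (unitp s * x).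
by rewrite /unitp=> a0 ax; case: (boolP (0 < s <= 1))=> h; rewrite ?mul1r ?mul0r//; exact: ax. Qed.
Let predF_H Y : predictable F Y -> predictable H Y.
move=> pY A /pY; apply: sub_smallest2r; first by [].
move=> B [[A' FA <-]|[s [t [A' [s0 st t1 FA ->]]]]]; [left|right].
by exists A'=> //; apply: FH FA; rewrite lexx ler01.
by exists s, t, A'; split=> //; apply: FH FA; rewrite s0 (le_trans st t1).
Qed.
(** The bound on [blam] makes its positive part integrable, as [compensates_intensity] requires. *)
Let cb0 : compensates P N H (fun p=> unitp p.1 * blam p.1 p.2) /\
{ae Q, forall p, unitp p.1 * blam p.1 p.2 = b p}.
case: model=> _ _ _ _ [pb bi bM].
have mb:= predictable_unitp fH pb; have mb':= pred_meas fH mb.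
have leC : {ae Q, forall p, unitp p.1 * blam p.1 p.2 <= C}.
have:= ae_snd (@U01 R) blamC; apply: filterS=> -[s w] /= h.
by apply: (unit_case (A:= fun x=> x <= C))=> // /andP[s0 s1]; apply: h; rewrite s1 ltW.
have cbl : compensates P N H (fun p=> unitp p.1 * blam p.1 p.2).
apply: compensates_intensity=> //.
pose m (p : R * T):= Num.min C (Num.max (unitp p.1 * blam p.1 p.2) 0).
apply: (@L1_ae _ _ _ _ m); first mf.
 by apply: filterS leC=> p h; rewrite /m min_r// ge_max h.
apply: (L1by C)=> [|p]; first by apply: measurable_minr=> //; mf.
by rewrite ger0N /m ?ge_min ?lexx// le_min C0 le_max lexx orbT.
split=> //; move: leC (compensates_ge0 fH cbl); apply: filterS2=> p h h0.
by rewrite /b clip0_id// h0.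
Qed.
(** The bound [C] is inherited from the G-intensity through [compensates_le]. *)
Let cl0 : compensates P N F (fun p=> unitp p.1 * lam p.1 p.2) /\
{ae Q, forall p, unitp p.1 * lam p.1 p.2 = l p}.
case: model=> _ _ _ [pl li lM] _.
have cl : compensates P N F (fun p=> unitp p.1 * lam p.1 p.2).
by apply: compensates_intensity=> //; exact: L1_max0.
split=> //; have bC : {ae Q, forall p, unitp p.1 * blam p.1 p.2 <= C}.
by apply: filterS cb0.2=> p ->; have /andP[]:= clip0_itv (unitp p.1 * blam p.1 p.2) C0.
move: (compensates_ge0 fF cl) (compensates_le fF fH FH cl cb0.1 C0 bC).
by apply: filterS2=> p h0 h; rewrite /l clip0_id// h0.
Qed.
Let mclip0 (HH : R -> set (set T)) (f : R * T -> R) : mT (f : predT HH -> R) ->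
mT ((fun p=> clip0 C (f p)) : predT HH -> R).
by move=> mf; apply: measurable_maxr=> //; exact: meas_clip. Qed.
Let mb : mT (b : predT H -> R).
by apply: mclip0; case: cb0=> -[]. Qed.
Let ml : mT (l : predT F -> R).
by apply: mclip0; case: cl0=> -[]. Qed.
Let mG : mT ((fun p=> unitp p.1 * G p.1 p.2) : predT H -> R).
by case: resid=> cG aG _; apply: pred_lim fH aG _=> w; case: (cG w). Qed.
Let mg : mT (g : predT H -> R).
exact: meas_clip. Qed.
Let gC p : `|g p| <= C'. exact: clip_bd. Qed.
Let GE w : (forall t : R, 0 <= t <= 1 -> `|G t w| <= C') -> forall s, unitp s * G s w = g (s, w).
move=> h s; rewrite /g clip_id//=; apply: (unit_case (A:= fun x=> `|x| <= C')); first by rewrite normr0.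
by move=> /andP[s0 s1]; apply: h; rewrite s1 ltW.
Qed.
Let cb : compensates P N H b.
by apply: compensates_ae cb0.1 mb cb0.2. Qed.
Let cl : compensates P N F l.
by apply: compensates_ae cl0.1 ml cl0.2. Qed.
(** On a rectangle ]s, t] x A the set A belongs to F_{u-} for every u in ]s, t], and there [G u] has
    conditional mean 0. Fubini and the pi-system of rectangles give the rest. *)
Let gK (K : R * T -> R) M : mT (K : predT F -> R) ->
bdd K M -> Ex Q (fun p=> K p * g p) = 0.
have mg':= pred_meas fH mg.
have rect s t A : 0 <= s -> s <= t -> t <= 1 -> F s A ->
 Ex Q (fun p=> \1_(`]s, t] `*` A) p * g p) = 0.
move=> s0 st t1 FA.
have mA : measurable A by have [h _]:= fF; apply: (h s _).2=> //; rewrite s0 (le_trans st t1).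
have mR : measurable (`]s, t] `*` A : set (R * T)) by exact: measurableX.
rewrite (@Ex_pair_bd _ _ _ _ _ _ _ _ C'); last first.
- by move=> p; rewrite normrM -[C']mul1r ler_pM// indicE; case: (_ \in _); rewrite ?normr1 ?normr0 ?ler01.
- mf.
rewrite -[RHS](@Ex_cst _ _ _ U01); congr (Ex _ _); apply/funext=> u.
have [/andP[su ut]|ust]:= boolP (s < u <= t); last first.
 rewrite -[RHS](@Ex_cst _ _ _ P); congr (Ex _ _); apply/funext=> w.
 by rewrite indicE memNset ?mul0r// => -[/=]; rewrite in_itv/= (negbTE ust).
have u01 : 0 <= u <= 1 by lra.
have [_ _ /(_ u u01)[Gi _ _ hG]]:= resid.
have AE w : \1_(`]s, t] `*` A) (u, w) = \1_A w :> R.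
 rewrite !indicE; congr (_%:R); congr nat_of_bool; apply/idP/idP; rewrite !inE /= in_itv/= su ut.
  by move=> [].
 by [].
under [fun y=> _]eq_fun do rewrite AE.
have mGu : mT (G u) by exact: (L1_meas Gi).
rewrite (@Ex_ae _ _ _ _ _ (fun w=> \1_A w * G u w)).
- have FA' : left_filtration F u A.
  rewrite /left_filtration leNgt (le_lt_trans s0 su)/=; apply: sub_sig.
  by exists s=> //=; rewrite in_itv/= s0.
 have:= hG A FA'; rewrite integral0=> h0; rewrite /Ex /Rintegral -[RHS]/(fine 0%E) -h0.
 congr fine; rewrite [RHS]integral_mkcond; apply: eq_integral=> w _.
 by rewrite patchE indicE; case: ifP=> _ /=; rewrite ?mul1r ?mul0r.
- apply: mfunM; first mf.
 have:= mpair2 u mg'; exact.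
- mf.
- apply: filterS GC=> w h; rewrite -GE// unit01 ?mul1r//.
 lra.
move=> mK KM; have z (f : R * T -> R) : Ex Q (fun p=> f p * 0) = 0.
by rewrite -[RHS](Ex_cst Q 0); eqEx=> p; rewrite mulr0.
have mB B : pgen F B -> measurable B.
move=> [s [t [A [s0 st t1 FA ->]]]]; apply: measurableX=> //.
by have [h _]:= fF; apply: (h s _).2=> //; rewrite s0 (le_trans st t1).
have F0T : F 0 setT.
have [h _]:= fF; have /h[[h0 h1 _] _] : 0 <= (0 : R) <= 1 by rewrite lexx ler01.
by have:= h1 _ h0; rewrite setD0.
rewrite -[RHS](z K); apply: (@Ex_pi_weight _ _ _ Q _ _ Q _ (pgen F) id id g (fun=> 0) _ mB mB _ _ _ _ K M mK KM).
- exact: pgen_setI.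
- exact: (L1_bd Q mg' gC).
- exact: L1_cst.
(* The constant weight is covered by the rectangle ]0, 1] x T, outside which [g] vanishes. *)
- rewrite Ex_cst -[RHS](rect 0 1 setT)//; congr (Ex _ _); apply/funext=> -[s w]; rewrite -[LHS]mul1r.
rewrite /= indicE; have [/andP[s0 s1]|s01]:= boolP (0 < s <= 1).
 by rewrite mem_set//= in_itv/= s0 s1.
by rewrite /g /unitp (negbTE s01) mul0r clip_id ?mulr0 ?normr0.
- by move=> B [s [t [A [s0 st t1 FA ->]]]]; rewrite z; exact: rect.
Qed.
Let complete : P.-negligible `<=` measurable.
by case: uF=> h1 _ _ h A /h; apply: (h1 0 _).2; rewrite lexx ler01. Qed.
Let lE w : {ae U01, forall s, unitp s * lam s w = l (s, w)} -> (forall t : R, 0 <= t <= 1 -> `|G t w| <= C') ->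
forall t, 0 <= t <= 1 -> int_compensated (N ^~ w) (lam ^~ w) (G ^~ w) t =
jsum N (fun p=> (p.1 <= t)%R%:R * g p) w - tint (fun p=> (p.1 <= t)%R%:R * (g p * l p)) w.
move=> lw Gw t t01.
have ml':= pred_meas fF ml; have mg':= pred_meas fH mg.
have mlam : mT (fun s=> unitp s * lam s w).
have:= mpair1 w (L1_meas lam1); exact.
have mgw : mT (fun s=> g (s, w)) by mf.
have mlw : mT (fun s=> l (s, w)) by mf.
have E s : unitp s * (G s w * lam s w) = g (s, w) * (unitp s * lam s w).
by rewrite -GE// /unitp; case: (0 < s <= 1); rewrite ?mul1r ?mul0r.
congr (_ - _).
rewrite int_countingE// /jsum; apply: eq_psum=> // s s01.
by rewrite /= -GE// unit01// mul1r.
rewrite Rintegral_unitp//; last by under eq_fun do rewrite E; exact: mfunM.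
have mle : mT (fun s : R=> (s <= t)%R%:R : R).
mf.
apply: Ex_ae; [..|by apply: filterS lw=> s h; rewrite E h].
by apply: mfunM=> //; under eq_fun do rewrite E; exact: mfunM.
mf.
Qed.
Let le_bd (t : R) (p : R * T) : `|(p.1 <= t)%R%:R : R| <= 1.
by rewrite ger0N ?ler0n// lern1 leq_b1. Qed.
Lemma model_reduced : reduced N F H lam G C C' b l g.
have ml':= pred_meas fF ml; have mg':= pred_meas fH mg; have mb':= pred_meas fH mb.
have b0C p : 0 <= b p <= C by exact: clip0_itv.
have l0C p : 0 <= l p <= C by exact: clip0_itv.
have bC p : `|b p| <= C by have /andP[h ?]:= b0C p; rewrite ger0N.
have lC p : `|l p| <= C by have /andP[h ?]:= l0C p; rewrite ger0N.
have mle (t : R) : mT (fun p : R * T=> (p.1 <= t)%R%:R : R).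
mf.
have pred_le (t : R) (K : R * T -> R) : mT (K : predT H -> R) -> (forall p, ~~ (0 < p.1 <= 1) -> K p = 0) ->
 0 <= t <= 1 -> mT ((fun p=> (p.1 <= t)%R%:R * K p) : predT H -> R).
move=> mK K0 /andP[t0 t1].
rewrite (_ : (fun p=> _) = (fun p=> (0 < p.1 <= t)%R%:R * K p)).
 exact: (mfunM (pred_itv fH (lexx 0) t0 t1) mK).
apply/funext=> p; have [/andP[p0 p1]|p01]:= boolP (0 < p.1 <= 1).
 by rewrite p0.
by rewrite K0// !mulr0.
have g0 p : ~~ (0 < p.1 <= 1) -> g p = 0.
by move=> p01; rewrite /g /unitp (negbTE p01) mul0r clip_id ?normr0.
have EC (K : R * T -> R) M t : mT (K : predT H -> R) -> bdd K M ->
 (forall p, ~~ (0 < p.1 <= 1) -> K p = 0) -> 0 <= t <= 1 ->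
 Ex P (jsum N (fun p=> (p.1 <= t)%R%:R * K p)) = Ex Q (fun p=> (p.1 <= t)%R%:R * (K p * b p)).
move=> mK KM K0 t01; have [_ _ _ e]:= cb; rewrite (e _ M); first by congr (Ex _ _); apply/funext=> p; rewrite mulrA.
 exact: pred_le.
by move=> p; rewrite normrM -[M]mul1r ler_pM.
have mbd (f : R * T -> R) M t : mT f -> bdd f M ->
mT (fun p : R * T=> (p.1 <= t)%R%:R * f p) /\ (forall p : R * T, `|(p.1 <= t)%R%:R * f p| <= M).
move=> mf fM; split; first mf.
by move=> p; rewrite normrM -[M]mul1r ler_pM.
have gl p : `|g p * l p| <= C' * C by rewrite normrM ler_pM.
have gb p : `|g p * b p| <= C' * C by rewrite normrM ler_pM.
have mgl : mT (fun p=> g p * l p) by mf.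
have mgb : mT (fun p=> g p * b p) by mf.
have [_ lamE2]:= ae_pair (L1_meas lam1) ml' cl0.2.
have meas_jsum t (K : R * T -> R) : mT K -> mT (jsum N (fun p=> (p.1 <= t)%R%:R * K p)).
by move=> mK; apply: m_jsum=> //; mf.
split=> //.
- move=> K M mK KM; have [_ _ _ h1]:= cb; have [_ _ _ h2]:= cl.
by rewrite -(h1 K M) ?(h2 K M)//; apply: pred_sub mK; exact: FH.
- move=> t t01; have [mt tM]:= mbd _ _ t mgl gl; have [mt' tM']:= mbd _ _ t mgb gb.
rewrite /lcm_gamma unlock (fine_integral_ae complete (g:= fun w=>
 jsum N (fun p=> (p.1 <= t)%R%:R * g p) w - tint (fun p=> (p.1 <= t)%R%:R * (g p * l p)) w)).
+ have Lt : L1 P (tint (fun p=> (p.1 <= t)%R%:R * (g p * l p))).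
  apply: (L1by (C' * C)); first exact: meas_Ex2.
  by move=> w; apply: Ex_bd=> // ; have:= mpair1 w mt; exact.
 rewrite ExB//; last first.
  have [N1 _ _ _]:= cb; apply: (L1_le _ (L1Z C' N1))=> [|w]; first exact: meas_jsum.
  by apply: jsum_bd=> // p; rewrite normrM -[C']mul1r ler_pM.
 rewrite (EC g C')// -[Ex P (tint _)](Ex_pair2_bd _ _ mt tM).
 rewrite -ExB; [|exact: L1_bd mt' tM'|exact: L1_bd mt tM].
 by congr (Ex _ _); apply/funext=> p; rewrite -mulrBr -mulrBr.
+ by apply: mfunB; [exact: meas_jsum|exact: meas_Ex2].
+ by move: lamE2 GC; apply: filterS2=> w h1 h2; exact: lE.
- move=> t t01; have mg2 : mT (fun p=> g p ^+ 2) by exact: mfunX.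
rewrite /lcm_variance unlock (fine_integral_ae complete (g:= jsum N (fun p=> (p.1 <= t)%R%:R * g p ^+ 2))).
+ rewrite (EC (fun p=> g p ^+ 2) (C' ^+ 2))//.
 * mf.
 * by move=> p; rewrite normrX lerXn2r ?nnegrE.
 * by move=> p /g0 ->; rewrite expr0n.
+ exact: meas_jsum.
+ apply: filterS GC=> w h; rewrite int_countingE// /jsum; apply: eq_psum=> // s s01.
 by rewrite /= -GE// unit01// mul1r.
(* Under H_0 the same [lam] is an intensity for the larger filtration, where compensators are
   unique. *)
- move=> lM; case: model=> _ _ _ [pl li _] _.
have cl' : compensates P N H (fun p=> unitp p.1 * lam p.1 p.2).
 by apply: compensates_intensity=> //; [exact: predF_H|exact: L1_max0].
by move: (compensates_uniq fH cb cl') cl0.2; apply: filterS2=> p ->.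
- exact: L1_meas lam1.
- exact: pred_meas mG.
- exact: cl0.2.
- have:= ae_snd (@U01 R) GC; apply: filterS=> -[s w] h; exact: GE.
Qed.
End reduction.

(** * Estimates as functions of the training data, and their errors *)

Section fitted.
Context {R : realType} d (T : mType d) (P : prob T R).
Context dS (S : mType dS) (PS : prob S R) (n : nat) (Z : 'I_n -> S -> T).
Hypothesis iidZ : iid_sample P PS Z.
Notation Q:= (U01 \x P)%E.
Notation predT H:= (sigmaT (pgen H)).
Lemma meas_int_section d1 (A1 : mType d1) d2 (A2 : mType d2) (mu : prob A2 R)
 (f : A1 * A2 -> R) : mT (fun p=> (f p)%:E) -> (forall p, 0 <= f p) ->
mT (fun x=> \int[mu]_y (f (x, y))%:E)%E.
move=> mf f0; have f0' p : (0 <= (f p)%:E)%E by rewrite lee_fin.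
exact: (@measurable_fun_fubini_tonelli_F _ _ _ _ _ mu (fun p=> (f p)%:E) mf f0').
Qed.
Lemma pair_idM d1 (A1 : mType d1) d1' (A2 : mType d1') d2 d3 (B1 : mType d2) (B2 : mType d3)
(i : A1 -> A2) d4 (U : mType d4) (f : A2 * B2 -> U) (j : B1 -> B2) :
mT i -> mT j -> mT f ->
mT (fun p=> f (i p.1, j p.2)).
move=> mi mj mf; apply: (mcompT mf); apply: mpair=> /=.
mf.
mf.
Qed.
Lemma fitted_obs (J : {set 'I_n}) H (Y : S -> R -> T -> R) : filt H -> fitted_predictable Z J H Y ->
mT ((fun p=> unitp p.2.1 * Y p.1 p.2.1 p.2.2) : obsT Z (~: J) * predT H -> R).
move=> fH fY; apply: fitted_unitp=> //.
have E : obs_gen Z (~: J) = \bigcup_(j in [set j | j \notin J]) preimage_set_system setT (Z j) measurable.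
by rewrite /obs_gen; congr (bigcup _ _); apply/seteqP; split=> j /=; rewrite finset.in_setC.
by rewrite E.
Qed.
Lemma obs_pred (I : {set 'I_n}) H (f : obsT Z I * (R * T) -> R) : filt H ->
mT (f : obsT Z I * predT H -> R) -> mT f.
move=> fH mf; rewrite (_ : f = fun p=> f (p.1, p.2)); last by apply/funext=> -[].
exact: (pair_idM (@measurable_id _ (obsT Z I) setT) (pred_id fH) mf).
Qed.
Lemma obs_prodM (I : {set 'I_n}) d' (U : mType d') (f : obsT Z I * U -> R) :
mT f -> mT (f : S * U -> R).
move=> mf; have:= pair_idM (@meas_obs_id _ _ _ _ _ _ _ _ _ iidZ I) (@measurable_id _ U setT) mf.
by congr measurable_fun; apply/funext=> -[].
Qed.
End fitted.
Lemma ae_sections (R : realType) d1 (A1 : mType d1) (P1 : prob A1 R)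
 d2 (A2 : mType d2) (P2 : prob A2 R) (A : A1 * A2 -> Prop) :
{ae (P1 \x P2)%E, forall p, A p} -> {ae P1, forall x, {ae P2, forall y, A (x, y)}}.
move=> [B [mB B0 AB]]; have [h _] : {ae P1, forall x, {ae P2, forall y, \1_B (x, y) = 0 :> R}} /\
 {ae P2, forall y, {ae P1, forall x, \1_B (x, y) = 0 :> R}}.
apply: (@ae_pair _ _ _ P1 _ _ P2 \1_B (cst 0)); [mf|by []|].
by exists B; split=> // p /= h; apply: contrapT=> nB; apply: h; rewrite indicE memNset.
apply: filterS h=> x; apply: filterS=> y h; apply: contrapT=> /AB Bxy.
by move: h; rewrite indicE mem_set// => /eqP; rewrite oner_eq0.
Qed.
Section error.
Context {R : realType} d (T : mType d) (P : prob T R).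
Context dS (S : mType dS) (PS : prob S R).
Notation Q:= (U01 \x P)%E.
Variables (W : R -> T -> R) (What : S -> R -> T -> R) (e : R).
Let E (p : S * (R * T)) : R:= unitp p.2.1 * W p.2.1 p.2.2 - unitp p.2.1 * What p.1 p.2.1 p.2.2.
Hypotheses (mE : mT E)
(e0 : 0 <= e)
(err_e : (estimation_error P PS W What <= e%:E)%E).
Let mE2 : mT (fun p=> (E p ^+ 2)%:E).
mf. Qed.
(** Tonelli over training data, observation and time, with the null time 0 discarded. *)
Let int_err : (\int[PS]_s \int[Q]_p (E (s, p) ^+ 2)%:E <= (e ^+ 2)%:E)%E.
have E20 p : (0 <= (E p ^+ 2)%:E)%E by rewrite lee_fin sqr_ge0.
have mEs s : mT (fun p=> (E (s, p) ^+ 2)%:E).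
mf.
have swapm : mT (fun q : (S * T) * R=> (q.1.1, (q.2, q.1.2)) : S * (R * T)).
apply: mpair; first exact: mcompT.
by apply: mpair=> //; exact: mcompT.
have mE3 : mT (fun q : (S * T) * R=> (E (q.1.1, (q.2, q.1.2)) ^+ 2)%:E).
mf.
have -> : (\int[PS]_s \int[Q]_p (E (s, p) ^+ 2)%:E =
 \int[PS \x P]_q \int[lebesgue_measure]_(u in `[0%R, 1%R]) ((W u q.2 - What q.1 u q.2) ^+ 2)%:E)%E.
have mE4 : mT (fun q : S * T=> \int[U01]_u (E (q.1, (u, q.2)) ^+ 2)%:E)%E.
 exact: (meas_int_section U01 mE3 (fun q=> sqr_ge0 _)).
transitivity (\int[PS \x P]_q \int[U01]_u (E (q.1, (u, q.2)) ^+ 2)%:E)%E.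
 rewrite fubini_tonelli1//; last by move=> q; exact: integral_ge0.
 apply: eq_integral=> s _; rewrite (fubini_tonelli2 _ (mEs s))//.
apply: eq_integral=> -[s w] _ /=.
have mu : mT (fun u=> (E (s, (u, w)) ^+ 2)%:E).
 mf.
rewrite int_U01// -!(integral_itv_obnd_cbnd (r:= 0)).
- apply: eq_integral=> u; rewrite inE /= in_itv/= => u01.
 by rewrite /E/= /unitp u01 !mul1r.
- apply: (eq_measurable_fun (fun u=> (E (s, (u, w)) ^+ 2)%:E)); last mf.
 by move=> u; rewrite inE /= in_itv/= => u01; rewrite /E/= /unitp u01 !mul1r.
- mf.
have Hx y : (0 <= y)%E -> (sqrte y <= e%:E)%E -> (y <= (e ^+ 2)%:E)%E.
case: y=> [x||]//=; rewrite !lee_fin=> x0 xe.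
by rewrite -[leLHS](sqr_sqrtr x0) lerXn2r// nnegrE ?sqrtr_ge0.
by apply: Hx err_e; apply: integral_ge0=> q _; apply: integral_ge0=> u _; rewrite lee_fin sqr_ge0.
Qed.
(** Clipping towards a bounded target can only reduce the error, so the rates carry over to clipped
    estimates. *)
Lemma clipped_error (D : S * (R * T) -> R) M : mT D -> bdd D M ->
(forall s, {ae Q, forall p, `|D (s, p)| <= `|E (s, p)|}) ->
Ex PS (fun s=> Ex Q (fun p=> D (s, p) ^+ 2)) <= e ^+ 2.
move=> mD DM DE.
have mD2 : mT (fun p=> D p ^+ 2) by mf.
have D2 p : `|D p ^+ 2| <= M ^+ 2.
by rewrite normrX lerXn2r ?nnegrE// (le_trans _ (DM p)).
have mDs s : mT (fun p=> D (s, p) ^+ 2) by mf.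
rewrite -lee_fin EFin_Ex; last first.
apply: (L1by (M ^+ 2))=> [|s]; first exact: (meas_Ex _ mD2).
by apply: Ex_bd.
apply: le_trans int_err; apply: ge0_le_integral=> //.
- by move=> s _; rewrite lee_fin Ex_ge0// => p; nn.
- by apply/mEFinP; exact: (meas_Ex _ mD2).
- exact: (meas_int_section Q mE2 (fun q=> sqr_ge0 (E q))).
move=> s _; rewrite EFin_Ex; last exact: (L1by (M ^+ 2)).
apply: ae_ge0_le_integral=> //.
- by move=> p _; rewrite lee_fin sqr_ge0.
- mf.
- by move=> p _; rewrite lee_fin sqr_ge0.
- mf.
- by apply: filterS (DE s)=> p h _; rewrite lee_fin -[leLHS]real_normK ?num_real// -[leRHS]real_normK ?num_real// lerXn2r ?nnegrE.
Qed.
(** For some training data the error is finite and the estimate bounded by [C]; then |W| is at most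
    C + 1 plus the squared error. *)
Lemma L1_of_error C : mT (fun p : R * T=> unitp p.1 * W p.1 p.2) ->
{ae (PS \x P)%E, forall p, forall t : R, 0 <= t <= 1 -> `|What p.1 t p.2| <= C} ->
0 <= C -> L1 Q (fun p=> unitp p.1 * W p.1 p.2).
move=> mW lamC C0.
have h1:= ae_sections lamC.
have mI : mT (fun s=> \int[Q]_p (E (s, p) ^+ 2)%:E)%E.
exact: (meas_int_section Q mE2 (fun q=> sqr_ge0 (E q))).
have fin : PS.-integrable setT (fun s=> \int[Q]_p (E (s, p) ^+ 2)%:E)%E.
apply/integrableP; split; first mf.
rewrite (eq_integral (fun s=> \int[Q]_p (E (s, p) ^+ 2)%:E))%E; last first.
 by move=> s _; rewrite gee0_abs// integral_ge0// => p _; rewrite lee_fin sqr_ge0.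
exact: le_lt_trans int_err (ltry _).
have [s0 [Es0 Bs0]] : exists s, (\int[Q]_p (E (s, p) ^+ 2)%:E < +oo)%E /\ {ae P, forall w, forall t : R, 0 <= t <= 1 -> `|What s t w| <= C}.
apply: (@ae_exists _ _ _ PS); move: (integrable_ae measurableT fin) h1; apply: filterS2=> s h h'; split=> //.
by have:= h I; rewrite ge0_fin_numE// integral_ge0// => p _; rewrite lee_fin sqr_ge0.
apply/integrableP; split; first exact/mEFinP.
have mEs : mT (fun p=> E (s0, p) ^+ 2).
mf.
apply: (@le_lt_trans _ _ (\int[Q]_p ((C + 1)%:E + (E (s0, p) ^+ 2)%:E))%E).
apply: ae_ge0_le_integral=> //.
- by apply: mcompT=> //; exact/mEFinP.
- by move=> p _; rewrite -EFinD lee_fin addr_ge0 ?addr_ge0 ?sqr_ge0.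
- by apply: emeasurable_funD=> //; mf.
have:= ae_snd (@U01 R) Bs0; apply: filterS=> -[u w] /= h _.
rewrite -EFinD lee_fin /E /=; have hC : `|unitp u * What s0 u w| <= C.
 rewrite /unitp; case: (boolP (0 < u <= 1))=> [/andP[u0 u1]|_]; last by rewrite mul0r normr0.
 by rewrite mul1r; apply: h; rewrite ltW.
set x:= unitp u * W u w; set y:= unitp u * What s0 u w in hC *.
have h1' : `|x| <= `|x - y| + `|y| by rewrite -{1}(subrK y x) ler_normD.
have:= sqr_ge0 (`|x - y| - 1); rewrite -(real_normK (num_real (x - y))); nra.
rewrite ge0_integralD//; [|by move=> p _; rewrite lee_fin addr_ge0|by move=> p _; rewrite lee_fin sqr_ge0|mf].
rewrite integral_cst// [X in (_ * X)%E]probability_setT mule1; exact: lte_add_pinfty (ltry _) Es0.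
Qed.
End error.
Lemma sum_sub_cst (R : pzRingType) (I : Type) (s : seq I) (F : I -> R) m :
\sum_(i <- s) (F i - m) = \sum_(i <- s) F i - (size s)%:R * m.
by rewrite sumrB big_const_seq count_predT iter_addr_0 -[X in _ - X]mulr_natl. Qed.

(** * Fluctuations of sample sums and chaining *)

Section fluctuations.
Context {R : realType} d (T : mType d) (P : prob T R).
Context dS (S : mType dS) (PS : prob S R) (n : nat) (Z : 'I_n -> S -> T).
Hypothesis iidZ : iid_sample P PS Z.
Context (N : R -> T -> nat) (H : R -> set (set T)) (b : R * T -> R) (C : R).
Hypotheses (hN : forall w, counting_path (N ^~ w))
(mN : forall t, 0 <= t <= 1 -> mT (fun w=> (N t w)%:R : R))
(aN : adapted H (fun t w=> (N t w)%:R : R))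
(fH : filt H)
(cb : compensates P N H b)
(b0C : forall p, 0 <= b p <= C).
Variables (I0 : {set 'I_n}) (L : seq 'I_n).
Hypotheses (uL : uniq L) (LI : forall j, j \in L -> j \notin I0) (L0 : (0 < size L)%N).
Let r : R:= (size L)%:R.
Let r_gt0 : 0 < r. by rewrite ltr0n. Qed.
Let C0 : 0 <= C. by have /andP[h /(le_trans h)]:= b0C (0, point). Qed.
Definition powc (k : nat) : R:= C * (k.+1%:R * 2 ^+ k) * count_const C k.
Lemma powc_ge0 k : 0 <= powc k.
by rewrite /powc !mulr_ge0 ?exprn_ge0 ?ler0n//; exact: (count_const_ge0 b0C). Qed.
(** One constant for the second and the fourth moment of a centred increment; the two groups of
    terms are the cases k = 0 and k = 1 of [mom]. *)
Definition fluct_const (kap : R) : R :=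
4 * kap ^+ 2 * (powc 1 + 1) + 2 * (kap * (powc 0 + 1)) ^+ 2 +
(64 * kap ^+ 4 * (powc 3 + 1) + 8 * (kap * (powc 0 + 1)) ^+ 4).
Lemma dyadic_step l (i : nat) : (i < 2 ^ l)%N ->
[/\ 0 <= (2 ^+ l)^-1 * i%:R :> R, (2 ^+ l)^-1 * i%:R <= (2 ^+ l)^-1 * i.+1%:R :> R,
 (2 ^+ l)^-1 * i.+1%:R <= 1 :> R & (2 ^+ l)^-1 * i.+1%:R - (2 ^+ l)^-1 * i%:R = (2 ^+ l)^-1 :> R].
move=> il; have p0 : 0 < 2 ^+ l :> R by rewrite exprn_gt0.
split; first mf.
- by rewrite ler_pM2l ?invr_gt0// ler_nat.
- by rewrite mulrC ler_pdivr// mul1r -natrX ler_nat.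
lra.
Qed.
Section one_process.
(** A process controlled by [N] and by time: below, the estimated integral, and also [N] itself. *)
Variables (y : R -> obsT Z I0 * T -> R) (kap : R).
Hypotheses (kap0 : 0 <= kap)
(my : forall t, 0 <= t <= 1 -> mT (y t))
(yinc : forall s t p, 0 <= s -> s <= t -> t <= 1 ->
`|y t p - y s p| <= kap * ((N t p.2)%:R - (N s p.2)%:R + (t - s)))
(y0 : forall p, y 0 p = 0).
Definition ymean t (s : S) : R:= Ex P (fun w=> y t (s, w)).
Definition fluct t (s : S) : R:= (Num.sqrt r)^-1 * \sum_(j <- L) (y t (s, Z j s) - ymean t s).
Let K:= fluct_const kap.
Let K_ge0 : 0 <= K.
by rewrite /K /fluct_const !addr_ge0 ?mulr_ge0 ?exprn_ge0 ?addr_ge0 ?mulr_ge0 ?addr_ge0 ?powc_ge0.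
Qed.
Lemma L1_path t s : 0 <= t <= 1 -> L1 P (fun w=> y t (s, w)).
move=> /andP[t0 t1]; have t01 : 0 <= t <= 1 by rewrite t0.
have N1 : L1 P (fun w=> (N 1 w)%:R) by case: cb.
apply: (L1le (fun w=> kap * ((N 1 w)%:R + 1))).
- by have:= mpair2 s (my t01); exact.
- by apply: L1Z; apply: L1D=> //; exact: L1_cst.
move=> w; have:= yinc (s, w) (lexx 0) t0 t1; rewrite y0 subr0=> h; apply: le_trans h _.
have [n0 _ _ _]:= hN w; rewrite /= n0 !subr0 lerM2l// lerD// ler_nat.
exact: (cnt_le (hN w)).
Qed.
Section increment.
Variables (u v : R).
Hypotheses (u0 : 0 <= u) (uv : u <= v) (v1 : v <= 1).
Let u01 : 0 <= u <= 1. by rewrite u0 (le_trans uv v1). Qed.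
Let v01 : 0 <= v <= 1. by rewrite v1 (le_trans u0 uv). Qed.
Let dt0 : 0 <= v - u. by rewrite subr_ge0. Qed.
Let dt1 : v - u <= 1. by rewrite lerBlDr (le_trans v1)// lerDl. Qed.
Let DN w : R:= (N v w)%:R - (N u w)%:R.
Let DN0 w : 0 <= DN w. by rewrite subr_ge0 ler_nat (cnt_le (hN w)). Qed.
Let DNk k : L1 P (fun w=> DN w ^+ k.+1) /\ Ex P (fun w=> DN w ^+ k.+1) <= powc k * (v - u).
exact: count_pow cb b0C _ _ u0 uv v1 k. Qed.
Let D (p : obsT Z I0 * T):= y v p - y u p.
Let mD : mT D. by apply: mfunB; exact: my. Qed.
Let mDs s : mT (fun w=> D (s, w)).
mf. Qed.
Let D_le p : `|D p| <= kap * (DN p.2 + (v - u)). exact: yinc. Qed.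
Let L1DN : L1 P DN. by have []:= DNk 0. Qed.
Let DL1 s : L1 P (fun w=> D (s, w)).
apply: (L1_le (mDs s) _ (fun w=> D_le (s, w)))=> /=.
by apply: L1Z; apply: L1D=> //; exact: L1_cst.
Qed.
Let m s:= Ex P (fun w=> D (s, w)).
Let m_le s : `|m s| <= kap * (powc 0 + 1) * (v - u).
apply: le_trans (Ex_norm (DL1 s)) _.
apply: le_trans (Ex_le (L1_norm (DL1 s)) _ (fun w=> D_le (s, w))) _=> /=.
by apply: L1Z; apply: L1D=> //; exact: L1_cst.
rewrite ExZ; last by apply: L1D=> //; exact: L1_cst.
rewrite ExD//; last exact: L1_cst.
by rewrite Ex_cst -mulrA lerM2l// mulrDl mul1r lerD2r; have []:= DNk 0.
Qed.
Let Phi p:= D p - m p.1.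
Let mPhi : mT Phi.
apply: mfunB=> //; apply: (mcompT (f:= m))=> //.
exact: meas_Ex.
Qed.
(** An increment is at most kap (DN + dt), whose powers have a mean of order dt by [count_pow]; its
    conditional mean is of order dt as well. *)
Let mom k s : (k <= 1)%N ->
L1 P (fun w=> Phi (s, w) ^+ (2 * k.+1)) /\ Ex P (fun w=> Phi (s, w) ^+ (2 * k.+1)) <= K * (v - u).
move=> k1; pose j:= (2 * k.+1).-1; have jE : (2 * k.+1 = j.+1)%N by rewrite prednK// muln_gt0.
(* (x + z)^2 <= 2 (x^2 + z^2) and (x + z)^4 <= 8 (x^4 + z^4), written with the common factor 2 c. *)
pose c : R:= if k is 0%N then 1 else 4.
pose B w : R:= (2 * c) * (2 * c * kap ^+ (2 * k.+1) * (DN w ^+ j.+1 + (v - u)) +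
(kap * (powc 0 + 1)) ^+ (2 * k.+1) * (v - u)).
have pw (x z : R) : (x + z) ^+ (2 * k.+1) <= 2 * c * (x ^+ (2 * k.+1) + z ^+ (2 * k.+1)).
have h2 (x' z' : R) : (x' + z') ^+ 2 <= 2 * (x' ^+ 2 + z' ^+ 2) by have:= sqr_ge0 (x' - z'); nra.
case: k k1 @c @j jE @B=> [|[|//]] _ c j _ B; rewrite /c; first by rewrite muln1 mulr1 h2.
rewrite (_ : (2 * 2)%N = 4%N)//; apply: le_trans (_ : (2 * (x ^+ 2 + z ^+ 2)) ^+ 2 <= _).
 by rewrite (exprM (x + z) 2 2); apply: lerXn2r; rewrite ?nnegrE ?h2 ?(le_trans _ (h2 x z)) ?sqr_ge0.
by have:= h2 (x ^+ 2) (z ^+ 2); rewrite -!exprM; lra.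
have dtk (e : nat) : (0 < e)%N -> (v - u) ^+ e <= v - u.
by case: e=> // e _; rewrite exprS -[leRHS]mulr1 lerM2l// exprn_ile1.
have pl k' (x' y' : R) : `|x'| <= y' -> `|x'| ^+ k' <= y' ^+ k'.
by move=> h; rewrite lerXn2r// nnegrE ?normr_ge0// (le_trans _ h).
have sq x : x ^+ (2 * k.+1) = `|x| ^+ (2 * k.+1) :> R by rewrite !exprM real_normK ?num_real.
have c0 : 0 <= c by rewrite /c; case: (k)=> //.
have le w : Phi (s, w) ^+ (2 * k.+1) <= B w.
apply: le_trans (pw _ _) _; rewrite /B lerM2l ?mulr_ge0//; apply: lerD.
 rewrite sq; apply: le_trans (_ : (kap * (DN w + (v - u))) ^+ (2 * k.+1) <= _).
  exact: (pl _ _ _ (D_le (s, w))).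
 rewrite exprMn [2 * c * _]mulrC -mulrA lerM2l ?exprn_ge0//.
 by apply: le_trans (pw _ _) _; rewrite -jE lerM2l ?mulr_ge0// lerD2l dtk.
rewrite sq normrN; apply: le_trans (_ : (kap * (powc 0 + 1) * (v - u)) ^+ (2 * k.+1) <= _).
 exact: (pl _ _ _ (m_le s)).
by rewrite exprMn lerM2l ?dtk// exprn_ge0// mulr_ge0 ?addr_ge0 ?powc_ge0.
have [L1j Ej]:= DNk j.
have LB : L1 P B.
by apply: L1Z; apply: L1D; [apply: L1Z; apply: L1D=> //|]; exact: L1_cst.
have LPhi : L1 P (fun w=> Phi (s, w) ^+ (2 * k.+1)).
apply: (L1_le _ LB)=> [|w]; first by apply: mfunX; have:= mpair2 s mPhi; exact.
by rewrite ger0N ?le// sq exprn_ge0.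
split=> //; apply: le_trans (Ex_le LPhi LB le) _.
rewrite ExZ; last by apply: L1D; [apply: L1Z; apply: L1D=> //|]; exact: L1_cst.
rewrite ExD ?Ex_cst; [|by apply: L1Z; apply: L1D=> //; exact: L1_cst|exact: L1_cst].
rewrite ExZ; last by apply: L1D=> //; exact: L1_cst.
rewrite ExD ?Ex_cst//; last exact: L1_cst.
apply: le_trans (_ : 2 * c * (2 * c * kap ^+ (2 * k.+1) * (powc j * (v - u) + (v - u)) +
(kap * (powc 0 + 1)) ^+ (2 * k.+1) * (v - u)) <= _).
by rewrite lerM2l ?mulr_ge0// lerD2r lerM2l ?lerD2r// !mulr_ge0 ?exprn_ge0.
have -> : 2 * c * (2 * c * kap ^+ (2 * k.+1) * (powc j * (v - u) + (v - u)) +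
(kap * (powc 0 + 1)) ^+ (2 * k.+1) * (v - u)) =
((2 * c) ^+ 2 * kap ^+ (2 * k.+1) * (powc j + 1) + 2 * c * (kap * (powc 0 + 1)) ^+ (2 * k.+1)) * (v - u).
ring.
rewrite ler_wpM2r// /K /fluct_const; have nn a e : 0 <= a -> 0 <= (kap * (a + 1)) ^+ e by move=> a0; rewrite exprn_ge0 ?mulr_ge0 ?addr_ge0.
have nk e : 0 <= kap ^+ e * (powc 1 + 1) by rewrite mulr_ge0 ?exprn_ge0 ?addr_ge0 ?powc_ge0.
have nk' e : 0 <= kap ^+ e * (powc 3 + 1) by rewrite mulr_ge0 ?exprn_ge0 ?addr_ge0 ?powc_ge0.
have:= nn _ 2%N (powc_ge0 0); have:= nn _ 4%N (powc_ge0 0); have:= nk 2%N; have:= nk' 4%N.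
case: k k1 @c @j jE {L1j Ej} @B {LB LPhi le pw c0 sq}=> [|[|//]] _ c j _ B h1 h2 h3 h4; rewrite /c /j /=.
lra.
have -> : (2 * 4) ^+ 2 = 64 :> R by ring.
lra.
Qed.
Let fluctE s : fluct v s - fluct u s = (Num.sqrt r)^-1 * ssum Phi L s.
rewrite /fluct -mulrBr -sumrB /ssum; congr (_ * _); apply: eq_bigr=> j _.
rewrite /Phi /D /m /ymean /= ExB; [by ring|exact: L1_path..].
Qed.
(** The term linear in v - u comes from the jumps; it is of the order of the square as long as v - u
    is at least of order 1 / r. *)
Lemma fluct_pow4 : L1 PS (fun s=> (fluct v s - fluct u s) ^+ 4) /\
Ex PS (fun s=> (fluct v s - fluct u s) ^+ 4) <= 8 * K ^+ 2 * (v - u) ^+ 2 + 3 * K * (v - u) / r.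
have mom' k s (k1 : (k <= 1)%N):= mom s k1.
have [h2 h4]:= (fun s=> mom (k:= 0) s isT, fun s=> mom (k:= 1) s isT).
have Phi0 s : Ex P (fun w=> Phi (s, w)) = 0.
by rewrite /Phi/= ExB; [rewrite Ex_cst subrr|exact: DL1|exact: L1_cst].
have [Ls Es]:= ssum_pow4 iidZ mPhi (fun s=> (h2 s).1) Phi0 uL LI (fun s=> (h2 s).2) (fun s=> (h4 s).1) (fun s=> (h4 s).2).
have E : (fun s=> (fluct v s - fluct u s) ^+ 4) = (fun s=> r ^- 2 * ssum Phi L s ^+ 4).
apply/funext=> s; rewrite fluctE exprMn; congr (_ * _).
by rewrite exprVn (exprM _ 2 2) sqr_sqrtr// ler0n.
rewrite E; split; first exact: L1Z.
rewrite ExZ// mulrC ler_pdivr ?exprn_gt0//; apply: le_trans Es _.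
by rewrite -/r le_eqVlt; apply/orP; left; apply/eqP; field; rewrite gt_eqF.
Qed.
End increment.
(** The analogue of [dmax] for sample fluctuations: it bounds all increments over one dyadic
    level. *)
Definition fdelta (l : nat) (s : S) : R:= rho ^+ l + rho ^- (3 * l) *
\sum_(i < 2 ^ l) (fluct ((2 ^+ l)^-1 * i.+1%:R) s - fluct ((2 ^+ l)^-1 * i%:R) s) ^+ 4.
Let pow4_ge0 (x : R) : 0 <= x ^+ 4. by rewrite exprn_even_ge0. Qed.
Lemma fdelta_ge0 l s : 0 <= fdelta l s.
by rewrite /fdelta addr_ge0 ?mulr_ge0 ?invr_ge0 ?exprn_ge0 ?(ltW rho_gt0)// sumr_ge0.
Qed.
(** The condition on l gives (v - u) / r <= 2 (v - u)^2 for v - u = 2^-l, so both terms of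
    [fluct_pow4] are of order 4^-l. *)
Lemma Ex_fdelta l : 2 ^+ l <= 2 * r ->
L1 PS (fdelta l) /\ Ex PS (fdelta l) <= (8 * K ^+ 2 + 6 * K + 1) * rho ^+ l.
move=> lr; have p0 : 0 < 2 ^+ l :> R by rewrite exprn_gt0.
pose X i s:= (fluct ((2 ^+ l)^-1 * i.+1%:R) s - fluct ((2 ^+ l)^-1 * i%:R) s) ^+ 4.
have XP (i : 'I_(2 ^ l)) : L1 PS (X i) /\ Ex PS (X i) <= (8 * K ^+ 2 + 6 * K) * (2 ^+ l) ^- 2.
have [h0 h1 h2 h3]:= dyadic_step (ltn_ord i); have [Lx Ei]:= fluct_pow4 h0 h1 h2; split=> //.
apply: le_trans Ei _; rewrite h3 [leRHS]mulrDl exprVn; apply: lerD=> //.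
rewrite -[3 * K * _ / r]mulrA (_ : 6 * K = 3 * K * 2); last by ring.
rewrite -[leRHS]mulrA lerM2l ?mulr_ge0// expr2 invfM mulrCA lerM2l ?invr_ge0 ?exprn_ge0//.
by rewrite ler_pdivlMr// mulrC ler_pdivr// mulrC.
have LX : L1 PS (fun s=> \sum_(i < 2 ^ l) X i s).
rewrite (_ : (fun s=> _) = (fun s=> \sum_(i <- index_enum ('I_(2 ^ l)%N)) X i s))//.
by apply: L1_sum=> i; have []:= XP i.
split; first by apply: L1D; [exact: L1_cst|exact: L1Z].
rewrite ExD; [|exact: L1_cst|exact: L1Z]; rewrite Ex_cst ExZ// Ex_sum=> [|i]; last by have []:= XP i.
rewrite mulrDl mul1r [leRHS]addrC lerD2l mulrC ler_pdivr ?exprn_gt0 ?rho_gt0//.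
apply: le_trans (ler_sum _ (fun i _=> (XP i).2)) _.
rewrite [leLHS]sumr_const card_ord -[leLHS]mulr_natr natrX -!mulrA lerM2l ?addr_ge0 ?mulr_ge0 ?exprn_ge0//.
rewrite expr2 invfM -mulrA mulVf ?gt_eqF// mulr1 -exprD (_ : (l + 3 * l = 4 * l)%N); last by lia.
rewrite -exprVn exprM lerXn2r ?nnegrE ?exprn_ge0 ?(ltW rho_gt0)// /rho; lra.
Qed.
Definition fgrid l (t : R) s:= fluct ((2 ^+ l)^-1 * (dyidx l t)%:R) s.
Lemma fluct_step l i s : (i < 2 ^ l)%N ->
`|fluct ((2 ^+ l)^-1 * i.+1%:R) s - fluct ((2 ^+ l)^-1 * i%:R) s| <= fdelta l s.
move=> il; have r0 : 0 < rho ^+ l :> R by rewrite exprn_gt0// rho_gt0.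
apply: le_trans (norm_le_pow4 _ r0) _; rewrite /fdelta lerD2l mulrC -exprM [(l * 3)%N]mulnC.
rewrite lerM2l ?invr_ge0 ?exprn_ge0 ?(ltW rho_gt0)// (bigD1 (Ordinal il))//= lerDl sumr_ge0//.
Qed.
(** Passing to the next level moves the left grid point of t by at most one step of that level; the
    differences telescope. *)
Lemma fgrid_chain L1 m t s : 0 <= t <= 1 -> (L1 <= m)%N ->
`|fgrid m t s - fgrid L1 t s| <= \sum_(L1.+1 <= l < m.+1) fdelta l s.
move=> /andP[t0 t1]; elim: m=> [|m IH] Lm.
by rewrite (_ : L1 = 0)%N ?subrr ?normr0 ?big_geq//; lia.
have [->|Lm']:= eqVneq L1 m.+1; first by rewrite subrr normr0 big_geq.
rewrite big_nat_recr/=; last by lia.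
rewrite -(subrKA (fgrid m t s)) [leRHS]addrC; apply: le_trans (ler_normD _ _) (lerD _ _).
2: by apply: IH; lia.
rewrite /fgrid; have E (k : nat) : (2 ^+ m)^-1 * k%:R = (2 ^+ m.+1)^-1 * (2 * k)%:R :> R.
by rewrite exprS invfM natrM mulrACA mulVf ?mul1r.
rewrite E; have [->|e]:= dyidxS m t0; first by rewrite subrr normr0 fdelta_ge0.
rewrite e; apply: fluct_step.
have:= dyidx_le m.+1 (t:= t); rewrite t0 t1 e=> /(_ isT).
by [].
Qed.
Lemma fluct0 s : fluct 0 s = 0.
rewrite /fluct big1 ?mulr0// => j _; rewrite y0 /ymean (_ : (fun w=> _) = fun=> 0) ?Ex_cst ?subrr//.
by apply/funext=> w; rewrite y0.
Qed.
Lemma fgrid_level0 t s : 0 <= t <= 1 -> `|fgrid 0 t s| <= fdelta 0 s.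
move=> t01; rewrite /fgrid; have:= dyidx_le 0 t01; case: (dyidx 0 t)=> [|[|//]] _.
by rewrite mulr0 fluct0 normr0 fdelta_ge0.
by have:= @fluct_step 0 0 s isT; rewrite mulr0 fluct0 subr0.
Qed.
End one_process.
Definition count_obs (t : R) (p : obsT Z I0 * T) : R:= (N t p.2)%:R.
Let count_meas t : 0 <= t <= 1 -> mT (count_obs t).
by move=> t01; exact: (mcompT (mN t01) msnd). Qed.
Let count_inc s t p : 0 <= s -> s <= t -> t <= 1 ->
`|count_obs t p - count_obs s p| <= 1 * ((N t p.2)%:R - (N s p.2)%:R + (t - s)).
move=> s0 st t1; rewrite /count_obs mul1r ger0N ?lerDl ?subr_ge0// ler_nat.
exact: (cnt_le (hN _)).
Qed.
Let count0 p : count_obs 0 p = 0.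
by rewrite /count_obs; have [-> _ _ _]:= hN p.2. Qed.
Section all_times.
Variables (y : R -> obsT Z I0 * T -> R) (kap : R).
Hypotheses (kap0 : 0 <= kap)
(my : forall t, 0 <= t <= 1 -> mT (y t))
(yinc : forall s t p, 0 <= s -> s <= t -> t <= 1 ->
`|y t p - y s p| <= kap * ((N t p.2)%:R - (N s p.2)%:R + (t - s)))
(y0 : forall p, y 0 p = 0).
Variables (m : nat).
Hypothesis rm : r <= 2 ^+ m.
(** Chaining over the levels L1 + 1 to m, plus the passage from the grid of level m to all times. *)
Definition fosc L1 s:= \sum_(L1.+1 <= l < m.+1) fdelta y l s +
(kap * fdelta count_obs m s + 2 * kap * (powc 0 + 1) / Num.sqrt r).
Lemma fosc_ge0 L1 s : 0 <= fosc L1 s.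
apply: addr_ge0; first by apply: sumr_ge0=> l _; exact: fdelta_ge0.
by rewrite addr_ge0 ?divr_ge0 ?sqrtr_ge0 ?mulr_ge0 ?fdelta_ge0 ?addr_ge0 ?powc_ge0.
Qed.
(* Between two points of the finest grid both the process and its mean move by at
most the number of jumps in the interval, whose fluctuation is controlled in turn. *)
Let fluct_end t s : 0 <= t <= 1 ->
`|fluct y t s - fgrid y m t s| <= kap * fdelta count_obs m s + 2 * kap * (powc 0 + 1) / Num.sqrt r.
move=> /andP[t0 t1]; have p0 : 0 < 2 ^+ m :> R by rewrite exprn_gt0.
have q0 : 0 < (2 ^+ m)^-1 :> R by nn.
have sr : 0 < Num.sqrt r by nn.
have rhs0 : 0 <= kap * fdelta count_obs m s + 2 * kap * (powc 0 + 1) / Num.sqrt r.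
apply: addr_ge0; first by rewrite mulr_ge0 ?fdelta_ge0.
by rewrite divr_ge0 ?(ltW sr)// !mulr_ge0// addr_ge0 ?powc_ge0.
rewrite /fgrid; set i:= dyidx m t.
have /andP[i1 i2]:= dyidx_itv m t0; have im:= dyidx_le m (_ : 0 <= t <= 1).
have {}im : (i <= 2 ^ m)%N by apply: im; rewrite t0.
set u:= (2 ^+ m)^-1 * i%:R; pose v : R:= (2 ^+ m)^-1 * i.+1%:R.
have ut : u <= t by rewrite /u mulrC ler_pdivr// mulrC.
have tv : t <= v by rewrite /v mulrC ler_pdivlMr// mulrC ltW.
(* Index 2^m occurs only at t = 1, which is itself a grid point with no interval to its right. *)
have [iE|im']:= eqVneq i (2 ^ m)%N.
suff -> : t = u by rewrite subrr normr0.
by apply/eqP; rewrite eq_le ut andbT /u iE natrX mulVf ?gt_eqF.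
have {im im'} im : (i < 2 ^ m)%N by rewrite ltn_neqAle im' im.
have [u0 uv v1 vu]:= dyadic_step im; rewrite -/u -/v in u0 uv v1 vu.
have t01 : 0 <= t <= 1 by rewrite t0. have u01 : 0 <= u <= 1 by lra.
have v01 : 0 <= v <= 1 by lra.
pose DN w : R:= (N v w)%:R - (N u w)%:R.
have [L1DN EDN] : L1 P DN /\ Ex P DN <= powc 0 * (2 ^+ m)^-1.
by rewrite -vu; have:= count_pow hN mN aN fH cb b0C u0 uv v1 0.
have DNge w : 0 <= DN w by rewrite subr_ge0 ler_nat (cnt_le (hN w)).
have Dle p : `|y t p - y u p| <= kap * (DN p.2 + (2 ^+ m)^-1).
apply: le_trans (yinc _ u0 ut t1) _; rewrite lerM2l// -vu lerD ?lerB ?ler_nat//.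
exact: (cnt_le (hN _)).
have LB : L1 P (fun w=> kap * (DN w + (2 ^+ m)^-1)) by apply: L1Z; apply: L1D=> //; exact: L1_cst.
have yE : ymean y t s - ymean y u s = Ex P (fun w=> y t (s, w) - y u (s, w)).
by rewrite /ymean ExB//; exact: (L1_path kap0 my yinc y0).
have mean_le : `|ymean y t s - ymean y u s| <= kap * ((powc 0 + 1) * (2 ^+ m)^-1).
rewrite yE; have LD : L1 P (fun w=> y t (s, w) - y u (s, w)) by apply: L1B; exact: (L1_path kap0 my yinc y0).
apply: le_trans (Ex_norm LD) _; apply: le_trans (Ex_le (L1_norm LD) LB (fun w=> Dle (s, w))) _.
rewrite ExZ; last by apply: L1D=> //; exact: L1_cst.
by rewrite ExD//; [rewrite Ex_cst lerM2l// mulrDl mul1r lerD2r|exact: L1_cst].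
(* Jumps of the whole sample in one interval of level m: their fluctuation is a level-m increment of
   [count_obs], and their mean is at most r times a multiple of the mesh. *)
have sumDN : \sum_(j <- L) DN (Z j s) <= Num.sqrt r * fdelta count_obs m s + r * (powc 0 * (2 ^+ m)^-1).
have:= le_trans (ler_norm _) (fluct_step count_obs s im); rewrite -/u -/v.
move/(lerM2l (ltW sr)); rewrite /fluct -mulrBr -sumrB mulVKf ?gt_eqF// => h.
rewrite -lerBlDr; apply: le_trans h; rewrite -[X in X * (_ * _)]/r.
rewrite -sum_sub_cst.
have EE : ymean count_obs v s - ymean count_obs u s = Ex P DN.
 by rewrite /ymean -ExB//; exact: (L1_path ler01 count_meas count_inc count0).
apply: ler_sum=> j _; rewrite (_ : _ - (_ - _) = DN (Z j s) - Ex P DN); last by rewrite -EE /DN /count_obs/=; ring.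
by rewrite lerD2l lerN2.
have -> : fluct y t s - fluct y u s =
 (Num.sqrt r)^-1 * \sum_(j <- L) ((y t (s, Z j s) - y u (s, Z j s)) - (ymean y t s - ymean y u s)).
by rewrite /fluct -mulrBr -sumrB; congr (_ * _); apply: eq_bigr=> j _; ring.
rewrite normrM ger0N ?invr_ge0 ?sqrtr_ge0// -ler_pdivlMl ?invr_gt0// invrK.
have : \sum_(j <- L) `|y t (s, Z j s) - y u (s, Z j s) - (ymean y t s - ymean y u s)| <=
 \sum_(j <- L) (kap * DN (Z j s) + kap * ((powc 0 + 2) / 2 ^+ m)).
apply: ler_sum=> j _; apply: le_trans (ler_normB _ _) _.
by apply: le_trans (lerD (Dle (s, Z j s)) mean_le) _; rewrite le_eqVlt; apply/orP; left; apply/eqP; ring.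
move=> h; apply: le_trans (ler_norm_sum _ _ _) (le_trans h _).
rewrite big_split/= -mulr_sumr big_const_seq count_predT iter_addr_0 -[X in _ + X]mulr_natl -/r.
have k1:= lerM2l kap0 sumDN.
(* The mesh is at most 1 / r, so the means add up to a constant, which is divided by sqrt r in the
   end. *)
have rq : r * (2 ^+ m)^-1 <= 1 by rewrite ler_pdivr// mul1r.
have k2:= lerM2l (_ : 0 <= kap * (2 * powc 0 + 2)) rq.
have {}k2:= k2 (mulr_ge0 kap0 (addr_ge0 (mulr_ge0 (ler0n _ _) (powc_ge0 _)) (ler0n _ _))).
have -> : Num.sqrt r * (kap * fdelta count_obs m s + 2 * kap * (powc 0 + 1) / Num.sqrt r) =
 kap * (Num.sqrt r * fdelta count_obs m s) + 2 * kap * (powc 0 + 1) by field; rewrite gt_eqF.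
by apply: le_trans (lerD k1 (lexx _)) _; lra.
Qed.
Lemma fluct_osc L1 t s : 0 <= t <= 1 -> (L1 <= m)%N -> `|fluct y t s - fgrid y L1 t s| <= fosc L1 s.
move=> t01 Lm; rewrite -(subrKA (fgrid y m t s)) addrC; apply: le_trans (ler_normD _ _) (lerD _ _).
exact: fgrid_chain.
exact: fluct_end.
Qed.
Definition oscc k:= 8 * fluct_const k ^+ 2 + 6 * fluct_const k + 1.
Lemma Ex_fosc L1' : 2 ^+ m <= 2 * r -> (L1' <= m)%N -> L1 PS (fosc L1') /\
Ex PS (fosc L1') <= (9 * oscc kap + kap * oscc 1) * rho ^+ L1' + 2 * kap * (powc 0 + 1) / Num.sqrt r.
move=> mr Lm; have rho0:= rho_gt0 : 0 < rho :> R.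
have rS k : rho ^+ k.+1 = 9 / 10 * rho ^+ k :> R by rewrite exprS.
have fc k : 0 <= k -> 0 <= oscc k.
by move=> k0; rewrite /oscc /fluct_const !addr_ge0 ?mulr_ge0 ?exprn_ge0 ?addr_ge0 ?mulr_ge0 ?addr_ge0 ?exprn_ge0 ?powc_ge0.
have dl l : (l <= m)%N -> L1 PS (fdelta y l) /\ Ex PS (fdelta y l) <= oscc kap * rho ^+ l.
move=> lm; apply: (@Ex_fdelta y kap)=> //; apply: le_trans mr.
by apply: ler_weXn2l=> //; rewrite ler1n.
have [Ln En]:= Ex_fdelta ler01 count_meas count_inc count0 mr.
(* As 1 - rho = 1 / 10, the sum of rho^l for L1' < l <= m is exactly 9 rho^L1' - 10 rho^(m+1); the
   subtracted term carries the induction. *)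
have Ls : L1 PS (fun s=> \sum_(L1'.+1 <= l < m.+1) fdelta y l s) /\
 Ex PS (fun s=> \sum_(L1'.+1 <= l < m.+1) fdelta y l s) <= 9 * oscc kap * rho ^+ L1' - 10 * oscc kap * rho ^+ m.+1.
have dl' : forall l, (l < m.+1)%N -> L1 PS (fdelta y l) /\ Ex PS (fdelta y l) <= oscc kap * rho ^+ l by mf.
have {Ln En} : (L1'.+1 <= m.+1)%N by [].
elim: m.+1 dl'=> [//|k IH] dk; rewrite leq_eqVlt=> /orP[/eqP <-|Lk].
 rewrite (_ : (fun s=> _) = fun=> 0) ?Ex_cst; last by apply/funext=> s; rewrite big_geq.
 by split; [exact: L1_cst|rewrite rS; lra].
have E s : \sum_(L1'.+1 <= l < k.+1) fdelta y l s = \sum_(L1'.+1 <= l < k) fdelta y l s + fdelta y k s by rewrite big_nat_recr.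
have [Lk1 Ek1]:= IH (fun l lk=> dk l (leqW lk)) Lk; have [Lk2 Ek2]:= dk k (leqnn _).
rewrite (_ : (fun s=> _) = (fun s=> \sum_(L1'.+1 <= l < k) fdelta y l s + fdelta y k s)); last exact/funext.
split; first exact: L1D.
by rewrite ExD//; apply: le_trans (lerD Ek1 Ek2) _; rewrite rS; lra.
have [Ls1 Es1]:= Ls.
split; first by apply: L1D=> //; apply: L1D; [exact: L1Z|exact: L1_cst].
rewrite ExD//; last by apply: L1D; [exact: L1Z|exact: L1_cst].
rewrite ExD; [|exact: L1Z|exact: L1_cst]; rewrite ExZ// Ex_cst addrA lerD2r mulrDl.
have rm' : rho ^+ m <= rho ^+ L1' :> R by apply: ler_wiXn2l=> //; rewrite ltW ?rho_lt1.
have m0 : 0 <= 10 * oscc kap * rho ^+ m.+1 by rewrite !mulr_ge0 ?fc ?exprn_ge0 ?(ltW rho0).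
apply: lerD; first by apply: le_trans Es1 _; rewrite lerBlDr lerDl.
by rewrite -mulrA lerM2l//; apply: le_trans En _; rewrite lerM2l// fc.
Qed.
End all_times.
End fluctuations.

(** * Expectations of functions not known to be measurable *)

Section lower_integral.
Context {R : realType} d (T : mType d) (P : prob T R).
(** A nonnegative integral is a supremum over simple functions below the integrand, which is
    monotone for arbitrary functions. *)
Lemma integral_mono (f h : T -> \bar R) : (forall x, 0 <= f x)%E -> (forall x, f x <= h x)%E ->
(\int[P]_x f x <= \int[P]_x h x)%E.
move=> f0 fh; rewrite !ge0_integralTE// => [|x]; last exact: le_trans (f0 x) (fh x).
by apply: le_ereal_sup=> _ [g gf <-]; exists g=> // x; exact: le_trans (gf x) (fh x).
Qed.
(* No measurability of f: its integral is squeezed between those of h - B and h + B. *)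
Lemma integral_squeeze (f h B : T -> R) : L1 P h -> L1 P B -> (forall x, `|f x - h x| <= B x) ->
`|fine 'E_P[f] - Ex P h| <= Ex P B.
move=> Lh LB fhB; have Lm:= L1B Lh LB; have Lp:= L1D Lh LB; rewrite unlock.
have pm (x y : R) : x <= y -> Num.max x 0 <= Num.max y 0.
by move=> xy; rewrite ge_max !le_max xy lexx !orbT.
have [lo hi] : (forall x, h x - B x <= f x) /\ (forall x, f x <= h x + B x).
by split=> x; have:= fhB x; rewrite ler_norml=> /andP[]; lra.
have E (k : T -> R) : L1 P k -> [/\ (\int[P]_x (Num.max (k x) 0)%:E = (Ex P (fun x=> Num.max (k x) 0))%:E)%E,
 (\int[P]_x (Num.max (- k x) 0)%:E = (Ex P (fun x=> Num.max (- k x) 0))%:E)%E &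
 Ex P k = Ex P (fun x=> Num.max (k x) 0) - Ex P (fun x=> Num.max (- k x) 0)].
move=> Lk; have Lk':= L1_max0 (L1N Lk); have Lk'':= L1_max0 Lk; rewrite -!EFin_Ex -?ExB//; split=> //.
by eqEx=> x; exact: max0_split.
have max0 (x : R) : 0 <= Num.max x 0 by rewrite le_max lexx orbT.
have mono (k1 k2 : T -> R) : (forall x, k1 x <= k2 x) -> (\int[P]_x (Num.max (k1 x) 0)%:E <= \int[P]_x (Num.max (k2 x) 0)%:E)%E.
by move=> k12; apply: integral_mono=> x; rewrite lee_fin//; exact: pm.
have [p1 n1 e1]:= E _ Lm; have [p2 n2 e2]:= E _ Lp.
have -> : (\int[P]_x (f x)%:E = \int[P]_x (Num.max (f x) 0)%:E - \int[P]_x (Num.max (- f x) 0)%:E)%E.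
by rewrite integralE; congr (_ - _)%E; apply: eq_integral=> x _; rewrite ?funeposE ?funenegE EFin_max.
have:= mono _ _ lo; have:= mono _ _ hi; rewrite p1 p2.
have:= mono (fun x=> - f x) (fun x=> - (h x - B x)) (fun x=> ltac:(rewrite lerN2; exact: lo)).
have:= mono (fun x=> - (h x + B x)) (fun x=> - f x) (fun x=> ltac:(rewrite lerN2; exact: hi)).
rewrite n1 n2; case: (\int[P]_x _)%E=> [u||]//; case: (\int[P]_x _)%E=> [v||]//; rewrite !lee_fin=> h1 h2 h3 h4.
rewrite /= ler_norml; move: e1 e2; rewrite ExB// ExD//; lra.
Qed.
(** The bound B is enlarged on a null set so as to hold everywhere; completeness keeps it
    measurable. *)
Lemma integral_squeeze_ae (f h B : T -> R) : P.-negligible `<=` measurable -> L1 P h -> L1 P B ->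
{ae P, forall x, `|f x - h x| <= B x} -> `|fine 'E_P[f] - Ex P h| <= Ex P B.
move=> cP Lh LB fhB; pose B' x:= if `|f x - h x| <= B x then B x else `|f x - h x|.
have BE : {ae P, forall x, B' x = B x} by apply: filterS fhB=> x; rewrite /B'=> ->.
have mB' : mT B'.
move=> _ A mA; rewrite setTI; apply: (ae_measurable_set cP (B:= B @^-1` A)).
 by rewrite -[X in measurable X]setTI; exact: (L1_meas LB).
by apply: filterS BE=> x /= ->.
have LB' : L1 P B' by apply: (L1_ae mB' _ LB); apply: filterS BE=> x ->.
rewrite -(Ex_ae mB' (L1_meas LB) BE); apply: integral_squeeze=> // x.
by rewrite /B'; case: ifP=> // /negbT; rewrite -ltNge=> /ltW.
Qed.
End lower_integral.

(** * Cadlag paths and the Skorokhod distance *)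

Section cadlag_paths.
Context {R : realType}.
Implicit Types x y : R -> R.
Lemma cadlagD x y : cadlag x -> cadlag y -> cadlag (fun t=> x t + y t).
move=> [x1 x2] [y1 y2]; split=> t t01; first exact: cvgD (x1 t t01) (y1 t t01).
by have [a xa]:= x2 t t01; have [c yc]:= y2 t t01; exists (a + c); exact: cvgD.
Qed.
Lemma cadlagZ c x : cadlag x -> cadlag (fun t=> c * x t).
move=> [x1 x2]; split=> t t01; first by apply: cvgMr; exact: x1.
by have [a xa]:= x2 t t01; exists (c * a); exact: cvgMr.
Qed.
Lemma cadlag_sum (I : Type) (s : seq I) (x : I -> R -> R) : (forall i, cadlag (x i)) ->
cadlag (fun t=> \sum_(i <- s) x i t).
move=> xc; split=> t t01; first by apply: cvg_sum_seq=> i; exact: (xc i).1.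
have /choice[a ha] (i : I) : exists l : R, x i s @[s --> t^'-] --> l by exact: (xc i).2.
by exists (\sum_(i <- s) a i); exact: cvg_sum_seq.
Qed.
Lemma cadlag_near x : (forall t, 0 <= t < 1 -> \forall s \near t^'+, x s = x t) ->
(forall t, 0 < t <= 1 -> exists l, \forall s \near t^'-, x s = l) -> cadlag x.
move=> h1 h2; split=> t t01; first by apply: cvg_near_cst; exact: h1.
by have [l hl]:= h2 t t01; exists l; exact: cvg_near_cst.
Qed.
Lemma cadlag_indic a : cadlag (fun t : R=> (a <= t)%R%:R).
apply: cadlag_near=> t _.
case: (leP a t)=> ta; near=> s; first by rewrite (le_trans ta)//; apply/ltW; near: s; by [].
by rewrite leNgt (_ : s < a)//; near: s; by [].
case: (ltP a t)=> ta; [exists 1|exists 0]; near=> s.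
by rewrite (_ : a <= s)//; near: s; exact: nbhs_left_ge.
by rewrite leNgt (lt_le_trans _ ta)//; near: s; by [].
Unshelve. all: by end_near. Qed.
Lemma cadlag_cvg x : (forall t, 0 <= t <= 1 -> forall e, 0 < e -> exists2 dl : R, 0 < dl &
 forall s, 0 <= s <= 1 -> `|s - t| < dl -> `|x s - x t| < e) -> cadlag x.
move=> xc; split=> t /andP[t0 t1]; last exists (x t); apply/cvgrPdist_lt=> e e0.
have [dl dl0 H]:= xc t (ltac:(rewrite t0 ltW//)) e e0; near=> s.
have ts : t < s by [].
rewrite distrC; apply: H; first by rewrite (le_trans t0 (ltW ts)); near: s; exact: nbhs_right_le.
by rewrite gtr0_norm ?subr_gt0// ltrBlDl; near: s; apply: nbhs_right_lt; rewrite ltrDl.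
have [dl dl0 H]:= xc t (ltac:(rewrite t1 ltW//)) e e0; near=> s.
have ts : s < t by [].
rewrite distrC; apply: H; first by rewrite (le_trans (ltW ts) t1) andbT; near: s; exact: nbhs_left_ge.
by rewrite distrC gtr0_norm ?subr_gt0// ltrBlDr -ltrBlDl; near: s; apply: nbhs_left_gt; rewrite ltrBlDr ltrDl.
Unshelve. all: by end_near. Qed.
(* The path equal to u_i on the i-th dyadic interval of level L. *)
Definition step (L : nat) (u : seq R) (t : R) : R:= nth 0 u (dyidx L t).
Lemma cadlag_lip x A : 0 <= A ->
(forall u v, 0 <= u -> u <= v -> v <= 1 -> `|x v - x u| <= A * (v - u)) -> cadlag x.
move=> A0 lip; have A1 : 0 < A + 1 by lra.
apply: cadlag_cvg=> t /andP[t0 t1] e e0; exists (e / (A + 1))=> [|u /andP[u0 u1]]; first by rewrite divr_gt0.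
rewrite ltr_pdivlMr// mulrC; apply: le_lt_trans; apply: le_trans (_ : A * `|u - t| <= _); last by rewrite ler_wpM2r// lerDl.
case: (leP t u)=> tu; first by rewrite [in leRHS]ger0N ?subr_ge0// lip.
by rewrite distrC [in leRHS]ltr0_norm ?subr_lt0// opprB lip// ltW.
Qed.
Lemma cadlag_step L u : cadlag (step L u).
have p0 : 0 < 2 ^+ L :> R by nn.
have eqidx (s : R) (k : nat) : 0 <= s -> k%:R <= 2 ^+ L * s -> 2 ^+ L * s < k.+1%:R -> dyidx L s = k.
by move=> s0 h1 h2; apply: truncn_def; rewrite h1.
apply: cadlag_near=> t /andP[t0 t1].
have /andP[i1 i2]:= dyidx_itv L t0; near=> s; rewrite /step (@eqidx s (dyidx L t))//.
- by rewrite (le_trans t0)//; apply/ltW; near: s; by [].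
- by rewrite (le_trans i1)// ler_pM2l//; apply/ltW; near: s; by [].
- rewrite mulrC -ltr_pdivlMr//; near: s; apply: nbhs_right_lt.
 by rewrite ltr_pdivlMr// mulrC.
have /andP[i1 i2]:= dyidx_itv L (ltW t0); move: i1 i2; set k:= dyidx L t=> i1 i2.
(* The left limit at a dyadic point is the value on the preceding interval, so the index sought
   satisfies m < 2^L t <= m + 1. *)
have [m m1 m2] : exists2 m : nat, m%:R < 2 ^+ L * t & 2 ^+ L * t <= m.+1%:R.
have [e|ne]:= eqVneq (k%:R : R) (2 ^+ L * t); last by exists k; rewrite ?lt_neqAle ?ne// ltW.
have k0 : (0 < k)%N by rewrite -(ltr_nat R) e mulr_gt0.
by exists k.-1; rewrite -e ?ltr_nat prednK// ltn_predL.
exists (nth 0 u m); near=> s; have st : s < t by near: s; exact: nbhs_left_lt.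
rewrite /step (@eqidx s m)//; first by near: s; exact: nbhs_left_ge.
- rewrite mulrC -ler_pdivr//; apply/ltW; near: s; apply: nbhs_left_gt.
by rewrite ltr_pdivrMr// mulrC.
- by apply: lt_le_trans m2; rewrite ltr_pM2l.
Unshelve. all: by end_near. Qed.
Lemma cadlag_eq x y : (forall t, 0 <= t <= 1 -> x t = y t) -> cadlag x -> cadlag y.
move=> xy [x1 x2]; split=> t /andP[t0 t1].
rewrite -xy ?t0 ?ltW//; apply: cvg_trans (x1 t (ltac:(by rewrite t0 t1))); apply: near_eq_cvg; near=> s; apply: xy.
apply/andP; split; last by near: s; exact: nbhs_right_le.
by rewrite (le_trans t0)//; apply/ltW; near: s; by [].
have [l xl]:= x2 t (ltac:(by rewrite t0 t1)); exists l; apply: cvg_trans xl; apply: near_eq_cvg; near=> s; apply: xy.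
apply/andP; split; first by near: s; exact: nbhs_left_ge.
by apply: le_trans t1; apply/ltW; near: s; exact: nbhs_left_lt.
Unshelve. all: by end_near. Qed.
(** Turns a supremum over [0, 1] into a countable one. [clip01] keeps the times in [0, 1] and
    reaches the endpoint 1, where there is no right limit to use. *)
Lemma cadlag_gt_rat x K : cadlag x -> (exists2 t, 0 <= t <= 1 & K < `|x t|) ->
exists q : rat, K < `|x (clip01 (ratr q))|.
move=> [x1 _] [t /andP[t0 t1] Kt]; have id01 s : 0 <= s <= 1 -> clip01 s = s.
by move=> /andP[s0 s1]; rewrite /clip01 min_r// max_r.
have [t1'|t1']:= ltP t 1; last first.
by exists 1%Q; rewrite rmorph1 id01 ?lexx ?ler01// -(le_anti (introT andP (conj t1 t1'))).
have : \forall u \near t^'+, K < `|x u| by apply: cvgr_gt Kt; apply: cvg_norm; apply: x1; rewrite t0.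
move=> /nbhs_ballP[e /= e0 he]; have te : t < Num.min (t + e) 1 by rewrite lt_min ltrDl e0.
have [q]:= rat_in_itvoo te; rewrite in_itv/= lt_min=> /andP[tq /andP[qe q1]]; exists q.
rewrite id01 ?(le_trans t0) ?ltW//; apply: he=> //.
by rewrite /ball /= distrC gtr0_norm ?subr_gt0// ltrBlDl.
Qed.
(** The identity is the time change; all paths below are compared uniformly. *)
Lemma skorokhod_le x y (c : R) : 0 <= c -> (forall t, 0 <= t <= 1 -> `|x t - y t| <= c) ->
(skorokhod_dist x y <= c%:E)%E.
move=> c0 xy; apply: ereal_inf_le; exists (maxe (time_change_norm (@idfun R)) (supnorm (fun t=> x t - y t))).
by exists idfun=> //; split=> //; apply: continuous_subspaceT=> z; exact: cvg_id.
rewrite ge_max; apply/andP; split; apply: ge_ereal_sup=> z /=.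
by move=> [p [_ p12 _] <-]; rewrite divff ?subr_eq0 ?gt_eqF// ln1 normr0 lee_fin.
by move=> [t]; rewrite in_itv/= => t01 <-; rewrite lee_fin xy.
Qed.
Lemma BL1_le (f : (R -> R) -> R) x y (c : R) : BL1 cadlag skorokhod_dist f -> cadlag x -> cadlag y -> 0 <= c ->
(forall t, 0 <= t <= 1 -> `|x t - y t| <= c) -> `|f x - f y| <= c.
by move=> [_ fL] cx cy c0 xy; rewrite -lee_fin; exact: le_trans (fL x y cx cy) (skorokhod_le c0 xy). Qed.
Variables (V : R -> R) (kappa : R).
Hypotheses (kap0 : 0 < kappa) (V0 : V 0 = 0)
(Vi : forall s t, 0 <= s -> s <= t -> t <= 1 -> 0 <= V t - V s <= kappa * (t - s)).
Lemma gmart_osc_cvg u e : 0 < e -> exists k, Num.sqrt kappa * BMosc k u < e.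
move=> e0; have /cvgrPdist_lt/(_ e e0)[k _ /(_ k (leqnn k))] : Num.sqrt kappa * BMosc l u @[l --> \oo] --> 0.
by rewrite -[0](mulr0 (Num.sqrt kappa)); apply: cvgMr; exact: BMosc_cvg.
by rewrite sub0r normrN ger0N ?mulr_ge0 ?sqrtr_ge0 ?BMosc_ge0//; exists k.
Qed.
Lemma cadlag_gmart u : cadlag (gmart V kappa ^~ u).
apply: cadlag_cvg=> t /andP[t0 t1] e e0; have [k hk]:= gmart_osc_cvg u e0.
exists (2 ^+ k)^-1=> [|s /andP[s0 s1] st]; first nn.
apply: le_lt_trans hk; case: (leP t s)=> ts.
by apply: (gmart_modulus kap0 V0 Vi)=> //; rewrite -[_ - _]ger0N ?subr_ge0// ltW.
by rewrite distrC; apply: (gmart_modulus kap0 V0 Vi)=> //; [nn|rewrite -[_ - _]gtr0_norm ?subr_gt0// distrC ltW].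
Qed.
Lemma gmart_grid k u t : 0 <= t <= 1 ->
`|gmart V kappa t u - gmart V kappa ((2 ^+ k)^-1 * (dyidx k t)%:R) u| <= Num.sqrt kappa * BMosc k u.
move=> /andP[t0 t1]; have p0 : 0 < 2 ^+ k :> R by rewrite exprn_gt0.
have /andP[d1 d2]:= dyidx_itv k t0; apply: (gmart_modulus kap0 V0 Vi)=> //.
- by rewrite mulrC ler_pdivr// mulrC.
- by rewrite lerBlDr -[X in X + _]mulr1 -mulrDr mulrC ler_pdivlMr// mulrC addrC natr1 ltW.
Qed.
End cadlag_paths.
Lemma sqrD_le (R : realDomainType) (x y : R) : (x + y) ^+ 2 <= 2 * x ^+ 2 + 2 * y ^+ 2.
by have:= sqr_ge0 (x - y); lra. Qed.
Lemma abs_le_sqr (R : realDomainType) (x : R) : `|x| <= 1 + x ^+ 2.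
by rewrite -(real_normK (num_real x)); have:= sqr_ge0 (`|x| - 1); nra. Qed.
(** Optimizing a in Young's inequality, in place of Cauchy-Schwarz; eta > 0 keeps a = (h + eta) / (g
    + eta) positive and finite when g or h vanishes. *)
Lemma le_prod_young (R : realFieldType) (X g h : R) : 0 <= g -> 0 <= h ->
(forall a, 0 < a -> X <= (a * g ^+ 2 + h ^+ 2 / a) / 2) -> X <= g * h.
move=> g0 h0 H; apply/ler_addgt0Pr=> e e0; pose eta:= e / (g + h + 1).
have s0 : 0 < g + h + 1 by lra.
have eta0 : 0 < eta by rewrite divr_gt0.
have ge : 0 < g + eta by lra. have he : 0 < h + eta by lra.
apply: le_trans (H _ (divr_gt0 he ge)) _; rewrite invf_div.
have k1 : (h + eta) / (g + eta) * g ^+ 2 <= (h + eta) * g.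
by rewrite mulrAC ler_pdivr// -mulrA lerM2l ?(ltW he)// mulrDr expr2 lerDl mulr_ge0// ltW.
have k2 : h ^+ 2 * ((g + eta) / (h + eta)) <= (g + eta) * h.
by rewrite mulrA ler_pdivr// mulrC -mulrA lerM2l ?(ltW ge)// mulrDr expr2 lerDl mulr_ge0// ltW.
have : eta * (g + h + 1) = e by rewrite mulfVK ?gt_eqF.
by lra.
Qed.
Lemma young1 (R : realFieldType) (x e : R) : 0 < e -> `|x| <= e + x ^+ 2 / e.
move=> e0; rewrite -(ler_pM2l e0) mulrDr mulrCA divff ?gt_eqF// mulr1 -(real_normK (num_real x)).
by have:= sqr_ge0 (`|x| - e); nra.
Qed.

(** * The experiment at a fixed sample size *)

Section experiment.
Context {R : realType} d (T : mType d) (P : prob T R).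
Context dS (S : mType dS) (PS : prob S R) (n : nat) (Z : 'I_n -> S -> T).
Hypothesis iidZ : iid_sample P PS Z.
Notation Q:= (U01 \x P)%E.
Notation predT H:= (sigmaT (pgen H)).
Context (N : R -> T -> nat) (F H : R -> set (set T)) (lam G : R -> T -> R) (C C' : R) (b l g : R * T -> R).
Hypotheses (red : reduced P N F H lam G C C' b l g)
(C0 : 0 <= C) (C'0 : 0 <= C').
Variables (I0 : {set 'I_n}) (L : seq 'I_n).
Hypotheses (uL : uniq L) (LI : forall j, j \in L -> j \notin I0) (L0 : (0 < size L)%N).
Let r : R:= (size L)%:R.
Variables (Gh Lh : obsT Z I0 * (R * T) -> R).
Hypotheses (mGh : mT (Gh : obsT Z I0 * predT H -> R))
(mLh : mT (Lh : obsT Z I0 * predT F -> R))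
(GhC : forall p, `|Gh p| <= C') (LhC : forall p, `|Lh p| <= C).
Let hN:= red_hN red. Let mN:= red_mN red. Let fF:= red_fF red. Let fH:= red_fH red.
Let aN:= red_aN red. Let cb:= red_cb red. Let b0C:= red_b red.
Let mb : mT b. by case: cb=> _ _ /(pred_meas fH). Qed.
Let mg : mT g. exact: pred_meas (red_mg red). Qed.
Let ml : mT l. exact: pred_meas (red_ml red). Qed.
Let bC p : `|b p| <= C. by have /andP[h ?]:= b0C p; rewrite ger0N. Qed.
Let lC p : `|l p| <= C. by have /andP[h ?]:= red_l red p; rewrite ger0N. Qed.
Let gC p : `|g p| <= C'. exact: (red_g red). Qed.
Let mGh' : mT Gh. exact: obs_pred mGh. Qed.
Let mLh' : mT Lh. exact: obs_pred mLh. Qed.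
Let mGs s : mT ((fun p=> Gh (s, p)) : predT H -> R).
mf. Qed.
Let mLs s : mT ((fun p=> Lh (s, p)) : predT F -> R).
mf. Qed.
Let mGs' s : mT (fun p=> Gh (s, p)). mf. Qed.
Let mLs' s : mT (fun p=> Lh (s, p)). mf. Qed.
Definition upto (t : R) (p : R * T) : R:= (0 < p.1 <= t)%R%:R.
Let pred_upto (HH : R -> set (set T)) t : filt HH -> 0 <= t <= 1 -> mT (upto t : predT HH -> R).
by move=> fHH /andP[t0 t1]; have:= pred_itv fHH (lexx 0) t0 t1; exact. Qed.
Let mitv s t : mT (fun p : R * T=> (s < p.1 <= t)%R%:R : R).
exact: (mcompT (meas_itvR s t) mfst). Qed.
Let upto_bd t p : `|upto t p| <= 1. by rewrite ger0N ?ler0n// lern1 leq_b1. Qed.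
Let bdM (f h : R * T -> R) A B : bdd f A -> bdd h B -> forall p, `|f p * h p| <= A * B.
by move=> fA hB p; rewrite normrM ler_pM. Qed.
Let uptoM t (f : R * T -> R) A : bdd f A -> forall p, `|upto t p * f p| <= A.
by move=> fA p; rewrite -[A]mul1r; exact: bdM. Qed.
(* Integrals up to t of a bounded predictable process against N and against time. *)
Definition jpart (K : R * T -> R) t w : R:= jsum N (fun p=> upto t p * K p) w.
Definition tpart (K : R * T -> R) t w : R:= tint (fun p=> upto t p * K p) w.
Lemma part_incr (K : R * T -> R) A s t w : mT K -> bdd K A ->
0 <= s -> s <= t -> t <= 1 ->
`|jpart K t w - jpart K s w| <= A * ((N t w)%:R - (N s w)%:R) /\
`|tpart K t w - tpart K s w| <= A * (t - s).
move=> mK KA s0 st t1; have A0 : 0 <= A:= le_trans (normr_ge0 _) (KA (0, w)).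
have E u : upto t (u, w) * K (u, w) - upto s (u, w) * K (u, w) = (s < u <= t)%R%:R * K (u, w).
rewrite /upto /= -mulrBl; congr (_ * _); case: (ltP 0 u)=> u0 /=; last first.
 by rewrite subrr ltNge (le_trans u0 s0).
case: (leP u s)=> us /=; first by rewrite (le_trans us st) subrr.
by rewrite subr0.
have le u : `|(s < u <= t)%R%:R * K (u, w)| <= A * (s < u <= t)%R%:R.
by rewrite normrM mulrC ler_pM// ger0N ?ler0n.
split.
rewrite /jpart /jsum -[X in _ - X]mul1r -mulNr -psumZ -psumD.
rewrite (_ : psum _ _ = psum (N ^~ w) (fun u=> (s < u <= t)%R%:R * K (u, w))); last first.
 by apply: eq_psum=> // u _; rewrite mulN1r E.
apply: le_trans (psum_norm _ _) _; rewrite -(psum_count (hN w))// -psumZ; apply: psum_le=> // u _; exact: le.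
have mu v : mT (fun u=> upto v (u, w) * K (u, w)).
by apply: mfunM; [exact: meas_itvR|have:= mpair1 w mK; exact].
have Lu v : L1 U01 (fun u=> upto v (u, w) * K (u, w)) by apply: (L1by A)=> // u; exact: uptoM.
rewrite /tpart /tint -ExB//; apply: le_trans (Ex_norm (L1B (Lu _) (Lu _))) _.
rewrite -(@Ex_U01_itv R s t)// -ExZ; last first.
by apply: (L1by 1)=> [|u]; [exact: meas_itvR|rewrite ger0N ?ler0n// lern1 leq_b1].
apply: Ex_le=> [||u]; last by rewrite E; exact: le.
by apply: L1_norm; exact: L1B.
by apply: L1Z; apply: (L1by 1)=> [|u]; [exact: meas_itvR|rewrite ger0N ?ler0n// lern1 leq_b1].
Qed.
Lemma meas_jpart (K : R * T -> R) t : mT K -> mT (jpart K t).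
by move=> mK; apply: m_jsum=> //; exact: mfunM (mitv _ _) mK. Qed.
Lemma meas_tpart (K : R * T -> R) t : mT K -> mT (tpart K t).
by move=> mK; apply: meas_Ex2; exact: mfunM (mitv _ _) mK. Qed.
Lemma Ex_tpart (K : R * T -> R) A t : mT K -> bdd K A ->
L1 P (tpart K t) /\ Ex P (tpart K t) = Ex Q (fun p=> upto t p * K p).
move=> mK KA; have mu : mT (fun p=> upto t p * K p) by exact: mfunM (mitv _ _) mK.
split; last by rewrite (Ex_pair2_bd _ _ mu (uptoM t KA)).
apply: (L1by A)=> [|w]; first exact: meas_tpart.
by apply: Ex_bd=> [|u]; [have:= mpair1 w mu; exact|exact: uptoM].
Qed.
Lemma Ex_jpart (K : R * T -> R) A t : 0 <= t <= 1 -> mT (K : predT H -> R) -> bdd K A ->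
L1 P (jpart K t) /\ Ex P (jpart K t) = Ex Q (fun p=> upto t p * (K p * b p)).
move=> t01 mK KA; have [N1 _ _ e]:= cb; split; last first.
rewrite /jpart (e _ A); first by congr (Ex _ _); apply/funext=> p; rewrite mulrA.
 by apply: mfunM=> //; exact: pred_upto.
exact: uptoM.
apply: (L1_le _ (L1Z A N1))=> [|w]; first by apply: meas_jpart; exact: pred_meas mK.
by apply: jsum_bd=> // p; exact: uptoM.
Qed.
(** The integral of the estimated residual against the estimated martingale for one observation,
    with the training data as first argument. *)
Definition rpath t (p : obsT Z I0 * T) : R :=
jpart (fun q=> Gh (p.1, q)) t p.2 - tpart (fun q=> Gh (p.1, q) * Lh (p.1, q)) t p.2.
Definition kapp : R:= C' * (1 + C).
Let GL s p : `|Gh (s, p) * Lh (s, p)| <= C' * C. by rewrite normrM ler_pM. Qed.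
Let mGL s : mT (fun p=> Gh (s, p) * Lh (s, p)). mf. Qed.
Lemma kapp_ge0 : 0 <= kapp. by rewrite mulr_ge0// addr_ge0. Qed.
Lemma rpath_incr s t p : 0 <= s -> s <= t -> t <= 1 ->
`|rpath t p - rpath s p| <= kapp * ((N t p.2)%:R - (N s p.2)%:R + (t - s)).
move=> s0 st t1; case: p=> x w.
have [h1 _]:= part_incr w (mGs' x) (fun p=> GhC (x, p)) s0 st t1.
have [_ h2]:= part_incr w (mGL x) (GL x) s0 st t1.
have dN : 0 <= (N t w)%:R - (N s w)%:R :> R by rewrite subr_ge0 ler_nat (cnt_le (hN w)).
have dt : 0 <= t - s by rewrite subr_ge0.
rewrite (_ : _ - _ = (jpart (fun q=> Gh (x, q)) t w - jpart (fun q=> Gh (x, q)) s w) -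
(tpart (fun q=> Gh (x, q) * Lh (x, q)) t w - tpart (fun q=> Gh (x, q) * Lh (x, q)) s w)); last by rewrite /rpath/=; ring.
apply: le_trans (ler_normB _ _) (le_trans (lerD h1 h2) _); rewrite /=.
have:= mulr_ge0 (mulr_ge0 C'0 C0) dN; have:= mulr_ge0 C'0 dt; rewrite /kapp; lra.
Qed.
Lemma rpath0 p : rpath 0 p = 0.
have E q : upto 0 q = 0 by rewrite /upto; case: ltgtP=> //= h; rewrite leNgt h.
have [c0 _ _ _]:= hN p.2; rewrite /rpath /jpart /tpart /jsum /tint.
rewrite (_ : (fun s=> upto 0 (s, p.2) * (Gh _ * _)) = fun=> 0) ?Ex_cst; last by apply/funext=> u; rewrite E mul0r.
by rewrite subr0 /psum big1// => i _; rewrite E mul0r.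
Qed.
Lemma meas_resid_path t : mT (rpath t).
have mu : mT (fun q : obsT Z I0 * (R * T)=> upto t q.2) by exact: (mcompT (mitv 0 t) msnd).
apply: mfunB.
exact: (meas_jsum2 hN mN (K:= fun q=> upto t q.2 * Gh q) (mfunM mu mGh')).
have mphi : mT (fun q : (obsT Z I0 * T) * R=> (q.1.1, (q.2, q.1.2)) : obsT Z I0 * (R * T)).
apply: mpair; first exact: mcompT.
by apply: mpair=> //; exact: mcompT.
exact: (meas_Ex _ (mcompT (mfunM mu (mfunM mGh' mLh')) mphi)).
Qed.
Definition nuisance (s : obsT Z I0) : R:= Ex Q (fun p=> `|Gh (s, p) - g p| * `|l p - Lh (s, p)|).
(** The hypothesis replaces [b] by [l] against Gh - g. The mean minus gamma is then E int (Gh - g)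
    (l - Lh) plus E int g (l - Lh), and the latter vanishes because l - Lh is F-predictable. *)
Lemma mean_gamma t s : 0 <= t <= 1 ->
Ex Q (fun p=> upto t p * ((Gh (s, p) - g p) * b p)) = Ex Q (fun p=> upto t p * ((Gh (s, p) - g p) * l p)) ->
`|ymean P rpath t s - lcm_gamma P N lam G t| <= nuisance s.
have g0:= red_g0 red; move=> t01 hGb; have mu : mT (upto t):= mitv 0 t.
have LB (f h : R * T -> R) A B : mT f -> mT h ->
 bdd f A -> bdd h B -> L1 Q (fun p=> upto t p * (f p * h p)).
move=> mf mh fA hB; apply: (L1by (A * B)); first by apply: mfunM=> //; mf.
by apply: uptoM; exact: bdM.
have [Lj Ej]:= Ex_jpart t01 (mGs s) (fun p=> GhC (s, p)).
have [Lt Et]:= Ex_tpart t (mGL s) (GL s).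
have mB (f h : R * T -> R) A B : mT f -> mT h ->
bdd f A -> bdd h B -> mT (fun p=> f p - h p) /\ (forall p, `|f p - h p| <= A + B).
move=> mf mh fA hB; split; first mf.
by move=> p; rewrite (le_trans (ler_normB _ _)) ?lerD.
have [m1 d1]:= mB _ _ _ _ (mGs' s) mg (fun p=> GhC (s, p)) gC.
have [m2 d2]:= mB _ _ _ _ ml (mLs' s) lC (fun p=> LhC (s, p)).
rewrite /ymean ExB// Ej Et (red_gamma red)//.
have -> : Ex Q (fun p=> (p.1 <= t)%R%:R * (g p * (b p - l p))) =
Ex Q (fun p=> upto t p * (g p * b p)) - Ex Q (fun p=> upto t p * (g p * l p)).
rewrite -ExB; [|exact: (LB _ _ C' C)..]; congr (Ex _ _); apply/funext=> p; rewrite -mulrBr -mulrBr /upto.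
have [/andP[-> _]//|/g0->]:= boolP (0 < p.1 <= 1); lra.
have -> : Ex Q (fun p=> upto t p * (Gh (s, p) * b p)) =
 Ex Q (fun p=> upto t p * ((Gh (s, p) - g p) * l p)) + Ex Q (fun p=> upto t p * (g p * b p)).
rewrite -hGb -ExD; [|exact: LB m1 mb d1 bC|exact: (LB _ _ C' C)].
by congr (Ex _ _); apply/funext=> p; ring.
have gl0 : Ex Q (fun p=> upto t p * (g p * (l p - Lh (s, p)))) = 0.
rewrite -(red_gK red (K:= fun p=> upto t p * (l p - Lh (s, p))) (M:= C + C)).
- by congr (Ex _ _); apply/funext=> p; ring.
- apply: mfunM; first exact: pred_upto.
 by apply: mfunB=> //; exact: (red_ml red).
- exact: uptoM.
have e : Ex Q (fun p=> upto t p * ((Gh (s, p) - g p) * l p)) + Ex Q (fun p=> upto t p * (g p * l p)) =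
 Ex Q (fun p=> upto t p * (Gh (s, p) * Lh (s, p))) + (Ex Q (fun p=> upto t p * ((Gh (s, p) - g p) * (l p - Lh (s, p)))) +
 Ex Q (fun p=> upto t p * (g p * (l p - Lh (s, p))))).
have L1a:= LB _ _ _ _ m1 ml d1 lC; have L1b:= LB _ _ _ _ mg ml gC lC; have L1c:= LB _ _ _ _ m1 m2 d1 d2.
have L1d:= LB _ _ _ _ mg m2 gC d2; have L1e:= LB _ _ _ _ (mGs' s) (mLs' s) (fun p=> GhC (s, p)) (fun p=> LhC (s, p)).
rewrite -ExD// -(ExD L1c L1d) -(ExD L1e (L1D L1c L1d)).
by congr (Ex _ _); apply/funext=> p; ring.
rewrite gl0 addr0 in e; rewrite (_ : forall x y z v : R, x + y - z - (y - v) = x + v - z); last by move=> *; ring.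
rewrite e addrAC subrr add0r.
apply: le_trans (Ex_norm (LB _ _ _ _ m1 m2 d1 d2)) _; apply: Ex_le=> [||p].
- by apply: L1_norm; exact: LB m1 m2 d1 d2.
- apply: (L1by ((C' + C') * (C + C)))=> [|p].
 by apply: mfunM; exact: mcompT.
by rewrite normrM !normr_id ler_pM.
- by rewrite !normrM -[leRHS]mul1r ler_wpM2r// mulr_ge0.
Qed.
Let L1_sqr d' (T' : mType d') (P' : prob T' R) (f : T' -> R) A :
mT f -> bdd f A -> L1 P' (fun w=> f w ^+ 2).
move=> mf fA; apply: (L1by (A ^+ 2))=> [|w]; first mf.
by rewrite normrX lerXn2r ?nnegrE// (le_trans _ (fA w)).
Qed.
Let Ex_var (f : T -> R) A : mT f -> bdd f A ->
Ex P (fun w=> (f w - Ex P f) ^+ 2) <= Ex P (fun w=> f w ^+ 2).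
move=> mf fA; have Lf:= L1_bd P mf fA; have Lf2:= L1_sqr P mf fA.
rewrite (_ : (fun w=> _) = (fun w=> f w ^+ 2 - (2 * Ex P f * f w - Ex P f ^+ 2))); last by apply/funext=> w; ring.
have Lc : L1 P (fun w=> 2 * Ex P f * f w - Ex P f ^+ 2) by apply: L1B; [exact: L1Z|exact: L1_cst].
rewrite ExB// ExB; [rewrite ExZ// Ex_cst|exact: L1Z|exact: L1_cst].
by have:= sqr_ge0 (Ex P f); lra.
Qed.
Let Ex_sqr_le (f : R -> R) A : mT f -> bdd f A ->
Ex U01 f ^+ 2 <= Ex U01 (fun u=> f u ^+ 2).
move=> mf fA; have Lf:= L1_bd U01 mf fA; have Lf2:= L1_sqr U01 mf fA.
rewrite -subr_ge0 (_ : _ - _ = Ex U01 (fun u=> f u ^+ 2) - (2 * Ex U01 f * Ex U01 f - Ex U01 f ^+ 2)); last by ring.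
rewrite -[X in _ - (_ - X)](Ex_cst U01) -[2 * _ * _]ExZ// -ExB ?L1_cst//; last exact: L1Z.
rewrite -ExB//; last by apply: L1B; [exact: L1Z|exact: L1_cst].
apply: Ex_ge0=> u; rewrite (_ : _ - _ = (f u - Ex U01 f) ^+ 2) ?sqr_ge0//; ring.
Qed.
(** The oracle integral of g against dN - b ds, centred with or without H_0. *)
Definition noise t (w : T) : R:= jpart g t w - tpart (fun p=> g p * b p) t w.
Definition nsum t (s : S) : R:= (Num.sqrt r)^-1 * \sum_(j <- L) noise t (Z j s).
Definition mse (f h : R * T -> R) : R:= Ex Q (fun p=> (f p - h p) ^+ 2).
Let mse_bd (f h : R * T -> R) A : mT f -> mT h -> bdd f A -> bdd h A ->
[/\ mT (fun p=> f p - h p), forall p, `|f p - h p| <= A + A & L1 Q (fun p=> (f p - h p) ^+ 2)].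
move=> mf mh fA hA; have m:= mfunB mf mh.
have bd p : `|f p - h p| <= A + A by rewrite (le_trans (ler_normB _ _)) ?lerD.
by split=> //; exact: L1_sqr m bd.
Qed.
Let iso (K : R * T -> R) A t : 0 <= t <= 1 -> mT (K : predT H -> R) -> bdd K A ->
let X w:= jpart K t w - tpart (fun p=> K p * b p) t w in
[/\ mT X, L1 P (fun w=> X w ^+ 2), Ex P X = 0 &
  Ex P (fun w=> X w ^+ 2) = Ex Q (fun p=> upto t p * (K p ^+ 2 * b p))].
move=> t01 mK KA X; have [m1 l1 e1 e2]:= compensated_isometry hN mN aN fH cb b0C (mfunM (pred_upto fH t01) mK) (uptoM t KA).
have XE : X = fun w=> jsum N (fun p=> upto t p * K p) w - tint (fun p=> upto t p * K p * b p) w.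
by apply/funext=> w; rewrite /X /tpart /tint; congr (_ - Ex _ _); apply/funext=> p; rewrite mulrA.
split; [by rewrite XE|by rewrite XE|by rewrite XE|].
rewrite XE e2; congr (Ex _ _); apply/funext=> p; rewrite exprMn /upto.
by case: (0 < _ <= t); rewrite ?expr1n ?expr0n/= ?mulrA.
Qed.
Let mLGb s : mT (fun p=> Gh (s, p) * (b p - Lh (s, p))).
mf. Qed.
(** The difference is X, the compensated integral of Gh - g, plus the centred version of Y = int Gh
    (b - Lh) ds. The isometry bounds the first, Jensen's inequality the second. *)
Let noise_cond t s : 0 <= t <= 1 ->
L1 P (fun w=> (rpath t (s, w) - ymean P rpath t s - noise t w) ^+ 2) /\
Ex P (fun w=> rpath t (s, w) - ymean P rpath t s - noise t w) = 0 /\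
Ex P (fun w=> (rpath t (s, w) - ymean P rpath t s - noise t w) ^+ 2) <=
 2 * C * mse (fun p=> Gh (s, p)) g + 2 * C' ^+ 2 * mse b (fun p=> Lh (s, p)).
move=> t01; have [m1 d1 s1]:= mse_bd (mGs' s) mg (fun p=> GhC (s, p)) gC.
have [m2 d2 s2]:= mse_bd mb (mLs' s) bC (fun p=> LhC (s, p)).
have d3 p : `|Gh (s, p) * (b p - Lh (s, p))| <= C' * (C + C) by rewrite normrM ler_pM.
pose X w:= jpart (fun p=> Gh (s, p) - g p) t w - tpart (fun p=> (Gh (s, p) - g p) * b p) t w.
pose Y:= tpart (fun p=> Gh (s, p) * (b p - Lh (s, p))) t.
have [mX LX X0 XE]:= iso t01 (mfunB (mGs s) (red_mg red)) d1; rewrite -/X in mX LX X0 XE.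
have [mn _ n0 _]:= iso t01 (red_mg red) gC; rewrite -/(noise t) in mn n0.
have mY : mT Y by exact: meas_tpart.
have Yu w : mT (fun u=> upto t (u, w) * (Gh (s, (u, w)) * (b (u, w) - Lh (s, (u, w))))).
by have:= mpair1 w (mfunM (mitv 0 t) (mLGb s)); exact.
have YC w : `|Y w| <= C' * (C + C) by apply: (Ex_bd _ (Yu w))=> u; exact: (uptoM t d3).
have RE w : rpath t (s, w) = noise t w + X w + Y w.
have mm (K : R * T -> R) u : mT K -> mT (fun v=> upto t (v, u) * K (v, u)).
 by move=> mK; have:= mpair1 u (mfunM (mitv 0 t) mK); exact.
have Lm (K : R * T -> R) A u : mT K -> bdd K A -> L1 U01 (fun v=> upto t (v, u) * K (v, u)).
 by move=> mK KA; apply: (L1by A)=> [|v]; [exact: mm|exact: uptoM].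
have j1 : jpart (fun p=> Gh (s, p)) t w = jpart g t w + jpart (fun p=> Gh (s, p) - g p) t w.
 by rewrite /jpart /jsum -psumD; congr psum; apply/funext=> u; ring.
have Lgb:= Lm _ _ w (mfunM mg mb) (bdM gC bC).
have Ldb:= Lm _ _ w (mfunM m1 mb) (bdM d1 bC).
have Ly:= Lm _ _ w (mLGb s) d3; have LGL:= Lm _ _ w (mGL s) (GL s).
have t1 : tpart (fun p=> g p * b p) t w + tpart (fun p=> (Gh (s, p) - g p) * b p) t w =
  tpart (fun p=> Gh (s, p) * Lh (s, p)) t w + Y w.
 by rewrite /Y /tpart /tint -ExD// -(ExD LGL Ly); congr (Ex _ _); apply/funext=> u; ring.
rewrite /rpath /noise /X /= j1; rewrite -[X in _ = _ + X](addKr (tpart (fun p=> Gh (s, p) * Lh (s, p)) t w)) -t1; ring.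
have LX1 : L1 P X.
by apply: (L1_le mX _ (fun w=> abs_le_sqr (X w))); apply: L1D=> //; exact: L1_cst.
have LY : L1 P Y by exact: (L1_bd P mY YC).
have Ln : L1 P (noise t).
apply: L1B; first by have []:= Ex_jpart t01 (red_mg red) gC.
by have []:= Ex_tpart t (mfunM mg mb) (bdM gC bC).
have yE : ymean P rpath t s = Ex P Y.
rewrite /ymean; under [fun w=> rpath _ _]eq_fun do rewrite RE.
by rewrite ExD//; [rewrite ExD// n0 X0 !add0r|exact: L1D].
have E w : rpath t (s, w) - ymean P rpath t s - noise t w = X w + (Y w - Ex P Y) by rewrite RE yE; ring.
under [fun w=> (_ - _) ^+ 2]eq_fun do rewrite E.
rewrite (_ : (fun w=> rpath _ _ - _ - _) = (fun w=> X w + (Y w - Ex P Y))); last exact/funext.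
have LYc : L1 P (fun w=> Y w - Ex P Y) by apply: L1B=> //; exact: L1_cst.
have LYc2 : L1 P (fun w=> (Y w - Ex P Y) ^+ 2).
apply: (@L1_sqr _ _ _ _ (C' * (C + C) + `|Ex P Y|))=> [|w]; first mf.
by rewrite (le_trans (ler_normB _ _))// lerD2r.
have sq w:= sqrD_le (X w) (Y w - Ex P Y).
have L2 : L1 P (fun w=> 2 * X w ^+ 2 + 2 * (Y w - Ex P Y) ^+ 2) by apply: L1D; exact: L1Z.
have LE : L1 P (fun w=> (X w + (Y w - Ex P Y)) ^+ 2).
apply: (L1_le _ L2)=> [|w]; last by rewrite ger0N ?sqr_ge0.
mf.
split=> //; split; first by rewrite ExD// X0 ExB// ?Ex_cst ?subrr ?addr0//; exact: L1_cst.
apply: le_trans (Ex_le LE L2 sq) _; rewrite ExD; [|exact: L1Z..]; rewrite !ExZ// -!mulrA; apply: lerD; rewrite lerM2l//.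
rewrite XE -ExZ//; apply: Ex_le=> [||p]; [|exact: L1Z|].
 apply: (L1by ((C' + C') ^+ 2 * C))=> [|p].
  by apply: mfunM; [exact: mitv|apply: mfunM=> //; mf].
 apply: (uptoM t (f:= fun p=> (Gh (s, p) - g p) ^+ 2 * b p))=> q; rewrite normrM ler_pM// normrX; apply: lerXn2r; rewrite ?nnegrE ?addr_ge0//; exact: d1.
rewrite mulrCA mulrC -mulrA; have /andP[u0 u1] : 0 <= upto t p <= 1 by rewrite ler0n lern1 leq_b1.
by have /andP[b0 b1]:= b0C p; rewrite /= mulrA ler_wpM2r ?sqr_ge0// -[C]mul1r ler_pM.
apply: le_trans (Ex_var mY YC) _.
have LY2:= L1_sqr P mY YC.
have mB2 : mT (fun p=> (b p - Lh (s, p)) ^+ 2) by mf.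
have B2 p : `|(b p - Lh (s, p)) ^+ 2| <= (C + C) ^+ 2 by rewrite normrX lerXn2r ?nnegrE// addr_ge0.
have mBw w : mT (fun u=> b (u, w) - Lh (s, (u, w))).
mf.
have Lw w : L1 U01 (fun u=> (b (u, w) - Lh (s, (u, w))) ^+ 2) by apply: L1_sqr=> // u; exact: d2.
have LB2 : L1 P (fun w=> Ex U01 (fun u=> (b (u, w) - Lh (s, (u, w))) ^+ 2)).
exact: (L1_pair2 (L1_bd Q mB2 B2) Lw).
rewrite /mse (Ex_pair2_bd _ _ mB2 B2) mulrA -expr2 -ExZ//; apply: Ex_le=> // [|w]; first exact: L1Z.
have LK : L1 U01 (fun u=> upto t (u, w) * (Gh (s, (u, w)) * (b (u, w) - Lh (s, (u, w))))).
by apply: (L1by (C' * (C + C)))=> // u; exact: (uptoM t d3).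
have KC u : `|upto t (u, w) * (Gh (s, (u, w)) * (b (u, w) - Lh (s, (u, w))))| <= C' * (C + C) by exact: (uptoM t d3).
have jen : Y w ^+ 2 <= Ex U01 (fun u=> (upto t (u, w) * (Gh (s, (u, w)) * (b (u, w) - Lh (s, (u, w))))) ^+ 2).
exact: Ex_sqr_le (Yu w) KC.
apply: le_trans jen _; rewrite -ExZ//; apply: Ex_le=> [||u]; [exact: L1_sqr (Yu w) KC|exact: L1Z|].
rewrite -(real_normK (num_real (_ * (_ * _)))) -(real_normK (num_real (b _ - _))) -exprMn.
by rewrite lerXn2r ?nnegrE ?mulr_ge0// normrM -[leRHS]mul1r ler_pM// normrM ler_wpM2r.
Qed.
(* Under H_0 the oracle noise, with the true residual and intensity, approximates the
fluctuations of the estimator. *)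
Lemma noise_approx A B t : 0 <= t <= 1 -> {ae Q, forall p, b p = l p} ->
Ex PS (fun s=> mse (fun p=> Gh (s, p)) g) <= A -> Ex PS (fun s=> mse l (fun p=> Lh (s, p))) <= B ->
L1 PS (fun s=> (fluct P L rpath t s - nsum t s) ^+ 2) /\
Ex PS (fun s=> (fluct P L rpath t s - nsum t s) ^+ 2) <=
 2 * C * A + 2 * C' ^+ 2 * B.
move=> t01 bl hA hB; pose Phi (p : obsT Z I0 * T):= rpath t p - ymean P rpath t p.1 - noise t p.2.
have mPhi : mT Phi.
apply: mfunB; first apply: mfunB.
- exact: meas_resid_path.
- exact: (mcompT (meas_Ex _ (meas_resid_path t)) mfst).
- have [mn _ _ _]:= iso t01 (red_mg red) gC; mf.
have h2 s:= (noise_cond s t01).1; have h0 s:= (noise_cond s t01).2.1.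
have msq d1 (A1 : mType d1) (f : A1 * (R * T) -> R) (h : A1 * (R * T) -> R) A' : mT f -> mT h ->
 bdd f A' -> bdd h A' -> mT (fun s=> Ex Q (fun p=> (f (s, p) - h (s, p)) ^+ 2)) /\
 forall s, `|Ex Q (fun p=> (f (s, p) - h (s, p)) ^+ 2)| <= (A' + A') ^+ 2.
move=> mf mh fA hA'; have m : mT (fun p=> (f p - h p) ^+ 2) by apply: mfunX; mf.
split; first exact: (meas_Ex _ m).
move=> s; apply: Ex_bd=> [|p]; first by have:= mpair2 s m; exact.
have h1 : `|f (s, p) - h (s, p)| <= A' + A' by rewrite (le_trans (ler_normB _ _)) ?lerD.
by rewrite normrX lerXn2r ?nnegrE// (le_trans _ h1).
have [mg1 bg1]:= msq _ _ Gh (fun p=> g p.2) C' mGh' (mcompT mg msnd) GhC (fun p=> gC p.2).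
have [ml1 bl1]:= msq _ _ (fun p=> l p.2) Lh C (mcompT ml msnd) mLh' (fun p=> lC p.2) LhC.
have mseE s : mse b (fun p=> Lh (s, p)) = mse l (fun p=> Lh (s, p)).
have [_ _ /L1_meas m2]:= mse_bd mb (mLs' s) bC (fun p=> LhC (s, p)).
have [_ _ /L1_meas m2']:= mse_bd ml (mLs' s) lC (fun p=> LhC (s, p)).
by apply: Ex_ae=> //; apply: filterS bl=> p ->.
have Lg : L1 PS (fun s=> mse (fun p=> Gh (s, p)) g):= L1_bd PS (obs_idM iidZ mg1) bg1.
have Ll : L1 PS (fun s=> mse l (fun p=> Lh (s, p))):= L1_bd PS (obs_idM iidZ ml1) bl1.
have LB : L1 PS (fun s=> 2 * C * mse (fun p=> Gh (s, p)) g + 2 * C' ^+ 2 * mse l (fun p=> Lh (s, p))).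
by apply: L1D; apply: L1Z.
pose m2 s:= Ex P (fun w=> Phi (s, w) ^+ 2).
have m2le s : m2 s <= 2 * C * mse (fun p=> Gh (s, p)) g + 2 * C' ^+ 2 * mse l (fun p=> Lh (s, p)).
by rewrite -mseE; have [_ []]:= noise_cond s t01.
have Lm2 : L1 PS m2.
apply: (L1_le _ LB)=> [|s].
 exact: (obs_idM iidZ (meas_Ex _ (mfunX 2 mPhi))).
by rewrite ger0N//; apply: Ex_ge0=> w; nn.
have [Ls Es]:= ssum_sqr iidZ mPhi h2 h0 uL LI Lm2.
have r0 : 0 < r by rewrite ltr0n.
have E : (fun s=> (fluct P L rpath t s - nsum t s) ^+ 2) = (fun s=> r^-1 * ssum Phi L s ^+ 2).
apply/funext=> s; rewrite /fluct /nsum -mulrBr exprMn exprVn sqr_sqrtr ?ltW// -sumrB.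
by [].
rewrite E; split; [exact: L1Z|rewrite ExZ// Es mulrA mulVf ?gt_eqF// mul1r].
apply: le_trans (Ex_le Lm2 LB m2le) _; rewrite ExD; [|exact: L1Z..]; rewrite !ExZ//.
by apply: lerD; apply: lerM2l=> //; rewrite mulr_ge0 ?exprn_ge0.
Qed.
Let V:= lcm_variance P N G.
Let g2b p : 0 <= g p ^+ 2 * b p <= C' ^+ 2 * C.
have /andP[b0 b1]:= b0C p; rewrite mulr_ge0 ?sqr_ge0//= ler_pM ?sqr_ge0//.
by rewrite -(real_normK (num_real (g p))) lerXn2r ?nnegrE.
Qed.
Let g2b_bd p : `|g p ^+ 2 * b p| <= C' ^+ 2 * C.
by have /andP[h ?]:= g2b p; rewrite ger0N. Qed.
Let mg2b : mT (fun p=> g p ^+ 2 * b p).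
mf. Qed.
Let Lu (f : R * T -> R) A t : mT f -> bdd f A -> L1 Q (fun p=> upto t p * f p).
by move=> mf fA; apply: (L1by A); [exact: mfunM (mitv _ _) mf|exact: uptoM]. Qed.
Let VE t : 0 <= t <= 1 -> V t = Ex Q (fun p=> upto t p * (g p ^+ 2 * b p)).
move=> t01; rewrite /V (red_var red)//; congr (Ex _ _); apply/funext=> p; rewrite /upto.
by have [/andP[-> _]//|/(red_g0 red)->]:= boolP (0 < p.1 <= 1); rewrite expr0n !mul0r !mulr0.
Qed.
(** g^2 b is at most C'^2 C, which becomes the constant kappa of the Gaussian clock. *)
Lemma variance_incr s t : 0 <= s -> s <= t -> t <= 1 -> 0 <= V t - V s <= C' ^+ 2 * C * (t - s).
move=> s0 st t1; have s1:= le_trans st t1; have t0:= le_trans s0 st.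
rewrite !VE ?s0 ?t0// -ExB; [|exact: Lu mg2b g2b_bd..].
have E p : upto t p * (g p ^+ 2 * b p) - upto s p * (g p ^+ 2 * b p) = (s < p.1 <= t)%R%:R * (g p ^+ 2 * b p).
rewrite /upto -mulrBl; congr (_ * _); case: (ltP 0 p.1)=> u0 /=; last by rewrite subrr ltNge (le_trans u0 s0).
case: (leP p.1 s)=> us /=; first by rewrite (le_trans us st) subrr.
by rewrite subr0.
under eq_fun do rewrite E.
have m1 : mT (fun p : R * T=> (s < p.1 <= t)%R%:R : R) by mf.
have b1 (p : R * T) : `|(s < p.1 <= t)%R%:R : R| <= 1 by rewrite ger0N ?ler0n// lern1 leq_b1.
apply/andP; split; first by apply: Ex_ge0=> p; have /andP[? _]:= g2b p; rewrite mulr_ge0.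
rewrite -(@Ex_U01_itv R s t)//.
have -> : Ex U01 (fun u : R=> (s < u <= t)%R%:R) = Ex Q (fun p=> (s < p.1 <= t)%R%:R).
by rewrite (Ex_pair_bd _ _ m1 b1); congr (Ex _ _); apply/funext=> u; rewrite /= (Ex_cst P).
rewrite -ExZ; last exact: (L1_bd Q m1 b1).
apply: Ex_le=> [||p]; [|by apply: L1Z; exact: (L1_bd Q m1 b1)|].
apply: (L1by (C' ^+ 2 * C))=> [|p]; first mf.
by rewrite normrM -[leRHS]mul1r ler_pM.
by rewrite mulrC ler_wpM2r//; have /andP[]:= g2b p.
Qed.
Lemma variance0 : V 0 = 0.
rewrite VE ?lexx ?ler01// (_ : (fun p=> _) = fun=> 0) ?Ex_cst//; apply/funext=> p.
by rewrite /upto; case: ltgtP=> h; rewrite ?mul0r// leNgt h mul0r.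
Qed.
Lemma meas_noise t : 0 <= t <= 1 -> mT (noise t).
by move=> t01; have []:= iso t01 (red_mg red) gC. Qed.
Lemma noise_sum_pow2 t : 0 <= t <= 1 -> L1 PS (fun s=> nsum t s ^+ 2) /\
Ex PS (fun s=> nsum t s ^+ 2) <= C' ^+ 2 * C.
move=> t01; have [mn n2 n0 nE]:= iso t01 (red_mg red) gC; rewrite -/(noise t) in mn n2 n0 nE.
have r0 : 0 < r by rewrite ltr0n.
have [Ls Es]:= @ssum_sqr _ _ _ P _ _ PS _ Z iidZ I0 (fun p=> noise t p.2) (mcompT mn msnd) (fun=> n2) (fun=> n0) L uL LI (L1_cst PS (Ex P (fun w=> noise t w ^+ 2))).
have E : (fun s=> nsum t s ^+ 2) = (fun s=> r^-1 * ssum (fun p : obsT Z I0 * T=> noise t p.2) L s ^+ 2).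
by apply/funext=> s; rewrite /nsum exprMn exprVn sqr_sqrtr ?ltW.
rewrite E; split; [exact: L1Z|rewrite ExZ// Es /= Ex_cst mulrA mulVf ?gt_eqF// mul1r nE -VE//].
have /andP[t0 t1]:= t01; have /andP[_]:= variance_incr (lexx 0) t0 t1; rewrite variance0 !subr0=> h.
by apply: le_trans h _; rewrite -[leRHS]mulr1 lerM2l// mulr_ge0 ?exprn_ge0.
Qed.
(** Bounds the fourth moment of a compensated integral with integrand at most B, which is itself at
    most B (N_1 + C). *)
Definition clt_const (B : R) : R:= 8 * B ^+ 4 * (powc C 3 + C ^+ 4).
(** A linear combination over several times is the integral of a single bounded predictable K; the
    isometry for K produces the covariances V (min t_i t_j). *)
Lemma noise_clt (I : finType) (a t : I -> R) A b0 : (forall i, 0 <= t i <= 1) -> bdd a A ->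
`|Ex PS (fun s=> cos (b0 + \sum_i a i * nsum (t i) s)) -
 expR (- ((\sum_i \sum_j a i * a j * V (Num.min (t i) (t j))) / 2)) * cos b0| <=
(2 + 4 * clt_const (#|I|%:R * A * C')) / Num.sqrt r.
move=> t01 aA; pose K (p : R * T) : R:= \sum_i a i * (upto (t i) p * g p).
pose psi w:= jsum N K w - tint (fun p=> K p * b p) w.
pose B : R:= #|I|%:R * A * C'.
have KB p : `|K p| <= B.
apply: le_trans (ler_norm_sum _ _ _) _; rewrite /B -mulrA mulr_natl -sumr_const; apply: ler_sum=> i _.
by rewrite normrM ler_pM//; exact: uptoM.
have B0 : 0 <= B:= le_trans (normr_ge0 _) (KB (0, point)).
have mK : mT (K : predT H -> R).
by apply: msum=> i; apply: mfunM=> //; apply: mfunM; [exact: pred_upto|exact: (red_mg red)].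
have [mpsi psi2 psi0 psiE]:= compensated_isometry hN mN aN fH cb b0C mK KB; rewrite -/psi in mpsi psi2 psi0 psiE.
have mKw w : mT (fun u=> K (u, w)) by have:= mpair1 w (pred_meas fH mK); exact.
have mbw w : mT (fun u=> b (u, w)) by mf.
have psi_sum w : psi w = \sum_i a i * noise (t i) w.
rewrite /psi /noise; under eq_bigr do rewrite mulrBr.
rewrite sumrB; congr (_ - _).
 rewrite /jpart /jsum /psum exchange_big /=; apply: eq_bigr=> i _.
 by rewrite mulr_sumr.
have Li i : L1 U01 (fun u=> a i * (upto (t i) (u, w) * (g (u, w) * b (u, w)))).
 apply: L1Z; apply: (L1by (C' * C))=> [|u]; last exact: (uptoM (t i) (bdM gC bC)).
 by have:= mpair1 w (mfunM (mitv 0 (t i)) (mfunM mg mb)); exact.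
rewrite /tint (_ : (fun u=> K (u, w) * b (u, w)) = (fun u=> \sum_(i <- index_enum I) a i * (upto (t i) (u, w) * (g (u, w) * b (u, w))))).
 rewrite Ex_sum//; apply: eq_bigr=> i _; rewrite ExZ//.
 by apply: (L1by (C' * C))=> [|u]; [have:= mpair1 w (mfunM (mitv 0 (t i)) (mfunM mg mb)); exact|exact: (uptoM (t i) (bdM gC bC))].
by apply/funext=> u; rewrite mulr_suml; apply: eq_bigr=> i _; rewrite !mulrA.
have N4 : L1 P (fun w=> (N 1 w)%:R ^+ 4):= L1_N1 hN mN aN fH cb b0C 4.
have N4E : Ex P (fun w=> (N 1 w)%:R ^+ 4) <= powc C 3.
have [_]:= count_pow hN mN aN fH cb b0C (lexx 0) ler01 (lexx 1) 3; rewrite subr0 mulr1; apply: le_trans.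
rewrite le_eqVlt; apply/orP; left; apply/eqP; congr (Ex _ _); apply/funext=> w.
by have [-> _ _ _]:= hN w; rewrite subr0.
have psi_le w : psi w ^+ 4 <= 8 * B ^+ 4 * ((N 1 w)%:R ^+ 4 + C ^+ 4).
have h : `|psi w| <= B * ((N 1 w)%:R + C).
 rewrite mulrDr; apply: le_trans (ler_normB _ _) (lerD _ _); first exact: jsum_bd.
 by apply: Ex_bd=> [|u]; [mf|rewrite normrM ler_pM].
have sqle (x : R) : x ^+ 4 = (x ^+ 2) ^+ 2 by rewrite -exprM.
have k : psi w ^+ 4 <= (B * ((N 1 w)%:R + C)) ^+ 4.
 rewrite (_ : psi w ^+ 4 = `|psi w| ^+ 4); last by rewrite !sqle real_normK ?num_real.
 by rewrite lerXn2r// nnegrE (le_trans _ h).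
apply: le_trans k _; rewrite exprMn (mulrC 8) -[leRHS]mulrA; apply: lerM2l; first nn.
have n0 : 0 <= (N 1 w)%:R :> R by [].
have:= sqrD_le (N 1 w)%:R C; have:= sqrD_le ((N 1 w)%:R ^+ 2) (C ^+ 2); rewrite -!exprM=> h1 h2.
apply: le_trans (_ : (2 * (N 1 w)%:R ^+ 2 + 2 * C ^+ 2) ^+ 2 <= _).
 by rewrite sqle lerXn2r ?nnegrE ?addr_ge0 ?mulr_ge0 ?exprn_ge0 ?addr_ge0.
lra.
have LB : L1 P (fun w=> 8 * B ^+ 4 * ((N 1 w)%:R ^+ 4 + C ^+ 4)) by apply: L1Z; apply: L1D=> //; exact: L1_cst.
have psi4 : L1 P (fun w=> psi w ^+ 4).
by apply: (L1_le _ LB)=> [|w]; [mf|rewrite ger0N ?exprn_even_ge0].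
have psiM : Ex P (fun w=> psi w ^+ 4) <= clt_const B.
apply: le_trans (Ex_le psi4 LB psi_le) _; rewrite ExZ; last by apply: L1D=> //; exact: L1_cst.
by rewrite ExD ?Ex_cst//; [rewrite lerM2l ?lerD2r// mulr_ge0 ?exprn_ge0|exact: L1_cst].
have:= clt_cos iidZ mpsi psi4 psi0 psiM b0 uL L0.
rewrite psiE (_ : Ex Q (fun p=> K p ^+ 2 * b p) = \sum_i \sum_j a i * a j * V (Num.min (t i) (t j))).
rewrite (_ : (fun s=> cos (b0 + \sum_i a i * nsum (t i) s)) = (fun s=> cos (b0 + (Num.sqrt (size L)%:R)^-1 * \sum_(j <- L) psi (Z j s))))//.
apply/funext=> s; congr (cos (_ + _)); under [in RHS]eq_bigr do rewrite psi_sum.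
rewrite exchange_big mulr_sumr /=; apply: eq_bigr=> i _.
by rewrite /nsum mulrCA mulr_sumr.
have min01 i j : 0 <= Num.min (t i) (t j) <= 1.
by have /andP[i0 i1]:= t01 i; have /andP[j0 j1]:= t01 j; rewrite le_min i0 j0 ge_min i1.
rewrite (_ : (fun p=> K p ^+ 2 * b p) = (fun p=> \sum_(i <- index_enum I) \sum_(j <- index_enum I) a i * a j * (upto (Num.min (t i) (t j)) p * (g p ^+ 2 * b p)))).
rewrite Ex_sum=> [|i]; last by apply: L1_sum=> j; apply: L1Z; exact: Lu mg2b g2b_bd.
apply: eq_bigr=> i _; rewrite Ex_sum=> [|j]; last by apply: L1Z; exact: Lu mg2b g2b_bd.
by apply: eq_bigr=> j _; rewrite ExZ ?VE//; exact: Lu mg2b g2b_bd.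
apply/funext=> p; rewrite expr2 /K mulr_suml mulr_suml; apply: eq_bigr=> i _.
rewrite mulr_sumr mulr_suml; apply: eq_bigr=> j _.
have -> : upto (Num.min (t i) (t j)) p = upto (t i) p * upto (t j) p.
by rewrite /upto le_min; case: (0 < p.1)=> /=; rewrite ?mul0r// -natrM mulnb.
by ring.
Qed.
(** Cauchy-Schwarz jointly over training data, observation and time, by [le_prod_young]. *)
Lemma Ex_nuisance eg eh : 0 <= eg -> 0 <= eh ->
Ex PS (fun s=> mse (fun p=> Gh (s, p)) g) <= eg ^+ 2 -> Ex PS (fun s=> mse l (fun p=> Lh (s, p))) <= eh ^+ 2 ->
L1 PS nuisance /\ Ex PS nuisance <= eg * eh.
move=> eg0 eh0 hg hh; have D1 q : `|Gh q - g q.2| <= C' + C' by rewrite (le_trans (ler_normB _ _)) ?lerD.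
have D2 q : `|l q.2 - Lh q| <= C + C by rewrite (le_trans (ler_normB _ _)) ?lerD.
have m1 : mT (fun q : obsT Z I0 * (R * T)=> Gh q - g q.2).
mf.
have m2 : mT (fun q : obsT Z I0 * (R * T)=> l q.2 - Lh q).
mf.
have sec (f : obsT Z I0 * (R * T) -> R) A : mT f -> bdd f A ->
 L1 PS (fun s=> Ex Q (fun p=> f (s, p))) /\ forall s, L1 Q (fun p=> f (s, p)).
move=> mf fA; have Lf s : L1 Q (fun p=> f (s, p)).
 by apply: (L1by A)=> //; have:= mpair2 s mf; exact.
split=> //; apply: (L1by A)=> [|s]; first exact: (obs_idM iidZ (meas_Ex _ mf)).
by apply: Ex_bd=> //; mf.
have sqA (x A : R) : `|x| <= A -> `|x ^+ 2| <= A ^+ 2.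
by move=> h; rewrite normrX lerXn2r ?nnegrE// (le_trans _ h).
have [L1g Lg]:= sec _ _ (mfunX 2 m1) (fun q=> sqA _ _ (D1 q)).
have [L1h Lh']:= sec _ _ (mfunX 2 m2) (fun q=> sqA _ _ (D2 q)).
have mn : mT (fun q : obsT Z I0 * (R * T)=> `|Gh q - g q.2| * `|l q.2 - Lh q|).
by apply: mfunM; exact: mcompT.
have n_le q : `| `|Gh q - g q.2| * `|l q.2 - Lh q| | <= (C' + C') * (C + C) by rewrite normrM !normr_id ler_pM.
have [L1n Ln]:= sec _ _ mn n_le.
split=> //; apply: le_prod_young=> // a a0.
have le (s : S) : nuisance s <= (2^-1 * a) * mse (fun p=> Gh (s, p)) g + (2^-1 / a) * mse l (fun p=> Lh (s, p)).
rewrite /mse -(ExZ _ (Lg s)) -(ExZ _ (Lh' s)) -ExD; [|exact: L1Z (Lg s)|exact: L1Z (Lh' s)].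
apply: Ex_le=> // [|p]; first by apply: L1D; [exact: L1Z (Lg s)|exact: L1Z (Lh' s)].
set x:= Gh _ - _; set y:= l p - _; rewrite -(real_normK (num_real x)) -(real_normK (num_real y)).
have:= sqr_ge0 (a * `|x| - `|y|); rewrite -(pmulr_rge0 _ (_ : 0 < (2 * a)^-1)) ?invr_gt0 ?mulr_gt0//.
move=> h; rewrite -subr_ge0; apply: le_trans h _; rewrite le_eqVlt; apply/orP; left; apply/eqP; field.
by rewrite gt_eqF.
apply: le_trans (Ex_le L1n _ le) _; first by apply: L1D; exact: L1Z.
rewrite ExD; [|exact: L1Z..]; rewrite !ExZ// mulrDl; apply: lerD.
by rewrite (mulrC 2^-1) mulrAC ler_pM2r ?invr_gt0// ler_pM2l.
by rewrite -mulrA (mulrC 2^-1) ler_pM2r ?invr_gt0// mulrC ler_pM2r ?invr_gt0.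
Qed.
Let my t (_ : 0 <= t <= 1):= meas_resid_path t.
(** A dyadic mesh comparable to 1 / r: fine enough for [fluct_osc] and coarse enough for
    [Ex_fdelta]. *)
Lemma exists_level l0 : 2 ^+ l0 <= r -> exists m, [/\ r <= 2 ^+ m, 2 ^+ m <= 2 * r & (l0 <= m)%N].
rewrite /r -natrX ler_nat=> hl; have /= /andP[h1 h2]:= trunc_log_bounds (isT : (1 < 2)%N) L0.
exists (trunc_log 2 (size L)).+1; split; [by rewrite -natrX ler_nat ltnW|by rewrite exprS -natrX ler_pM2l ?ler_nat|].
by rewrite -(leq_exp2l _ _ (isT : (1 < 2)%N)); exact: leq_trans hl (ltnW h2).
Qed.
(* Y is the rescaled estimator of the covariance measure. *)
Variable Y : S -> R -> R.
Hypotheses (YE : {ae PS, forall s, forall t, 0 <= t <= 1 ->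
Y s t = (Num.sqrt r)^-1 * \sum_(j <- L) rpath t (s, Z j s)})
(complete : PS.-negligible `<=` measurable).
(** The hypothesis of [mean_gamma] at all times. It holds under H_0 since b = l, and for additive
    residuals since Gh - g is then F-predictable. *)
Definition balanced s:= forall t, 0 <= t <= 1 ->
Ex Q (fun p=> upto t p * ((Gh (s, p) - g p) * b p)) = Ex Q (fun p=> upto t p * ((Gh (s, p) - g p) * l p)).
Let r0 : 0 < r. by rewrite ltr0n. Qed.
Let sr0 : 0 < Num.sqrt r. nn. Qed.
Let srr : r = Num.sqrt r * Num.sqrt r. by rewrite -expr2 sqr_sqrtr// ltW. Qed.
Let decomp s t : (forall t, 0 <= t <= 1 -> Y s t = (Num.sqrt r)^-1 * \sum_(j <- L) rpath t (s, Z j s)) ->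
0 <= t <= 1 -> Y s t = fluct P L rpath t s + Num.sqrt r * ymean P rpath t s.
move=> h t01; by rewrite h// /fluct sum_sub_cst mulrBr [X in _ * (X * _)]srr -[X in _ - _ * X]mulrA mulKf ?gt_eqF// subrK.
Qed.
Let gam:= lcm_gamma P N lam G.
Let Y_le m l0 s t : r <= 2 ^+ m -> (l0 <= m)%N -> balanced s ->
(forall t, 0 <= t <= 1 -> Y s t = (Num.sqrt r)^-1 * \sum_(j <- L) rpath t (s, Z j s)) -> 0 <= t <= 1 ->
`|Y s t - Num.sqrt r * gam t - fgrid P L rpath l0 t s| <=
 Num.sqrt r * nuisance s + fosc P N C L rpath kapp m l0 s.
move=> rm lm bs h t01; rewrite (decomp h t01).
rewrite (_ : _ - _ - _ = Num.sqrt r * (ymean P rpath t s - gam t) +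
(fluct P L rpath t s - fgrid P L rpath l0 t s)); last by ring.
apply: le_trans (ler_normD _ _) (lerD _ _); first by rewrite normrM gtr0_norm// ler_pM2l//; exact: mean_gamma (bs t t01).
exact: (fluct_osc hN mN aN fH cb b0C uL L0 kapp_ge0 my rpath_incr rpath0 rm).
Qed.
Let cadlag_path w s : cadlag (fun t=> rpath t (s, w)).
rewrite /rpath /= (_ : (fun t=> _) = (fun t=> jpart (fun q=> Gh (s, q)) t w + -1 * tpart (fun q=> Gh (s, q) * Lh (s, q)) t w)); last by apply/funext=> t; rewrite mulN1r.
apply: cadlagD; [|apply: cadlagZ].
rewrite (_ : (fun t=> _) = (fun t=> \sum_(i <- index_enum 'I_(N 1 w)) ((0 < jtime (N ^~ w) i)%R%:R * Gh (s, (jtime (N ^~ w) i, w))) * (jtime (N ^~ w) i <= t)%R%:R)).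
 by apply: cadlag_sum=> i; apply: cadlagZ; exact: cadlag_indic.
by apply/funext=> t; apply: eq_bigr=> i _; rewrite /upto /= -mulnb natrM; ring.
apply: (@cadlag_lip _ _ (C' * C))=> [|u v u0 uv v1]; first nn.
by have [_]:= part_incr w (mGL s) (GL s) u0 uv v1.
Qed.
Let cadlag_est s : cadlag (fun t=> (Num.sqrt r)^-1 * \sum_(j <- L) rpath t (s, Z j s)).
by apply: cadlagZ; apply: cadlag_sum=> j; by []. Qed.
Section gaussian_limit.
Hypotheses (kap0 : 0 < C' ^+ 2 * C) (bl : {ae Q, forall p, b p = l p}).
Variables (eg eh : R).
Hypotheses (eg0 : 0 <= eg) (eh0 : 0 <= eh)
(Eg : Ex PS (fun s=> mse (fun p=> Gh (s, p)) g) <= eg ^+ 2)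
(Eh : Ex PS (fun s=> mse l (fun p=> Lh (s, p))) <= eh ^+ 2).
Variable f : (R -> R) -> R.
Hypothesis fBL : BL1 cadlag skorokhod_dist f.
Variables (l0 D : nat) (c e0 e1 : R).
Hypotheses (lr : 2 ^+ l0 <= r) (c0 : 0 < c) (D0 : (0 < D)%N) (e00 : 0 < e0) (e10 : 0 < e1).
Let I:= 'I_(2 ^ l0).+1.
Let kappa:= C' ^+ 2 * C.
Let U:= gmart V kappa.
Let tt (i : I) : R:= (2 ^+ l0)^-1 * i%:R.
Let tt01 i : 0 <= tt i <= 1.
have p0 : 0 < 2 ^+ l0 :> R by nn.
by rewrite /tt mulr_ge0 ?invr_ge0 ?(ltW p0)//= mulrC ler_pdivr// mul1r -natrX ler_nat -ltnS.
Qed.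
Let Fs (v : seq R) : R:= f (step l0 v).
Let err (x : R) : R:= c * x ^+ 2 + e0 + (e0 * c ^+ 2 * D%:R)^-1.
Let sz : R:= #|I|%:R.
(** In order: the bias, the oscillation between grid points of level l0, the replacement of
    fluctuations by noise at the grid points, the Bernstein error on both sides, the central limit
    theorem, the oscillation of the Gaussian limit. *)
Definition approx_bound : R:= Num.sqrt r * (eg * eh) +
((9 * oscc C kapp + kapp * oscc C 1) * rho ^+ l0 + 2 * kapp * (powc C 0 + 1) / Num.sqrt r) +
sz * (e1 + (2 * C * eg ^+ 2 + 2 * C' ^+ 2 * eh ^+ 2) / e1) + 2 * (sz * err (Num.sqrt kappa)) +
2 ^+ (D * size (enum I)) * ((2 + 4 * clt_const (sz * ((size (enum I))%:R * D%:R * c) * C')) / Num.sqrt r) +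
Num.sqrt kappa * (180 * rho ^+ l0).
(** Both sides are compared with one trigonometric polynomial of the grid values, for which noise
    and Gaussian limit differ by O(1 / sqrt r). *)
Lemma BL_approx : `|fine 'E_PS[f \o Y] - fine 'E_U01[f \o (fun u t=> U t u)]| <= approx_bound.
have [m [rm mr lm]]:= exists_level lr.
have Fs1 v : `|Fs v| <= 1 by apply: fBL.1; exact: cadlag_step.
have Fsl : l1_lipschitz Fs.
move=> u u'; move=> su; apply: BL1_le fBL (cadlag_step _ _) (cadlag_step _ _) _ _; first nn.
move=> t _; rewrite /step; elim: u u' (dyidx l0 t) su=> [|x u IH] [|x' u']//= k.
 by rewrite !nth_nil subrr normr0 big_nil.
move=> [su]; rewrite big_cons; case: k=> [|k] /=; first by rewrite lerDl sumr_ge0.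
by apply: le_trans (IH _ _ su) _; rewrite lerDr.
pose t_ (v : I -> R):= map v (enum I).
have stepE (v : I -> R) t (t01 : 0 <= t <= 1) : exists2 i : I, step l0 (t_ v) t = v i & i = dyidx l0 t :> nat.
have:= dyidx_le l0 t01; rewrite -ltnS=> h; exists (Ordinal h)=> //.
by rewrite /step (nth_map (Ordinal h)) ?size_enum_ord// (nth_ord_enum _ (Ordinal h)).
pose X1 i s:= nsum (tt i) s. pose X2 i u:= U (tt i) u.
have Vi:= variance_incr; have V0:= variance0.
have mX2 i : mT (X2 i) by exact: (meas_gmart kap0 V0 Vi).
have mX1 i : mT (X1 i).
apply: mfunM=> //; apply: msum=> j.
by apply: mcompT; [exact: meas_noise|exact: (meas_obs iidZ)].
have tp:= trigp_mbern D c0 (enum I) Fs1.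
pose h (v : I -> R):= mbern c D (enum I) Fs v.
have hb v : `|h v| <= 2 ^+ (D * size (enum I)):= trigp_bd v tp.
have L1h d1 (T1 : mType d1) (P1 : prob T1 R) (W : I -> T1 -> R) :
 (forall i, mT (W i)) -> L1 P1 (fun w=> h (W^~ w)).
by move=> mW; apply: (L1by (2 ^+ (D * size (enum I))))=> //; exact: meas_trigp mW tp.
have gl (a : I -> R) : gausslaw U01 (fun u=> \sum_i a i * X2 i u) (\sum_i \sum_j a i * a j * V (Num.min (tt i) (tt j))).
exact: (gausslaw_gmart kap0 V0 Vi a tt01).
have cmp : `|Ex PS (fun s=> h (X1^~ s)) - Ex U01 (fun u=> h (X2^~ u))| <=
 2 ^+ (D * size (enum I)) * ((2 + 4 * clt_const (sz * ((size (enum I))%:R * D%:R * c) * C')) / Num.sqrt r).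
apply: trigp_compare tp=> // [|a b1 aA].
 rewrite divr_ge0 ?(ltW sr0)// addr_ge0// mulr_ge0// /clt_const.
 rewrite mulr_ge0 ?addr_ge0 ?exprn_ge0 ?(powc_ge0 b0C)//.
 nn.
have:= noise_clt b1 tt01 aA; have:= gl a b1 1; rewrite expr1n mul1r.
by under [in LHS]eq_fun do rewrite mul1r; move=> ->.
have X1sq i:= noise_sum_pow2 (tt01 i).
have Vle i : V (tt i) <= kappa.
have /andP[t0 t1]:= tt01 i; have /andP[_]:= Vi _ _ (lexx 0) t0 t1; rewrite V0 !subr0=> hv.
by apply: le_trans hv _; rewrite -[leRHS]mulr1 lerM2l// ltW.
have X2sq i : L1 U01 (fun u=> X2 i u ^+ 2) /\ Ex U01 (fun u=> X2 i u ^+ 2) <= kappa.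
have g1 : gausslaw U01 (X2 i) (V (tt i)).
 move=> b1 a; have:= @gausslaw_gmart _ _ _ kap0 V0 Vi unit (fun=> 1) (fun=> tt i) (fun=> tt01 i) b1 a.
 by under eq_fun do rewrite (big_pred1 Datatypes.tt) ?mul1r//; rewrite !(big_pred1 Datatypes.tt) ?minxx ?mul1r// => -[].
have v0 : 0 <= V (tt i) by have /andP[t0 t1]:= tt01 i; have /andP[]:= Vi _ _ (lexx 0) t0 t1; rewrite V0 subr0.
by split; [exact: gausslaw_L2 g1|rewrite (gausslaw_var _ g1)].
have Eerr d1 (T1 : mType d1) (P1 : prob T1 R) (W : I -> T1 -> R) :
 (forall i, L1 P1 (fun w=> W i w ^+ 2) /\ Ex P1 (fun w=> W i w ^+ 2) <= kappa) ->
 L1 P1 (fun w=> \sum_(i <- enum I) err (W i w)) /\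
 Ex P1 (fun w=> \sum_(i <- enum I) err (W i w)) <= sz * err (Num.sqrt kappa).
move=> W2; have Le i : L1 P1 (fun w=> err (W i w)).
 by rewrite /err; under eq_fun do rewrite -addrA; apply: L1D; [apply: L1Z; exact: (W2 i).1|exact: L1_cst].
split; first exact: L1_sum.
rewrite Ex_sum// /sz mulr_natl -sumr_const big_enum /=; apply: ler_sum=> i _.
rewrite /err; under [fun w=> _]eq_fun do rewrite -addrA.
rewrite ExD; [|by apply: L1Z; exact: (W2 i).1|exact: L1_cst]; rewrite Ex_cst ExZ; last exact: (W2 i).1.
by rewrite -addrA lerD2r ler_pM2l// sqr_sqrtr ?(ltW kap0)//; exact: (W2 i).2.
have [L1e1 E1]:= Eerr _ _ _ X1 X1sq; have [L1e2 E2]:= Eerr _ _ _ X2 X2sq.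
(* Distance q to the step path costs q by the Lipschitz property of f; the Bernstein approximation
   costs the sum of the [err]. *)
have bnd (y : R -> R) (v : I -> R) (q : R) : cadlag y -> 0 <= q -> (forall t, 0 <= t <= 1 -> `|y t - step l0 (t_ v) t| <= q) ->
 `|f y - h v| <= q + \sum_(i <- enum I) err (v i).
move=> cy q0 hq; rewrite -(subrKA (Fs (t_ v))); apply: le_trans (ler_normD _ _) (lerD _ _).
 exact: (BL1_le fBL cy (cadlag_step _ _) q0 hq).
by rewrite distrC; exact: (mbern_err c0 D0).
have [LO EO]:= @L1_BMosc R l0.
have hU : `|fine 'E_U01[f \o (fun u t=> U t u)] - Ex U01 (fun u=> h (X2^~ u))| <=
 Num.sqrt kappa * (180 * rho ^+ l0) + sz * err (Num.sqrt kappa).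
have LB : L1 U01 (fun u=> Num.sqrt kappa * BMosc l0 u + \sum_(i <- enum I) err (X2 i u)) by apply: L1D=> //; exact: L1Z.
apply: le_trans (integral_squeeze (L1h _ _ _ _ mX2) LB _) _=> [u|].
 apply: bnd; [exact: (cadlag_gmart kap0 V0 Vi)|by rewrite mulr_ge0 ?sqrtr_ge0 ?BMosc_ge0|].
 move=> t t01; have [i -> iE]:= stepE (X2^~ u) t t01.
 by have:= gmart_grid kap0 V0 Vi l0 u t01; rewrite -iE.
rewrite ExD//; last exact: L1Z.
by rewrite ExZ// lerD// lerM2l// sqrtr_ge0.
(* Only second moments of this difference are known; [young1] turns them into a linear bound. *)
pose Rm i s:= e1 + (fluct P L rpath (tt i) s - nsum (tt i) s) ^+ 2 / e1.
have appr i:= noise_approx (tt01 i) bl Eg Eh.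
have LR i : L1 PS (Rm i).
by apply: L1D; [exact: L1_cst|under eq_fun do rewrite mulrC; apply: L1Z; exact: (appr i).1].
have bs s : balanced s by move=> t _; apply: Ex_ae; [..|by apply: filterS bl=> p ->];
apply: mfunM; do ?[exact: mitv|apply: mfunM=> //; exact: mfunB].
(* Under H_0 gamma vanishes, so the rescaled estimator needs no centring. *)
have gam0 t : 0 <= t <= 1 -> gam t = 0.
move=> t01; rewrite /gam (red_gamma red)// -[RHS](@Ex_cst _ _ _ Q); apply: Ex_ae=> //.
 mf.
by apply: filterS bl=> p ->; rewrite subrr !mulr0.
have [Ln En]:= Ex_nuisance eg0 eh0 Eg Eh.
have [Lf Ef]:= Ex_fosc iidZ hN mN aN fH cb b0C uL LI L0 kapp_ge0 my rpath_incr rpath0 mr lm.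
have LRs : L1 PS (fun s=> \sum_(i <- enum I) Rm i s) by exact: L1_sum.
have LB : L1 PS (fun s=> Num.sqrt r * nuisance s + fosc P N C L rpath kapp m l0 s +
\sum_(i <- enum I) Rm i s + \sum_(i <- enum I) err (X1 i s)).
by do 2![apply: L1D=> //]; apply: L1D=> //; exact: L1Z.
have Rm_ge i s : `|fluct P L rpath (tt i) s - nsum (tt i) s| <= Rm i s.
by apply: young1.
have Bs_ge s : 0 <= Num.sqrt r * nuisance s + fosc P N C L rpath kapp m l0 s + \sum_(i <- enum I) Rm i s.
have R0 i : 0 <= Rm i s by exact: le_trans (Rm_ge i s).
rewrite addr_ge0 ?sumr_ge0// addr_ge0 ?mulr_ge0 ?(ltW sr0)//; last by apply: fosc_ge0=> //; exact: kapp_ge0.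
by apply: Ex_ge0=> p; rewrite mulr_ge0.
have hS : `|fine 'E_PS[f \o Y] - Ex PS (fun s=> h (X1^~ s))| <=
 Ex PS (fun s=> Num.sqrt r * nuisance s + fosc P N C L rpath kapp m l0 s +
  \sum_(i <- enum I) Rm i s + \sum_(i <- enum I) err (X1 i s)).
apply: integral_squeeze_ae complete (L1h _ _ _ _ mX1) LB _; apply: filterS YE=> s hs.
apply: bnd=> //; first by apply: cadlag_eq (cadlag_est s)=> t /hs ->.
move=> t t01; have [i -> iE]:= stepE (X1^~ s) t t01.
have:= Y_le rm lm (bs s) hs t01; rewrite gam0// mulr0 subr0=> hY.
rewrite -(subrKA (fgrid P L rpath l0 t s)); apply: le_trans (ler_normD _ _) (lerD hY _).
rewrite /fgrid -iE; apply: le_trans (Rm_ge i s) _; rewrite big_enum /= (bigD1 i)//= lerDl.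
by apply: sumr_ge0=> j _; exact: le_trans (Rm_ge j s).
apply: le_trans (ler_distD (Ex PS (fun s=> h (X1^~ s))) _ _) _.
have h3:= ler_distD (Ex U01 (fun u=> h (X2^~ u))) (Ex PS (fun s=> h (X1^~ s))) (fine 'E_U01[f \o (fun u t=> U t u)]).
rewrite distrC in hU; apply: le_trans (lerD hS (le_trans h3 (lerD cmp hU))) _.
rewrite ExD//; last by apply: L1D=> //; apply: L1D=> //; exact: L1Z.
rewrite ExD//; last by apply: L1D=> //; exact: L1Z.
rewrite ExD//; last exact: L1Z.
rewrite ExZ// (_ : approx_bound = (Num.sqrt r * (eg * eh) + ((9 * oscc C kapp + kapp * oscc C 1) * rho ^+ l0 +
2 * kapp * (powc C 0 + 1) / Num.sqrt r) + sz * (e1 + (2 * C * eg ^+ 2 + 2 * C' ^+ 2 * eh ^+ 2) / e1) + sz * err (Num.sqrt kappa)) +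
(2 ^+ (D * size (enum I)) * ((2 + 4 * clt_const (sz * ((size (enum I))%:R * D%:R * c) * C')) / Num.sqrt r) +
(Num.sqrt kappa * (180 * rho ^+ l0) + sz * err (Num.sqrt kappa)))); last by rewrite /approx_bound; ring.
apply: lerD=> //; apply: lerD=> //; apply: lerD.
by apply: lerD=> //; apply: lerM2l En; nn.
rewrite Ex_sum// /sz mulr_natl -sumr_const big_enum /=; apply: ler_sum=> i _.
rewrite /Rm ExD ?Ex_cst; [|exact: L1_cst|by under eq_fun do rewrite mulrC; apply: L1Z; exact: (appr i).1].
under [fun s=> _ / e1]eq_fun do rewrite mulrC.
by rewrite ExZ ?lerD2l 1?mulrC ?ler_pM2r ?invr_gt0//; [exact: (appr i).2|exact: (appr i).1].
Qed.
End gaussian_limit.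
Section tail.
Hypothesis bal : {ae PS, forall s, balanced s}.
Variables (eg eh K : R).
Hypotheses (eg0 : 0 <= eg) (eh0 : 0 <= eh) (K0 : 0 < K)
(Eg : Ex PS (fun s=> mse (fun p=> Gh (s, p)) g) <= eg ^+ 2)
(Eh : Ex PS (fun s=> mse l (fun p=> Lh (s, p))) <= eh ^+ 2).
Definition tail_const : R:= oscc C kapp + (9 * oscc C kapp + kapp * oscc C 1) + 2 * kapp * (powc C 0 + 1).
Let exceed (y : S -> R -> R) s t:= K < `|y s t - Num.sqrt r * gam t|.
Let est s t:= (Num.sqrt r)^-1 * \sum_(j <- L) rpath t (s, Z j s).
Let Exc : set S:= [set s | exists2 t : R, 0 <= t <= 1 & exceed Y s t].
(** Markov's inequality for a bound of the supremum made of the bias, the oscillation from level 0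
    on, and the fluctuation over [0, 1] at level 0. *)
Lemma tail_bound :
(PS Exc <= ((Num.sqrt r * (eg * eh) + tail_const) / K)%:E)%E.
have gamE t : 0 <= t <= 1 -> gam t = Ex P (tpart (fun p=> g p * (b p - l p)) t).
have bl p : `|b p - l p| <= C + C by rewrite (le_trans (ler_normB _ _)) ?lerD.
move=> t01; have [_ ->]:= Ex_tpart t (mfunM mg (mfunB mb ml)) (bdM gC bl).
rewrite /gam (red_gamma red)//; congr (Ex _ _); apply/funext=> p; rewrite /upto /=.
by have [/andP[-> _]//|/(red_g0 red)->]:= boolP (0 < p.1 <= 1); rewrite !mul0r !mulr0.
have cadlag_gam : cadlag gam.
have mk : mT (fun p=> g p * (b p - l p)) by mf.
have kb p : `|g p * (b p - l p)| <= C' * (C + C) by rewrite normrM ler_pM// (le_trans (ler_normB _ _)) ?lerD.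
apply: (@cadlag_lip _ _ (C' * (C + C)))=> [|u v u0 uv v1]; first nn.
rewrite !gamE ?u0 ?(le_trans uv) ?(le_trans u0)// -ExB; [|exact: (Ex_tpart _ mk kb).1..].
apply: Ex_bd=> [|w]; last by have []:= part_incr w mk kb u0 uv v1.
by apply: mfunB; exact: meas_tpart.
have mest t s' : 0 <= t <= 1 -> measurable [set s | K < `|est s t - s'| ].
move=> t01; rewrite -[X in measurable X]setTI; apply: (mfun_lt (f:= cst K))=> //; apply: mcompT=> //.
apply: mfunB=> //; apply: mfunM=> //; apply: msum=> j.
have mj : mT (fun s : S=> (s, Z j s) : obsT Z I0 * T).
 by apply: mpair; [exact: (@meas_obs_id _ _ _ P _ _ PS)|exact: (meas_obs iidZ)].
exact: (mcompT (meas_resid_path t) mj).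
(* The event is an uncountable union; on cadlag paths rational times suffice, and the remaining
   sample points form a null set. *)
have mE : measurable Exc.
apply: (ae_measurable_set complete (B:= \bigcup_(q : rat) [set s | exceed est s (clip01 (ratr q))])).
 by apply: bigcupT_measurable_rat=> q; apply: mest; exact: clip01_itv.
apply: filterS YE=> s hs; split=> [[t t01]|[q _ /= hq]]; last first.
 by exists (clip01 (ratr q)); [exact: clip01_itv|rewrite /exceed hs ?clip01_itv].
rewrite /exceed hs// -/(est s t)=> ht.
have [||q hq]:= @cadlag_gt_rat _ (fun t=> est s t - Num.sqrt r * gam t) K; last by exists q.
 by under eq_fun do rewrite -mulNr; apply: cadlagD; [exact: cadlag_est|exact: cadlagZ].
by exists t.
have Lg0 : 2 ^+ 0 <= r by rewrite expr0 ler1n.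
have [m [rm mr lm]]:= exists_level Lg0.
have [Ln En]:= Ex_nuisance eg0 eh0 Eg Eh.
have [Lf Ef]:= Ex_fosc iidZ hN mN aN fH cb b0C uL LI L0 kapp_ge0 my rpath_incr rpath0 mr lm.
have d0 : 2 ^+ 0 <= 2 * r by lra.
have [Ld Ed]:= Ex_fdelta iidZ hN mN aN fH cb b0C uL LI L0 kapp_ge0 my rpath_incr rpath0 d0.
pose Bd s:= Num.sqrt r * nuisance s + fosc P N C L rpath kapp m 0 s + fdelta P L rpath 0 s.
have LB : L1 PS Bd by apply: L1D=> //; apply: L1D=> //; exact: L1Z.
have B0 s : 0 <= Bd s.
rewrite /Bd addr_ge0 ?fdelta_ge0// addr_ge0 ?mulr_ge0 ?(ltW sr0)//; last by apply: fosc_ge0=> //; exact: kapp_ge0.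
by apply: Ex_ge0=> p; rewrite mulr_ge0.
have mEB : measurable (Exc `&` [set s | K < Bd s]).
apply: measurableI=> //; rewrite -[X in measurable X]setTI; apply: (mfun_lt (f:= cst K))=> //.
exact: L1_meas LB.
have EE : PS Exc =
 PS (Exc `&` [set s | K < Bd s]).
rewrite -(fineK (fin_num_measure PS _ mE)) -(fineK (fin_num_measure PS _ mEB)) -!Ex_indic//; congr EFin.
apply: Ex_ae; [exact/measurable_indicP..|]; move: YE bal; apply: filterS2=> s hs bs; rewrite !indicE; congr (nat_of_bool _)%:R.
apply/idP/idP; rewrite !inE; last by case.
move=> [t t01 ht]; split; first by exists t.
apply: lt_le_trans ht _; rewrite -(subrK (fgrid P L rpath 0 t s) (Y s t - _)).
apply: le_trans (ler_normD _ _) (lerD (Y_le rm lm bs hs t01) (fgrid_level0 _ _ rpath0 _ t01)).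
rewrite EE -(fineK (fin_num_measure PS _ mEB)) lee_fin -Ex_indic// ler_pdivlMr// mulrC -ExZ; last first.
by apply: (L1by 1)=> [|s]; [mf|rewrite indicE ger0N ?ler0n// lern1 leq_b1].
apply: le_trans (Ex_le _ LB _) _=> [|s|].
- apply: L1Z; apply: (L1by 1)=> [|s]; [mf|rewrite indicE ger0N ?ler0n// lern1 leq_b1//].
- rewrite indicE; case: (boolP (s \in _))=> [|_]; last by rewrite mulr0.
by rewrite inE mulr1=> -[_ /= /ltW].
rewrite /Bd ExD//; last by apply: L1D=> //; exact: L1Z.
rewrite ExD//; last exact: L1Z.
rewrite ExZ// /tail_const -addrA; apply: lerD; first by rewrite ler_pM2l.
rewrite expr0 in Ef; rewrite expr0 mulr1 in Ed; rewrite addrC -addrA; apply: lerD=> //; apply: le_trans Ef _.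
rewrite mulr1 lerD2l.
have k0 : 0 <= 2 * kapp * (powc C 0 + 1) by rewrite !mulr_ge0 ?kapp_ge0 ?addr_ge0 ?(powc_ge0 b0C).
have s1 : 1 <= Num.sqrt r by rewrite -{1}sqrtr1 ler_wsqrtr// ler1n.
by rewrite ler_pdivr// ler_peMr.
Qed.
End tail.
End experiment.

(** * From the estimator to its bounded representation *)

Section estimator.
Context {R : realType} d (T : mType d) (P : prob T R).
Context dS (S : mType dS) (PS : prob S R) (n : nat) (Z : 'I_n -> S -> T).
Hypothesis iidZ : iid_sample P PS Z.
Notation Q:= (U01 \x P)%E.
Notation predT H:= (sigmaT (pgen H)).
Context (N : R -> T -> nat) (F H : R -> set (set T)) (lam G : R -> T -> R) (C C' : R) (b l g : R * T -> R).
Hypotheses (red : reduced P N F H lam G C C' b l g)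
(C0 : 0 <= C) (C'0 : 0 <= C').
Variables (J : {set 'I_n}) (lamhat Ghat : S -> R -> T -> R).
Hypotheses (fl : fitted_predictable Z J F lamhat) (fg : fitted_predictable Z J H Ghat)
(lamhatC : {ae (PS \x P)%E, forall p, forall t : R, 0 <= t <= 1 -> `|lamhat p.1 t p.2| <= C})
(GhatC : {ae (PS \x P)%E, forall p, forall t : R, 0 <= t <= 1 -> `|Ghat p.1 t p.2| <= C'}).
Let hN:= red_hN red. Let mN:= red_mN red. Let fF:= red_fF red. Let fH:= red_fH red.
Definition at_unit (W : S -> R -> T -> R) (p : obsT Z (~: J) * (R * T)) : R:= unitp p.2.1 * W p.1 p.2.1 p.2.2.
Definition clipped (c : R) W p : R:= clip c (at_unit W p).
Let ml : measurable_fun setT (at_unit lamhat : obsT Z (~: J) * predT F -> R):= fitted_obs fF fl.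
Let mg : measurable_fun setT (at_unit Ghat : obsT Z (~: J) * predT H -> R):= fitted_obs fH fg.
Let ml' : mT (at_unit lamhat):= obs_pred fF ml.
Let mg' : mT (at_unit Ghat):= obs_pred fH mg.
Let bad c (W : S -> R -> T -> R) (p : obsT Z (~: J) * (R * T)) : R:= (c < `|at_unit W p|)%R%:R.
Let mbad c W : mT (at_unit W) -> mT (bad c W).
by move=> mW; apply: meas_bool; apply: mfun_lt=> //; mf. Qed.
(* The clipped estimates differ from the estimates on a set that is null for dt x P and
carries almost surely no jump of a fresh observation. *)
Lemma estimator_rep : {ae PS, forall s, forall j, j \in J -> forall t, 0 <= t <= 1 ->
int_compensated (N ^~ (Z j s)) (lamhat s ^~ (Z j s)) (Ghat s ^~ (Z j s)) t =
rpath N (clipped C' Ghat) (clipped C lamhat) t (s, Z j s)}.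
apply: filter_forall=> j; have [jJ|]:= boolP (j \in J); last by move=> _; apply: nearW.
(* The number of jumps at which [Ghat] exceeds its bound, plus the times spent by either estimate
   beyond its bound. *)
pose be (q : obsT Z (~: J) * T) : R:= psum (N ^~ q.2) (fun u=> bad C' Ghat (q.1, (u, q.2))) +
Ex U01 (fun u=> bad C' Ghat (q.1, (u, q.2)) + bad C lamhat (q.1, (u, q.2))).
have be0 q : 0 <= be q.
by apply: addr_ge0; [apply: psum_ge0=> u|apply: Ex_ge0=> u; rewrite addr_ge0].
have mbe : mT be.
apply: mfunD; first exact: (meas_jsum2 hN mN (mbad C' mg')).
have mphi : mT (fun q : (obsT Z (~: J) * T) * R=> (q.1.1, (q.2, q.1.2)) : obsT Z (~: J) * (R * T)).
 apply: mpair; first exact: mcompT.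
 by apply: mpair=> //; exact: mcompT.
exact: (meas_Ex _ (mcompT (mfunD (mbad C' mg') (mbad C ml')) mphi)).
(* Truncated so as to be integrable; it vanishes exactly when [be] does. *)
pose mb q:= Num.min (be q) 1.
have mmb : mT mb by exact: measurable_minr.
have mb0 q : 0 <= mb q by rewrite le_min be0 ler01.
have mb1 q : `|mb q| <= 1 by rewrite ger0N// ge_min lexx orbT.
have E0 : Ex (obsP iidZ (~: J) \x P)%E mb = 0.
rewrite (Ex_pair_bd _ _ mmb mb1) Ex_obsP; last first.
 by apply: (L1by 1)=> [|s]; [exact: (meas_Ex _ mmb)|apply: Ex_bd=> //; have:= mpair2 s mmb; exact].
rewrite -(Ex_pair_bd PS P (obs_prodM iidZ mmb) mb1) -[RHS](@Ex_cst _ _ _ (PS \x P)%E).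
apply: Ex_ae=> //; first exact: (obs_prodM iidZ mmb).
move: lamhatC GhatC; apply: filterS2=> -[s w] /= h1 h2.
have un (W : S -> R -> T -> R) c u : 0 <= c -> (forall t : R, 0 <= t <= 1 -> `|W s t w| <= c) -> bad c W (s, (u, w)) = 0.
 move=> c0 h; rewrite /bad ltNge /at_unit /= (_ : _ <= c)// /unitp; case: (boolP (0 < u <= 1))=> [/andP[u0 u1]|_].
  by rewrite mul1r h// ltW.
 by rewrite mul0r normr0.
rewrite /mb /be (_ : (fun u=> bad _ _ _) = fun=> 0); last by apply/funext=> u; exact: un.
rewrite (_ : (fun u=> _ + _) = fun=> 0); last by apply/funext=> u; rewrite !un// addr0.
by rewrite Ex_cst addr0 /psum big1// min_l.
(* An observation in J is a fresh copy with respect to the training data, so [mb] vanishes there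
   because it vanishes under [PS \x P]. *)
have jI : j \notin ~: J by rewrite finset.in_setC jJ.
have [Lt Et]:= obs_transfer jI (L1_bd (obsP iidZ (~: J) \x P)%E mmb mb1).
have : {ae PS, forall s, mb (s, Z j s) = 0} by apply: Ex_eq0=> //; rewrite Et.
apply: filterS=> s mbs _ t t01; have bes : be (s, Z j s) = 0.
by move: mbs; rewrite /mb; case: leP=> // _ /eqP; rewrite oner_eq0.
set w:= Z j s; have okE c W (q : obsT Z (~: J) * (R * T)) : bad c W q = 0 -> clipped c W q = at_unit W q.
by rewrite /bad /clipped=> /eqP; rewrite pnatr_eq0 eqb0 -leNgt=> h; rewrite clip_id.
have bn c W q : 0 <= bad c W q by nn.
have [bj bt] : psum (N ^~ w) (fun u=> bad C' Ghat (s, (u, w))) = 0 /\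
 Ex U01 (fun u=> bad C' Ghat (s, (u, w)) + bad C lamhat (s, (u, w))) = 0.
move: bes; rewrite /be /= -/w; set x:= psum _ _; set y:= Ex _ _=> e.
have x0 : 0 <= x by apply: psum_ge0.
have y0 : 0 <= y by apply: Ex_ge0=> u; rewrite addr_ge0.
by split; apply/eqP; rewrite eq_le; apply/andP; split=> //; rewrite -e ?lerDl ?lerDr.
have sec (f : obsT Z (~: J) * (R * T) -> R) : mT f -> mT (fun u=> f (s, (u, w))).
by move=> mf; have:= mpair1 w (mpair2 (s : obsT Z (~: J)) mf); exact.
rewrite /int_compensated /rpath; congr (_ - _).
rewrite int_countingE//; apply: eq_bigr=> i _; have:= psumr_eq0P (fun (i : 'I_(N 1 w)) _=> bn C' Ghat (s, (jtime (N ^~ w) i, w))) bj; move/(_ i isT).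
have j1 : 0 < jtime (N ^~ w) i <= 1 by rewrite jtime_gt0//; have /andP[_]:= jtime01 (N ^~ w) i.
by move=> /okE; rewrite /= /upto /= => ->; rewrite /at_unit /unitp /= j1 mul1r; have /andP[-> _]:= j1.
have mG:= sec _ mg'; have mL:= sec _ ml'.
have ug u : unitp u * (Ghat s u w * lamhat s u w) = at_unit Ghat (s, (u, w)) * at_unit lamhat (s, (u, w)).
by rewrite /at_unit /= /unitp; case: (0 < u <= 1); rewrite ?mul1r ?mul0r.
rewrite Rintegral_unitp//; last by under eq_fun do rewrite ug; exact: mfunM.
have mle : mT (fun u : R=> (u <= t)%R%:R : R) by mf.
apply: Ex_ae.
- by apply: mfunM=> //; under eq_fun do rewrite ug; exact: mfunM.
- apply: mfunM; first exact: meas_itvR.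
by apply: mfunM; apply: meas_clip.
have : {ae U01, forall u, bad C' Ghat (s, (u, w)) + bad C lamhat (s, (u, w)) = 0}.
apply: Ex_eq0=> // [|u]; last nn.
apply: (L1by (1 + 1))=> [|u]; first by apply: mfunD; apply: sec; exact: mbad.
by rewrite ger0N ?addr_ge0// lerD// lern1 leq_b1.
apply: filterS=> u e; have [e1 e2] : bad C' Ghat (s, (u, w)) = 0 /\ bad C lamhat (s, (u, w)) = 0.
by split; apply/eqP; rewrite eq_le bn andbT -e ?lerDl ?lerDr.
rewrite ug !okE// /upto /= /at_unit /= /unitp; case: (ltP 0 u)=> u0 //=.
by rewrite !mul0r !mulr0.
Qed.
Lemma estimator_path : (0 < #|J|)%N -> {ae PS, forall s, forall t, 0 <= t <= 1 ->
Num.sqrt #|J|%:R * lcm_estimator Z J N lamhat Ghat s t = (Num.sqrt (size (enum J))%:R)^-1 *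
 \sum_(j <- enum J) rpath N (clipped C' Ghat) (clipped C lamhat) t (s, Z j s)}.
move=> J0; have r0 : 0 < (#|J|%:R : R) by rewrite ltr0n.
apply: filterS estimator_rep=> s h t t01; rewrite /lcm_estimator mulrA -cardE big_enum /=; congr (_ * _).
by rewrite -{2}(sqr_sqrtr (ltW r0)) expr2 invfM mulVKf// gt_eqF// sqrtr_gt0.
by apply: eq_bigr=> j jJ; exact: h.
Qed.
Let Gh:= clipped C' Ghat.
Let Lh:= clipped C lamhat.
Lemma clipped_pred : [/\ mT (Gh : obsT Z (~: J) * predT H -> R), mT (Lh : obsT Z (~: J) * predT F -> R),
forall p, `|Gh p| <= C' & forall p, `|Lh p| <= C].
by split=> [||p|p]; [exact: meas_clip|exact: meas_clip|exact: clip_bd|exact: clip_bd]. Qed.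
Let merr (W : R -> T -> R) (What : S -> R -> T -> R) : mT (fun p : R * T=> unitp p.1 * W p.1 p.2) -> mT (at_unit What) ->
mT (fun p : S * (R * T)=> unitp p.2.1 * W p.2.1 p.2.2 - unitp p.2.1 * What p.1 p.2.1 p.2.2).
move=> mW mWh; apply: mfunB; last exact: (obs_prodM iidZ mWh).
mf.
Qed.
Let clipB c (x y a : R) : `|x| <= c -> y = x -> `|clip c a - x| <= `|y - a|.
by move=> xc ->; rewrite -{1}(clip_id xc) distrC; exact: clip_lip. Qed.
Lemma residual_mse e : 0 <= e -> (estimation_error P PS G Ghat <= e%:E)%E ->
Ex PS (fun s=> mse P (fun p=> Gh (s, p)) g) <= e ^+ 2.
have [mGh _ hG _]:= clipped_pred; have mgg:= pred_meas fH (red_mg red).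
move=> e0 ee; apply: (clipped_error (merr (red_mG red) mg') e0 ee (D:= fun q=> Gh q - g q.2) (M:= C' + C')).
- by apply: mfunB; [exact: (obs_prodM iidZ (obs_pred fH mGh))|mf].
- by move=> p; rewrite (le_trans (ler_normB _ _)) ?lerD// (red_g red).
- by move=> s; apply: filterS (red_GE red)=> p h; apply: clipB h; exact: (red_g red).
Qed.
Lemma intensity_mse e : 0 <= e -> (estimation_error P PS lam lamhat <= e%:E)%E ->
Ex PS (fun s=> mse P l (fun p=> Lh (s, p))) <= e ^+ 2.
have [_ mLh _ hL]:= clipped_pred; have mll:= pred_meas fF (red_ml red).
have lC p : `|l p| <= C by have /andP[h ?]:= red_l red p; rewrite ger0N.
move=> e0 ee; apply: (clipped_error (merr (red_mlam red) ml') e0 ee (D:= fun q=> l q.2 - Lh q) (M:= C + C)).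
- by apply: mfunB; [mf|exact: (obs_prodM iidZ (obs_pred fF mLh))].
- by move=> p; rewrite (le_trans (ler_normB _ _)) ?lerD.
- by move=> s; apply: filterS (red_lamE red)=> p h; rewrite distrC; exact: clipB h.
Qed.
(** The process X cancels: Ghat - G = Pi - Pihat is F-predictable, and [b] and [l] have the same
    integrals against bounded F-predictable processes. *)
Lemma balanced_additive (X Pi : R -> T -> R) (Pihat : S -> R -> T -> R) : predictable F Pi ->
(forall t w, 0 <= t <= 1 -> G t w = X t w - Pi t w) -> fitted_predictable Z J F Pihat ->
(forall s t w, 0 <= t <= 1 -> Ghat s t w = X t w - Pihat s t w) ->
{ae PS, forall s, balanced P b l g Gh s}.
move=> pPi GE fP GhE; have [mGh _ hG _]:= clipped_pred; have:= ae_sections GhatC; apply: filterS=> s hs t /andP[t0 t1].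
pose k (p : R * T) : R:= unitp p.1 * Pi p.1 p.2 - at_unit Pihat (s, p).
have mk : mT (k : predT F -> R).
by apply: mfunB; [exact: predictable_unitp|have:= mpair2 (s : obsT Z (~: J)) (fitted_obs fF fP); exact].
(* Clipping makes k bounded, as [red_bl] requires, and changes nothing almost everywhere. *)
pose K:= fun p=> clip (C' + C') (k p).
have KE : {ae Q, forall p, Gh (s, p) - g p = K p}.
move: (ae_snd (@U01 R) hs) (red_GE red); apply: filterS2=> -[u w] /= h gE.
have kE : Gh (s, (u, w)) - g (u, w) = k (u, w).
 rewrite -gE /k /Gh /clipped /at_unit /= /unitp; case: (boolP (0 < u <= 1))=> [/andP[u0 u1]|_].
  rewrite !mul1r clip_id ?h ?(ltW u0)// GE ?GhE ?(ltW u0)//; ring.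
 by rewrite !mul0r clip_id ?normr0// subrr.
by rewrite kE /K clip_id// -kE (le_trans (ler_normB _ _)) ?lerD// (red_g red).
have mu : mT (upto t : predT F -> R) by have:= pred_itv fF (lexx 0) t0 t1; exact.
have mK : mT (K : predT F -> R) by exact: meas_clip.
have mb : mT b by case: (red_cb red)=> _ _ /(pred_meas fH).
have mll:= pred_meas fF (red_ml red); have mu':= pred_meas fF mu; have mK':= pred_meas fF mK.
have mD : mT (fun p=> Gh (s, p) - g p).
by apply: mfunB; [have:= mpair2 (s : obsT Z (~: J)) (obs_pred fH mGh); exact|exact: pred_meas (red_mg red)].
have KC p : `|upto t p * K p| <= 1 * (C' + C').
by rewrite normrM ler_pM//; [rewrite ger0N ?ler0n// lern1 leq_b1|apply: clip_bd; rewrite addr_ge0].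
have E (v : R * T -> R) : mT v -> Ex Q (fun p=> upto t p * ((Gh (s, p) - g p) * v p)) = Ex Q (fun p=> upto t p * K p * v p).
move=> mv; apply: Ex_ae; [..|by apply: filterS KE=> p ->; rewrite mulrA].
 mf.
mf.
by rewrite !E//; apply: (red_bl red) KC; mf.
Qed.
End estimator.

(** * Choice of the parameters, and the theorem *)

Lemma le_small {R : realFieldType} (A e : R) : 0 < e ->
exists2 x, 0 < x <= 1 & forall y, 0 <= y -> y <= x -> A * y <= e.
move=> e0; have a0 : 0 < `|A| + 1 by rewrite ltr_wpDl.
exists (Num.min 1 (e / (`|A| + 1))); first by rewrite lt_min ltr01 divr_gt0//= ge_min lexx.
move=> y y0; rewrite le_min ler_pdivlMr// => /andP[_]; apply: le_trans.
by rewrite mulrC lerM2l// (le_trans (ler_norm _))// lerDl.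
Qed.
Lemma fine_rates {R : realType} (x y : \bar R) (sr e : R) : (0 <= x)%E -> (0 <= y)%E -> (x <= e%:E)%E -> (y <= e%:E)%E ->
(sr%:E * x * y <= e%:E)%E ->
[/\ (x <= (fine x)%:E)%E, (y <= (fine y)%:E)%E, fine x <= e, fine y <= e & sr * (fine x * fine y) <= e].
by case: x=> [x||]//; case: y=> [y||]//=; rewrite !lee_fin mulrA. Qed.
Lemma scaled_supnorm {R : realType} (sr K : R) (x : R -> R) : 0 < sr ->
(K%:E < sr%:E * supnorm x)%E <-> exists2 t, 0 <= t <= 1 & K < sr * `|x t|.
move=> s0; split=> [|[t t01 Kt]]; last first.
apply: (@lt_le_trans _ _ (sr%:E * (`|x t|)%:E)%E); first by [].
by apply: lee_wpmul2l; [rewrite lee_fin ltW|apply: ereal_sup_ubound; exists t=> //=; rewrite in_itv].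
apply: contraPP=> h; apply/negP; rewrite -leNgt.
apply: (@le_trans _ _ (sr%:E * (K / sr)%:E)%E); last by rewrite -EFinM mulrC mulfVK ?gt_eqF.
apply: lee_wpmul2l; first by rewrite lee_fin ltW.
apply: ge_ereal_sup=> z [t /=]; rewrite in_itv/= => t01 <-; rewrite lee_fin ler_pdivlMr// mulrC leNgt.
by apply/negP=> ht; apply: h; exists t.
Qed.
(** Eight error terms, each at most eps / 8. The level l0 fixes the number of grid points; c and e0
    are chosen next, then D, which depends on them, then e1 and dl; last comes r1, against constants
    exponential in D. *)
Lemma approx_small {R : realType} (C C' eps : R) : 0 < C -> 0 < C' -> 0 < eps ->
exists (l0 D : nat) (c e0 e1 dl r1 : R), [/\ 0 < c, (0 < D)%N, 0 < e0, 0 < e1 & 0 < dl] /\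
forall n (L : seq 'I_n) eg eh, 0 <= eg -> eg <= dl -> 0 <= eh -> eh <= dl -> r1 <= (size L)%:R ->
 Num.sqrt (size L)%:R * (eg * eh) <= dl -> 2 ^+ l0 <= ((size L)%:R : R) /\ approx_bound C C' L eg eh l0 D c e0 e1 <= eps.
move=> C0 C'0 eps0; pose e:= eps / 8; have e_gt0 : 0 < e by rewrite divr_gt0.
pose k:= kapp C C'; pose kappa:= C' ^+ 2 * C; have kap0 : 0 < kappa by rewrite mulr_gt0// exprn_gt0.
have [x1 /andP[x10 _] H1]:= le_small (9 * oscc C k + k * oscc C 1 + Num.sqrt kappa * 180) e_gt0.
have [l0 Hl] : exists l0, rho ^+ l0 <= x1.
have : rho ^+ m @[m --> \oo] --> (0 : R) by apply: cvg_expr; rewrite ger0N ?(ltW rho_gt0) ?rho_lt1.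
move=> /cvgrPdist_le/(_ _ x10)[m _ /(_ m (leqnn m))]; rewrite sub0r normrN ger0N ?exprn_ge0 ?(ltW rho_gt0)//.
by exists m.
pose sz : R:= #|{: 'I_(2 ^ l0).+1}|%:R; have sz0 : 0 <= sz by rewrite ler0n.
have [c /andP[c0 _] Hc]:= le_small (2 * sz * kappa) e_gt0.
have [e0 /andP[e00 _] He0]:= le_small (2 * sz) e_gt0.
have [x3 /andP[x30 _] H3]:= le_small (2 * sz * (e0 * c ^+ 2)^-1) e_gt0.
pose D:= (Num.truncn x3^-1).+1; have D0 : 0 < (D%:R : R) by rewrite ltr0n.
have Dx : (D%:R)^-1 <= x3 by rewrite invf_ple ?posrE// ltW// truncnS_gt.
have [e1 /andP[e10 _] He1]:= le_small sz e_gt0.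
have [dl /andP[dl0 dl1] Hd]:= le_small (sz * (2 * C + 2 * C' ^+ 2) / e1) e_gt0.
pose X:= 2 * k * (powc C 0 + 1) +
2 ^+ (D * size (enum 'I_(2 ^ l0).+1)) * (2 + 4 * clt_const C (sz * ((size (enum 'I_(2 ^ l0).+1))%:R * D%:R * c) * C')).
have [x5 /andP[x50 _] H5]:= le_small X e_gt0.
exists l0, D, c, e0, e1, (Num.min e dl), (Num.max (2 ^+ l0) (x5^-1 ^+ 2)); split; first by rewrite lt_min e_gt0.
move=> n L eg eh eg0; rewrite !le_min ge_max=> /andP[_ egd] eh0 /andP[_ ehd] /andP[r1 r2] /andP[rr _]; split=> //.
have sr : (Num.sqrt ((size L)%:R : R))^-1 <= x5.
by rewrite invf_ple ?posrE ?sqrtr_gt0 ?(lt_le_trans _ r2) ?exprn_gt0 ?invr_gt0// -(ger0N (ltW (_ : 0 < x5^-1))) ?invr_gt0// -sqrtr_sqr ler_wsqrtr.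
have h1:= H1 _ (exprn_ge0 l0 (ltW rho_gt0)) Hl; have h2:= Hc _ (ltW c0) (lexx _); have h3:= He0 _ (ltW e00) (lexx _).
have Di : 0 <= (D%:R : R)^-1 by nn.
have h4:= H3 _ Di Dx; have h5:= He1 _ (ltW e10) (lexx _).
have h6 : sz * ((2 * C * eg ^+ 2 + 2 * C' ^+ 2 * eh ^+ 2) / e1) <= e.
have sq (a : R) : 0 <= a -> a <= dl -> a ^+ 2 <= dl by move=> a0 ad; rewrite expr2 -[dl]mulr1 ler_pM// (le_trans ad).
apply: le_trans (Hd _ (ltW dl0) (lexx _)); rewrite -2![leRHS]mulrA lerM2l// [leRHS]mulrCA [leRHS]mulrC ler_pM2r ?invr_gt0//.
by rewrite [leRHS]mulrDl; apply: lerD; apply: lerM2l; rewrite ?sq// mulr_ge0 ?exprn_ge0 ?(ltW C0) ?(ltW C'0).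
have ri : 0 <= (Num.sqrt ((size L)%:R : R))^-1 by nn.
have h7:= H5 _ ri sr.
have -> : approx_bound C C' L eg eh l0 D c e0 e1 = Num.sqrt (size L)%:R * (eg * eh) +
(9 * oscc C k + k * oscc C 1 + Num.sqrt kappa * 180) * rho ^+ l0 + sz * e1 +
sz * ((2 * C * eg ^+ 2 + 2 * C' ^+ 2 * eh ^+ 2) / e1) + 2 * sz * kappa * c + 2 * sz * e0 +
2 * sz * (e0 * c ^+ 2)^-1 * D%:R^-1 + X / Num.sqrt (size L)%:R.
rewrite /approx_bound -/sz -/k -/kappa sqr_sqrtr ?(ltW kap0)// /X invfM; ring.
by rewrite (_ : eps = e + e + e + e + e + e + e + e); [do 7 apply: lerD=> //|rewrite /e; field].
Qed.


Theorem theorem4p6 (R : realType) (Theta : Type)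
    (d : Theta -> measure_display)
    (Omega : forall th, measurableType (d th))
    (P : forall th, probability (Omega th) R)
    (F : forall th, R -> set (set (Omega th)))
    (N : forall th, R -> Omega th -> nat)
    (X lam blam G : forall th, R -> Omega th -> R)
    (dS : Theta -> measure_display)
    (S : forall th, measurableType (dS th))
    (PS : forall th, probability (S th) R)
    (Z : forall th n, 'I_n -> S th -> Omega th)
    (J : forall n, {set 'I_n})
    (lamhat Ghat : forall th, nat -> S th -> R -> Omega th -> R)
    (Hmodel : forall th,
      counting_model (P th) (F th) (N th) (X th) (lam th) (blam th))
    (Hresidual : forall th, residual_process (P th) (F th) (X th) (G th))
    (Hsample : forall th n, iid_sample (P th) (PS th) (@Z th n))
    (Hlamhat : forall th n,
      fitted_predictable (@Z th n) (J n) (F th) (lamhat th n))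
    (HGhat : forall th n,
      fitted_predictable (@Z th n) (J n) (enlarge (F th) (X th)) (Ghat th n))
    (Hbounded : exists C C' : R, [/\ 0 < C, 0 < C' & forall th,
      [/\ (forall w, caglad (blam th ^~ w)) /\
          {ae P th, forall w, forall t : R, 0 <= t <= 1 -> blam th t w <= C},
          (forall w, caglad (G th ^~ w)) /\
          {ae P th, forall w, forall t : R, 0 <= t <= 1 -> `|G th t w| <= C'},
          forall n, {ae (PS th \x P th)%E, forall p, forall t : R, 0 <= t <= 1 ->
            `|lamhat th n p.1 t p.2| <= C} &
          forall n, {ae (PS th \x P th)%E, forall p, forall t : R, 0 <= t <= 1 ->
            `|Ghat th n p.1 t p.2| <= C'}]])
    (HJ : #|J n| @[n --> \oo] --> \oo)
    (Hrates :
      let g th n := estimation_error (P th) (PS th) (G th) (Ghat th n) in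
      let h th n := estimation_error (P th) (PS th) (lam th) (lamhat th n) in
      sup_nonneg [set: Theta] (fun th => maxe (g th n) (maxe (h th n)
        ((Num.sqrt (#|J n|%:R : R))%:E * g th n * h th n)%E))
        @[n --> \oo] --> 0%E) :
  let gamma th := lcm_gamma (P th) (N th) (lam th) (G th) in
  let gammahat th n :=
    lcm_estimator (@Z th n) (J n) (N th) (lamhat th n) (Ghat th n) in
  let Theta0 :=
    [set th | cond_local_indep (P th) (F th) (N th) (X th) (lam th)] in
  (exists (dU : Theta -> measure_display)
          (OmegaU : forall th, measurableType (dU th))
          (PU : forall th, probability (OmegaU th) R)
          (U : forall th, R -> OmegaU th -> R),
    (forall th, Theta0 th ->
      gaussian_martingale (PU th) (lcm_variance (P th) (N th) (G th)) (U th)) /\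
    unif_cvg_distr cadlag skorokhod_dist Theta0
      PS (fun th n s t => Num.sqrt #|J n|%:R * gammahat th n s t)
      PU (fun th w t => U th t w)) /\
  ((forall th, additive_residual (P th) (F th) (X th) (G th)) ->
   (forall th n, exists2 Pihat,
      fitted_predictable (@Z th n) (J n) (F th) Pihat &
      forall s t w, 0 <= t <= 1 -> Ghat th n s t w = X th t w - Pihat s t w) ->
   forall eps : R, 0 < eps -> exists2 K : R, 0 < K &
     (limn_esup (fun n => sup_nonneg [set: Theta] (fun th => PS th
        [set s | K%:E < (Num.sqrt (#|J n|%:R : R))%:E *
                        supnorm (fun t => (gammahat th n s t - gamma th t)%R)]))
      < eps%:E)%E).
Proof.
Proof.
move=> gamma gammahat Theta0; have [C [C' [C0 C'0 bd]]]:= Hbounded.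
have C0':= ltW C0; have C'0':= ltW C'0.
pose g th n:= estimation_error (P th) (PS th) (G th) (Ghat th n).
pose h th n:= estimation_error (P th) (PS th) (lam th) (lamhat th n).
(* The rates are used in this form: past some n, one bound for all parameters. *)
have rate e : 0 < e -> \forall n \near \oo, forall th, [/\ (g th n <= e%:E)%E, (h th n <= e%:E)%E &
 ((Num.sqrt (#|J n|%:R : R))%:E * g th n * h th n <= e%:E)%E].
move=> e0; have hn : nbhs (0%E : \bar R) [set x | (x < e%:E)%E].
 by apply: open_nbhs_nbhs; split; [exact: open_ereal_lt_ereal|rewrite /= lte_fin].
have : \forall n \near \oo, (sup_nonneg [set: Theta] (fun th=> maxe (g th n) (maxe (h th n)
 ((Num.sqrt (#|J n|%:R : R))%:E * g th n * h th n)))%E < e%:E)%E:= Hrates _ hn.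
apply: filterS=> n /= hs th; move/ltW: hs=> hs.
have : (maxe (g th n) (maxe (h th n) ((Num.sqrt (#|J n|%:R : R))%:E * g th n * h th n)) <= e%:E)%E.
 by apply: le_trans hs; apply: ereal_sup_ubound; right; exists th.
by rewrite !ge_max=> /and3P.
have dims (x : R) : \forall n \near \oo, x <= #|J n|%:R by exact: (HJ _ (nbhs_infty_ger x)).
have g0 th n : (0 <= g th n)%E by exact: sqrte_ge0.
have h0 th n : (0 <= h th n)%E by exact: sqrte_ge0.
have complete th : (PS th).-negligible `<=` measurable by have [c _ _ _]:= Hsample th 0%N; exact: c.
have redx th : exists b l gg, reduced (P th) (N th) (F th) (enlarge (F th) (X th)) (lam th) (G th) C C' b l gg.
have [[_ bC] [_ GC] lC _]:= bd th.
(* A single index with error at most 1 makes [lam] integrable, through [L1_of_error]. *)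
have [n0 _ /(_ n0 (leqnn n0)) /(_ th) [_ hn _]]:= rate 1 ltr01.
have [uF _ [_ mX] [pl _ _] _]:= Hmodel th; have fF:= usual_filt uF.
have ml:= pred_meas fF (predictable_unitp fF pl).
have mlh:= obs_prodM (Hsample th n0) (obs_pred fF (fitted_obs fF (Hlamhat th n0))).
have mE : mT (fun p : S th * (R * Omega th)=> unitp p.2.1 * lam th p.2.1 p.2.2 - unitp p.2.1 * lamhat th n0 p.1 p.2.1 p.2.2).
 mf.
have L1l:= L1_of_error mE ler01 hn ml (lC n0) C0'.
by eexists _, _, _; exact: (model_reduced (Hmodel th) (Hresidual th) C0' C'0' bC GC L1l).
pose V th:= lcm_variance (P th) (N th) (G th); pose kappa:= C' ^+ 2 * C.
have kap0 : 0 < kappa by rewrite mulr_gt0// exprn_gt0.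
have Vi th s t : 0 <= s -> s <= t -> t <= 1 -> 0 <= V th t - V th s <= kappa * (t - s).
by have [b [l [gg rd]]]:= redx th; exact: (variance_incr rd C'0').
have V0 th : V th 0 = 0 by have [b [l [gg rd]]]:= redx th; exact: (variance0 rd).
have setup th n b l gg (rd : reduced (P th) (N th) (F th) (enlarge (F th) (X th)) (lam th) (G th) C C' b l gg) :
 (0 < #|J n|)%N -> forall eg eh, (g th n <= eg%:E)%E -> (h th n <= eh%:E)%E -> [/\ 0 <= eg, 0 <= eh,
 uniq (enum (J n)) /\ (forall j, j \in enum (J n) -> j \notin ~: J n), (0 < size (enum (J n)))%N &
 Ex (PS th) (fun s=> mse (P th) (fun p=> clipped (Z:= @Z th n) (J:= J n) C' (Ghat th n) (s, p)) gg) <= eg ^+ 2 /\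
 Ex (PS th) (fun s=> mse (P th) l (fun p=> clipped (Z:= @Z th n) (J:= J n) C (lamhat th n) (s, p))) <= eh ^+ 2].
move=> J0 eg eh hg hh; have eg0 : 0 <= eg by rewrite -lee_fin (le_trans (g0 th n) hg).
have eh0 : 0 <= eh by rewrite -lee_fin (le_trans (h0 th n) hh).
split=> //; [split; first exact: enum_uniq|by rewrite -cardE|split].
- by move=> j; rewrite mem_enum finset.in_setC negbK.
- exact: (residual_mse (Hsample th n) rd C0' C'0' (Hlamhat th n) (HGhat th n)).
- exact: (intensity_mse (Hsample th n) rd C0' C'0' (Hlamhat th n) (HGhat th n)).
split.
(* All limits live on the same uniform space: one Brownian motion, run at the clock of each
   parameter. *)
exists (fun=> _), (fun=> R), (fun=> U01), (fun th=> gmart (V th) kappa); split.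
 by move=> th _; exact: (gmart_gaussian_martingale kap0 (V0 th) (Vi th)).
split.
 (* Dyadic step paths with rational values are countable; the common separable set consists of the
    cadlag paths that are uniform limits of them, and contains the limit paths. *)
 pose st k (s : seq rat) : R -> R:= step k (map ratr s).
 exists [set x | cadlag x /\ forall e : R, 0 < e -> exists k s, forall t, 0 <= t <= 1 -> `|x t - st k s t| <= e].
  split=> [x []//|]; exists (range (fun p=> st p.1 p.2)); split.
  - exact: sub_countable (card_image_le _ _) (countableP _).
  - move=> _ [p _ <-]; split; first exact: cadlag_step.
   by move=> e e0; exists p.1, p.2=> t _; rewrite subrr normr0 ltW.
  - move=> x e [cx hx] e0; have [k [s hp]]:= hx (e / 2) (ltac:(by rewrite divr_gt0)).
   exists (st k s); first by exists (k, s).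
   by apply: le_lt_trans (skorokhod_le _ hp) _; rewrite ?lte_fin ?ltr_pdivrMr ?ltr_pMr ?ltr1n// ltW// divr_gt0.
 move=> th _; apply: nearW=> u; split; first exact: (cadlag_gmart kap0 (V0 th) (Vi th)).
 move=> e e0; have e20 : 0 < e / 2 by rewrite divr_gt0.
 have [k hk]:= gmart_osc_cvg kappa u e20.
 have /choice[q hq] (i : nat) : exists q : rat, `|gmart (V th) kappa ((2 ^+ k)^-1 * i%:R) u - ratr q| <= e / 2.
  set x:= gmart _ _ _ _; have xe : x - e / 2 < x + e / 2 by lra.
  have [q]:= rat_in_itvoo xe.
  by rewrite in_itv/= => /andP[q1 q2]; exists q; rewrite ler_norml; lra.
 exists k, (mkseq q (2 ^ k).+1)=> t t01; have dk : (dyidx k t < (2 ^ k).+1)%N by exact: dyidx_le.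
 rewrite /st /step (nth_map 0) ?size_mkseq// nth_mkseq//.
 rewrite (splitr e) -(subrKA (gmart (V th) kappa ((2 ^+ k)^-1 * (dyidx k t)%:R) u)).
 apply: le_trans (ler_normD _ _) (lerD _ (hq _)); apply: le_trans (ltW hk).
 exact: (gmart_grid kap0 (V0 th) (Vi th)).
have sn0 n : (0 <= sup_nonneg Theta0 (fun th=> dBL cadlag skorokhod_dist (PS th)
  (fun s t=> (Num.sqrt #|J n|%:R * gammahat th n s t)%R) U01 (fun u t=> gmart (V th) kappa t u)))%E.
 by apply: ereal_sup_ubound; left.
have small e : 0 < e -> \forall n \near \oo, (sup_nonneg Theta0 (fun th=> dBL cadlag skorokhod_dist (PS th)
  (fun s t=> (Num.sqrt #|J n|%:R * gammahat th n s t)%R) U01 (fun u t=> gmart (V th) kappa t u)) <= e%:E)%E.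
 (* The parameters are fixed before n and depend on [C], [C'] and e only, which makes the
    convergence uniform. *)
 move=> e0; have [l0 [D [c [e1 [e2 [dl [r1 [[c0 D0 e10 e20 dl0] H]]]]]]]]:= approx_small C0 C'0 e0.
 near=> n; have J0 : (0 < #|J n|)%N by rewrite -(ltr_nat R) (@lt_le_trans _ _ 1)//; near: n; exact: dims.
 apply: ge_ereal_sup=> z [->|[th thH <-]]; first by rewrite lee_fin ltW.
 apply: ge_ereal_sup=> y [f fBL <-]; rewrite lee_fin; have [b [l [gg rd]]]:= redx th.
 have [hg hh hp] : [/\ (g th n <= dl%:E)%E, (h th n <= dl%:E)%E & ((Num.sqrt (#|J n|%:R : R))%:E * g th n * h th n <= dl%:E)%E].
  (* The condition on n must not depend on the parameter, so the latter is generalized before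
     [near]. *)
  by move: th {thH b l gg rd}; near: n; exact: rate.
 have [p2 p3 p4 p5 p1]:= fine_rates (g0 th n) (h0 th n) hg hh hp.
 have [eg0 eh0 [uL LI] L0 [Eg Eh]]:= setup th n b l gg rd J0 _ _ p2 p3.
 have [||lr]:= H _ (enum (J n)) _ _ eg0 p4 eh0 p5; first by rewrite -cardE; near: n; exact: dims.
  by rewrite -cardE.
 apply: le_trans; have [_ _ lC GC]:= bd th.
 have [mGh mLh GhC LhC]:= clipped_pred rd C0' C'0' (Hlamhat th n) (HGhat th n).
 have YE:= estimator_path (Hsample th n) rd C0' C'0' (Hlamhat th n) (HGhat th n) (lC n) (GC n) J0.
 exact: (BL_approx (Hsample th n) rd C0' C'0' uL LI L0 mGh mLh GhC LhC YE (complete th) kap0 (red_H0 rd thH) eg0 eh0 Eg Eh fBL lr c0 D0 e10 e20).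
apply/fine_cvgP; split.
 have:= small 1 ltr01; apply: filterS=> n hn.
 by rewrite ge0_fin_numE ?(le_lt_trans hn) ?ltry//; exact: sn0.
apply/cvgrPdist_le=> e e0; have:= small e e0; apply: filterS=> n hn.
rewrite sub0r normrN /= ger0N ?fine_ge0// -lee_fin fineK// ge0_fin_numE ?(le_lt_trans hn) ?ltry//.
(* Makes the bound of [tail_bound] at most eps / 2 once sqrt |J| times the product of the two errors
   is at most 1; the other half leaves room for the strict inequality. *)
move=> Hadd HPihat eps eps0; pose K:= (1 + `|tail_const C C'|) * 2 / eps.
have K0 : 0 < K by rewrite divr_gt0// mulr_gt0// ltr_wpDr.
exists K=> //; apply: (@le_lt_trans _ _ (eps / 2)%:E); last by rewrite lte_fin ltr_pdivrMr// ltr_pMr// ltr1n.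
pose u n:= sup_nonneg [set: Theta] (fun th=> PS th [set s |
(K%:E < (Num.sqrt (#|J n|%:R : R))%:E * supnorm (fun t=> (gammahat th n s t - gamma th t)%R))%E]).
(* A limit superior is an infimum, over neighbourhoods of infinity, of suprema; the neighbourhood is
   the set where the bound holds. *)
apply: ereal_inf_le; exists (ereal_sup (u @` [set n | (u n <= (eps / 2)%:E)%E])); last by apply: ge_ereal_sup=> z [n un <-].
exists [set n | (u n <= (eps / 2)%:E)%E]=> //; near=> n; rewrite /= /u.
have J0 : (0 < #|J n|)%N by rewrite -(ltr_nat R) (@lt_le_trans _ _ 1)//; near: n; exact: dims.
apply: ge_ereal_sup=> z [->|[th _ <-]]; first by rewrite lee_fin ltW// divr_gt0.
have [hg hh hp] : [/\ (g th n <= 1%:E)%E, (h th n <= 1%:E)%E & ((Num.sqrt (#|J n|%:R : R))%:E * g th n * h th n <= 1%:E)%E].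
by move: th; near: n; exact: rate.
have [p2 p3 p4 p5 p1]:= fine_rates (g0 th n) (h0 th n) hg hh hp.
have [b [l [gg rd]]]:= redx th.
have [eg0 eh0 [uL LI] L0 [Eg Eh]]:= setup th n b l gg rd J0 _ _ p2 p3.
have [_ _ lC GC]:= bd th; have [mGh mLh GhC LhC]:= clipped_pred rd C0' C'0' (Hlamhat th n) (HGhat th n).
have YE:= estimator_path (Hsample th n) rd C0' C'0' (Hlamhat th n) (HGhat th n) (lC n) (GC n) J0.
have [Pi [pPi _] GE]:= Hadd th; have [Pihat fP GhE]:= HPihat th n.
have bal:= balanced_additive rd C0' C'0' (Hlamhat th n) (HGhat th n) (GC n) pPi GE fP GhE.
have s0 : 0 < Num.sqrt (#|J n|%:R : R) by rewrite sqrtr_gt0 ltr0n.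
have:= tail_bound (Hsample th n) rd C0' C'0' uL LI L0 mGh mLh GhC LhC YE (complete th) bal eg0 eh0 K0 Eg Eh.
rewrite -cardE; set E1:= (X in PS th X); set E2:= (X in _ -> (PS th X <= _)%E).
rewrite (_ : E2 = E1); last first.
apply/seteqP; split=> s; rewrite /E1 /E2 /=.
 by move=> /(scaled_supnorm _ _ s0)[t t01 ht]; exists t; rewrite // -mulrBr normrM gtr0_norm.
by move=> [t t01 ht]; apply/(scaled_supnorm _ _ s0); exists t=> //; move: ht; rewrite -mulrBr normrM gtr0_norm.
move=> h1; apply: le_trans h1 _; rewrite lee_fin ler_pdivr// /K.
rewrite (_ : eps / 2 * _ = 1 + `|tail_const C C'|); last by field; rewrite gt_eqF.
by apply: lerD=> //; exact: ler_norm.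
Unshelve. all: by end_near. Qed.
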